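(* Let $n \ge 1$. There exist a $C > 0$ and an $\epsilon > 0$ such that, if $W(X_1,\dots,X_n)$ is a self-adjoint non-commutative power series containing only terms of even degree and $\|W\|_C < \epsilon$, then there is a corresponding non-commutative power series $V(Y_1,\dots,Y_n)$ such that the free Gibbs law associated to $\tfrac12|Y|^2 + V$ is well defined and, when $Y = (Y_1,\dots,Y_n)$ has the free Gibbs law associated to $\tfrac12|Y|^2 + V$, then $X = Y + \mathcal{D}_Y V(Y)$ has the free Gibbs law associated to $\tfrac12|X|^2 + W$.
   Context: Non-commutative (nc) power series are in $n$ self-adjoint non-commuting variables. For a nc power series $\sum_I a_I X_I$ ($I$ ranging over multi-indices (words) of length $|I|$), $\|\sum_I a_I X_I\|_A = \sum_I |a_I| A^{|I|}$. Write $|X|^2 = X_1^2+\dots+X_n^2$. The cyclic gradient is $\mathcal{D} = (\mathcal{D}_{x_1},\dots,\mathcal{D}_{x_n})$ (written $\mathcal{D}_Y$ when the variables are $Y$), with $\mathcal{D}_{x_i}(x_{i_1}\cdots x_{i_m}) = \sum_{j=1}^m \delta_{i,i_j}\, x_{i_{j+1}}\cdots x_{i_m}x_{i_1}\cdots x_{i_{j-1}}$. The difference quotients are $\partial_{x_i}(x_{i_1}\cdots x_{i_m}) = \sum_{j=1}^m \delta_{i,i_j}\, x_{i_1}\cdots x_{i_{j-1}}\otimes x_{i_{j+1}}\cdots x_{i_m}$, and for an $n$-tuple $P=(P_1,\dots,P_n)$, $JP$ is the matrix with entries $(JP)_{ij} = \partial_{x_j}P_i$. The law of an $n$-tuple $(X_1,\dots,X_n)$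 of self-adjoint elements of a tracial non-commutative probability space $(M,\tau)$ is the functional $P\mapsto \tau(P(X_1,\dots,X_n))$ on nc polynomials. Potentials are assumed self-adjoint. Free Gibbs laws are taken with a norm cutoff: a number $T>2$ is fixed, and the free Gibbs law associated to a potential $\tfrac12|X|^2+W$ (with $W$ a small perturbation) is the unique tracial law $\tau$ satisfying the bounded Schwinger–Dyson equation $\tau(P\cdot(X+\mathcal{D}W(X))) = \tau\otimes\tau(\mathrm{Tr}(JP))$ for all $n$-tuples $P$ of nc polynomials, together with $|\tau(X_{i_1}\cdots X_{i_k})|\le T^k$ for all words. (Here $P\cdot Q=\sum_i P_iQ_i$.) For each $T>2$ there is an $R>0$ such that $\|W\|_T<R$ implies that this law exists and is unique. *)

(* Defs.v *)
(* Scalars are the complex numbers R[i] over R : realType. *)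
From HB Require Import structures.
From mathcomp Require Import all_boot all_order all_algebra.
From mathcomp Require Import all_classical all_reals all_analysis.
From mathcomp.real_closed Require Import complex.

Set Implicit Arguments.
Unset Strict Implicit.
Unset Printing Implicit Defensive.

Import Order.TTheory GRing.Theory Num.Theory.
Import numFieldNormedType.Exports.
Import ComplexField.Normc.

Local Open Scope classical_set_scope.
Local Open Scope ring_scope.

(* A word [:: i_1; ...; i_k] stands for the monomial X_{i_1} ... X_{i_k}. *)
Notation word n := (seq 'I_n).

(* A power series is its family of coefficients; sums and differences of series
   are those of functions. *)
Notation ncseries R n := (word n -> R[i]).

Section PowerSeries.
Variables (R : realType) (n : nat).
Implicit Types (f g : ncseries R n) (i j : 'I_n) (w u : word n).

Definition ncmono u : ncseries R n := fun w => (w == u)%:R.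

Definition ncvar i : ncseries R n := ncmono [:: i].

Definition ncmul f g : ncseries R n :=
  fun w => \sum_(k < (size w).+1) f (take k w) * g (drop k w).

Definition ncnorm (A : R) f : \bar R :=
  \esum_(w in [set: word n]) (normc (f w) * A ^+ size w)%:E.

(* The variables are self-adjoint, so the adjoint of a monomial is the reversed
   monomial. *)
Definition nc_selfadjoint f : Prop := forall w, f (rev w) = conjc (f w).

Definition nc_even f : Prop := forall w, odd (size w) -> f w = 0.

Definition is_ncpoly f : Prop := finite_set [set w | f w != 0].

Definition cyc_grad_mono i w : ncseries R n :=
  \sum_(j < size w | nth i w j == i) ncmono (drop j.+1 w ++ take j w).

(* For a given u only words w of length (size u).+1 contribute, so the sum is
   finite even when f is not a polynomial. *)
Definition cyc_grad i f : ncseries R n :=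
  fun u => \sum_(w \in [set: word n]) f w * cyc_grad_mono i w u.

(* An element of the algebraic tensor square of the nc polynomials is its family
   of coefficients on the basis of the u (x) v. *)
Definition tmono (p : word n * word n) : word n * word n -> R[i] :=
  fun q => (q == p)%:R.

Definition diff_quot_mono j w : word n * word n -> R[i] :=
  \sum_(k < size w | nth j w k == j) tmono (take k w, drop k.+1 w).

Definition diff_quot j f : word n * word n -> R[i] :=
  fun p => \sum_(w \in [set: word n]) f w * diff_quot_mono j w p.

Definition ncJ (P : 'I_n -> ncseries R n) : 'M[word n * word n -> R[i]]_n :=
  \matrix_(i, j) diff_quot j (P i).

(* Summation by increasing degree: there are finitely many words of each length,
   so this is the norm convergence of a series in V. *)
Definition wsums_to (V : zmodType) (nrm : V -> R) (F : word n -> V) (l : V) : Prop :=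
  (fun N : nat => nrm (\sum_(k < N) \sum_(w : k.-tuple 'I_n) F w - l)) @ \oo
    --> (0 : R).

(* A linear functional on nc polynomials is given by its values on monomials.
   nc_pairing tau f l: the (degreewise) extension of tau to series takes the
   value l at f. *)
Definition nc_pairing (tau : word n -> R[i]) f (l : R[i]) : Prop :=
  wsums_to (@normc R) (fun w => f w * tau w) l.

Definition tensor_pairing (tau : word n -> R[i])
    (F : word n * word n -> R[i]) : R[i] :=
  \sum_(p \in [set: word n * word n]) F p * (tau p.1 * tau p.2).

End PowerSeries.

(* The norm is an explicit field, and not an instance of the normed modules of
   the library, because Hierarchy-Builder cannot join these with rings: their
   only common extensions are the ordered domains. *)
HB.mixin Record isCStarAlgebra (R : realType) A of GRing.Algebra R[i] A := {
  star : A -> A ;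
  starK : forall x, star (star x) = x ;
  starD : forall x y, star (x + y) = star x + star y ;
  starZ : forall (a : R[i]) x, star (a *: x) = conjc a *: star x ;
  starM : forall x y, star (x * y) = star y * star x ;
  cnorm : A -> R ;
  cnorm0_eq0 : forall x, cnorm x = 0 -> x = 0 ;
  cnormD : forall x y, cnorm (x + y) <= cnorm x + cnorm y ;
  cnormZ : forall (a : R[i]) x, cnorm (a *: x) = normc a * cnorm x ;
  cnormM : forall x y, cnorm (x * y) <= cnorm x * cnorm y ;
  cnorm_star_mul : forall x, cnorm (star x * x) = cnorm x ^+ 2 ;
  cnorm_complete : forall u : nat -> A,
    (forall e : R, 0 < e ->
       exists N : nat, forall p q : nat, (N <= p)%N -> (N <= q)%N ->
         cnorm (u p - u q) < e) ->
    exists l, (fun k => cnorm (u k - l)) @ \oo --> (0 : R) }.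

#[short(type="cstarAlgType")]
HB.structure Definition CStarAlgebra (R : realType) :=
  {A of GRing.Algebra R[i] A & isCStarAlgebra R A}.

(* A unital C*-algebra with a faithful tracial state. *)
HB.mixin Record isTracial (R : realType) M of CStarAlgebra R M := {
  trace : M -> R[i] ;
  traceD : forall x y, trace (x + y) = trace x + trace y ;
  traceZ : forall (a : R[i]) x, trace (a *: x) = a * trace x ;
  trace1 : trace 1 = 1 ;
  trace_ge0 : forall x, 0 <= trace (star x * x) ;
  trace_faithful : forall x, trace (star x * x) = 0 -> x = 0 ;
  traceC : forall x y, trace (x * y) = trace (y * x) }.

#[short(type="tracialNCSpaceType")]
HB.structure Definition TracialNCSpace (R : realType) :=
  {M of CStarAlgebra R M & isTracial R M}.

Section Laws.
Variables (R : realType) (n : nat).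

Definition selfadjoint_tuple (M : cstarAlgType R) (X : 'I_n -> M) : Prop :=
  forall i, star (X i) = X i.

Definition monom (M : cstarAlgType R) (X : 'I_n -> M) (w : word n) : M :=
  \prod_(i <- w) X i.

Definition series_eval (M : cstarAlgType R) (f : ncseries R n) (X : 'I_n -> M)
    (x : M) : Prop :=
  wsums_to (@cnorm R M) (fun w => f w *: monom X w) x.

Definition law (M : tracialNCSpaceType R) (X : 'I_n -> M) : word n -> R[i] :=
  fun w => trace (monom X w).

Definition is_tracial_law (tau : word n -> R[i]) : Prop :=
  exists (M : tracialNCSpaceType R) (X : 'I_n -> M),
    selfadjoint_tuple X /\ tau = law X.

(* tau (P . (X + D W (X))) = (tau (x) tau) (Tr (J P)) *)
Definition schwinger_dyson (W : ncseries R n) (tau : word n -> R[i]) : Prop :=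
  forall P : 'I_n -> ncseries R n, (forall i, is_ncpoly (P i)) ->
    nc_pairing tau (\sum_i ncmul (P i) (ncvar R i + cyc_grad i W))
      (tensor_pairing tau (\tr (ncJ P))).

Definition cutoff (T : R) (tau : word n -> R[i]) : Prop :=
  forall w, normc (tau w) <= T ^+ size w.

Definition bounded_sd_law (T : R) (W : ncseries R n) (tau : word n -> R[i]) : Prop :=
  [/\ is_tracial_law tau, schwinger_dyson W tau & cutoff T tau].

(* tau is the free Gibbs law of |X|^2/2 + W with cutoff T. *)
Definition free_gibbs_law (T : R) (W : ncseries R n) (tau : word n -> R[i]) : Prop :=
  unique (bounded_sd_law T W) tau.

Definition free_gibbs_well_defined (T : R) (W : ncseries R n) : Prop :=
  exists tau, free_gibbs_law T W tau.

Definition has_free_gibbs_law (T : R) (W : ncseries R n)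
    (M : tracialNCSpaceType R) (X : 'I_n -> M) : Prop :=
  selfadjoint_tuple X /\ free_gibbs_law T W (law X).

End Laws.

(* Main.v *)
From HB Require Import structures.
From mathcomp Require Import all_boot all_order all_algebra.
From mathcomp Require Import all_classical all_reals all_analysis.
From mathcomp.real_closed Require Import complex.
From mathcomp Require Import ring lra.
Require Import Defs.

(** The theorem is an instance of free monotone transport, carried out on
    coefficients. A law is a function [tau] on words, a series is a function on
    words, and all series involved have finite weighted l^1 norm, so every
    identity below is an absolutely convergent rearrangement of sums.

    Potentials are handled through their Euler derivative: if [phi] is
    cyclically symmetric and [psi w = |w| phi w], then the i-th component of
    the cyclic gradient of [phi] is [u |-> psi (i u)] ([fld]), and
    [F i = x_i + psi (i _)] ([pert]) is the change of variables generated by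
    [phi].

    Change of variables ([sd_change_of_variables]). Let [tau] solve the
    Schwinger-Dyson equation of |x|^2/2 + V0. The law of [F] under [tau] solves
    that of |x|^2/2 + W as soon as |x|^2/2 + V0 and
      |F|^2/2 + W o F - (1 (x) tau + tau (x) 1) Tr log JF
    agree up to a constant and up to cyclic permutation of words. To see this,
    test the equation for V0 on the tuple r = (JF)^-1 # (P o F). A variation of
    x by r moves F by JF # r = P o F, so the first two terms give the left-hand
    side of the equation for W tested on P; the variation of the logarithm is
    Tr ((JF)^-1 delta_r (JF)), and it cancels what distinguishes J r from (J (P
    o F)) (JF)^-1 = (J P) o F.

    Since x . D phi and psi agree up to cyclic permutation, |F|^2/2 is |x|^2/2
    + psi + |D phi|^2/2, and the condition becomes a fixed point equation for
    psi,
      psi = V0 + Xi tau W psi,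
    with Xi the cyclic average of the logarithm minus |D phi|^2/2 minus W o F.
    On the unit ball of a weighted l^1 space of large radius Xi is Lipschitz
    with a small constant: each derivative gains a power of the radius, and W
    is small ([sb_XiB]).

    The equation cannot be solved for V in one step, because the law of Y
    depends on V. The semicircular law is the known solution for the potential
    0, and two changes of variables are composed: one with Euler derivative p
    from the semicircular law to the law of Y, and one with Euler derivative s
    from the law of Y to the law of X. The second one is required to be the
    gradient of V itself, so V w = s w / |w|, and the two equations become
      p = Xi sigma V p,   s = |w| / (|w| - 1) Xi (law of Y) W s,
    where sigma is the semicircular law and the law of Y is a function of p.
    The factor is bounded since W is even, so that nothing of degree one
    occurs. This is one contraction in the pair (p, s) ([exists_potentials],
    [two_step_transport]).

    It remains to pass between functions on words and operators. Two solutions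
    of the Schwinger-Dyson equation with the same exponential bound are equal,
    because the equation halves their distance in a weighted supremum norm
    ([sd_mono_unique]). Hence every Y with the free Gibbs law of V has the law
    constructed above. As the trace is faithful, the bound on the moments
    bounds the norms of the Y_i ([cnorm_le_cutoff]), so the gradient of V
    converges on Y and the law of X = Y + D V (Y) is the one computed on words
    ([law_of_series]). Finally, the free Gibbs laws are laws of operators: the
    semicircular tuple is realized on the full Fock space, and the others by
    evaluating series at it. *)

Set Implicit Arguments.
Unset Strict Implicit.
Unset Printing Implicit Defensive.

Import Order.TTheory GRing.Theory Num.Theory.
Import numFieldNormedType.Exports.
Import ComplexField.Normc.

Local Open Scope classical_set_scope.
Local Open Scope ring_scope.

Local Notation Re := complex.Re.
Local Notation Im := complex.Im.

(** * Summable families of real and complex numbers *)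

Section NonnegativeSums.
Variable R : realType.
Implicit Types (I J : choiceType).

(** Summability and an estimate in one predicate: this is the form in which
    weighted norms are propagated, a bound being transformed at each step and
    the exact sum never being computed. *)
Definition bsum I (g : I -> R) (c : R) : Prop :=
  (\esum_(i in [set: I]) (g i)%:E <= c%:E)%E.

Definition psum I (g : I -> R) : R := fine (\esum_(i in [set: I]) (g i)%:E).

Lemma esum_seq I (g : I -> R) (s : seq I) : uniq s -> (forall i, 0 <= g i) ->
  (\esum_(i in [set` s]) (g i)%:E = (\sum_(i <- s) g i)%:E)%E.
Proof.
move=> us g0; rewrite esum_fset.
- by rewrite -fsbig_seq // sumEFin.
- exact: finite_seq.
- by move=> i _; rewrite lee_fin.
Qed.

Lemma bsum_sumP I (g : I -> R) c : (forall i, 0 <= g i) ->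
  bsum g c <-> (forall s : seq I, uniq s -> \sum_(i <- s) g i <= c).
Proof.
move=> g0; split=> [h s us|h].
  rewrite -lee_fin -esum_seq //; apply: le_trans h.
  rewrite esum_mkcond; apply: le_esum => i _.
  by case: ifP => // _; rewrite lee_fin.
rewrite /bsum; apply: ge_ereal_sup => _ [A [fA _] <-].
rewrite fsbig_finite //= sumEFin lee_fin; exact: h.
Qed.

Lemma bsum_sum I (g : I -> R) c (s : seq I) : (forall i, 0 <= g i) ->
  bsum g c -> uniq s -> \sum_(i <- s) g i <= c.
Proof. by move=> g0 /(bsum_sumP _ g0); exact. Qed.

Lemma bsum_le I (g h : I -> R) c : (forall i, g i <= h i) -> bsum h c -> bsum g c.
Proof.
by move=> gh; apply: le_trans; apply: le_esum => i _; rewrite lee_fin.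
Qed.

Lemma bsum_leR I (g : I -> R) c d : c <= d -> bsum g c -> bsum g d.
Proof. by move=> cd h; apply: le_trans h _; rewrite lee_fin. Qed.

Lemma bsum_ge0 I (g : I -> R) c : (forall i, 0 <= g i) -> bsum g c -> 0 <= c.
Proof. by move=> g0 /bsum_sum => /(_ [::] g0); rewrite big_nil; exact. Qed.

Lemma bsum_term I (g : I -> R) c i : (forall i, 0 <= g i) -> bsum g c -> g i <= c.
Proof.
by move=> g0 /bsum_sum => /(_ [:: i] g0); rewrite big_seq1; exact.
Qed.

Lemma bsumD I (g h : I -> R) c d : (forall i, 0 <= g i) -> (forall i, 0 <= h i) ->
  bsum g c -> bsum h d -> bsum (fun i => g i + h i) (c + d).
Proof.
move=> g0 h0 gc hd; rewrite /bsum EFinD.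
under eq_esum do rewrite EFinD.
by rewrite esumD ?leeD // => i _; rewrite lee_fin.
Qed.

Lemma bsumZ I (g : I -> R) c (a : R) : 0 <= a -> (forall i, 0 <= g i) ->
  bsum g c -> bsum (fun i => a * g i) (a * c).
Proof.
move=> a0 g0 gc; apply/bsum_sumP; first by move=> i; rewrite mulr_ge0.
move=> s us; rewrite -mulr_sumr ler_wpM2l //; exact: (bsum_sum g0 gc).
Qed.

Lemma bsum0 I : bsum (fun _ : I => 0 : R) 0.
Proof. by rewrite /bsum esum1. Qed.

Lemma bsum_big I (T : Type) (s : seq T) (g : T -> I -> R) (c : T -> R) :
  (forall t i, 0 <= g t i) -> (forall t, bsum (g t) (c t)) ->
  bsum (fun i => \sum_(t <- s) g t i) (\sum_(t <- s) c t).
Proof.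
move=> g0 gc; elim: s => [|t s IH].
  rewrite big_nil; under [X in bsum X]funext do rewrite big_nil.
  exact: bsum0.
rewrite big_cons; under [X in bsum X]funext do rewrite big_cons.
by apply: bsumD => // i; apply: sumr_ge0.
Qed.

Lemma esum_pairE I J (g : I * J -> R) : (forall p, 0 <= g p) ->
  \esum_(p in [set: I * J]) (g p)%:E =
  \esum_(i in [set: I]) \esum_(j in [set: J]) (g (i, j))%:E.
Proof.
move=> g0; rewrite esum_esum; last by move=> i j _ _; rewrite lee_fin.
have -> : [set: I] `*`` (fun=> [set: J]) = [set: I * J] by apply/seteqP; split.
by apply: eq_esum => -[i j].
Qed.

Lemma bsum_pair I J (g : I * J -> R) (c : I -> R) d : (forall p, 0 <= g p) ->
  (forall i, bsum (fun j => g (i, j)) (c i)) -> bsum c d -> bsum g d.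
Proof.
move=> g0 gc cd; rewrite /bsum esum_pairE //; apply: le_trans cd.
by apply: le_esum => i _; exact: gc.
Qed.

Lemma bsum_mul I J (g : I -> R) (h : J -> R) c d :
  (forall i, 0 <= g i) -> (forall j, 0 <= h j) -> bsum g c -> bsum h d ->
  bsum (fun p : I * J => g p.1 * h p.2) (c * d).
Proof.
move=> g0 h0 gc hd.
have d0 := bsum_ge0 h0 hd.
apply: (@bsum_pair _ _ _ (fun i => d * g i)).
- by move=> p; rewrite mulr_ge0.
- by move=> i /=; rewrite (mulrC d); apply: bsumZ.
- by rewrite (mulrC c); apply: bsumZ.
Qed.

Lemma bsum_inj I J (g : J -> R) (e : I -> J) c : (forall j, 0 <= g j) ->
  injective e -> bsum g c -> bsum (fun i => g (e i)) c.
Proof.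
move=> g0 ie /(bsum_sumP _ g0) gc; apply/bsum_sumP => // s us.
by have := gc (map e s); rewrite (map_inj_uniq ie) big_map; exact.
Qed.

Lemma esum_inj I J (g : J -> R) (e : I -> J) : injective e ->
  (forall j, (forall i, e i <> j) -> g j = 0) ->
  \esum_(i in [set: I]) (g (e i))%:E = \esum_(j in [set: J]) (g j)%:E.
Proof.
move=> ie g0; rewrite -(@reindex_esum R _ _ [set: I] (range e) e (fun j => (g j)%:E)).
  rewrite esum_mkcond; apply: eq_esum => j _; case: ifPn => //.
  by rewrite notin_setE => h; rewrite g0 // => i eij; apply: h; exists i.
by split; [move=> i _; exists i | move=> i j _ _; exact: ie | move=> j].
Qed.

(** The lists [s i] are disjoint since [p] recovers the index, so a finite part
    of the grouped sum is a finite part of the original one. *)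
Lemma bsum_fiber I J (g : J -> R) (s : I -> seq J) (p : J -> I) c :
  (forall j, 0 <= g j) -> (forall i, uniq (s i)) ->
  (forall i j, j \in s i -> p j = i) -> bsum g c ->
  bsum (fun i => \sum_(j <- s i) g j) c.
Proof.
move=> g0 us ps gc; apply/bsum_sumP; first by move=> i; apply: sumr_ge0.
move=> t ut; have -> : \sum_(i <- t) \sum_(j <- s i) g j =
    \sum_(j <- flatten (map s t)) g j.
  by rewrite big_flatten /= big_map.
apply: (bsum_sum g0 gc).
elim: t ut => //= i t IH /andP[it ut]; rewrite cat_uniq us IH // andbT /=.
apply/hasPn => j /flattenP[_ /mapP[k kt ->] jk]; apply/negP => /= ji.
by move: it; rewrite -(ps _ _ ji) (ps _ _ jk) kt.
Qed.

Lemma bsum_fin_psum I (g : I -> R) c : (forall i, 0 <= g i) -> bsum g c ->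
  (\esum_(i in [set: I]) (g i)%:E = (psum g)%:E)%E.
Proof.
move=> g0 gc; rewrite /psum fineK // fin_numElt.
have e0 : (0 <= \esum_(i in [set: I]) (g i)%:E)%E by apply: esum_ge0 => i _; rewrite lee_fin.
rewrite (lt_le_trans (ltNy0) e0) /=.
by apply: le_lt_trans gc _; rewrite ltry.
Qed.

Lemma bsum_psum I (g : I -> R) c : (forall i, 0 <= g i) -> bsum g c ->
  bsum g (psum g).
Proof. by move=> g0 gc; rewrite /bsum (bsum_fin_psum g0 gc). Qed.

Lemma psum_le I (g : I -> R) c : (forall i, 0 <= g i) -> bsum g c -> psum g <= c.
Proof. by move=> g0 gc; rewrite -lee_fin -(bsum_fin_psum g0 gc). Qed.

Lemma psum_ge0 I (g : I -> R) : (forall i, 0 <= g i) -> 0 <= psum g.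
Proof. by move=> g0; apply: fine_ge0; apply: esum_ge0 => i _; rewrite lee_fin. Qed.

Lemma psumD I (g h : I -> R) c d : (forall i, 0 <= g i) -> (forall i, 0 <= h i) ->
  bsum g c -> bsum h d -> psum (fun i => g i + h i) = psum g + psum h.
Proof.
move=> g0 h0 gc hd; apply: EFin_inj.
rewrite EFinD -(bsum_fin_psum g0 gc) -(bsum_fin_psum h0 hd).
rewrite -(@bsum_fin_psum _ _ (c + d)); first last.
- exact: bsumD.
- by move=> i; rewrite addr_ge0.
under eq_esum do rewrite EFinD.
by rewrite esumD // => i _; rewrite lee_fin.
Qed.

Lemma psumZ I (g : I -> R) c (a : R) : 0 <= a -> (forall i, 0 <= g i) -> bsum g c ->
  psum (fun i => a * g i) = a * psum g.
Proof.
move=> a0 g0 gc; have [->|a1] := eqVneq a 0.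
  rewrite mul0r /psum esum1 // => i _; by rewrite mul0r.
have ag0 i : 0 <= a * g i by rewrite mulr_ge0.
have ia0 : 0 <= a^-1 by rewrite invr_ge0.
apply/eqP; rewrite eq_le; apply/andP; split.
  apply: (psum_le ag0); apply: bsumZ => //; exact: bsum_psum gc.
rewrite -ler_pdivlMl ?lt_neqAle ?(eq_sym 0) ?a1 //.
apply: (psum_le g0).
have gE : g = fun i => a^-1 * (a * g i) by apply/funext => i; rewrite mulKf.
rewrite {1}gE; apply: bsumZ => //; apply: (bsum_psum ag0 (c := a * c)).
exact: bsumZ.
Qed.

(** Tonelli, with the inner sums finite because they are parts of the total
    one. *)
Lemma psum_pair I J (g : I * J -> R) c : (forall p, 0 <= g p) -> bsum g c ->
  [/\ forall i, bsum (fun j => g (i, j)) (psum (fun j => g (i, j))),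
      bsum (fun i => psum (fun j => g (i, j))) c &
      psum g = psum (fun i => psum (fun j => g (i, j)))].
Proof.
move=> g0 gc.
have h i : bsum (fun j => g (i, j)) (psum (fun j => g (i, j))).
  apply: (@bsum_psum _ _ c) => //.
  by apply: (bsum_inj g0 _ gc) => j k [].
have E : \esum_(p in [set: I * J]) (g p)%:E =
    \esum_(i in [set: I]) (psum (fun j => g (i, j)))%:E.
  rewrite esum_pairE //; apply: eq_esum => i _.
  exact: bsum_fin_psum (h i).
by split => //; rewrite ?/bsum -?E // /psum -?E.
Qed.

Lemma psum_inj I J (g : J -> R) (e : I -> J) : injective e ->
  (forall j, (forall i, e i <> j) -> g j = 0) -> psum (fun i => g (e i)) = psum g.
Proof. by move=> ie g0; rewrite /psum (esum_inj ie g0). Qed.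

Lemma psum_seq I (g : I -> R) (s : seq I) : uniq s -> (forall i, 0 <= g i) ->
  (forall i, i \notin s -> g i = 0) -> psum g = \sum_(i <- s) g i.
Proof.
move=> us g0 gs; rewrite /psum -[RHS]/(fine (\sum_(i <- s) g i)%:E) -esum_seq //.
rewrite [in RHS]esum_mkcond; congr fine; apply: eq_esum => i _.
by case: ifPn => //; rewrite mem_setE /= => /gs ->.
Qed.

Lemma bsum_seq I (g : I -> R) (s : seq I) : uniq s -> (forall i, 0 <= g i) ->
  (forall i, i \notin s -> g i = 0) -> bsum g (\sum_(i <- s) g i).
Proof.
move=> us g0 gs; rewrite /bsum -esum_seq // [leRHS]esum_mkcond; apply: le_esum => i _.
by case: ifPn => //; rewrite mem_setE /= => /gs ->.
Qed.

(** The sum of a summable family is exhausted by finite subfamilies: otherwise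
    the sum could be lowered by [e]. *)
Lemma bsum_tail I (g : I -> R) c (e : R) : (forall i, 0 <= g i) -> bsum g c -> 0 < e ->
  exists2 s : seq I, uniq s & bsum (fun i => if i \in s then 0 else g i) e.
Proof.
move=> g0 gc e0.
have [s us hs] : exists2 s : seq I, uniq s & psum g - e < \sum_(i <- s) g i.
  apply: contrapT => /forall2NP h.
  have : psum g <= psum g - e.
    apply: (psum_le g0); apply/bsum_sumP => // s us.
    by rewrite leNgt; apply/negP; case: (h s) => [/(_ us)|/[apply]].
  by move=> ?; lra.
exists s => //; apply/bsum_sumP => [i|t ut]; first by case: ifP.
rewrite (bigID (mem s)) /= big1 ?add0r; last by move=> i ->.
rewrite (eq_bigr g); last by move=> i /negbTE ->.
rewrite -big_filter; set t' := [seq i <- t | i \notin s].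
have : \sum_(i <- s ++ t') g i <= psum g.
  apply: (bsum_sum g0 (bsum_psum g0 gc)).
  rewrite cat_uniq us filter_uniq // andbT; apply/hasPn => i.
  by rewrite mem_filter => /andP[].
rewrite big_cat /=; lra.
Qed.

End NonnegativeSums.

Section ComplexSums.
Variable R : realType.
Local Notation C := (R[i]).
Implicit Types (I J : choiceType).

Lemma normc_ge0 (x : C) : 0 <= normc x.
Proof. by case: x => a b; rewrite /normc sqrtr_ge0. Qed.

Lemma normcD (x y : C) : normc (x + y) <= normc x + normc y.
Proof. exact: le_normcD. Qed.

Lemma normcB (x y : C) : normc (x - y) <= normc x + normc y.
Proof. by rewrite -[normc y]normcN; exact: le_normcD. Qed.

Lemma Re_le_normc (x : C) : `|Re x| <= normc x.
Proof.
case: x => a b; rewrite /normc /= -sqrtr_sqr ler_wsqrtr //.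
by rewrite lerDl sqr_ge0.
Qed.

Lemma Im_le_normc (x : C) : `|Im x| <= normc x.
Proof.
case: x => a b; rewrite /normc /= -sqrtr_sqr ler_wsqrtr //.
by rewrite lerDr sqr_ge0.
Qed.

Lemma normc_real (a : R) : normc (a%:C)%C = `|a|.
Proof. by rewrite /normc /= expr0n /= addr0 sqrtr_sqr. Qed.

Lemma normc_nat (k : nat) : normc (k%:R : C) = k%:R.
Proof. by rewrite -(rmorph_nat (real_complex R)) normc_real normr_nat. Qed.

Lemma normc_conj (x : C) : normc (conjc x) = normc x.
Proof. by case: x => a b; rewrite /normc /= sqrrN. Qed.

Lemma normc_sum (T : Type) (s : seq T) (P : pred T) (F : T -> C) :
  normc (\sum_(i <- s | P i) F i) <= \sum_(i <- s | P i) normc (F i).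
Proof.
elim/big_rec2: _ => [|i x y _ h]; first by rewrite normc0.
by apply: le_trans (normcD _ _) _; rewrite lerD2l.
Qed.

(** A total sum, which is the genuine one on absolutely summable families.
    Positive and negative parts are summed separately, so that reindexing
    reduces to sums of nonnegative families. *)
Definition rsum I (g : I -> R) : R :=
  psum (fun i => Num.max (g i) 0) - psum (fun i => Num.max (- g i) 0).

Definition csum I (f : I -> C) : C :=
  Complex (rsum (fun i => Re (f i))) (rsum (fun i => Im (f i))).

Lemma maxr0_ge0 (x : R) : 0 <= Num.max x 0.
Proof. by rewrite le_max lexx orbT. Qed.

Lemma maxr0_le (x y : R) : `|x| <= y -> Num.max x 0 <= y.
Proof.
by move=> h; rewrite ge_max (le_trans (ler_norm x) h) (le_trans (normr_ge0 x) h).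
Qed.

Lemma maxr0_sub (x : R) : x = Num.max x 0 - Num.max (- x) 0.
Proof.
case: (leP 0 x) => h.
  have h' : - x <= 0 by rewrite oppr_le0.
  by rewrite (max_r h') subr0.
have h' : 0 <= - x by rewrite oppr_ge0 ltW.
by rewrite (max_l h') sub0r opprK.
Qed.

(** Any way of writing [g] as a difference of summable nonnegative families may
    be used; linearity and Fubini follow by choosing it suitably. *)
Lemma rsum_diff I (g a b : I -> R) c d : (forall i, 0 <= a i) -> (forall i, 0 <= b i) ->
  bsum a c -> bsum b d -> (forall i, g i = a i - b i) -> rsum g = psum a - psum b.
Proof.
move=> a0 b0 ac bd gE; rewrite /rsum.
set gp := fun i => Num.max (g i) 0; set gm := fun i => Num.max (- g i) 0.
have pc : bsum gp c.
  apply: bsum_le ac => i; rewrite /gp ge_max a0 andbT gE gerBl; exact: b0.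
have md : bsum gm d.
  apply: bsum_le bd => i; rewrite /gm ge_max b0 andbT gE opprB gerBl; exact: a0.
have p0 i : 0 <= gp i by exact: maxr0_ge0.
have m0 i : 0 <= gm i by exact: maxr0_ge0.
apply/eqP; rewrite subr_eq addrAC eq_sym subr_eq eq_sym; apply/eqP.
rewrite -(psumD p0 b0 pc bd) -(psumD a0 m0 ac md); congr psum; apply/funext => i.
by have := maxr0_sub (g i); rewrite -/(gp i) -/(gm i) gE; lra.
Qed.

Lemma rsum_psum I (g : I -> R) c : (forall i, 0 <= g i) -> bsum g c -> rsum g = psum g.
Proof.
move=> g0 gc; rewrite (rsum_diff g0 (fun=> lexx 0) gc (bsum0 _ I)) => [|i].
  by rewrite {2}/psum esum1 // subr0.
by rewrite subr0.
Qed.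

Lemma bsum_maxp I (g : I -> R) c : bsum (fun i => `|g i|) c ->
  bsum (fun i => Num.max (g i) 0) c.
Proof. by apply: bsum_le => i; exact: maxr0_le. Qed.

Lemma bsum_maxm I (g : I -> R) c : bsum (fun i => `|g i|) c ->
  bsum (fun i => Num.max (- g i) 0) c.
Proof. by apply: bsum_le => i; apply: maxr0_le; rewrite normrN. Qed.

Lemma rsumD I (g h : I -> R) c d : bsum (fun i => `|g i|) c ->
  bsum (fun i => `|h i|) d -> rsum (fun i => g i + h i) = rsum g + rsum h.
Proof.
move=> gc hd.
have p0 (f : I -> R) i : 0 <= Num.max (f i) 0 by exact: maxr0_ge0.
have [gp gm] := (bsum_maxp gc, bsum_maxm gc).
have [hp hm] := (bsum_maxp hd, bsum_maxm hd).
rewrite (@rsum_diff _ _ (fun i => Num.max (g i) 0 + Num.max (h i) 0)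
  (fun i => Num.max (- g i) 0 + Num.max (- h i) 0) (c + d) (c + d)).
- rewrite (psumD (p0 _) (p0 _) gp hp) (psumD (p0 (fun i => - g i)) (p0 (fun i => - h i)) gm hm).
  rewrite /rsum; lra.
- by move=> i; rewrite addr_ge0 ?maxr0_ge0.
- by move=> i; rewrite addr_ge0 ?maxr0_ge0.
- apply: bsumD gp hp; exact: p0.
- apply: bsumD gm hm => i; exact: maxr0_ge0.
- by move=> i; rewrite {1}(maxr0_sub (g i)) {1}(maxr0_sub (h i)); lra.
Qed.

Lemma rsumN I (g : I -> R) : rsum (fun i => - g i) = - rsum g.
Proof.
rewrite /rsum opprB; congr (_ - _); congr psum; apply/funext => i.
by rewrite opprK.
Qed.

Lemma rsumZ I (g : I -> R) c (a : R) : bsum (fun i => `|g i|) c ->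
  rsum (fun i => a * g i) = a * rsum g.
Proof.
wlog a0 : a / 0 <= a => [hw gc|gc].
  have [a0|a0] := leP 0 a; first exact: hw.
  have -> : (fun i => a * g i) = fun i => - ((- a) * g i).
    by apply/funext => i; rewrite mulNr opprK.
  by rewrite rsumN hw ?oppr_ge0 ?ltW // mulNr opprK.
have [gp gm] := (bsum_maxp gc, bsum_maxm gc).
rewrite (@rsum_diff _ _ (fun i => a * Num.max (g i) 0)
  (fun i => a * Num.max (- g i) 0) (a * c) (a * c)).
- by rewrite (psumZ a0 _ gp) ?(psumZ a0 _ gm) -?mulrBr // => i; exact: maxr0_ge0.
- by move=> i; rewrite mulr_ge0 ?maxr0_ge0.
- by move=> i; rewrite mulr_ge0 ?maxr0_ge0.
- by apply: bsumZ gp => // i; exact: maxr0_ge0.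
- by apply: bsumZ gm => // i; exact: maxr0_ge0.
- by move=> i; rewrite -mulrBr -maxr0_sub.
Qed.

Lemma rsum_pair I J (g : I * J -> R) c : bsum (fun p => `|g p|) c ->
  rsum g = rsum (fun i => rsum (fun j => g (i, j))).
Proof.
move=> gc.
have p0 p : 0 <= Num.max (g p) 0 by exact: maxr0_ge0.
have m0 p : 0 <= Num.max (- g p) 0 by exact: maxr0_ge0.
have [_ cp Ep] := psum_pair p0 (bsum_maxp gc).
have [_ cm Em] := psum_pair m0 (bsum_maxm gc).
rewrite {1}/rsum Ep Em.
rewrite -(@rsum_diff _ (fun i => rsum (fun j => g (i, j))) _ _ _ _ _ _ cp cm) //.
- by move=> i; apply: psum_ge0.
- by move=> i; apply: psum_ge0.
Qed.

Lemma rsum_inj I J (g : J -> R) (e : I -> J) : injective e ->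
  (forall j, (forall i, e i <> j) -> g j = 0) -> rsum (fun i => g (e i)) = rsum g.
Proof.
move=> ie g0; rewrite /rsum.
rewrite (psum_inj (g := fun j => Num.max (g j) 0) ie).
  rewrite (psum_inj (g := fun j => Num.max (- g j) 0) ie) // => j /g0 ->.
  by rewrite oppr0 maxxx.
by move=> j /g0 ->; rewrite maxxx.
Qed.

Lemma rsum_seq I (g : I -> R) (s : seq I) : uniq s ->
  (forall i, i \notin s -> g i = 0) -> rsum g = \sum_(i <- s) g i.
Proof.
move=> us gs; rewrite /rsum (psum_seq us (g := fun i => Num.max (g i) 0)).
- rewrite (psum_seq us (g := fun i => Num.max (- g i) 0)).
  + by rewrite -sumrB; apply: eq_bigr => i _; rewrite -maxr0_sub.
  + by move=> i; exact: maxr0_ge0.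
  + by move=> i /gs ->; rewrite oppr0 maxxx.
- by move=> i; exact: maxr0_ge0.
- by move=> i /gs ->; rewrite maxxx.
Qed.

Lemma bsum_Re I (f : I -> C) c : bsum (fun i => normc (f i)) c ->
  bsum (fun i => `|Re (f i)|) c.
Proof. by apply: bsum_le => i; exact: Re_le_normc. Qed.

Lemma bsum_Im I (f : I -> C) c : bsum (fun i => normc (f i)) c ->
  bsum (fun i => `|Im (f i)|) c.
Proof. by apply: bsum_le => i; exact: Im_le_normc. Qed.

Lemma eq_csum I (f g : I -> C) : (forall i, f i = g i) -> csum f = csum g.
Proof. by move=> /funext ->. Qed.

Lemma csumD I (f g : I -> C) c d : bsum (fun i => normc (f i)) c ->
  bsum (fun i => normc (g i)) d -> csum (fun i => f i + g i) = csum f + csum g.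
Proof.
move=> fc gd; apply/eqP; rewrite eq_complex /=; apply/andP; split; apply/eqP.
  rewrite -(rsumD (bsum_Re fc) (bsum_Re gd)); congr rsum; apply/funext => i.
  by rewrite raddfD.
rewrite -(rsumD (bsum_Im fc) (bsum_Im gd)); congr rsum; apply/funext => i.
by rewrite raddfD.
Qed.

Lemma csumN I (f : I -> C) : csum (fun i => - f i) = - csum f.
Proof.
apply/eqP; rewrite eq_complex /=; apply/andP; split; apply/eqP;
 rewrite -rsumN; congr rsum; apply/funext => i; by rewrite raddfN.
Qed.

Lemma csumB I (f g : I -> C) c d : bsum (fun i => normc (f i)) c ->
  bsum (fun i => normc (g i)) d -> csum (fun i => f i - g i) = csum f - csum g.
Proof.
move=> fc gd; rewrite (csumD (g := fun i => - g i) (d := d) fc) ?csumN //.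
by apply: bsum_le gd => i; rewrite normcN.
Qed.

Lemma csumZ I (f : I -> C) c (a : C) : bsum (fun i => normc (f i)) c ->
  csum (fun i => a * f i) = a * csum f.
Proof.
move=> fc; case: a => a b.
have hr := bsum_Re fc; have hi := bsum_Im fc.
have bz (x : R) (g : I -> R) : bsum (fun i => `|g i|) c -> bsum (fun i => `|x * g i|) (`|x| * c).
  move=> gc; have -> : (fun i => `|x * g i|) = fun i => `|x| * `|g i|.
    by apply/funext => i; rewrite normrM.
  exact: bsumZ.
apply/eqP; rewrite eq_complex /=; apply/andP; split; apply/eqP.
  rewrite -(rsumZ a hr) -(rsumZ b hi) -rsumN -(rsumD (c := `|a| * c) (d := `|b| * c)).
  - by congr rsum; apply/funext => i; case: (f i).
  - exact: bz.
  - by under [X in bsum X]funext do rewrite normrN; exact: bz.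
rewrite -(rsumZ a hi) -(rsumZ b hr) -(rsumD (c := `|a| * c) (d := `|b| * c)).
- by congr rsum; apply/funext => i; case: (f i).
- exact: bz.
- exact: bz.
Qed.

Lemma csumZr I (f : I -> C) c (a : C) : bsum (fun i => normc (f i)) c ->
  csum (fun i => f i * a) = csum f * a.
Proof. by move=> fc; rewrite mulrC -(csumZ a fc); apply: eq_csum => i; rewrite mulrC. Qed.

Lemma csum_conj I (f : I -> C) : csum (fun i => conjc (f i)) = conjc (csum f).
Proof.
apply/eqP; rewrite eq_complex /=; apply/andP; split; apply/eqP.
  by congr rsum; apply/funext => i; case: (f i).
by rewrite -rsumN; congr rsum; apply/funext => i; case: (f i).
Qed.

Lemma csum_pair I J (f : I * J -> C) c : bsum (fun p => normc (f p)) c ->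
  csum f = csum (fun i => csum (fun j => f (i, j))).
Proof.
by move=> fc; congr Complex; rewrite (rsum_pair (bsum_Re fc), rsum_pair (bsum_Im fc)).
Qed.

Lemma csum_inj I J (f : J -> C) (e : I -> J) : injective e ->
  (forall j, (forall i, e i <> j) -> f j = 0) -> csum (fun i => f (e i)) = csum f.
Proof.
move=> ie f0; congr Complex.
  by rewrite (rsum_inj (g := fun j => Re (f j)) ie) // => j /f0 ->.
by rewrite (rsum_inj (g := fun j => Im (f j)) ie) // => j /f0 ->.
Qed.

Lemma csum_bij I J (f : J -> C) (e : I -> J) (d : J -> I) : cancel e d -> cancel d e ->
  csum (fun i => f (e i)) = csum f.
Proof.
move=> ed de; apply: csum_inj; first exact: can_inj ed.
by move=> j /(_ (d j)); rewrite de.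
Qed.

Lemma csum_seq I (f : I -> C) (s : seq I) : uniq s ->
  (forall i, i \notin s -> f i = 0) -> csum f = \sum_(i <- s) f i.
Proof.
move=> us f0; apply/eqP; rewrite eq_complex /= raddf_sum raddf_sum /=.
rewrite (rsum_seq us) ?(rsum_seq us) ?eqxx // => i /f0 -> //.
Qed.

Lemma csum1 I (f : I -> C) k : (forall i, i != k -> f i = 0) -> csum f = f k.
Proof.
move=> h; rewrite (@csum_seq _ _ [:: k]) ?big_seq1 // => i.
by rewrite inE; exact: h.
Qed.

Lemma csum0 I : csum (fun _ : I => 0) = 0.
Proof. by rewrite (@csum_seq _ _ [::]) ?big_nil. Qed.

(** After multiplication by a phase the sum is real and equal to its modulus,
    and only the real parts of the terms contribute. *)
Lemma csum_le I (f : I -> C) c : bsum (fun i => normc (f i)) c -> normc (csum f) <= c.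
Proof.
move=> fc; have c0 : 0 <= c by apply: bsum_ge0 fc => i; exact: normc_ge0.
set z := csum f; have [->|z0] := eqVneq z 0; first by rewrite normc0.
have nz : normc z != 0 by apply: contra z0 => /eqP/eq0_normc ->.
pose w : C := conjc z * (((normc z)^-1)%:C)%C.
have nw : normc w = 1.
  by rewrite normcM normc_conj normc_real ger0_norm ?invr_ge0 ?normc_ge0 // divff.
have -> : normc z = Re (csum (fun i => w * f i)).
  rewrite (csumZ w fc) -/z /w mulrAC mulrC.
  move: nz; rewrite /z; case: (csum f) => x y /=.
  set s := Num.sqrt _ => s0.
  have s2 : s * s = x * x + y * y.
    by rewrite -expr2 sqr_sqrtr ?addr_ge0 ?sqr_ge0 // !expr2.
  by rewrite mulNr opprK !mul0r subr0 -s2 mulKf.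
rewrite /csum /= (@rsum_diff _ _ (fun i => Num.max (Re (w * f i)) 0)
  (fun i => Num.max (- Re (w * f i)) 0) c c).
- apply: (@le_trans _ _ (psum (fun i => Num.max (Re (w * f i)) 0))).
    rewrite gerBl; apply: psum_ge0 => i; exact: maxr0_ge0.
  apply: psum_le => [i|]; first exact: maxr0_ge0.
  apply: bsum_le fc => i; apply: maxr0_le.
  by apply: le_trans (Re_le_normc _) _; rewrite normcM nw mul1r.
- by move=> i; exact: maxr0_ge0.
- by move=> i; exact: maxr0_ge0.
- apply: bsum_le fc => i; apply: maxr0_le.
  by apply: le_trans (Re_le_normc _) _; rewrite normcM nw mul1r.
- apply: bsum_le fc => i; apply: maxr0_le; rewrite normrN.
  by apply: le_trans (Re_le_normc _) _; rewrite normcM nw mul1r.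
- by move=> i; rewrite -maxr0_sub.
Qed.

(** Both sides sum the restriction of [f] to the graph of [p], a subset of
    [J * I], in the two possible orders. *)
Lemma csum_fiber I J (f : J -> C) (s : I -> seq J) (p : J -> I) c :
  (forall i, uniq (s i)) -> (forall i j, (j \in s i) = (p j == i)) ->
  bsum (fun j => normc (f j)) c -> csum f = csum (fun i => \sum_(j <- s i) f j).
Proof.
move=> us ps fc.
pose h (q : J * I) : C := if p q.1 == q.2 then f q.1 else 0.
have hb : bsum (fun q => normc (h q)) c.
  apply: (bsum_pair (c := fun j => normc (f j))) => [q|j|//]; first exact: normc_ge0.
  rewrite /h /= -[X in bsum _ X](_ : \sum_(i <- [:: p j])
    normc (if p j == i then f j else 0) = _); last by rewrite big_seq1 eqxx.
  apply: bsum_seq => // [i|i]; first exact: normc_ge0.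
  by rewrite inE eq_sym => /negbTE ->; rewrite normc0.
have hb' : bsum (fun q : I * J => normc (h (q.2, q.1))) c.
  apply: (bsum_inj (g := fun q => normc (h q)) (e := fun q : I * J => (q.2, q.1))) hb.
    by move=> q; exact: normc_ge0.
  by move=> [a b] [a' b'] [-> ->].
transitivity (csum h).
  rewrite (csum_pair hb); apply: eq_csum => j.
  rewrite (@csum1 _ _ (p j)) /h /= ?eqxx // => i; by rewrite eq_sym => /negbTE ->.
rewrite -(@csum_bij _ _ h (fun q : I * J => (q.2, q.1)) (fun q => (q.2, q.1)));
  [|by case|by case].
rewrite (csum_pair hb'); apply: eq_csum => i.
rewrite (@csum_seq _ _ (s i)) // => [|j].
  by apply: eq_big_seq => j; rewrite ps /h /= => ->.
by rewrite ps /h /= => /negbTE ->.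
Qed.

Lemma csum_bigD I (T : Type) (s : seq T) (f : T -> I -> C) (c : T -> R) :
  (forall t, bsum (fun i => normc (f t i)) (c t)) ->
  csum (fun i => \sum_(t <- s) f t i) = \sum_(t <- s) csum (f t).
Proof.
move=> fc; elim: s => [|t s IH].
  by rewrite big_nil; apply: etrans (csum0 I); apply: eq_csum => i; rewrite big_nil.
rewrite big_cons -IH -(csumD (fc t) (d := \sum_(t <- s) c t)).
  by apply: eq_csum => i; rewrite big_cons.
have h : bsum (fun i => \sum_(t <- s) normc (f t i)) (\sum_(t <- s) c t).
  by apply: bsum_big => // x i; exact: normc_ge0.
by apply: bsum_le h => i; exact: normc_sum.
Qed.

Lemma csum_swap I J (f : I -> J -> C) c : bsum (fun p : I * J => normc (f p.1 p.2)) c ->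
  csum (fun i => csum (f i)) = csum (fun j => csum (fun i => f i j)).
Proof.
move=> fc; have fc' : bsum (fun p : J * I => normc (f p.2 p.1)) c.
  apply: (bsum_inj (g := fun q : I * J => normc (f q.1 q.2))
    (e := fun q : J * I => (q.2, q.1))) fc => [q|]; first exact: normc_ge0.
  by move=> [a b] [a' b'] [-> ->].
rewrite -[LHS](csum_pair (f := fun p => f p.1 p.2) fc).
rewrite -[RHS](csum_pair (f := fun p => f p.2 p.1) fc').
rewrite -(@csum_bij _ _ (fun p : I * J => f p.1 p.2)
  (fun q : J * I => (q.2, q.1)) (fun q => (q.2, q.1))) //; by case.
Qed.

End ComplexSums.

(** * Convolutions, and factorizations of words *)

Section Bilinear.
Variable R : realType.
Local Notation C := (R[i]).
Variables (I J1 J2 : choiceType) (s : I -> seq (J1 * J2)) (m : J1 * J2 -> I).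
Hypothesis us : forall i, uniq (s i).
Hypothesis ms : forall i p, (p \in s i) = (m p == i).

(** Products of series, products of tensors and the action of tensors on tuples
    are all convolutions along a multiplication map [m] with finite fibres,
    listed by [s]. Their norm estimates and the formulas for functionals of a
    product are therefore proved once. *)
Definition bconv (K1 K2 : Type) (K3 : nmodType) (op : K1 -> K2 -> K3)
    (f : J1 -> K1) (g : J2 -> K2) : I -> K3 :=
  fun i => \sum_(p <- s i) op (f p.1) (g p.2).

Variables (K1 K2 : Type) (K3 : nmodType) (op : K1 -> K2 -> K3).
Variables (n1 : K1 -> R) (n2 : K2 -> R) (n3 : K3 -> R).
Hypothesis n10 : forall x, 0 <= n1 x.
Hypothesis n20 : forall x, 0 <= n2 x.
Hypothesis n30 : n3 0 = 0.
Hypothesis n3D : forall x y, n3 (x + y) <= n3 x + n3 y.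
Hypothesis n3M : forall x y, n3 (op x y) <= n1 x * n2 y.
Variables (w1 : J1 -> R) (w2 : J2 -> R) (w3 : I -> R).
Hypothesis w10 : forall x, 0 <= w1 x.
Hypothesis w20 : forall x, 0 <= w2 x.
Hypothesis w30 : forall x, 0 <= w3 x.
Hypothesis w3M : forall p, w3 (m p) <= w1 p.1 * w2 p.2.

Lemma n3_sum (T : Type) (t : seq T) (F : T -> K3) :
  n3 (\sum_(i <- t) F i) <= \sum_(i <- t) n3 (F i).
Proof.
elim/big_rec2: _ => [|i x y _ h]; first by rewrite n30.
by apply: le_trans (n3D _ _) _; rewrite lerD2l.
Qed.

Lemma bsum_bconv (f : J1 -> K1) (g : J2 -> K2) c d :
  bsum (fun i => w1 i * n1 (f i)) c -> bsum (fun i => w2 i * n2 (g i)) d ->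
  bsum (fun i => w3 i * n3 (bconv op f g i)) (c * d).
Proof.
move=> fc gd.
have f0 i : 0 <= w1 i * n1 (f i) by rewrite mulr_ge0.
have g0 i : 0 <= w2 i * n2 (g i) by rewrite mulr_ge0.
have := bsum_fiber (s := s) (p := m) _ us _ (bsum_mul f0 g0 fc gd).
move=> H; apply: bsum_le (H _ _) => [i|p|i p]; last first.
- by rewrite ms => /eqP.
- by rewrite mulr_ge0.
rewrite /bconv; apply: le_trans (ler_wpM2l (w30 i) (n3_sum _ _)) _.
rewrite mulr_sumr big_seq [leRHS]big_seq; apply: ler_sum => p; rewrite ms => /eqP <-.
rewrite mulrACA; apply: le_trans (ler_wpM2l (w30 _) (n3M _ _)) _.
by rewrite ler_wpM2r ?mulr_ge0.
Qed.

(** A functional with multiplicative bounds is applied to a convolution by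
    regrouping the double sum along the fibres of [m]. *)
Lemma csum_bconv (f : J1 -> K1) (g : J2 -> K2) c d (l : K3 -> C) (chi : I -> C) :
  l 0 = 0 -> (forall x y, l (x + y) = l x + l y) ->
  (forall x y, normc (l (op x y)) <= n1 x * n2 y) ->
  (forall p, normc (chi (m p)) <= w1 p.1 * w2 p.2) ->
  bsum (fun i => w1 i * n1 (f i)) c -> bsum (fun i => w2 i * n2 (g i)) d ->
  csum (fun i => l (bconv op f g i) * chi i) =
  csum (fun p : J1 * J2 => l (op (f p.1) (g p.2)) * chi (m p)).
Proof.
move=> l0 lD lM chiM fc gd.
have f0 i : 0 <= w1 i * n1 (f i) by rewrite mulr_ge0.
have g0 i : 0 <= w2 i * n2 (g i) by rewrite mulr_ge0.
rewrite [RHS](@csum_fiber _ I _ _ s m (c * d)) //.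
  apply: eq_csum => i; rewrite /bconv.
  have -> : l (\sum_(p <- s i) op (f p.1) (g p.2)) =
      \sum_(p <- s i) l (op (f p.1) (g p.2)).
    by elim/big_rec2: _ => [//|p x y _ <-]; rewrite lD.
  by rewrite mulr_suml; apply: eq_big_seq => p; rewrite ms => /eqP ->.
apply: bsum_le (bsum_mul f0 g0 fc gd) => p.
rewrite normcM mulrC [leRHS]mulrACA ler_pM ?normc_ge0 //.
Qed.

End Bilinear.

Section MatrixNorm.
Variable R : realType.
Local Notation C := (R[i]).

(** The sum of the moduli of the entries: it is submultiplicative and dominates
    both the entries and the trace. *)
Definition mnorm p q (A : 'M[C]_(p, q)) : R := \sum_i \sum_j normc (A i j).

Lemma mnorm_ge0 p q (A : 'M[C]_(p, q)) : 0 <= mnorm A.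
Proof. by apply: sumr_ge0 => i _; apply: sumr_ge0 => j _; exact: normc_ge0. Qed.

Lemma mnorm0 p q : mnorm (0 : 'M[C]_(p, q)) = 0.
Proof. by rewrite /mnorm big1 // => i _; rewrite big1 // => j _; rewrite mxE normc0. Qed.

Lemma mnormD p q (A B : 'M[C]_(p, q)) : mnorm (A + B) <= mnorm A + mnorm B.
Proof.
rewrite /mnorm -big_split; apply: ler_sum => i _; rewrite -big_split.
by apply: ler_sum => j _; rewrite mxE; exact: normcD.
Qed.

Lemma mnormN p q (A : 'M[C]_(p, q)) : mnorm (- A) = mnorm A.
Proof. by apply: eq_bigr => i _; apply: eq_bigr => j _; rewrite mxE normcN. Qed.

Lemma mnormZ p q a (A : 'M[C]_(p, q)) : mnorm (a *: A) = normc a * mnorm A.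
Proof.
rewrite mulr_sumr; apply: eq_bigr => i _; rewrite mulr_sumr; apply: eq_bigr => j _.
by rewrite mxE normcM.
Qed.

Lemma mnorm_sum p q (T : Type) (s : seq T) (F : T -> 'M[C]_(p, q)) :
  mnorm (\sum_(i <- s) F i) <= \sum_(i <- s) mnorm (F i).
Proof.
elim/big_rec2: _ => [|i x y _ h]; first by rewrite mnorm0.
by apply: le_trans (mnormD _ _) _; rewrite lerD2l.
Qed.

Lemma normc_le_mnorm p q (A : 'M[C]_(p, q)) i j : normc (A i j) <= mnorm A.
Proof.
rewrite /mnorm (bigD1 i) //= (bigD1 j) //= -addrA lerDl.
rewrite addr_ge0 ?sumr_ge0 // => k _; rewrite ?sumr_ge0 // => *; exact: normc_ge0.
Qed.

Lemma mnormM p q r (A : 'M[C]_(p, q)) (B : 'M[C]_(q, r)) :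
  mnorm (A *m B) <= mnorm A * mnorm B.
Proof.
rewrite {2}/mnorm mulr_suml; apply: ler_sum => i _.
apply: (@le_trans _ _ (\sum_j \sum_k normc (A i k) * normc (B k j))).
  apply: ler_sum => j _; rewrite mxE; apply: le_trans (normc_sum _ _ _) _.
  by apply: ler_sum => k _; rewrite normcM.
rewrite exchange_big mulr_suml; apply: ler_sum => k _ /=.
rewrite -mulr_sumr ler_wpM2l ?normc_ge0 // /mnorm [leRHS](bigD1 k) //= lerDl.
by apply: sumr_ge0 => l _; apply: sumr_ge0 => j _; exact: normc_ge0.
Qed.

Lemma normc_mxtrace p (A : 'M[C]_p) : normc (\tr A) <= mnorm A.
Proof.
rewrite /mxtrace; apply: le_trans (normc_sum _ _ _) _.
apply: ler_sum => i _; rewrite (bigD1 i) //= lerDl.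
by apply: sumr_ge0 => j _; exact: normc_ge0.
Qed.

End MatrixNorm.

Section WordFacts.
Variable n : nat.
Implicit Types (u v w x : word n) (k : 'I_n).

Fixpoint wfacts w : seq (word n * word n) :=
  ([::], w) :: if w is k :: w' then [seq (k :: p.1, p.2) | p <- wfacts w'] else [::].

Lemma mem_wfacts w (p : word n * word n) : (p \in wfacts w) = (p.1 ++ p.2 == w).
Proof.
elim: w p => [|k w IH] [a b] /=.
  by rewrite inE xpair_eqE -size_eq0 -[_ ++ _ == _]size_eq0 size_cat addn_eq0 -!size_eq0.
rewrite inE xpair_eqE; case: a => [|l a] /=.
  by case: eqP => //= _; apply/mapP => -[[c d] _ []].
rewrite eqseq_cons; apply/mapP/andP => [[[c d]]|[/eqP -> h]].
  by rewrite IH /= => h [-> -> ->].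
by exists (a, b); rewrite ?IH.
Qed.

Lemma uniq_wfacts w : uniq (wfacts w).
Proof.
elim: w => //= k w IH; rewrite map_inj_uniq ?IH ?andbT.
  by apply/mapP => -[[c d] _ []].
by move=> [a b] [c d] [-> ->].
Qed.

Section Sums.
Variable V : nmodType.

Lemma wfacts_nil (h : word n * word n -> V) : \sum_(p <- wfacts [::]) h p = h ([::], [::]).
Proof. by rewrite big_seq1. Qed.

Lemma wfacts_cons k w (h : word n * word n -> V) :
  \sum_(p <- wfacts (k :: w)) h p =
  h ([::], k :: w) + \sum_(p <- wfacts w) h (k :: p.1, p.2).
Proof. by rewrite /= big_cons big_map. Qed.

Arguments wfacts : simpl never.

(** The cut falls to the right or to the left of the distinguished letter. *)
Lemma wfacts_mid u k v (h : word n * word n -> V) :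
  \sum_(p <- wfacts (u ++ k :: v)) h p =
  \sum_(p <- wfacts v) h (u ++ k :: p.1, p.2) + \sum_(p <- wfacts u) h (p.1, p.2 ++ k :: v).
Proof.
elim: u h => [|l u IH] h; first by rewrite wfacts_cons wfacts_nil addrC.
rewrite cat_cons wfacts_cons IH wfacts_cons /= addrCA addrA.
by rewrite -[LHS]addrA [X in _ + X]addrC [LHS]addrA [LHS]addrAC -!addrA.
Qed.

(** Both sides run over the factorizations of [w] into three words. *)
Lemma wfacts_assoc w (h : word n -> word n -> word n -> V) :
  \sum_(p <- wfacts w) \sum_(q <- wfacts p.1) h q.1 q.2 p.2 =
  \sum_(p <- wfacts w) \sum_(q <- wfacts p.2) h p.1 q.1 q.2.
Proof.
elim: w h => [|k w IH] h; first by rewrite !wfacts_nil.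
rewrite !wfacts_cons /= wfacts_nil -?addrA; congr (_ + _).
under eq_bigr do rewrite wfacts_cons /=.
rewrite big_split /=; congr (_ + _).
exact: (IH (fun a b c => h (k :: a) b c)).
Qed.

Lemma wfacts_rev w (h : word n * word n -> V) :
  \sum_(p <- wfacts (rev w)) h p = \sum_(p <- wfacts w) h (rev p.2, rev p.1).
Proof.
rewrite -(big_map (fun p : word n * word n => (rev p.2, rev p.1)) xpredT h).
apply: perm_big; apply: uniq_perm; rewrite ?uniq_wfacts //.
  rewrite map_inj_uniq ?uniq_wfacts // => -[a b] [c d] [].
  by move=> /(can_inj revK) -> /(can_inj revK) ->.
move=> [a b]; rewrite mem_wfacts; apply/eqP/mapP => /= [E|[[c d]]].
  exists (rev b, rev a); rewrite ?revK // mem_wfacts /= -rev_cat E revK //.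
by rewrite mem_wfacts /= => /eqP <- [-> ->]; rewrite rev_cat.
Qed.

End Sums.

(** The ways of cutting a word into [t.1.1 ++ t.2 ++ t.1.2]; the pair of outer
    factors comes first because it is the index of a tensor in [act]. *)
Definition trips w : seq ((word n * word n) * word n) :=
  [seq ((p.1, q.2), q.1) | p <- wfacts w, q <- wfacts p.2].

Lemma mem_trips w t : (t \in trips w) = (t.1.1 ++ t.2 ++ t.1.2 == w).
Proof.
apply/allpairsPdep/eqP => [[[a b] [[c d] [/= h1 h2 ->]]] /=|].
  by move: h1 h2; rewrite !mem_wfacts /= => /eqP <- /eqP <-.
case: t => -[a b] c /= h; exists (a, c ++ b), (c, b).
by rewrite !mem_wfacts /= h !eqxx.
Qed.

Lemma uniq_trips w : uniq (trips w).
Proof.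
apply: allpairs_uniq_dep => [|p _|]; [exact: uniq_wfacts|exact: uniq_wfacts|].
move=> [[a b] [c d]] [[a' b'] [c' d']] /allpairsPdep[[x y] [[z t] [_ h [-> -> -> ->]]]].
move=> /allpairsPdep[[x' y'] [[z' t'] [_ h' [-> -> -> ->]]]] /= [ex et ez].
subst x t z; move: h h'; rewrite !mem_wfacts /= => /eqP h /eqP h'.
by rewrite -h -h'.
Qed.

Section Sums3.
Variable V : nmodType.

Lemma trips_sum w (h : (word n * word n) * word n -> V) :
  \sum_(t <- trips w) h t = \sum_(p <- wfacts w) \sum_(q <- wfacts p.2) h ((p.1, q.2), q.1).
Proof. exact: big_allpairs_dep. Qed.

(** The distinguished letter lies in the middle factor, in the right one or in
    the left one. *)
Lemma trips_mid (p : word n) k (q : word n) (h : (word n * word n) * word n -> V) :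
  \sum_(t <- trips (p ++ k :: q)) h t =
  \sum_(a <- wfacts p) \sum_(b <- wfacts q) h ((a.1, b.2), a.2 ++ k :: b.1) +
  (\sum_(t <- trips p) h ((t.1.1, t.1.2 ++ k :: q), t.2) +
   \sum_(t <- trips q) h ((p ++ k :: t.1.1, t.1.2), t.2)).
Proof.
rewrite !trips_sum wfacts_mid /= addrC.
under eq_bigr do rewrite wfacts_mid /=.
by rewrite big_split /= addrA.
Qed.

End Sums3.

Fixpoint occ w : seq ((word n * 'I_n) * word n) :=
  if w is k :: w' then ([::], k, w') :: [seq ((k :: o.1.1, o.1.2), o.2) | o <- occ w'] else [::].

Lemma mem_occ w o : (o \in occ w) = (o.1.1 ++ o.1.2 :: o.2 == w).
Proof.
elim: w o => [|k w IH] [[a l] b] /=; first by rewrite in_nil; case: a.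
rewrite inE !xpair_eqE; case: a => [|m a] /=.
  rewrite eqseq_cons; case: (l == k) => //=.
    by case: eqP => //= _; apply/mapP => -[[[c l'] d] _ []//].
  by apply/mapP => -[[[c l'] d] _ []].
rewrite eqseq_cons; apply/mapP/andP => [[[[c l'] d]]|[/eqP -> h]].
  by rewrite IH /= => h [-> -> -> ->].
by exists ((a, l), b); rewrite ?IH.
Qed.

Lemma uniq_occ w : uniq (occ w).
Proof.
elim: w => //= k w IH; rewrite map_inj_uniq ?IH ?andbT.
  by apply/mapP => -[[[c l] d] _ []].
by move=> [[a l] b] [[c l'] d] [-> -> ->].
Qed.

Lemma occ_cons (V : nmodType) k w (h : (word n * 'I_n) * word n -> V) :
  \sum_(o <- occ (k :: w)) h o =
  h ([::], k, w) + \sum_(o <- occ w) h ((k :: o.1.1, o.1.2), o.2).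
Proof. by rewrite /= big_cons big_map. Qed.

Arguments occ : simpl never.

Lemma size_occ w : size (occ w) = size w.
Proof. by elim: w => //= k w IH; rewrite /occ /= size_map -/occ IH. Qed.

(** Factorizations in the monoid of the monomials [u (x) v] with product
    [(a (x) b) (c (x) d) = ac (x) db], the one for which
    [(a (x) b) # x = a x b] is an action. *)
Definition pfacts (m : word n * word n) : seq ((word n * word n) * (word n * word n)) :=
  [seq ((a.1, b.2), (a.2, b.1)) | a <- wfacts m.1, b <- wfacts m.2].

Definition pmul (t : (word n * word n) * (word n * word n)) : word n * word n :=
  (t.1.1 ++ t.2.1, t.2.2 ++ t.1.2).

Lemma mem_pfacts m t : (t \in pfacts m) = (pmul t == m).
Proof.
case: m => u v; apply/allpairsP/eqP => [[[[a b] [c d]] [/= h1 h2 ->]]|].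
  by move: h1 h2; rewrite !mem_wfacts /= => /eqP <- /eqP <-.
case: t => -[a b] [c d] /= [<- <-]; exists ((a, c), (d, b)).
by rewrite !mem_wfacts /= !eqxx.
Qed.

Lemma uniq_pfacts m : uniq (pfacts m).
Proof.
apply: allpairs_uniq; rewrite ?uniq_wfacts // => -[[a b] [c d]] [[a' b'] [c' d']] _ _.
by move=> [-> -> -> ->].
Qed.

Lemma pfacts_sum (V : nmodType) m (h : (word n * word n) * (word n * word n) -> V) :
  \sum_(t <- pfacts m) h t =
  \sum_(a <- wfacts m.1) \sum_(b <- wfacts m.2) h ((a.1, b.2), (a.2, b.1)).
Proof. exact: big_allpairs_dep. Qed.

End WordFacts.

(** * Calculus of non-commutative series *)

Section Leibniz.
Variables (R : realType) (d : nat).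
Local Notation C := (R[i]).
Implicit Types (u v w : word d) (j k : 'I_d).

Definition tup := word d -> 'cV[C]_d.

(** The derivative of [h] along the direction [r]: one letter [j] of [h] at a
    time is replaced by the series [r_j]. *)
Definition delw (V : lmodType C) (r : tup) (h : word d -> V) : word d -> V :=
  fun w => \sum_(t <- trips w) \sum_j r t.2 j 0 *: h (t.1.1 ++ j :: t.1.2).

Lemma delw_sum (V : lmodType C) r (T : Type) (s : seq T) (h : T -> word d -> V) w :
  delw r (fun u => \sum_(i <- s) h i u) w = \sum_(i <- s) delw r (h i) w.
Proof.
rewrite /delw [RHS]exchange_big; apply: eq_bigr => t _ /=.
rewrite exchange_big; apply: eq_bigr => j _ /=; exact: scaler_sumr.
Qed.

Variables V1 V2 V3 : lmodType C.
Variable op : V1 -> V2 -> V3.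
Hypothesis opDl : forall x y z, op (x + y) z = op x z + op y z.
Hypothesis opDr : forall x y z, op x (y + z) = op x y + op x z.
Hypothesis opZl : forall a x z, op (a *: x) z = a *: op x z.
Hypothesis opZr : forall a x z, op x (a *: z) = a *: op x z.

Definition wconv (f : word d -> V1) (g : word d -> V2) : word d -> V3 :=
  fun w => \sum_(p <- wfacts w) op (f p.1) (g p.2).

Let op0l z : op 0 z = 0.
Proof. by rewrite -(scale0r 0) opZl scale0r. Qed.
Let op0r z : op z 0 = 0.
Proof. by rewrite -(scale0r 0) opZr scale0r. Qed.
Let op_suml (T : Type) (s : seq T) F z :
  op (\sum_(i <- s) F i) z = \sum_(i <- s) op (F i) z.
Proof. by apply: (big_morph (op^~ z)) => // x y; rewrite opDl. Qed.
Let op_sumr (T : Type) (s : seq T) F z :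
  op z (\sum_(i <- s) F i) = \sum_(i <- s) op z (F i).
Proof. by apply: (big_morph (op z)) => // x y; rewrite opDr. Qed.

(** In a product the replaced letter lies in one of the two factors, so both
    terms run over factorizations of [w] into four words. *)
Lemma delw_wconv r f g w :
  delw r (wconv f g) w = wconv (delw r f) g w + wconv f (delw r g) w.
Proof.
rewrite /delw /wconv.
under eq_bigr => t _ do under eq_bigr => j _ do rewrite wfacts_mid scalerDr.
under eq_bigr => t _ do rewrite big_split /=.
rewrite big_split /=; congr (_ + _).
  transitivity (\sum_(p <- wfacts w) \sum_(q <- wfacts p.2) \sum_(c <- wfacts q.2)
     \sum_j r q.1 j 0 *: op (f (p.1 ++ j :: c.1)) (g c.2)).
    rewrite trips_sum; apply: eq_bigr => p _; apply: eq_bigr => q _ /=.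
    rewrite exchange_big; apply: eq_bigr => j _ /=; exact: scaler_sumr.
  transitivity (\sum_(p <- wfacts w) \sum_(q <- wfacts p.1) \sum_(c <- wfacts q.2)
     \sum_j r c.1 j 0 *: op (f (q.1 ++ j :: c.2)) (g p.2)); last first.
    apply: eq_bigr => p _; rewrite trips_sum op_suml; apply: eq_bigr => q _ /=.
    rewrite op_suml; apply: eq_bigr => c _; rewrite op_suml; apply: eq_bigr => j _.
    by rewrite opZl.
  rewrite (wfacts_assoc w (fun a b c => \sum_(e <- wfacts b)
     \sum_j r e.1 j 0 *: op (f (a ++ j :: e.2)) (g c))).
  apply: eq_bigr => p _.
  by rewrite (wfacts_assoc p.2 (fun a b c => \sum_j r a j 0 *: op (f (p.1 ++ j :: b)) (g c))).
transitivity (\sum_(p <- wfacts w) \sum_(c <- wfacts p.1) \sum_(q <- wfacts p.2)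
     \sum_j r q.1 j 0 *: op (f c.1) (g (c.2 ++ j :: q.2))).
  rewrite trips_sum; apply: eq_bigr => p _; rewrite [RHS]exchange_big; apply: eq_bigr => q _ /=.
  rewrite exchange_big; apply: eq_bigr => j _ /=; exact: scaler_sumr.
rewrite (wfacts_assoc w (fun a b c => \sum_(q <- wfacts c)
     \sum_j r q.1 j 0 *: op (f a) (g (b ++ j :: q.2)))).
apply: eq_bigr => p _; rewrite trips_sum op_sumr; apply: eq_bigr => q _ /=.
rewrite op_sumr; apply: eq_bigr => c _; rewrite op_sumr; apply: eq_bigr => j _.
by rewrite opZr.
Qed.

End Leibniz.

Section SeriesRing.
Variables (R : realType) (d : nat).
Local Notation C := (R[i]).
Implicit Types (u v w : word d) (j k : 'I_d).

(** An alias of the type of series, so that the convolution product can be its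
    canonical multiplication. *)
Definition ser := word d -> C.
HB.instance Definition _ := GRing.Zmodule.copy ser (word d -> C).
Implicit Types (f g h : ser).

Definition ser1 : ser := fun w => (w == [::])%:R.
Definition sermul f g : ser := fun w => \sum_(p <- wfacts w) f p.1 * g p.2.

Lemma ser_sumE (T : Type) (s : seq T) (P : pred T) (F : T -> ser) w :
  (\sum_(i <- s | P i) F i) w = \sum_(i <- s | P i) F i w.
Proof. by elim/big_rec2: _ => // i x y _ <-. Qed.

Lemma sermulA : associative sermul.
Proof.
move=> f g h; apply/funext => w; rewrite /sermul.
under eq_bigr do rewrite mulr_sumr.
under [RHS]eq_bigr do rewrite mulr_suml.
rewrite -(wfacts_assoc w (fun a b c => f a * (g b * h c))).
by apply: eq_bigr => p _; apply: eq_bigr => q _; rewrite mulrA.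
Qed.

Lemma wfacts_delta0 (V : zmodType) w (F : word d * word d -> V) :
  (forall p, p.1 != [::] -> F p = 0) -> \sum_(p <- wfacts w) F p = F ([::], w).
Proof.
case: w => [|k w] F0; first by rewrite wfacts_nil.
by rewrite wfacts_cons big1 ?addr0 // => p _; rewrite F0.
Qed.

Lemma wfacts_delta1 (V : zmodType) w (F : word d * word d -> V) :
  (forall p, p.2 != [::] -> F p = 0) -> \sum_(p <- wfacts w) F p = F (w, [::]).
Proof.
elim: w F => [|k w IH] F F0; first by rewrite wfacts_nil.
by rewrite wfacts_cons F0 // add0r IH // => p h; rewrite F0.
Qed.

Lemma sermul1l : left_id ser1 sermul.
Proof.
move=> f; apply/funext => w; rewrite /sermul wfacts_delta0 /ser1 ?eqxx ?mul1r //=.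
by move=> p /negbTE ->; rewrite mul0r.
Qed.

Lemma sermul1r : right_id ser1 sermul.
Proof.
move=> f; apply/funext => w; rewrite /sermul wfacts_delta1 /ser1 ?eqxx ?mulr1 //=.
by move=> p /negbTE ->; rewrite mulr0.
Qed.

Lemma sermulDl : left_distributive sermul +%R.
Proof.
move=> f g h; apply/funext => w; rewrite -[RHS]/(sermul f h w + sermul g h w).
by rewrite /sermul -big_split; apply: eq_bigr => p _ /=; exact: mulrDl.
Qed.

Lemma sermulDr : right_distributive sermul +%R.
Proof.
move=> f g h; apply/funext => w; rewrite -[RHS]/(sermul f g w + sermul f h w).
by rewrite /sermul -big_split; apply: eq_bigr => p _ /=; exact: mulrDr.
Qed.

HB.instance Definition _ := GRing.Zmodule_isPzRing.Build ser
  sermulA sermul1l sermul1r sermulDl sermulDr.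

Lemma sermulE f g w : (f * g : ser) w = \sum_(p <- wfacts w) f p.1 * g p.2.
Proof. by []. Qed.

Lemma ser1E w : (1 : ser) w = (w == [::])%:R.
Proof. by []. Qed.

Lemma serDE f g w : (f + g : ser) w = f w + g w.
Proof. by []. Qed.

Lemma serBE f g w : (f - g : ser) w = f w - g w.
Proof. by []. Qed.

Lemma ncmulE (f g : ncseries R d) : ncmul f g = (f : ser) * (g : ser).
Proof.
apply/funext => w; rewrite sermulE /ncmul.
elim: w f g => [|k w IH] f g; first by rewrite big_ord1 wfacts_nil.
rewrite wfacts_cons big_ord_recl /=; congr (_ + _).
exact: (IH (fun u => f (k :: u)) g).
Qed.

Definition dels (r : tup R d) (h : ser) : ser := @delw R d (C^o) r h.

Lemma delsM r f g : dels r (f * g) = dels r f * g + f * dels r g.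
Proof.
apply/funext => w; rewrite /dels.
apply: (@delw_wconv R d (C^o) (C^o) (C^o) (fun x y => x * y)).
- by move=> x y z; rewrite mulrDl.
- by move=> x y z; rewrite mulrDr.
- by move=> a x z; rewrite /GRing.scale /= mulrA.
- by move=> a x z; rewrite /GRing.scale /= mulrCA.
Qed.

Lemma dels1 r : dels r 1 = 0.
Proof.
apply/funext => w; rewrite /dels /delw big1 // => t _; rewrite big1 // => j _.
rewrite ser1E; case: (t.1.1) => //=; by rewrite scaler0.
Qed.

(** [wprod F w] is the monomial [w] evaluated at the tuple of series [F]. *)
Definition wprod (F : 'I_d -> ser) w : ser := \prod_(k <- w) F k.

Lemma wprod_cons F k w : wprod F (k :: w) = F k * wprod F w.
Proof. by rewrite /wprod big_cons. Qed.

Lemma wprod_nil F : wprod F [::] = 1.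
Proof. by rewrite /wprod big_nil. Qed.

Lemma wprod_cat F u v : wprod F (u ++ v) = wprod F u * wprod F v.
Proof. by rewrite /wprod big_cat. Qed.

Lemma dels_wprod r F w : dels r (wprod F w) =
  \sum_(o <- occ w) wprod F o.1.1 * dels r (F o.1.2) * wprod F o.2.
Proof.
elim: w => [|k w IH]; first by rewrite wprod_nil dels1 big_nil.
rewrite wprod_cons delsM IH occ_cons /= wprod_nil mul1r mulr_sumr; congr (_ + _).
by apply: eq_bigr => o _; rewrite wprod_cons !mulrA.
Qed.

(** The chain rule for the difference quotients: the marked letter [j] of the
    product comes from exactly one of the factors, and the others are cut off
    on its two sides. *)
Lemma wprod_mid F w u j v : wprod F w (u ++ j :: v) =
  \sum_(o <- occ w) \sum_(a <- wfacts u) \sum_(b <- wfacts v)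
    wprod F o.1.1 a.1 * F o.1.2 (a.2 ++ j :: b.1) * wprod F o.2 b.2.
Proof.
elim: w u => [|k w IH] u.
  by rewrite wprod_nil ser1E big_nil; case: u.
rewrite wprod_cons sermulE wfacts_mid occ_cons /=; congr (_ + _).
  rewrite [RHS]wfacts_delta0 /= ?wprod_nil ?ser1E /=.
    by apply: eq_bigr => b _; rewrite mul1r.
  by move=> p h; rewrite big1 // => b _; rewrite ser1E (negbTE h) !mul0r.
under eq_bigr do rewrite IH mulr_sumr.
rewrite exchange_big; apply: eq_bigr => o _ /=.
under eq_bigr do rewrite mulr_sumr.
rewrite -(wfacts_assoc u (fun a1 a2 a3 => F k a1 * \sum_(b <- wfacts v)
    wprod F o.1.1 a2 * F o.1.2 (a3 ++ j :: b.1) * wprod F o.2 b.2)).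
apply: eq_bigr => a _; rewrite wprod_cons.
under [RHS]eq_bigr do rewrite sermulE !mulr_suml.
rewrite [RHS]exchange_big; apply: eq_bigr => c _ /=.
by rewrite mulr_sumr; apply: eq_bigr => b _; rewrite !mulrA.
Qed.

End SeriesRing.

Section TensorRing.
Variables (R : realType) (n : nat).
Local Notation d := n.+1.
Local Notation C := (R[i]).
Implicit Types (u v w : word d) (j k : 'I_d).

(** Matrices over the tensor square of the series. *)
Definition tens := word d * word d -> 'M[C]_d.
HB.instance Definition _ := GRing.Zmodule.copy tens (word d * word d -> 'M[C]_d).
Implicit Types (A B : tens) (r : tup R d).

Definition tens1 : tens := fun m => (m == ([::], [::]))%:R.
Definition tensmul A B : tens := fun m => \sum_(t <- pfacts m) A t.1 * B t.2.

Lemma tensmulE0 A B m : tensmul A B m =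
  \sum_(a <- wfacts m.1) \sum_(b <- wfacts m.2) A (a.1, b.2) * B (a.2, b.1).
Proof. exact: pfacts_sum. Qed.

Lemma tensmulA : associative tensmul.
Proof.
move=> A B D; apply/funext => -[u v]; rewrite !tensmulE0 /=.
transitivity (\sum_(a <- wfacts u) \sum_(c <- wfacts a.2) \sum_(b <- wfacts v)
   \sum_(e <- wfacts b.1) A (a.1, b.2) * (B (c.1, e.2) * D (c.2, e.1))).
  apply: eq_bigr => a _; rewrite exchange_big; apply: eq_bigr => b _ /=.
  rewrite tensmulE0 mulr_sumr; apply: eq_bigr => c _ /=; exact: mulr_sumr.
rewrite -(wfacts_assoc u (fun a1 a2 a3 => \sum_(b <- wfacts v)
   \sum_(e <- wfacts b.1) A (a1, b.2) * (B (a2, e.2) * D (a3, e.1)))).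
apply: eq_bigr => a _.
transitivity (\sum_(c <- wfacts a.1) \sum_(b <- wfacts v)
   \sum_(e <- wfacts b.2) A (c.1, e.2) * (B (c.2, e.1) * D (a.2, b.1))).
  apply: eq_bigr => c _.
  exact: (wfacts_assoc v (fun b1 b2 b3 => A (c.1, b3) * (B (c.2, b2) * D (a.2, b1)))).
rewrite [LHS]exchange_big; apply: eq_bigr => b _ /=.
rewrite tensmulE0 mulr_suml; apply: eq_bigr => c _ /=; rewrite mulr_suml.
by apply: eq_bigr => e _; rewrite mulrA.
Qed.

Lemma tensmul1l : left_id tens1 tensmul.
Proof.
move=> A; apply/funext => -[u v]; rewrite tensmulE0 wfacts_delta0 /=.
  rewrite wfacts_delta1 /= => [|p h].
    by rewrite /tens1 eqxx mul1r.
  by rewrite /tens1 xpair_eqE (negbTE h) andbF mul0r.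
by move=> p h; rewrite big1 // => b _; rewrite /tens1 xpair_eqE (negbTE h) mul0r.
Qed.

Lemma tensmul1r : right_id tens1 tensmul.
Proof.
move=> A; apply/funext => -[u v]; rewrite tensmulE0 wfacts_delta1 /=.
  rewrite wfacts_delta0 /= => [|p h].
    by rewrite /tens1 eqxx mulr1.
  by rewrite /tens1 xpair_eqE (negbTE h) andbF mulr0.
by move=> p h; rewrite big1 // => b _; rewrite /tens1 xpair_eqE (negbTE h) mulr0.
Qed.

Lemma tensmulDl : left_distributive tensmul +%R.
Proof.
move=> f g h; apply/funext => w; rewrite -[RHS]/(tensmul f h w + tensmul g h w).
by rewrite /tensmul -big_split; apply: eq_bigr => p _ /=; exact: mulrDl.
Qed.

Lemma tensmulDr : right_distributive tensmul +%R.
Proof.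
move=> f g h; apply/funext => w; rewrite -[RHS]/(tensmul f g w + tensmul f h w).
by rewrite /tensmul -big_split; apply: eq_bigr => p _ /=; exact: mulrDr.
Qed.

HB.instance Definition _ := GRing.Zmodule_isPzRing.Build tens
  tensmulA tensmul1l tensmul1r tensmulDl tensmulDr.

Lemma tensmulE A B m : (A * B : tens) m =
  \sum_(a <- wfacts m.1) \sum_(b <- wfacts m.2) A (a.1, b.2) * B (a.2, b.1).
Proof. exact: tensmulE0. Qed.

Lemma tens1E m : (1 : tens) m = (m == ([::], [::]))%:R.
Proof. by []. Qed.

Lemma tensDE A B m : (A + B : tens) m = A m + B m.
Proof. by []. Qed.

Lemma tensNE A m : (- A : tens) m = - A m.
Proof. by []. Qed.

Lemma tens_sumE (T : Type) (s : seq T) (P : pred T) (F : T -> tens) m :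
  (\sum_(i <- s | P i) F i) m = \sum_(i <- s | P i) F i m.
Proof. by elim/big_rec2: _ => // i x y _ <-. Qed.

(** [(a (x) b) # x = a x b], combined with the product of a matrix and a
    column. *)
Definition act A r : tup R d :=
  fun w => \sum_(t <- trips w) A t.1 *m r t.2.

Lemma act_sum3 A r w : act A r w =
  \sum_(p <- wfacts w) \sum_(q <- wfacts p.2) A (p.1, q.2) *m r q.1.
Proof. exact: trips_sum. Qed.

Lemma act_mul A B r : act (A * B) r = act A (act B r).
Proof.
apply/funext => w; rewrite !act_sum3.
transitivity (\sum_(p <- wfacts w) \sum_(a <- wfacts p.1) \sum_(q <- wfacts p.2)
  \sum_(b <- wfacts q.1) A (a.1, q.2) *m (B (a.2, b.2) *m r b.1)).
  apply: eq_bigr => p _; under eq_bigr do rewrite tensmulE /= mulmx_suml.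
  rewrite exchange_big; apply: eq_bigr => a _ /=.
  rewrite (wfacts_assoc p.2 (fun b1 b2 b3 => A (a.1, b3) *m (B (a.2, b2) *m r b1))).
  apply: eq_bigr => q _; rewrite mulmx_suml; apply: eq_bigr => b _.
  by rewrite mulmxA.
rewrite (wfacts_assoc w (fun a1 a2 y => \sum_(q <- wfacts y)
  \sum_(b <- wfacts q.1) A (a1, q.2) *m (B (a2, b.2) *m r b.1))).
apply: eq_bigr => p _ /=.
transitivity (\sum_(q <- wfacts p.2) \sum_(b <- wfacts q.1) \sum_(c <- wfacts b.2)
    A (p.1, q.2) *m (B (b.1, c.2) *m r c.1)).
  by rewrite (wfacts_assoc p.2 (fun b1 b2 b3 => \sum_(c <- wfacts b2)
    A (p.1, b3) *m (B (b1, c.2) *m r c.1))).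
apply: eq_bigr => q _; rewrite act_sum3 mulmx_sumr; apply: eq_bigr => b _.
by rewrite mulmx_sumr.
Qed.

Lemma act1 r : act 1 r = r.
Proof.
apply/funext => w; rewrite act_sum3 wfacts_delta0 /=.
  rewrite wfacts_delta1 /= ?tens1E ?eqxx ?mul1mx // => p h.
  by rewrite tens1E xpair_eqE (negbTE h) andbF mul0mx.
move=> p h; rewrite big1 // => q _.
by rewrite tens1E xpair_eqE (negbTE h) mul0mx.
Qed.

Lemma actDl A B r : act (A + B) r = act A r + act B r.
Proof.
apply/funext => w; rewrite /act fctE -big_split; apply: eq_bigr => t _.
by rewrite mulmxDl.
Qed.

Lemma actNl A r : act (- A) r = - act A r.
Proof.
apply/funext => w; rewrite /act fctE -sumrN; apply: eq_bigr => t _.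
by rewrite mulNmx.
Qed.

(** The Jacobian matrix of a tuple: contravariantly, [(d_j r_i)(u, v)] is the
    coefficient of [u j v] in [r_i]. *)
Definition jac r : tens := fun m => \matrix_(i, j) r (m.1 ++ j :: m.2) i 0.

Lemma jacD (r s : tup R d) : jac (r + s) = jac r + jac s.
Proof. by apply/funext => m; apply/matrixP => i j; rewrite !mxE. Qed.

Lemma jacN r : jac (- r) = - jac r.
Proof. by apply/funext => m; apply/matrixP => i j; rewrite !mxE. Qed.

(** Differentiation along [r] on either side of the tensor sign. *)
Definition delt r A : tens := fun m =>
  delw r (fun u => A (u, m.2)) m.1 + delw r (fun v => A (m.1, v)) m.2.

(** The product rule: the difference quotient hits [r], or the left or the
    right leg of [jac s]. Since second difference quotients commute, the last
    two terms together are the derivative of [jac s] along [r]. *)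
Lemma jac_act (r s : tup R d) : jac (act (jac s) r) = jac s * jac r + delt r (jac s).
Proof.
apply/funext => -[p q]; apply/matrixP => i j; rewrite !mxE /act summxE /=.
under eq_bigr do rewrite mxE.
rewrite trips_mid tensmulE summxE; congr (_ + (_ + _)).
- apply: eq_bigr => a _; rewrite summxE; apply: eq_bigr => b _.
  by rewrite mxE; apply: eq_bigr => k _; rewrite !mxE.
- rewrite /delw summxE; apply: eq_bigr => t _; rewrite summxE; apply: eq_bigr => k _.
  by rewrite !mxE mulrC /= -catA.
- rewrite /delw summxE; apply: eq_bigr => t _; rewrite summxE; apply: eq_bigr => k _.
  by rewrite !mxE mulrC /= -catA.
Qed.

Lemma delt_mul r A B : delt r (A * B) = delt r A * B + A * delt r B.
Proof.
apply/funext => -[p q]; rewrite tensDE /delt /= !tensmulE /=.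
have -> : (fun u => (A * B) (u, q)) = fun u => \sum_(b <- wfacts q)
   wconv *%R (fun u => A (u, b.2)) (fun u => B (u, b.1)) u.
  by apply/funext => u; rewrite tensmulE exchange_big.
have -> : (fun v => (A * B) (p, v)) = fun v => \sum_(a <- wfacts p)
   wconv (fun x y => y * x) (fun v => B (a.2, v)) (fun v => A (a.1, v)) v.
  by apply/funext => u; rewrite tensmulE.
rewrite !delw_sum.
have L1 (f g : word d -> 'M[C]_d) w : delw r (wconv *%R f g) w =
    wconv *%R (delw r f) g w + wconv *%R f (delw r g) w.
  apply: delw_wconv => [||a x z|a x z]; first exact: mulrDl.
  - exact: mulrDr.
  - by rewrite scalerAl.
  - by rewrite scalerAr.
pose op (x y : 'M[C]_d) := y * x.
have L2 (f g : word d -> 'M[C]_d) w : delw r (wconv op f g) w =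
    wconv op (delw r f) g w + wconv op f (delw r g) w.
  apply: delw_wconv => [x y z|x y z|a x z|a x z]; rewrite /op.
  - exact: mulrDr.
  - exact: mulrDl.
  - by rewrite scalerAr.
  - by rewrite scalerAl.
rewrite (eq_bigr _ (fun b _ => L1 _ _ _)) [X in _ + X = _](eq_bigr _ (fun b _ => L2 _ _ _)).
rewrite !big_split /= [X in _ + X = _]addrC addrACA; congr (_ + _).
  under [RHS]eq_bigr => a _ do under eq_bigr => b _ do rewrite mulrDl.
  under [RHS]eq_bigr => a _ do rewrite big_split /=.
  by rewrite [RHS]big_split /= /wconv /op [X in X + _ = _]exchange_big.
under [RHS]eq_bigr => a _ do under eq_bigr => b _ do rewrite mulrDr.
under [RHS]eq_bigr => a _ do rewrite big_split /=.
by rewrite [RHS]big_split /= /wconv /op [X in X + _ = _]exchange_big.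
Qed.

Lemma delt1 r : delt r 1 = 0.
Proof.
apply/funext => -[p q]; rewrite /delt /delw /= !big1 ?addr0 // => t _;
 rewrite big1 // => j _; rewrite tens1E xpair_eqE.
  by case: (t.1.1) => [|? ?] /=; rewrite ?andbF scaler0.
by case: (t.1.1) => [|? ?] /=; rewrite scaler0.
Qed.

Lemma delt_exp r A (k : nat) : delt r (A ^+ k.+1) =
  \sum_(i < k.+1) A ^+ i * delt r A * A ^+ (k - i).
Proof.
elim: k => [|k IH]; first by rewrite big_ord1 expr1 expr0 mul1r mulr1.
rewrite exprS delt_mul IH [RHS]big_ord_recl expr0 mul1r subn0; congr (_ + _).
rewrite mulr_sumr; apply: eq_bigr => i _.
by rewrite lift0 subSS !mulrA -exprS.
Qed.

Definition tupof (F : 'I_d -> ser R d) : tup R d := fun w => \col_k F k w.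

Definition tupat (f : ser R d) (i : 'I_d) : tup R d := fun w => f w *: delta_mx i 0.

Lemma act_jacE F r w k : act (jac (tupof F)) r w k 0 = dels r (F k) w.
Proof.
rewrite /act summxE; apply: eq_bigr => t _; rewrite mxE; apply: eq_bigr => j _.
by rewrite !mxE mulrC.
Qed.

(** The Jacobian of the tuple with the monomial [w] at [i], composed with [F]. *)
Definition jac_wprod (F : 'I_d -> ser R d) i w : tens := fun m =>
  \sum_(o <- occ w) (wprod F o.1.1 m.1 * wprod F o.2 m.2) *: delta_mx i o.1.2.

Lemma jac_chain F i w :
  jac (tupat (wprod F w) i) = jac_wprod F i w * jac (tupof F).
Proof.
apply/funext => -[u v]; apply/matrixP => i' j; rewrite tensmulE !mxE /= summxE.
rewrite wprod_mid mulr_suml.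
under [RHS]eq_bigr => a _ do rewrite summxE.
under [RHS]eq_bigr => a _ do under eq_bigr => b _ do
  rewrite /jac_wprod mulr_suml summxE.
under [RHS]eq_bigr => a _ do rewrite exchange_big.
rewrite [RHS]exchange_big; apply: eq_bigr => o _ /=; rewrite mulr_suml.
apply: eq_bigr => a _; rewrite mulr_suml; apply: eq_bigr => b _.
rewrite mxE (bigD1 o.1.2) //= big1 ?addr0; last first.
  by move=> k hk; rewrite !mxE (negbTE hk) andbF mulr0 mul0r.
rewrite !mxE !eqxx !andbT /=; ring.
Qed.

End TensorRing.

(** * Weighted l^1 norms *)

Section Norms.
Variables (R : realType) (n : nat).
Local Notation d := n.+1.
Local Notation C := (R[i]).
Implicit Types (u v w : word d) (f g h : ser R d) (r : tup R d).
Implicit Types (M N : tens R n) (A B D c e : R).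

(** Differentiation of a word produces one term for each letter; the resulting
    factor is absorbed by enlarging the radius by one. This inequality is used
    for every derivative below. *)
Lemma pow_derivative_le D (k : nat) : 0 <= D -> k%:R * D ^+ k.-1 <= (D + 1) ^+ k.
Proof.
move=> D0; case: k => [|k]; first by rewrite mul0r expr0 ler01.
elim: k => [|k IH] /=; first by rewrite expr0 mulr1 expr1 lerDr.
rewrite [(D + 1) ^+ _]exprSr mulrDr mulr1.
have h1 : D ^+ k.+1 <= (D + 1) ^+ k.+1 by rewrite lerXn2r ?nnegrE ?addr_ge0 // lerDl.
have h2 : k.+1%:R * D ^+ k.+1 <= (D + 1) ^+ k.+1 * D.
  by rewrite exprSr mulrA ler_wpM2r.
have -> : k.+2%:R * D ^+ k.+1 = k.+1%:R * D ^+ k.+1 + D ^+ k.+1.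
  by rewrite -natr1 mulrDl mul1r.
exact: lerD.
Qed.

(** A marked word is determined by the word and the position of the mark. *)
Lemma bsum_occ (g : word d -> nat -> R) c : (forall w k, 0 <= g w k) ->
  bsum (fun w => \sum_(k < size w) g w k) c ->
  bsum (fun o : (word d * 'I_d) * word d => g (o.1.1 ++ o.1.2 :: o.2) (size o.1.1)) c.
Proof.
move=> g0 gc.
pose h (p : word d * nat) := if (p.2 < size p.1)%N then g p.1 p.2 else 0.
have h0 p : 0 <= h p by rewrite /h; case: ifP => // _; exact: g0.
have hc : bsum h c.
  apply: (bsum_pair h0 _ gc) => w.
  have -> : \sum_(k < size w) g w k = \sum_(k <- iota 0 (size w)) h (w, k).
    rewrite -(big_mkord xpredT (g w)) /index_iota subn0.
    by apply: eq_big_seq => k; rewrite mem_iota add0n leq0n /h /= => ->.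
  apply: bsum_seq; rewrite ?iota_uniq // => k; rewrite mem_iota add0n leq0n /= => /negbTE hk.
  by rewrite /h hk.
have := bsum_inj (e := fun o : (word d * 'I_d) * word d =>
  (o.1.1 ++ o.1.2 :: o.2, size o.1.1)) h0 _ hc.
move=> H; apply: bsum_le (H _) => [q|].
  by rewrite /h /= size_cat /= addnS ltnS leq_addr.
move=> [[a k] b] [[a' k'] b'] [/= e1 e2].
move/eqP: e1; rewrite eqseq_cat // eqseq_cons => /and3P[/eqP -> /eqP -> /eqP ->] //.
Qed.

Lemma bsum_letter (g : (word d * 'I_d) * word d -> R) c : (forall o, 0 <= g o) ->
  bsum g c -> bsum (fun m : word d * word d => \sum_j g ((m.1, j), m.2)) c.
Proof.
move=> g0 gc.
have := bsum_fiber (s := fun m : word d * word d => [seq ((m.1, j), m.2) | j <- enum 'I_d])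
  (p := fun o => (o.1.1, o.2)) g0 _ _ gc.
move=> H; apply: bsum_le (H _ _) => [[u v]|[u v]|[u v] o].
- by rewrite big_map big_enum.
- by rewrite map_inj_uniq ?enum_uniq // => i j [].
- by case/mapP => j _ ->.
Qed.

(** Weighted norms of series ([sb]), tuples ([tb]) and tensors ([mb], with one
    radius for each leg). *)
Definition sb A f c := bsum (fun w => A ^+ size w * normc (f w)) c.
Definition tb A r c := bsum (fun w => A ^+ size w * mnorm (r w)) c.
Definition mb A B M c := bsum (fun m => A ^+ size m.1 * B ^+ size m.2 * mnorm (M m)) c.

Lemma sb_term0 A f w : 0 <= A -> 0 <= A ^+ size w * normc (f w).
Proof. by move=> A0; rewrite mulr_ge0 ?exprn_ge0 ?normc_ge0. Qed.

Lemma sb_ge0 A f c : 0 <= A -> sb A f c -> 0 <= c.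
Proof. by move=> A0; apply: bsum_ge0 => w; exact: sb_term0. Qed.

Lemma tb_term0 A r w : 0 <= A -> 0 <= A ^+ size w * mnorm (r w).
Proof. by move=> A0; rewrite mulr_ge0 ?exprn_ge0 ?mnorm_ge0. Qed.

Lemma tb_ge0 A r c : 0 <= A -> tb A r c -> 0 <= c.
Proof. by move=> A0; apply: bsum_ge0 => w; exact: tb_term0. Qed.

Lemma mb_term0 A B M m : 0 <= A -> 0 <= B -> 0 <= A ^+ size m.1 * B ^+ size m.2 * mnorm (M m).
Proof. by move=> A0 B0; rewrite !mulr_ge0 ?exprn_ge0 ?mnorm_ge0. Qed.

Lemma mb_ge0 A B M c : 0 <= A -> 0 <= B -> mb A B M c -> 0 <= c.
Proof. by move=> A0 B0; apply: bsum_ge0 => w; exact: mb_term0. Qed.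

Lemma sb_mono A B f c e : 0 <= A -> A <= B -> c <= e -> sb B f c -> sb A f e.
Proof.
move=> A0 AB ce h; apply: (bsum_leR ce); apply: bsum_le h => w.
by rewrite ler_wpM2r ?normc_ge0 // lerXn2r ?nnegrE // (le_trans A0).
Qed.

Lemma tb_mono A B r c e : 0 <= A -> A <= B -> c <= e -> tb B r c -> tb A r e.
Proof.
move=> A0 AB ce h; apply: (bsum_leR ce); apply: bsum_le h => w.
by rewrite ler_wpM2r ?mnorm_ge0 // lerXn2r ?nnegrE // (le_trans A0).
Qed.

Lemma mb_mono A A' B B' M c e : 0 <= A -> A <= A' -> 0 <= B -> B <= B' -> c <= e ->
  mb A' B' M c -> mb A B M e.
Proof.
move=> A0 AB B0 BB ce h; apply: (bsum_leR ce); apply: bsum_le h => w.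
rewrite ler_wpM2r ?mnorm_ge0 // ler_pM ?exprn_ge0 // lerXn2r ?nnegrE //.
  exact: le_trans AB.
exact: le_trans BB.
Qed.

Lemma sbD A f g c e : 0 <= A -> sb A f c -> sb A g e -> sb A (f + g) (c + e).
Proof.
move=> A0 fc ge; apply: bsum_le (bsumD _ _ fc ge) => w; last 2 first.
- exact: sb_term0.
- exact: sb_term0.
by rewrite -mulrDr ler_wpM2l ?exprn_ge0 // normcD.
Qed.

Lemma sbN A f c : sb A f c -> sb A (- f) c.
Proof. by apply: bsum_le => w; rewrite -[(- f) w]/(- f w) normcN. Qed.

Lemma sb0 A : sb A 0 0.
Proof. by apply: bsum_le (bsum0 R _) => w; rewrite normc0 mulr0. Qed.

Lemma sb_sum A (T : Type) (s : seq T) (f : T -> ser R d) (c : T -> R) : 0 <= A ->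
  (forall t, sb A (f t) (c t)) -> sb A (\sum_(t <- s) f t) (\sum_(t <- s) c t).
Proof.
move=> A0 fc; elim: s => [|t s IH]; first by rewrite !big_nil; exact: sb0.
by rewrite !big_cons; apply: sbD.
Qed.

Lemma sbZ A (a : C) f c : 0 <= A -> sb A f c -> sb A (fun w => a * f w) (normc a * c).
Proof.
move=> A0 fc; have := bsumZ (normc_ge0 a) _ fc => H; apply: bsum_le (H _) => w.
  by rewrite normcM mulrCA.
exact: sb_term0.
Qed.

Lemma mbD A B M N c e : 0 <= A -> 0 <= B -> mb A B M c -> mb A B N e -> mb A B (M + N) (c + e).
Proof.
move=> A0 B0 fc ge; apply: bsum_le (bsumD _ _ fc ge) => w; last 2 first.
- exact: mb_term0.
- exact: mb_term0.
by rewrite -mulrDr ler_wpM2l ?mulr_ge0 ?exprn_ge0 // mnormD.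
Qed.

Lemma mbN A B M c : mb A B M c -> mb A B (- M) c.
Proof. by apply: bsum_le => w; rewrite tensNE mnormN. Qed.

Lemma mb0 A B : mb A B 0 0.
Proof. by apply: bsum_le (bsum0 R _) => w; rewrite mnorm0 mulr0. Qed.

Lemma mb_sum A B (T : Type) (s : seq T) (f : T -> tens R n) (c : T -> R) :
  0 <= A -> 0 <= B ->
  (forall t, mb A B (f t) (c t)) -> mb A B (\sum_(t <- s) f t) (\sum_(t <- s) c t).
Proof.
move=> A0 B0 fc; elim: s => [|t s IH]; first by rewrite !big_nil; exact: mb0.
by rewrite !big_cons; apply: mbD.
Qed.

Lemma sb_mul A f g c e : 0 <= A -> sb A f c -> sb A g e -> sb A (f * g) (c * e).
Proof.
move=> A0; have p0 w : 0 <= A ^+ size w by rewrite exprn_ge0.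
apply: (@bsum_bconv R _ _ _ (@wfacts d) (fun p => p.1 ++ p.2) _ _ _ _ _ *%R
  (@normc R) (@normc R) (@normc R) _ _ _ _ _
  (fun w => A ^+ size w) (fun w => A ^+ size w)) => //.
- exact: uniq_wfacts.
- by move=> w p; rewrite mem_wfacts.
- by move=> x; exact: normc_ge0.
- by move=> x; exact: normc_ge0.
- by rewrite normc0.
- exact: normcD.
- by move=> x y; rewrite normcM.
- by move=> p; rewrite size_cat exprD.
Qed.

Lemma mb_mul A B M N c e : 0 <= A -> 0 <= B -> mb A B M c -> mb A B N e ->
  mb A B (M * N) (c * e).
Proof.
move=> A0 B0; have p0 (m : word d * word d) : 0 <= A ^+ size m.1 * B ^+ size m.2.
  by rewrite mulr_ge0 ?exprn_ge0.
apply: (@bsum_bconv R _ _ _ (@pfacts d) (@pmul d) _ _ _ _ _ *%R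
  (@mnorm R d d) (@mnorm R d d) (@mnorm R d d) _ _ _ _ _
  (fun m => A ^+ size m.1 * B ^+ size m.2)
  (fun m => A ^+ size m.1 * B ^+ size m.2)) => //.
- exact: uniq_pfacts.
- by move=> w p; rewrite mem_pfacts.
- exact: mnorm_ge0.
- exact: mnorm_ge0.
- exact: mnorm0.
- exact: mnormD.
- exact: mnormM.
- by move=> p; rewrite /= !size_cat !exprD le_eqVlt; apply/orP; left; apply/eqP; ring.
Qed.

Lemma tb_act A M r c e : 0 <= A -> mb A A M c -> tb A r e -> tb A (act M r) (c * e).
Proof.
move=> A0; have p0 (m : word d * word d) : 0 <= A ^+ size m.1 * A ^+ size m.2.
  by rewrite mulr_ge0 ?exprn_ge0.
have q0 w : 0 <= A ^+ size w by rewrite exprn_ge0.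
apply: (@bsum_bconv R _ _ _ (@trips d) (fun t => t.1.1 ++ t.2 ++ t.1.2) _ _ _ _ _
  (fun X Y => X *m Y) (@mnorm R d d) (@mnorm R d 1) (@mnorm R d 1) _ _ _ _ _
  (fun m => A ^+ size m.1 * A ^+ size m.2) (fun w => A ^+ size w)) => //.
- exact: uniq_trips.
- by move=> w p; rewrite mem_trips.
- exact: mnorm_ge0.
- exact: mnorm_ge0.
- exact: mnorm0.
- exact: mnormD.
- exact: mnormM.
- by move=> p; rewrite !size_cat !exprD -mulrA [A ^+ size p.2 * _]mulrC.
Qed.

Lemma bsum1 (I : choiceType) (g : I -> R) k : (forall i, 0 <= g i) ->
  (forall i, i != k -> g i = 0) -> bsum g (g k).
Proof.
move=> g0 h; have := @bsum_seq R I g [:: k]; rewrite big_seq1; apply=> // i.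
by rewrite inE; exact: h.
Qed.

Lemma mnorm1 : mnorm (1 : 'M[C]_d) = d%:R.
Proof.
rewrite /mnorm (eq_bigr (fun=> 1)); first by rewrite sumr_const card_ord.
move=> i _; rewrite (bigD1 i) //= big1 ?addr0 => [|j hj].
  by rewrite mxE eqxx normc1.
by rewrite mxE eq_sym (negbTE hj) normc0.
Qed.

Lemma mb1 A B : 0 <= A -> 0 <= B -> mb A B 1 d%:R.
Proof.
move=> A0 B0; have := @bsum1 _ (fun m => A ^+ size m.1 * B ^+ size m.2 * mnorm ((1 : tens R n) m))
  ([::], [::]) (fun m => mb_term0 _ _ A0 B0).
rewrite /= tens1E eqxx !mul1r mnorm1; apply=> m.
by rewrite tens1E => /negbTE ->; rewrite mnorm0 mulr0.
Qed.

Lemma mb_exp A B M c k : 0 <= A -> 0 <= B -> mb A B M c -> mb A B (M ^+ k) (d%:R * c ^+ k).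
Proof.
move=> A0 B0 h; elim: k => [|k IH]; first by rewrite !expr0 mulr1; exact: mb1.
by rewrite exprS exprS mulrCA; apply: mb_mul.
Qed.

Lemma mb_expS A B M c k : 0 <= A -> 0 <= B -> mb A B M c -> mb A B (M ^+ k.+1) (c ^+ k.+1).
Proof.
move=> A0 B0 h; elim: k => [|k IH]; first by rewrite !expr1.
by rewrite exprS (exprS c); apply: mb_mul.
Qed.

Lemma sum_pow2_le A B k : 0 <= B -> B < A ->
  \sum_(i < k) A ^+ i * B ^+ (k - i.+1) <= A ^+ k / (A - B).
Proof.
move=> B0 BA; rewrite ler_pdivlMr ?subr_gt0 // mulrC.
have -> : (A - B) * (\sum_(i < k) A ^+ i * B ^+ (k - i.+1)) = A ^+ k - B ^+ k.
  rewrite subrXX; congr (_ * _).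
  rewrite [RHS](reindex_inj rev_ord_inj) /=; apply: eq_bigr => i _.
  congr (A ^+ _ * _); case: k i => [[]//|k] i.
  by rewrite subSS /= subKn // -ltnS.
by rewrite gerBl exprn_ge0.
Qed.

Lemma mnorm_jac r m : mnorm (jac r m) = \sum_j mnorm (r (m.1 ++ j :: m.2)).
Proof.
rewrite /mnorm exchange_big; apply: eq_bigr => j _; apply: eq_bigr => i _.
by rewrite big_ord1 mxE.
Qed.

(** A word contributes to the Jacobian once for each of its letters, with
    weight [A ^ i * B ^ (k - i - 1)]; the sum over [i] is at most
    [A ^ k / (A - B)]. A loss in one of the two radii thus makes the difference
    quotient bounded, with a norm that is small when the gap is large. *)
Lemma mb_jac A B r c : 0 <= B -> B < A -> tb A r c -> mb A B (jac r) (c / (A - B)).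
Proof.
move=> B0 BA rc; have A0 : 0 <= A by apply: le_trans B0 (ltW BA).
have i0 : 0 <= (A - B)^-1 by rewrite invr_ge0 subr_ge0 ltW.
pose g w k := A ^+ k * B ^+ (size w - k.+1) * mnorm (r w).
have g0 w k : 0 <= g w k by rewrite !mulr_ge0 ?exprn_ge0 ?mnorm_ge0.
have h : bsum (fun w => \sum_(k < size w) g w k) (c / (A - B)).
  have := bsumZ i0 (fun w => tb_term0 r w A0) rc; rewrite mulrC.
  apply: bsum_le => w; rewrite /g -mulr_suml mulrA ler_wpM2r ?mnorm_ge0 //.
  by rewrite mulrC; exact: sum_pow2_le.
have := bsum_letter _ (bsum_occ g0 h) => H; apply: bsum_le (H _) => [[u v]|o]; last exact: g0.
rewrite mnorm_jac mulr_sumr; apply: ler_sum => j _.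
by rewrite /g /= size_cat /= addnS subSS addKn.
Qed.

Lemma mb_jac' A B r c : 0 <= B -> B < A -> tb A r c -> mb B A (jac r) (c / (A - B)).
Proof.
move=> B0 BA rc; have A0 : 0 <= A by apply: le_trans B0 (ltW BA).
have i0 : 0 <= (A - B)^-1 by rewrite invr_ge0 subr_ge0 ltW.
pose g w k := B ^+ k * A ^+ (size w - k.+1) * mnorm (r w).
have g0 w k : 0 <= g w k by rewrite !mulr_ge0 ?exprn_ge0 ?mnorm_ge0.
have h : bsum (fun w => \sum_(k < size w) g w k) (c / (A - B)).
  have := bsumZ i0 (fun w => tb_term0 r w A0) rc; rewrite mulrC.
  apply: bsum_le => w; rewrite /g -mulr_suml mulrA ler_wpM2r ?mnorm_ge0 //.
  rewrite mulrC; apply: le_trans _ (sum_pow2_le (size w) B0 BA).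
  rewrite (reindex_inj rev_ord_inj) /=; apply: ler_sum => i _.
  by rewrite mulrC -subSn ?ltn_ord // subSS subKn ?(ltnW (ltn_ord i)) // lexx.
have := bsum_letter _ (bsum_occ g0 h) => H; apply: bsum_le (H _) => [[u v]|o]; last exact: g0.
rewrite mnorm_jac mulr_sumr; apply: ler_sum => j _.
by rewrite /g /= size_cat /= addnS subSS addKn.
Qed.

Lemma mb_jac1 A r c : 0 <= A -> tb (A + 1) r c -> mb A A (jac r) c.
Proof.
move=> A0 rc; have := @mb_jac (A + 1) A r c A0; rewrite ltrDl ltr01 => /(_ isT rc).
rewrite [A + 1 - A]addrAC subrr add0r divr1; apply: mb_mono => //.
by rewrite lerDl.
Qed.

Lemma sb1 A : 0 <= A -> sb A (1 : ser R d) 1.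
Proof.
move=> A0; have h w : w != [::] -> A ^+ size w * normc (ser1 R w) = 0.
  by rewrite /ser1 => /negbTE ->; rewrite normc0 mulr0.
by have := bsum1 (fun w => sb_term0 (@ser1 R d) w A0) h; rewrite /ser1 eqxx expr0 mul1r normc_nat; apply.
Qed.

Lemma sb_wprod A (F : 'I_d -> ser R d) D w : 0 <= A -> 0 <= D -> (forall k, sb A (F k) D) ->
  sb A (wprod F w) (D ^+ size w).
Proof.
move=> A0 D0 FD; elim: w => [|k w IH].
  by rewrite wprod_nil expr0; exact: sb1.
by rewrite wprod_cons /= exprS; apply: sb_mul.
Qed.

Lemma mnorm_delta1 (a : C) (i : 'I_d) : mnorm (a *: (delta_mx i 0 : 'cV[C]_d)) = normc a.
Proof.
rewrite mnormZ /mnorm (bigD1 i) //= big_ord1 mxE !eqxx normc1 big1 ?addr0 ?mulr1 //.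
by move=> k hk; rewrite big_ord1 mxE (negbTE hk) normc0.
Qed.

Lemma mnorm_delta2 (a : C) (i j : 'I_d) : mnorm (a *: (delta_mx i j : 'M[C]_d)) = normc a.
Proof.
rewrite mnormZ /mnorm (bigD1 i) //= (bigD1 j) //= mxE !eqxx normc1 !big1 ?addr0 ?mulr1 //.
  by move=> k hk; rewrite big1 // => l _; rewrite mxE (negbTE hk) normc0.
by move=> k hk; rewrite mxE (negbTE hk) andbF normc0.
Qed.

Lemma tb_tupat A f i c : sb A f c -> tb A (tupat f i) c.
Proof. by apply: bsum_le => w; rewrite mnorm_delta1. Qed.

Lemma sb_comp A r k c : 0 <= A -> tb A r c -> sb A (fun w => r w k 0) c.
Proof.
by move=> A0; apply: bsum_le => w; rewrite ler_wpM2l ?exprn_ge0 // normc_le_mnorm.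
Qed.

End Norms.

(** * Tracial functionals and their first variation *)

Section Functional.
Variables (R : realType) (n : nat).
Local Notation d := n.+1.
Local Notation C := (R[i]).
Implicit Types (u v w : word d) (f g h : ser R d) (r : tup R d).
Implicit Types (M N : tens R n) (c e : R).

Variables (tau : word d -> C) (B : R).
Hypothesis B0 : 0 <= B.
Hypothesis tau_le : forall w, normc (tau w) <= B ^+ size w.
Hypothesis tauC : forall u v, tau (u ++ v) = tau (v ++ u).

Let B1_0 : 0 <= B + 1. Proof. by rewrite addr_ge0. Qed.
Let BB1 : B <= B + 1. Proof. by rewrite lerDl. Qed.

Definition pair f : C := csum (fun w => f w * tau w).
Definition tpair M : C := csum (fun m => \tr (M m) * (tau m.1 * tau m.2)).

Lemma pair_sum f c : sb B f c -> bsum (fun w => normc (f w * tau w)) c.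
Proof.
apply: bsum_le => w; rewrite normcM mulrC ler_wpM2r ?normc_ge0 //.
Qed.

Lemma pair_le f c : sb B f c -> normc (pair f) <= c.
Proof. by move=> /pair_sum; exact: csum_le. Qed.

Lemma pairD f g c e : sb B f c -> sb B g e -> pair (f + g) = pair f + pair g.
Proof.
move=> /pair_sum fc /pair_sum ge; rewrite -(csumD fc ge); apply: eq_csum => w.
by rewrite -mulrDl.
Qed.

Lemma pairN f : pair (- f) = - pair f.
Proof. by rewrite -csumN; apply: eq_csum => w; rewrite -mulNr. Qed.

Lemma pair_big (T : Type) (s : seq T) (f : T -> ser R d) (c : T -> R) :
  (forall t, sb B (f t) (c t)) -> pair (\sum_(t <- s) f t) = \sum_(t <- s) pair (f t).
Proof.
move=> fc; rewrite /pair -(csum_bigD s (fun t => pair_sum (fc t))).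
by apply: eq_csum => w; rewrite ser_sumE mulr_suml.
Qed.

Lemma pairM f g c e : sb B f c -> sb B g e ->
  pair (f * g) = csum (fun p : word d * word d => f p.1 * g p.2 * tau (p.1 ++ p.2)).
Proof.
move=> fc ge.
apply: (@csum_bconv R _ _ _ (@wfacts d) (fun p => p.1 ++ p.2) _ _ _ _ _ *%R
  (@normc R) (@normc R) _ _ (fun w => B ^+ size w) (fun w => B ^+ size w) _ _
  f g c e id tau) => //.
- exact: uniq_wfacts.
- by move=> w p; rewrite mem_wfacts.
- by move=> x; exact: normc_ge0.
- by move=> x; exact: normc_ge0.
- by move=> w; rewrite exprn_ge0.
- by move=> w; rewrite exprn_ge0.
- by move=> x y; rewrite normcM.
- by move=> p; rewrite -exprD -size_cat.
Qed.

Lemma pairMC f g c e : sb B f c -> sb B g e -> pair (f * g) = pair (g * f).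
Proof.
move=> fc ge; rewrite (pairM fc ge) (pairM ge fc).
rewrite -(@csum_bij _ _ _ (fun p : word d * word d => g p.1 * f p.2 * tau (p.1 ++ p.2))
  (fun q => (q.2, q.1)) (fun q => (q.2, q.1))); [|by case|by case].
by apply: eq_csum => p /=; rewrite tauC [f _ * _]mulrC.
Qed.

Lemma tpair_sum M c : mb B B M c ->
  bsum (fun m => normc (\tr (M m) * (tau m.1 * tau m.2))) c.
Proof.
apply: bsum_le => w; rewrite !normcM mulrC.
apply: ler_pM; rewrite ?mulr_ge0 ?normc_ge0 //; last exact: normc_mxtrace.
by rewrite ler_pM ?normc_ge0.
Qed.

Lemma tpair_le M c : mb B B M c -> normc (tpair M) <= c.
Proof. by move=> /tpair_sum; exact: csum_le. Qed.

Lemma tpairD M N c e : mb B B M c -> mb B B N e -> tpair (M + N) = tpair M + tpair N.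
Proof.
move=> /tpair_sum fc /tpair_sum ge; rewrite -(csumD fc ge); apply: eq_csum => w.
by rewrite tensDE mxtraceD -mulrDl.
Qed.

Lemma tpairN M : tpair (- M) = - tpair M.
Proof.
rewrite -csumN; apply: eq_csum => w.
by rewrite tensNE raddfN /= mulNr.
Qed.

Lemma tpair_big (T : Type) (s : seq T) (f : T -> tens R n) (c : T -> R) :
  (forall t, mb B B (f t) (c t)) -> tpair (\sum_(t <- s) f t) = \sum_(t <- s) tpair (f t).
Proof.
move=> fc; rewrite /tpair -(csum_bigD s (fun t => tpair_sum (fc t))).
by apply: eq_csum => w; rewrite tens_sumE raddf_sum mulr_suml.
Qed.

Lemma tpairMC M N c e : mb B B M c -> mb B B N e -> tpair (M * N) = tpair (N * M).
Proof.
move=> Mc Ne.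
have p0 (m : word d * word d) : 0 <= B ^+ size m.1 * B ^+ size m.2.
  by rewrite mulr_ge0 ?exprn_ge0.
have E (M' N' : tens R n) c' e' : mb B B M' c' -> mb B B N' e' -> tpair (M' * N') =
    csum (fun t : (word d * word d) * (word d * word d) =>
      \tr (M' t.1 * N' t.2) * (tau (pmul t).1 * tau (pmul t).2)).
  move=> h1 h2.
  apply: (@csum_bconv R _ _ _ (@pfacts d) (@pmul d) _ _ _ _ _ *%R
    (@mnorm R d d) (@mnorm R d d) _ _ (fun m => B ^+ size m.1 * B ^+ size m.2)
    (fun m => B ^+ size m.1 * B ^+ size m.2) _ _
    M' N' c' e' (@mxtrace _ _) (fun m => tau m.1 * tau m.2)) => //.
  - exact: uniq_pfacts.
  - by move=> w p; rewrite mem_pfacts.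
  - exact: mnorm_ge0.
  - exact: mnorm_ge0.
  - exact: mxtrace0.
  - exact: mxtraceD.
  - by move=> x y; apply: le_trans (normc_mxtrace _) (mnormM _ _).
  - move=> p; rewrite normcM.
    have -> : B ^+ size p.1.1 * B ^+ size p.1.2 * (B ^+ size p.2.1 * B ^+ size p.2.2) =
      B ^+ size (pmul p).1 * B ^+ size (pmul p).2.
      by rewrite /pmul /= !size_cat !exprD; ring.
    by rewrite ler_pM ?normc_ge0.
rewrite (E _ _ _ _ Mc Ne) (E _ _ _ _ Ne Mc).
rewrite -[RHS](@csum_bij _ _ _ _
  (fun q : (word d * word d) * (word d * word d) => (q.2, q.1)) (fun q => (q.2, q.1)));
  [|by case|by case].
apply: eq_csum => p /=; rewrite /pmul /= tauC [tau (p.2.2 ++ _)]tauC.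
by congr (_ * _); exact: mxtrace_mulC.
Qed.

(** [Epair r j w] is [tau (r_j w)], and [rho r w] is the variation of [tau w]
    along [r], with the inserted series moved to the front by traciality;
    [rpair r h] is then the variation of [tau (h)]. *)
Definition Epair r (j : 'I_d) w : C := csum (fun x => r x j 0 * tau (x ++ w)).
Definition rho r w : C := \sum_(o <- occ w) Epair r o.1.2 (o.2 ++ o.1.1).
Definition rpair r h : C := csum (fun w => h w * rho r w).

Lemma Epair_sum r j w c : tb B r c ->
  bsum (fun x => normc (r x j 0 * tau (x ++ w))) (c * B ^+ size w).
Proof.
move=> rc; have p0 : 0 <= B ^+ size w by rewrite exprn_ge0.
have := bsumZ p0 (fun x => tb_term0 r x B0) rc; rewrite mulrC; apply: bsum_le => x.
rewrite normcM mulrC mulrA -exprD addnC -size_cat.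
by rewrite ler_pM ?normc_ge0 ?normc_le_mnorm.
Qed.

Lemma Epair_le r j w c : tb B r c -> normc (Epair r j w) <= c * B ^+ size w.
Proof. by move=> rc; apply: csum_le; exact: Epair_sum. Qed.

Lemma rho_le r w c : tb B r c -> normc (rho r w) <= c * (B + 1) ^+ size w.
Proof.
move=> rc; apply: le_trans (normc_sum _ _ _) _.
apply: (@le_trans _ _ (\sum_(o <- occ w) c * B ^+ (size w).-1)).
  rewrite big_seq [leRHS]big_seq; apply: ler_sum => o; rewrite mem_occ => /eqP <-.
  apply: le_trans (Epair_le _ _ rc) _.
  by rewrite !size_cat /= addnS /= addnC.
rewrite big_const_seq count_predT size_occ iter_addr_0 -mulr_natl mulrCA.
rewrite ler_wpM2l ?(tb_ge0 B0 rc) //; exact: pow_derivative_le.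
Qed.

Lemma rpair_sum r h c e : tb B r c -> sb (B + 1) h e ->
  bsum (fun w => normc (h w * rho r w)) (c * e).
Proof.
move=> rc he; have c0 := tb_ge0 B0 rc.
have := bsumZ c0 (fun w => sb_term0 h w B1_0) he; apply: bsum_le => w.
rewrite normcM mulrC mulrA ler_wpM2r ?normc_ge0 //; exact: rho_le.
Qed.

Lemma rpair_le r h c e : tb B r c -> sb (B + 1) h e -> normc (rpair r h) <= c * e.
Proof. by move=> rc he; apply: csum_le; exact: rpair_sum. Qed.

Lemma rpairD r h g c e e' : tb B r c -> sb (B + 1) h e -> sb (B + 1) g e' ->
  rpair r (h + g) = rpair r h + rpair r g.
Proof.
move=> rc he ge; rewrite -(csumD (rpair_sum rc he) (rpair_sum rc ge)).
by apply: eq_csum => w; rewrite -mulrDl.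
Qed.

Lemma rpairN r h : rpair r (- h) = - rpair r h.
Proof. by rewrite -csumN; apply: eq_csum => w; rewrite -mulNr. Qed.

Lemma rpairZ r a h c e : tb B r c -> sb (B + 1) h e ->
  rpair r (fun w => a * h w) = a * rpair r h.
Proof.
move=> rc he; rewrite -(csumZ a (rpair_sum rc he)); apply: eq_csum => w.
by rewrite mulrA.
Qed.

Lemma rpair_big r (T : Type) (s : seq T) (h : T -> ser R d) c (e : T -> R) : tb B r c ->
  (forall t, sb (B + 1) (h t) (e t)) ->
  rpair r (\sum_(t <- s) h t) = \sum_(t <- s) rpair r (h t).
Proof.
move=> rc he; rewrite /rpair -(csum_bigD s (fun t => rpair_sum rc (he t))).
by apply: eq_csum => w; rewrite ser_sumE mulr_suml.
Qed.

Lemma bsum_mark (g : word d -> R) e : (forall w, 0 <= g w) ->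
  bsum (fun w => (B + 1) ^+ size w * g w) e ->
  bsum (fun o : (word d * 'I_d) * word d =>
     B ^+ (size o.2 + size o.1.1) * g (o.1.1 ++ o.1.2 :: o.2)) e.
Proof.
move=> g0 ge; pose k w (i : nat) := B ^+ (size w).-1 * g w.
have k0 w i : 0 <= k w i by rewrite mulr_ge0 ?exprn_ge0.
have := bsum_occ k0 _ => /(_ e) H; apply: bsum_le (H _) => [q|].
  by rewrite /k size_cat /= addnS /= addnC.
apply: bsum_le ge => w; rewrite sumr_const card_ord -mulr_natl mulrA.
by rewrite ler_wpM2r //; exact: pow_derivative_le.
Qed.

Lemma bsum_mark2 (g : word d -> R) e : (forall w, 0 <= g w) ->
  bsum (fun w => (B + 1) ^+ size w * g w) e ->
  bsum (fun m : word d * word d =>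
     B ^+ size m.1 * B ^+ size m.2 * \sum_j g (m.1 ++ j :: m.2)) e.
Proof.
move=> g0 /(bsum_mark g0) /bsum_letter h.
apply: bsum_le (h _) => [[u v]|q]; last by rewrite mulr_ge0 ?exprn_ge0.
by rewrite mulr_sumr; apply: ler_sum => j _; rewrite -exprD addnC.
Qed.

Lemma csum_occ (f : (word d * 'I_d) * word d -> C) c : bsum (fun o => normc (f o)) c ->
  csum (fun w => \sum_(o <- occ w) f o) =
  csum (fun m : word d * word d => \sum_j f ((m.1, j), m.2)).
Proof.
move=> fc; rewrite -(@csum_fiber _ _ _ f (@occ d) (fun o => o.1.1 ++ o.1.2 :: o.2) c) //.
- rewrite (@csum_fiber _ _ _ f (fun m => [seq ((m.1, j), m.2) | j <- enum 'I_d])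
     (fun o => (o.1.1, o.2)) c) //.
  + by apply: eq_csum => m; rewrite big_map big_enum.
  + by move=> m; rewrite map_inj_uniq ?enum_uniq // => i j [].
  + move=> [u v] [[a j] b]; apply/mapP/eqP => [[k _ [-> _ ->]]//|[<- <-]].
    by exists j; rewrite ?mem_enum.
- exact: uniq_occ.
- by move=> w o; rewrite mem_occ.
Qed.

(** Replacing a letter by [r_j] is a convolution of [r] with the family of the
    marked words of [h], whose norm is controlled at the radius [B + 1]. *)
Lemma bsum_delw (V : lmodType C) (nV : V -> R) (h : word d -> V) r c e :
  (forall x, 0 <= nV x) -> nV 0 = 0 -> (forall x y, nV (x + y) <= nV x + nV y) ->
  (forall a x, nV (a *: x) <= normc a * nV x) ->
  tb B r c -> bsum (fun w => (B + 1) ^+ size w * nV (h w)) e ->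
  bsum (fun w => B ^+ size w * nV (delw r h w)) (e * c).
Proof.
move=> V0 V00 VD VZ rc /(bsum_mark2 (fun w => V0 (h w))) he.
have p0 (m : word d * word d) : 0 <= B ^+ size m.1 * B ^+ size m.2.
  by rewrite mulr_ge0 ?exprn_ge0.
have Vs (T : Type) (s : seq T) (F : T -> V) : nV (\sum_(i <- s) F i) <= \sum_(i <- s) nV (F i).
  exact: n3_sum.
apply: (@bsum_bconv R _ _ _ (@trips d) (fun t => t.1.1 ++ t.2 ++ t.1.2) _ _ _ _ _
  (fun (X : 'I_d -> V) (y : 'cV[C]_d) => \sum_j y j 0 *: X j)
  (fun X => \sum_j nV (X j)) (@mnorm R d 1) nV _ _ _ _ _
  (fun m => B ^+ size m.1 * B ^+ size m.2) (fun w => B ^+ size w) _ _ _ _ _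
  (fun m j => h (m.1 ++ j :: m.2)) r) => //.
- exact: uniq_trips.
- by move=> w p; rewrite mem_trips.
- by move=> X; rewrite sumr_ge0.
- exact: mnorm_ge0.
- move=> X y; apply: le_trans (Vs _ _ _) _; rewrite mulr_suml; apply: ler_sum => j _.
  apply: le_trans (VZ _ _) _; rewrite mulrC ler_wpM2l //.
  exact: normc_le_mnorm.
- by move=> w; rewrite exprn_ge0.
- by move=> w; rewrite exprn_ge0.
- by move=> p; rewrite !size_cat !exprD -mulrA [B ^+ size p.2 * _]mulrC.
Qed.

Lemma sb_dels r h c e : tb B r c -> sb (B + 1) h e -> sb B (dels r h) (e * c).
Proof.
apply: bsum_delw => [x||x y|a x]; first exact: normc_ge0.
- exact: normc0.
- exact: normcD.
- by rewrite normcM.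
Qed.

Lemma rpair_occ_sum r h c e : tb B r c -> sb (B + 1) h e ->
  bsum (fun o : (word d * 'I_d) * word d =>
    normc (h (o.1.1 ++ o.1.2 :: o.2) * Epair r o.1.2 (o.2 ++ o.1.1))) (c * e).
Proof.
move=> rc he; have c0 := tb_ge0 B0 rc.
have he1 := bsum_mark (fun w => normc_ge0 (h w)) he.
have := bsumZ c0 (fun o => mulr_ge0 (exprn_ge0 _ B0) (normc_ge0 _)) he1.
apply: bsum_le => q; rewrite normcM mulrC mulrA ler_wpM2r ?normc_ge0 //.
by rewrite -size_cat; exact: Epair_le.
Qed.

Lemma rpair_occ r h c e : tb B r c -> sb (B + 1) h e ->
  rpair r h = csum (fun m : word d * word d =>
    \sum_j h (m.1 ++ j :: m.2) * Epair r j (m.2 ++ m.1)).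
Proof.
move=> rc he; rewrite -(csum_occ (rpair_occ_sum rc he)).
apply: eq_csum => w; rewrite mulr_sumr; apply: eq_big_seq => q.
by rewrite mem_occ => /eqP ->.
Qed.

(** Cyclic invariance of [tau] moves each inserted series to the front of its
    word, which is the form taken by [rho]. *)
Lemma pair_dels r h c e : tb B r c -> sb (B + 1) h e -> pair (dels r h) = rpair r h.
Proof.
move=> rc he; have c0 := tb_ge0 B0 rc.
have p0 (m : word d * word d) : 0 <= B ^+ size m.1 * B ^+ size m.2.
  by rewrite mulr_ge0 ?exprn_ge0.
have he2 := bsum_mark2 (fun w => normc_ge0 (h w)) he.
pose op (X : 'I_d -> C) (y : 'cV[C]_d) := \sum_j y j 0 * X j.
pose hX (m : word d * word d) j := h (m.1 ++ j :: m.2).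
have opM X y : normc (op X y) <= (\sum_j normc (X j)) * mnorm y.
  apply: le_trans (normc_sum _ _ _) _; rewrite mulr_suml; apply: ler_sum => j _.
  rewrite normcM mulrC ler_wpM2l ?normc_ge0 //; exact: normc_le_mnorm.
have tauM (p : (word d * word d) * word d) : normc (tau (p.1.1 ++ p.2 ++ p.1.2)) <=
    B ^+ size p.1.1 * B ^+ size p.1.2 * B ^+ size p.2.
  apply: le_trans (tau_le _) _.
  by rewrite !size_cat !exprD -mulrA [B ^+ size p.2 * _]mulrC.
transitivity (csum (fun p : (word d * word d) * word d =>
    op (hX p.1) (r p.2) * tau (p.1.1 ++ p.2 ++ p.1.2))).
  apply: (@csum_bconv R _ _ _ (@trips d) (fun t => t.1.1 ++ t.2 ++ t.1.2) _ _ _ _ _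
    op (fun X => \sum_j normc (X j)) (@mnorm R d 1) _ _
    (fun m => B ^+ size m.1 * B ^+ size m.2) (fun w => B ^+ size w) _ _
    hX r _ _ id tau) => //.
  - exact: uniq_trips.
  - by move=> w p; rewrite mem_trips.
  - by move=> X; rewrite sumr_ge0 // => *; exact: normc_ge0.
  - exact: mnorm_ge0.
  - by move=> w; rewrite exprn_ge0.
  - exact: he2.
  - exact: rc.
rewrite (@csum_pair _ _ _ _ (e * c)); last first.
  have := bsum_mul _ _ he2 rc => H; apply: bsum_le (H _ _) => [p|m|w]; last 2 first.
  - by rewrite mulr_ge0 // sumr_ge0 // => *; exact: normc_ge0.
  - exact: tb_term0.
  rewrite normcM mulrC [leRHS]mulrACA ler_pM ?normc_ge0 //; exact: opM.
rewrite (rpair_occ rc he).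
apply: eq_csum => -[u v] /=; rewrite /op.
under eq_csum => x do rewrite mulr_suml.
rewrite (@csum_bigD _ _ _ _ _ (fun j => normc (hX (u, v) j) * (c * B ^+ size (v ++ u)))).
  apply: eq_bigr => j _; rewrite -(csumZ _ (Epair_sum j (v ++ u) rc)).
  apply: eq_csum => x; rewrite [r x j 0 * _]mulrC -mulrA; congr (_ * (_ * _)).
  by rewrite tauC catA.
move=> j.
have := bsumZ (normc_ge0 (hX (u, v) j)) (fun x => normc_ge0 _) (Epair_sum j (v ++ u) rc).
by apply: bsum_le => x; rewrite tauC -catA -!normcM [r x j 0 * _]mulrC mulrA.
Qed.

(** [pair_dels] for one leg of a tensor, with the other leg as a parameter. *)
Lemma pair_dels_leg r (H : word d * word d -> C) c e : tb B r c ->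
  bsum (fun m => (B + 1) ^+ size m.1 * (B + 1) ^+ size m.2 * normc (H m)) e ->
  [/\ bsum (fun m => normc (dels r (fun u => H (u, m.2)) m.1 * (tau m.1 * tau m.2))) (e * c),
      bsum (fun m => normc (H m * (rho r m.1 * tau m.2))) (e * c) &
      csum (fun m => dels r (fun u => H (u, m.2)) m.1 * (tau m.1 * tau m.2)) =
      csum (fun m => H m * (rho r m.1 * tau m.2))].
Proof.
move=> rc He; have c0 := tb_ge0 B0 rc.
pose g (p : word d * word d) := (B + 1) ^+ size p.2 * (B + 1) ^+ size p.1 * normc (H (p.2, p.1)).
have g0 p : 0 <= g p by rewrite !mulr_ge0 ?exprn_ge0 ?normc_ge0.
have ge : bsum g e.
  apply: (bsum_inj (g := fun m : word d * word d => (B + 1) ^+ size m.1 *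
    (B + 1) ^+ size m.2 * normc (H m)) (e := fun p => (p.2, p.1))) He.
    by move=> m; rewrite !mulr_ge0 ?exprn_ge0 ?normc_ge0.
  by move=> [? ?] [? ?] [-> ->].
pose es v := psum (fun u => (B + 1) ^+ size u * normc (H (u, v))).
have Hv v : sb (B + 1) (fun u => H (u, v)) (es v).
  have hb : bsum (fun u => (B + 1) ^+ size u * normc (H (u, v))) (((B + 1) ^+ size v)^-1 * e).
    have i0 : 0 <= ((B + 1) ^+ size v)^-1 by rewrite invr_ge0 exprn_ge0.
    have hbv : bsum (fun u => g (v, u)) e.
      by apply: (bsum_inj (e := fun u => (v, u))) ge => // ? ? [].
    have := bsumZ i0 (fun u => g0 (v, u)) hbv; apply: bsum_le => u.
    rewrite /g /= mulrAC [X in _ <= _ * X]mulrC mulKf // expf_neq0 //.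
    by rewrite gt_eqF // ltr_wpDl.
  apply: (bsum_psum _ hb) => u.
  exact: (sb_term0 (fun u => H (u, v)) u B1_0).
have esE v : psum (fun u => g (v, u)) = (B + 1) ^+ size v * es v.
  rewrite -(psumZ (exprn_ge0 _ B1_0) _ (Hv v)) => [|u]; last exact: (sb_term0 (fun u => H (u, v)) u B1_0).
  by congr psum; apply/funext => u; rewrite /g /=; ring.
have [_ ges _] := psum_pair g0 ge.
have es0 v : 0 <= es v.
  by apply: psum_ge0 => u; exact: (sb_term0 (fun u => H (u, v)) u B1_0).
have ges' : bsum (fun v => B ^+ size v * (es v * c)) (e * c).
  have := bsumZ c0 (fun v => psum_ge0 (fun u => g0 (v, u))) ges; rewrite mulrC.
  apply: bsum_le => v; rewrite esE [leRHS]mulrC -mulrA ler_wpM2r ?mulr_ge0 //.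
  by rewrite lerXn2r ?nnegrE.
pose sw (q : word d * word d) := (q.2, q.1).
have swi : injective sw by move=> [? ?] [? ?] [-> ->].
have flip (F : word d * word d -> C) : bsum (fun p => normc (F (sw p))) (e * c) ->
    bsum (fun p => normc (F p)) (e * c).
  move=> h; have := bsum_inj (fun p => normc_ge0 _) swi h.
  by apply: bsum_le => -[].
have b1 : bsum (fun p : word d * word d => normc (dels r (fun u => H (u, p.1)) p.2 *
    (tau p.2 * tau p.1))) (e * c).
  apply: (bsum_pair (c := fun v => B ^+ size v * (es v * c))) ges' => [p|v].
    exact: normc_ge0.
  have := bsumZ (exprn_ge0 (size v) B0) (fun u => sb_term0 _ u B0) (sb_dels rc (Hv v)).
  apply: bsum_le => u /=; rewrite !normcM mulrC -mulrA.
  rewrite [leRHS]mulrCA ler_pM ?mulr_ge0 ?normc_ge0 //.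
  by rewrite ler_wpM2r ?normc_ge0.
have b2 : bsum (fun p : word d * word d => normc (H (p.2, p.1) * (rho r p.2 * tau p.1))) (e * c).
  apply: (bsum_pair (c := fun v => B ^+ size v * (es v * c))) ges' => [p|v].
    exact: normc_ge0.
  have := bsumZ (exprn_ge0 (size v) B0) (fun u => normc_ge0 _) (rpair_sum rc (Hv v)).
  rewrite (mulrC c); apply: bsum_le => u /=; rewrite mulrA [leLHS]normcM mulrC.
  by rewrite ler_wpM2r ?normc_ge0.
split; [exact: (flip (fun m => _ * _) b1) | exact: (flip (fun m => _ * _) b2) |].
rewrite -(@csum_bij _ _ _ _ sw sw); [|by case|by case].
rewrite -[RHS](@csum_bij _ _ _ _ sw sw); [|by case|by case].
rewrite (csum_pair b1) (csum_pair b2); apply: eq_csum => v /=.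
transitivity (pair (dels r (fun u => H (u, v))) * tau v).
  rewrite -(csumZr (tau v) (pair_sum (sb_dels rc (Hv v)))).
  by apply: eq_csum => u; rewrite mulrA.
rewrite (pair_dels rc (Hv v)) -(csumZr (tau v) (rpair_sum rc (Hv v))).
by apply: eq_csum => u; rewrite mulrA.
Qed.

Lemma mb_trace M e : mb (B + 1) (B + 1) M e ->
  bsum (fun m => (B + 1) ^+ size m.1 * (B + 1) ^+ size m.2 * normc (\tr (M m))) e.
Proof.
apply: bsum_le => m; rewrite ler_wpM2l ?mulr_ge0 ?exprn_ge0 //; exact: normc_mxtrace.
Qed.

Lemma mxtrace_delw r (h : word d -> 'M[C]_d) w :
  \tr (delw r h w) = dels r (fun u => \tr (h u)) w.
Proof.
rewrite /dels /delw raddf_sum; apply: eq_bigr => t _; rewrite raddf_sum.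
by apply: eq_bigr => j _ /=; rewrite mxtraceZ.
Qed.

(** The variation of [(tau (x) tau) (Tr M)] that comes from moving [tau] along
    [r]. *)
Definition rtpair r M : C :=
  csum (fun m => \tr (M m) * (rho r m.1 * tau m.2)) +
  csum (fun m => \tr (M m) * (tau m.1 * rho r m.2)).

Lemma flip_bsum (g : word d * word d -> R) e : (forall m, 0 <= g m) -> bsum g e ->
  bsum (fun m => g (m.2, m.1)) e.
Proof.
by move=> g0; apply: (bsum_inj (e := fun p : word d * word d => (p.2, p.1))) => // -[? ?] [? ?] [-> ->].
Qed.

(** Differentiation of [M] along [r] and variation of [tau (x) tau] along [r]
    coincide, by [pair_dels] on each leg. *)
Lemma tpair_delt r M c e : tb B r c -> mb (B + 1) (B + 1) M e ->
  tpair (delt r M) = rtpair r M.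
Proof.
move=> rc /mb_trace Me.
have [b1 _ E1] := pair_dels_leg rc Me.
have Me' : bsum (fun m => (B + 1) ^+ size m.1 * (B + 1) ^+ size m.2 *
    normc (\tr (M (m.2, m.1)))) e.
  have := flip_bsum _ Me => H; apply: bsum_le (H _) => m /=.
    by rewrite [X in _ <= X * _]mulrC.
  by rewrite !mulr_ge0 ?exprn_ge0 ?normc_ge0.
have [b2 _ E2] := pair_dels_leg rc Me'.
have b2' := flip_bsum (fun m => normc_ge0 _) b2.
pose sw (q : word d * word d) := (q.2, q.1).
rewrite /rtpair -E1.
have -> : csum (fun m => \tr (M m) * (tau m.1 * rho r m.2)) =
    csum (fun m => dels r (fun v => \tr (M (m.1, v))) m.2 * (tau m.2 * tau m.1)).
  rewrite -(@csum_bij _ _ _ _ sw sw); [|by case|by case].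
  rewrite -[RHS](@csum_bij _ _ _ _ sw sw); [|by case|by case].
  by rewrite E2; apply: eq_csum => -[u v] /=; rewrite [tau _ * _]mulrC.
rewrite -(csumD b1 b2'); apply: eq_csum => -[u v] /=.
by rewrite /delt mxtraceD !mxtrace_delw mulrDl [tau v * _]mulrC.
Qed.

Lemma mb_delt r M c e : tb B r c -> mb (B + 1) (B + 1) M e -> mb B B (delt r M) (e * c + e * c).
Proof.
move=> rc Me.
have H (M' : tens R n) : mb (B + 1) (B + 1) M' e ->
    bsum (fun m => B ^+ size m.1 * B ^+ size m.2 * mnorm (delw r (fun u => M' (u, m.1)) m.2)) (e * c).
  move=> Me'; have c0 := tb_ge0 B0 rc.
  pose g (p : word d * word d) := (B + 1) ^+ size p.1 * (B + 1) ^+ size p.2 * mnorm (M' (p.2, p.1)).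
  have g0 p : 0 <= g p by rewrite !mulr_ge0 ?exprn_ge0 ?mnorm_ge0.
  have ge : bsum g e.
    have := flip_bsum (fun m => mb_term0 M' m B1_0 B1_0) Me'; apply: bsum_le => m.
    by rewrite /g /= [X in X * _ <= _]mulrC.
  have [gi ges _] := psum_pair g0 ge.
  have := bsumZ c0 (fun v => psum_ge0 (fun u => g0 (v, u))) ges; rewrite mulrC.
  apply: bsum_pair => [m|v]; first by rewrite !mulr_ge0 ?exprn_ge0 ?mnorm_ge0.
  have q0 : 0 < (B + 1) ^+ size v by rewrite exprn_gt0 // ltr_wpDl.
  have hv : bsum (fun u => (B + 1) ^+ size u * mnorm (M' (u, v)))
      (((B + 1) ^+ size v)^-1 * psum (fun u => g (v, u))).
    have i0 : 0 <= ((B + 1) ^+ size v)^-1 by rewrite invr_ge0 ltW.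
    have := bsumZ i0 (fun u => g0 (v, u)) (gi v); apply: bsum_le => u.
    by rewrite /g /= -mulrA mulKf // gt_eqF.
  have := bsum_delw (@mnorm_ge0 R d d) (mnorm0 _ _ _) (@mnormD R d d) _ rc hv.
  have Z a (x : 'M[C]_d) : mnorm (a *: x) <= normc a * mnorm x by rewrite mnormZ.
  move=> /(_ Z) hd.
  have := bsumZ (exprn_ge0 (size v) B0) _ hd => /(_ (fun u => mulr_ge0 (exprn_ge0 _ B0) (mnorm_ge0 _))).
  move=> hh; apply: bsum_leR (bsum_le _ hh) => [|u]; last by rewrite mulrA.
  set x := psum _; have x0 : 0 <= x by exact: psum_ge0.
  have -> : B ^+ size v * ((B + 1) ^- size v * x * c) = B ^+ size v / (B + 1) ^+ size v * (c * x).
    by ring.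
  apply: ler_piMl; first by rewrite mulr_ge0.
  by rewrite ler_pdivrMr // mul1r lerXn2r ?nnegrE.
have h1 := H M Me.
have Me2 : mb (B + 1) (B + 1) (fun m => M (m.2, m.1)) e.
  have := flip_bsum (fun m => mb_term0 M m B1_0 B1_0) Me; apply: bsum_le => m.
  by rewrite /= [X in X * _ <= _]mulrC.
have h2 := H _ Me2.
have h1' := flip_bsum (fun m => mulr_ge0 (mulr_ge0 (exprn_ge0 _ B0) (exprn_ge0 _ B0)) (mnorm_ge0 _)) h1.
apply: bsum_le (bsumD _ _ h1' h2) => m; last 2 first.
- by rewrite !mulr_ge0 ?exprn_ge0 ?mnorm_ge0.
- by rewrite !mulr_ge0 ?exprn_ge0 ?mnorm_ge0.
rewrite /= [B ^+ size m.2 * _]mulrC -mulrDr ler_wpM2l ?mulr_ge0 ?exprn_ge0 //.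
exact: mnormD.
Qed.

End Functional.

(** * The Schwinger-Dyson equation under a change of variables *)

Section ChangeOfVariables.
Variables (R : realType) (n : nat).
Local Notation d := n.+1.
Local Notation C := (R[i]).
Implicit Types (u v w : word d) (h : ser R d) (r q : tup R d).
Implicit Types (M : tens R n) (c e : R).

Lemma bsum_csum (I J : choiceType) (f : I * J -> C) (b : I -> R) c :
  (forall i, 0 <= b i) -> bsum (fun p => b p.1 * normc (f p)) c ->
  bsum (fun i => b i * normc (csum (fun j => f (i, j)))) c.
Proof.
move=> b0 fc.
have g0 (p : I * J) : 0 <= b p.1 * normc (f p) by rewrite mulr_ge0 ?normc_ge0.
have [gi gs _] := psum_pair g0 fc; apply: bsum_le gs => i.
have [bi|bi] := eqVneq (b i) 0; first by rewrite {1}bi mul0r; apply: psum_ge0 => j; exact: (g0 (i, j)).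
have bi0 : 0 < b i by rewrite lt_neqAle eq_sym bi b0.
rewrite -ler_pdivlMl //; apply: csum_le.
have ib0 : 0 <= (b i)^-1 by rewrite invr_ge0.
by have := bsumZ ib0 (fun j => g0 (i, j)) (gi i); apply: bsum_le => j /=; rewrite mulKf.
Qed.

Lemma geometric_eq0 (x : C) (K q : R) : 0 <= q -> q < 1 ->
  (forall m, normc x <= K * q ^+ m) -> x = 0.
Proof.
move=> q0 q1 h; apply: eq0_normc; apply/eqP; rewrite eq_le normc_ge0 andbT.
have c0 : (fun m => K * q ^+ m) @ \oo --> (0 : R).
  rewrite -(mulr0 K); apply: cvgMr; apply: cvg_expr.
  by rewrite ger0_norm.
rewrite -(cvg_lim _ c0) //; apply: limr_ge; first by apply/cvg_ex; exists 0.
by near=> m; exact: h.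
Unshelve. all: by end_near. Qed.

Definition ncvarS (k : 'I_d) : ser R d := fun w => (w == [:: k])%:R.

(** The cyclic gradient as a sum over cuts: the words that give [y] when they
    are cut open at the letter [i] are the [b i a] with [y = a b]. *)
Definition gradw (i : 'I_d) (f : ser R d) : ser R d :=
  fun y => \sum_(b <- wfacts y) f (b.2 ++ i :: b.1).

Lemma csum_gradw_pair (i : 'I_d) (f : ser R d) (K : word d -> C) c :
  bsum (fun m : word d * word d => normc (f (m.1 ++ i :: m.2) * K (m.2 ++ m.1))) c ->
  bsum (fun y => normc (gradw i f y * K y)) c /\
  csum (fun y => gradw i f y * K y) =
  csum (fun m : word d * word d => f (m.1 ++ i :: m.2) * K (m.2 ++ m.1)).
Proof.
move=> hb; pose sw (q : word d * word d) := (q.2, q.1).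
have hb' : bsum (fun m : word d * word d => normc (f (m.2 ++ i :: m.1) * K (m.1 ++ m.2))) c.
  apply: (bsum_inj (g := fun m : word d * word d => normc (f (m.1 ++ i :: m.2) * K (m.2 ++ m.1)))
    (e := sw)) hb => [m|]; first exact: normc_ge0.
  by move=> [? ?] [? ?] [-> ->].
have E y : gradw i f y * K y =
    \sum_(b <- wfacts y) f (b.2 ++ i :: b.1) * K (b.1 ++ b.2).
  rewrite mulr_suml; apply: eq_big_seq => b; rewrite mem_wfacts => /eqP -> //.
split.
  have := bsum_fiber (s := @wfacts d) (p := fun b => b.1 ++ b.2) _ (@uniq_wfacts d) _ hb'.
  move=> H; apply: bsum_le (H _ _) => [y|b|y b].
  - by rewrite E; exact: normc_sum.
  - exact: normc_ge0.
  - by rewrite mem_wfacts => /eqP.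
under eq_csum => y do rewrite E.
rewrite -(@csum_fiber _ _ _ (fun b => f (b.2 ++ i :: b.1) * K (b.1 ++ b.2)) (@wfacts d)
  (fun b => b.1 ++ b.2) c) //; last 2 first.
- exact: uniq_wfacts.
- by move=> y b; rewrite mem_wfacts.
by rewrite -[RHS](@csum_bij _ _ _ _ sw sw); [|by case|by case].
Qed.

(** The Schwinger-Dyson equation for the tuple with entry [p] at [i] and zero
    elsewhere. *)
Definition sd_mono (tau : word d -> C) (f : ser R d) : Prop := forall (i : 'I_d) p,
  tau (p ++ [:: i]) + csum (fun y => gradw i f y * tau (p ++ y)) =
  \sum_(o <- occ p | o.1.2 == i) tau o.1.1 * tau o.2.

Definition compose (W : ser R d) (F : 'I_d -> ser R d) : ser R d :=
  fun u => csum (fun w => W w * wprod F w u).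

Lemma compose_sum A (W : ser R d) (F : 'I_d -> ser R d) D e : 0 <= A -> 0 <= D ->
  (forall k, sb A (F k) D) -> sb D W e ->
  bsum (fun p : word d * word d => A ^+ size p.1 * normc (W p.2 * wprod F p.2 p.1)) e.
Proof.
move=> A0 D0 FD We.
have : bsum (fun p : word d * word d => A ^+ size p.2 * normc (W p.1 * wprod F p.1 p.2)) e.
  apply: (bsum_pair _ _ We) => [p|w]; first by rewrite mulr_ge0 ?exprn_ge0 ?normc_ge0.
  have := bsumZ (normc_ge0 (W w)) (fun u => sb_term0 _ u A0) (sb_wprod w A0 D0 FD).
  rewrite mulrC; apply: bsum_le => u /=.
  by rewrite normcM mulrCA.
apply: (bsum_inj (e := fun q : word d * word d => (q.2, q.1))
  (g := fun p : word d * word d => A ^+ size p.2 * normc (W p.1 * wprod F p.1 p.2))).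
  by move=> p; rewrite mulr_ge0 ?exprn_ge0 ?normc_ge0.
by move=> [? ?] [? ?] [-> ->].
Qed.

Lemma sb_compose A (W : ser R d) (F : 'I_d -> ser R d) D e : 0 <= A -> 0 <= D ->
  (forall k, sb A (F k) D) -> sb D W e -> sb A (compose W F) e.
Proof.
move=> A0 D0 FD We; have := compose_sum A0 D0 FD We.
by apply: (@bsum_csum _ _ (fun p => W p.2 * wprod F p.2 p.1)) => u; rewrite exprn_ge0.
Qed.

(** Fubini for the substitution of [F] into [W]. When the weight [A ^ size u]
    vanishes there is no bound on the series defining [compose W F u], but then
    [K u] vanishes as well. *)
Lemma csum_compose A (W : ser R d) (F : 'I_d -> ser R d) D e (K : word d -> C) b :
  0 <= A -> 0 <= D -> (forall k, sb A (F k) D) -> sb D W e ->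
  (forall u, normc (K u) <= b * A ^+ size u) ->
  csum (fun u => compose W F u * K u) =
  csum (fun w => W w * csum (fun u => wprod F w u * K u)).
Proof.
move=> A0 D0 FD We Kb.
have b0 : 0 <= b by have := le_trans (normc_ge0 _) (Kb [::]); rewrite mulr1.
have hs := compose_sum A0 D0 FD We.
have hs2 : bsum (fun p : word d * word d => normc (W p.2 * wprod F p.2 p.1 * K p.1)) (b * e).
  have := bsumZ b0 _ hs => H; apply: bsum_le (H _) => p; last first.
    by rewrite mulr_ge0 ?exprn_ge0 ?normc_ge0.
  by rewrite normcM mulrC mulrA ler_wpM2r ?normc_ge0.
have Fs w : bsum (fun u => normc (wprod F w u * K u)) (b * D ^+ size w).
  have := bsumZ b0 (fun u => sb_term0 _ u A0) (sb_wprod w A0 D0 FD).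
  by apply: bsum_le => u; rewrite normcM mulrC mulrA ler_wpM2r ?normc_ge0.
transitivity (csum (fun u => csum (fun w => W w * wprod F w u * K u))).
  apply: eq_csum => u; rewrite /compose.
  have [E|ne] := eqVneq (A ^+ size u) 0.
    have K0 : K u = 0.
      by apply: eq0_normc; apply/eqP; rewrite eq_le normc_ge0 andbT (le_trans (Kb u)) // E mulr0.
    rewrite K0 mulr0; symmetry; under eq_csum => w do rewrite mulr0.
    exact: csum0.
  symmetry; apply: (@csumZr _ _ _ ((A ^+ size u)^-1 * e)).
  have i0 : 0 <= (A ^+ size u)^-1 by rewrite invr_ge0 exprn_ge0.
  have hu := bsum_inj (e := fun w => (u, w))
    (fun p : word d * word d => mulr_ge0 (exprn_ge0 (size p.1) A0) (normc_ge0 _)) _ hs.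
  have := bsumZ i0 _ (hu _) => H; apply: bsum_le (H _ _) => [w|w|? ? []//].
    by rewrite /= mulKf.
  by rewrite mulr_ge0 ?exprn_ge0 ?normc_ge0.
rewrite (csum_swap (f := fun u w => W w * wprod F w u * K u) hs2).
apply: eq_csum => w; rewrite -(csumZ _ (Fs w)); apply: eq_csum => u.
by rewrite mulrA.
Qed.

Variables (tau : word d -> C) (B : R).
Hypothesis B0 : 0 <= B.
Hypothesis tau_le : forall w, normc (tau w) <= B ^+ size w.
Hypothesis tauC : forall u v, tau (u ++ v) = tau (v ++ u).
Let B1_0 : 0 <= B + 1. Proof. by rewrite addr_ge0. Qed.
Let BB1 : B <= B + 1. Proof. by rewrite lerDl. Qed.

(** Both sides are linear and continuous in the tuple, so the equation for
    monomials extends to series of finite norm. *)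
Lemma sd_tuple V0 r c e : sd_mono tau V0 -> tb (B + 1) r c -> sb (B + 1) V0 e ->
  \sum_i Epair tau r i [:: i] + rpair tau r V0 = tpair tau (jac r).
Proof.
move=> sd rc Ve.
have rc' : tb B r c by apply: tb_mono rc.
have c0 := tb_ge0 B0 rc'.
have ro := rpair_occ_sum B0 tau_le rc' Ve.
have hr := bsum_mark B0 (fun w => mnorm_ge0 (r w)) rc.
pose f (o : (word d * 'I_d) * word d) : C :=
  r (o.1.1 ++ o.1.2 :: o.2) o.1.2 0 * (tau o.1.1 * tau o.2).
have fc : bsum (fun o => normc (f o)) c.
  apply: bsum_le hr => q; rewrite /f !normcM mulrC.
  apply: ler_pM; rewrite ?mulr_ge0 ?normc_ge0 ?normc_le_mnorm //.
  by rewrite exprD mulrC ler_pM ?normc_ge0.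
have -> : tpair tau (jac r) = csum (fun w => \sum_(o <- occ w) f o).
  rewrite (csum_occ fc); apply: eq_csum => m; rewrite /mxtrace mulr_suml.
  by apply: eq_bigr => j _; rewrite mxE.
pose g1 i (w : word d) := r w i 0 * tau (w ++ [:: i]).
pose g2 i (w : word d) := csum (fun y => r w i 0 * (gradw i V0 y * tau (w ++ y))).
have h1 i : bsum (fun w => normc (g1 i w)) (c * B ^+ 1) := Epair_sum B0 tau_le i [:: i] rc'.
have Vi i : bsum (fun m : word d * word d => normc (V0 (m.1 ++ i :: m.2)) * B ^+ size (m.2 ++ m.1)) e.
  have := bsum_inj (e := fun m : word d * word d => ((m.1, i), m.2)) _ _
    (bsum_mark B0 (fun w => normc_ge0 (V0 w)) Ve) => H.
  apply: bsum_le (H _ _) => [m|q|]; first by rewrite mulrC size_cat.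
    by rewrite mulr_ge0 ?exprn_ge0 ?normc_ge0.
  by move=> [? ?] [? ?] [-> ->].
have GV i w : bsum (fun y => normc (gradw i V0 y * tau (w ++ y))) (B ^+ size w * e) /\
   csum (fun y => gradw i V0 y * tau (w ++ y)) =
   csum (fun m : word d * word d => V0 (m.1 ++ i :: m.2) * tau (w ++ (m.2 ++ m.1))).
  apply: (csum_gradw_pair (K := fun y => tau (w ++ y))).
  have := bsumZ (exprn_ge0 (size w) B0) _ (Vi i) => H; apply: bsum_le (H _) => m.
    rewrite normcM mulrCA -exprD -size_cat ler_wpM2l ?normc_ge0 //.
  by rewrite mulr_ge0 ?exprn_ge0 ?normc_ge0.
have G2 i : bsum (fun p : word d * (word d * word d) =>
    normc (r p.1 i 0 * (V0 (p.2.1 ++ i :: p.2.2) * tau (p.1 ++ (p.2.2 ++ p.2.1))))) (c * e).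
  have := bsum_mul (fun w => tb_term0 r w B0) _ rc' (Vi i) => H; apply: bsum_le (H _) => p; last first.
    by rewrite mulr_ge0 ?exprn_ge0 ?normc_ge0.
  rewrite !normcM [leRHS]mulrAC.
  have -> : B ^+ size p.1 * (normc (V0 (p.2.1 ++ i :: p.2.2)) * B ^+ size (p.2.2 ++ p.2.1)) * mnorm (r p.1)
     = mnorm (r p.1) * (normc (V0 (p.2.1 ++ i :: p.2.2)) * B ^+ size (p.1 ++ (p.2.2 ++ p.2.1))).
    by rewrite (size_cat p.1) exprD; ring.
  by rewrite ler_pM ?mulr_ge0 ?normc_ge0 ?normc_le_mnorm // ler_wpM2l ?normc_ge0.
have g2E i w : g2 i w = csum (fun m : word d * word d =>
    r w i 0 * (V0 (m.1 ++ i :: m.2) * tau (w ++ (m.2 ++ m.1)))).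
  have [b E] := GV i w; rewrite /g2 (csumZ _ b) E; symmetry; apply: csumZ.
  have := bsumZ (exprn_ge0 (size w) B0) _ (Vi i) => H; apply: bsum_le (H _) => m.
    rewrite normcM mulrCA -exprD -size_cat ler_wpM2l ?normc_ge0 //.
  by rewrite mulr_ge0 ?exprn_ge0 ?normc_ge0.
have h2 i : bsum (fun w => normc (g2 i w)) (c * e).
  have := @bsum_csum _ _ (fun p : word d * (word d * word d) =>
     r p.1 i 0 * (V0 (p.2.1 ++ i :: p.2.2) * tau (p.1 ++ (p.2.2 ++ p.2.1)))) (fun=> 1) (c * e) _ _.
  move=> H; apply: bsum_le (H _ _) => [w||].
  - by rewrite mul1r g2E.
  - by move=> _; exact: ler01.
  - by apply: bsum_le (G2 i) => p; rewrite mul1r.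
transitivity (csum (fun w => \sum_i (g1 i w + g2 i w))); last first.
  apply: eq_csum => w; rewrite [RHS](partition_big (fun o => o.1.2) xpredT) //=.
  apply: eq_bigr => i _; rewrite /g1 /g2.
  have [b _] := GV i w; rewrite (csumZ _ b) -mulrDr sd mulr_sumr.
  rewrite big_seq_cond [RHS]big_seq_cond; apply: eq_bigr => q /andP[].
  by rewrite mem_occ /f => /eqP -> /eqP ->.
have h12 i : bsum (fun w => normc (g1 i w + g2 i w)) (c * B ^+ 1 + c * e).
  apply: bsum_le (bsumD _ _ (h1 i) (h2 i)) => w; [exact: normcD|exact: normc_ge0|exact: normc_ge0].
rewrite (csum_bigD _ h12).
rewrite (eq_bigr _ (fun i _ => csumD (h1 i) (h2 i))) big_split /=; congr (_ + _).
rewrite (rpair_occ B0 tau_le rc' Ve).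
have roi i : bsum (fun m : word d * word d => normc (V0 (m.1 ++ i :: m.2) *
    Epair tau r i (m.2 ++ m.1))) (c * e).
  apply: (bsum_inj (e := fun m : word d * word d => ((m.1, i), m.2)) _ _ ro) => [q|].
    exact: normc_ge0.
  by move=> [? ?] [? ?] [-> ->].
rewrite (csum_bigD _ roi); apply: eq_bigr => i _.
under [RHS]eq_csum => w do rewrite g2E.
rewrite (csum_swap (f := fun w (m : word d * word d) =>
   r w i 0 * (V0 (m.1 ++ i :: m.2) * tau (w ++ (m.2 ++ m.1)))) (G2 i)).
apply: eq_csum => m; rewrite -(csumZ _ (Epair_sum B0 tau_le i (m.2 ++ m.1) rc')).
by apply: eq_csum => w; rewrite mulrCA.
Qed.

Lemma csum_sym_sum M A e : mb A B M e -> 0 <= A ->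
  bsum (fun p : word d * word d => A ^+ size p.1 * normc (\tr (M p) * tau p.2)) e.
Proof.
move=> Me A0; apply: bsum_le Me => p; rewrite normcM -mulrA ler_wpM2l ?exprn_ge0 //.
by rewrite mulrC ler_pM ?normc_ge0 // normc_mxtrace.
Qed.

(** [legs M = (1 (x) tau + tau (x) 1) (Tr M)]. *)
Definition legs M : ser R d := fun w =>
  csum (fun v => \tr (M (w, v)) * tau v) + csum (fun v => \tr (M (v, w)) * tau v).

Definition flipt M : tens R n := fun m => M (m.2, m.1).

Lemma mb_flip A A' M e : 0 <= A -> 0 <= A' -> mb A A' M e -> mb A' A (flipt M) e.
Proof.
move=> A0 A0' Me; have := flip_bsum (fun m => mb_term0 M m A0 A0') Me.
by apply: bsum_le => m; rewrite /= [X in X * _ <= _]mulrC.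
Qed.

Lemma sb_leg A M e : 0 <= A -> mb A B M e ->
  sb A (fun w => csum (fun v => \tr (M (w, v)) * tau v)) e.
Proof.
move=> A0 Me; have := csum_sym_sum Me A0.
by apply: (@bsum_csum _ _ (fun p => \tr (M p) * tau p.2)) => u; rewrite exprn_ge0.
Qed.

Lemma sb_legs A M e e' : 0 <= A -> mb A B M e -> mb B A M e' -> sb A (legs M) (e + e').
Proof.
move=> A0 Me Me'; apply: (sbD A0 (sb_leg A0 Me)).
by have := sb_leg A0 (mb_flip B0 A0 Me').
Qed.

Lemma rpair_leg r M c e : tb B r c -> mb (B + 1) B M e ->
  rpair tau r (fun w => csum (fun v => \tr (M (w, v)) * tau v)) =
  csum (fun m => \tr (M m) * (rho tau r m.1 * tau m.2)).
Proof.
move=> rc Me; have c0 := tb_ge0 B0 rc.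
have hs := csum_sym_sum Me B1_0.
have hb : bsum (fun m => normc (\tr (M m) * (rho tau r m.1 * tau m.2))) (c * e).
  have := bsumZ c0 (fun m => mulr_ge0 (exprn_ge0 _ B1_0) (normc_ge0 _)) hs.
  apply: bsum_le => m; rewrite mulrCA normcM mulrA.
  by rewrite ler_wpM2r ?normc_ge0 //; exact: rho_le.
rewrite (csum_pair hb); apply: eq_csum => w.
transitivity (csum (fun v => \tr (M (w, v)) * tau v * rho tau r w)); last first.
  by apply: eq_csum => v; rewrite /= mulrAC mulrA.
have i0 : 0 <= ((B + 1) ^+ size w)^-1 by rewrite invr_ge0 exprn_ge0.
have q0 : (B + 1) ^+ size w != 0 by rewrite expf_neq0 // gt_eqF // ltr_wpDl.
symmetry; apply: (@csumZr _ _ _ (((B + 1) ^+ size w)^-1 * e)).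
have hu := bsum_inj (e := fun v => (w, v))
    (fun p : word d * word d => mulr_ge0 (exprn_ge0 (size p.1) B1_0) (normc_ge0 _)) _ hs.
have := bsumZ i0 _ (hu _) => H; apply: bsum_le (H _ _) => [v|v|? ? []//].
  by rewrite /= mulKf.
by rewrite mulr_ge0 ?exprn_ge0 ?normc_ge0.
Qed.

(** The variation of [tau (legs M)] in which only the argument of the outer
    [tau] moves is the variation of [(tau (x) tau) (Tr M)] with [M] fixed, one
    leg at a time. *)
Lemma rpair_legs r M c e e' : tb B r c -> mb (B + 1) B M e -> mb B (B + 1) M e' ->
  rpair tau r (legs M) = rtpair tau r M.
Proof.
move=> rc Me Me'; have Mf := mb_flip B0 B1_0 Me'.
rewrite (rpairD B0 tau_le rc (sb_leg B1_0 Me) (sb_leg B1_0 Mf)).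
rewrite (rpair_leg rc Me) (rpair_leg rc Mf); congr (_ + _).
pose sw (q : word d * word d) := (q.2, q.1).
rewrite -(@csum_bij _ _ _ _ sw sw); [|by case|by case].
by apply: eq_csum => -[u v] /=; rewrite /flipt /= [tau _ * _]mulrC.
Qed.

Variables (f : 'I_d -> ser R d) (W V0 L : ser R d) (q D eW eV kappa : R).
Let F (k : 'I_d) : ser R d := ncvarS k + f k.
Let A : tens R n := jac (tupof f).
Hypothesis (q0 : 0 <= q) (q1 : q < 1) (D0 : 0 <= D).
Hypothesis Aq : mb (B + 1) (B + 1) A q.
Hypothesis FD : forall k, sb (B + 1) (F k) D.
Hypothesis We : sb (D + 1) W eW.
Hypothesis Ve : sb (B + 1) V0 eV.

(** The truncations of [(1 (x) tau + tau (x) 1) Tr log (1 + A)]. *)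
Definition log_legs (M : tens R n) m : ser R d := fun w =>
  \sum_(i < m) ((-1) ^+ i / i.+1%:R) * legs (M ^+ i.+1) w.

(* [L] is the logarithm, as a limit of its truncations at a geometric rate. *)
Hypothesis Lm : forall m, sb (B + 1) (L - log_legs A m) (kappa * q ^+ m).

Let h : ser R d := (fun w => 2^-1 * (\sum_k F k * F k : ser R d) w) + compose W F - L.

Hypothesis sdV : sd_mono tau V0.
(* Only first variations of potentials matter: up to a constant and cyclic
   permutation, [|x|^2 / 2 + V0] is [h]. *)
Hypothesis heq : forall r c, tb (B + 1) r c ->
  \sum_i Epair tau r i [:: i] + rpair tau r V0 = rpair tau r h.

Let comp r k : ser R d := fun w => r w k 0.

(** The left-hand side of the Schwinger-Dyson equation of the law of [F] for
    [W], tested on a tuple [r] of series in the original variables. *)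
Definition sd_lhs r : C :=
  \sum_k pair tau (comp r k * F k) +
  csum (fun w => W w * \sum_(o <- occ w) pair tau (comp r o.1.2 * wprod F (o.2 ++ o.1.1))).

Let FDB k : sb B (F k) D.
Proof. exact: sb_mono (FD k). Qed.

Let wFB w : sb B (wprod F w) (D ^+ size w).
Proof. exact: sb_wprod. Qed.

Let WeD : sb D W eW.
Proof. by apply: sb_mono We => //; rewrite lerDl. Qed.

Lemma sd_lhs_term r c w : tb B r c ->
  normc (\sum_(o <- occ w) pair tau (comp r o.1.2 * wprod F (o.2 ++ o.1.1))) <=
  c * (D + 1) ^+ size w.
Proof.
move=> rc; apply: le_trans (normc_sum _ _ _) _.
apply: (@le_trans _ _ (\sum_(o <- occ w) c * D ^+ (size w).-1)).
  rewrite big_seq [leRHS]big_seq; apply: ler_sum => o; rewrite mem_occ => /eqP <-.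
  apply: le_trans (pair_le tau_le (sb_mul B0 (sb_comp o.1.2 B0 rc) (wFB _))) _.
  by rewrite !size_cat /= addnS /= addnC.
rewrite big_const_seq count_predT size_occ iter_addr_0 -mulr_natl mulrCA.
by rewrite ler_wpM2l ?(tb_ge0 B0 rc) //; exact: pow_derivative_le.
Qed.

Lemma sd_lhs_sum r c : tb B r c -> bsum (fun w => normc
  (W w * \sum_(o <- occ w) pair tau (comp r o.1.2 * wprod F (o.2 ++ o.1.1)))) (c * eW).
Proof.
move=> rc; have c0 := tb_ge0 B0 rc.
have D1_0 : 0 <= D + 1 by rewrite addr_ge0.
have := bsumZ c0 (fun w => sb_term0 W w D1_0) We; apply: bsum_le => w.
by rewrite normcM mulrC mulrA ler_wpM2r ?normc_ge0 //; exact: sd_lhs_term.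
Qed.

Lemma sd_lhs_le r c : tb B r c -> normc (sd_lhs r) <= c * (d%:R * D + eW).
Proof.
move=> rc; apply: le_trans (normcD _ _) _; rewrite mulrDr lerD //; last first.
  exact: (csum_le (sd_lhs_sum rc)).
apply: le_trans (normc_sum _ _ _) _.
apply: (@le_trans _ _ (\sum_(k < d) c * D)).
  apply: ler_sum => k _.
  exact: (pair_le tau_le (sb_mul B0 (sb_comp k B0 rc) (FDB k))).
by rewrite sumr_const card_ord -[leLHS]mulr_natl mulrCA.
Qed.

Lemma sd_lhsB r r' c c' : tb B r c -> tb B r' c' -> sd_lhs (r - r') = sd_lhs r - sd_lhs r'.
Proof.
move=> rc rc'.
have E (k : 'I_d) (g : ser R d) e : sb B g e ->
    pair tau (comp (r - r') k * g) = pair tau (comp r k * g) - pair tau (comp r' k * g).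
  move=> ge.
  have -> : comp (r - r') k = comp r k - comp r' k.
    by apply/funext => w; rewrite /comp serBE mxE; congr (_ + _); rewrite mxE.
  rewrite mulrBl (pairD tau_le (sb_mul B0 (sb_comp k B0 rc) ge)
    (sbN (sb_mul B0 (sb_comp k B0 rc') ge))).
  by rewrite pairN.
rewrite /sd_lhs opprD addrACA -sumrB; congr (_ + _).
  by apply: eq_bigr => k _; exact: E (FDB k).
rewrite -(csumB (sd_lhs_sum rc) (sd_lhs_sum rc')); apply: eq_csum => w.
rewrite -mulrBr -sumrB; congr (_ * _); apply: eq_bigr => o _; exact: E (wFB _).
Qed.

Lemma tupofF_jac : jac (tupof F) = 1 + A.
Proof.
apply/funext => -[u v]; apply/matrixP => i j.
rewrite [LHS]mxE [LHS]mxE tensDE [RHS]mxE [X in _ = _ + X]mxE [X in _ = _ + X]mxE.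
congr (_ + _); rewrite tens1E xpair_eqE /ncvarS /=; case: u => [|k u] /=.
  rewrite eqseq_cons eq_sym; case: (v == [::]) => /=; last by rewrite andbF mulr0n mxE.
  by rewrite andbT mulr1n mxE.
by rewrite eqseq_cons; case: u => [|? ?]; rewrite ?andbF /= mulr0n mxE.
Qed.

(** A variation of the variables by [r] moves [F] by [JF # r], so the first
    variation of [tau (|F|^2 / 2 + W o F)] is the left-hand side of the
    equation for [W] tested on [JF # r]. *)
Lemma rpair_potential r c : tb (B + 1) r c ->
  rpair tau r ((fun w => 2^-1 * (\sum_k F k * F k : ser R d) w) + compose W F) =
  sd_lhs (act (jac (tupof F)) r).
Proof.
move=> rc; have rc' : tb B r c by apply: tb_mono rc.
have FF k : sb (B + 1) (F k * F k) (D * D) := sb_mul B1_0 (FD k) (FD k).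
have FFs := sb_sum (index_enum 'I_d) B1_0 FF.
have cE k : comp (act (jac (tupof F)) r) k = dels r (F k).
  by apply/funext => w; rewrite /comp act_jacE.
have dF k := sb_dels B0 rc' (FD k).
rewrite (rpairD B0 tau_le rc' (sbZ 2^-1 B1_0 FFs) (sb_compose B1_0 D0 FD WeD)).
congr (_ + _).
  rewrite (rpairZ B0 tau_le _ rc' FFs) (rpair_big B0 tau_le _ rc' FF) mulr_sumr.
  apply: eq_bigr => k _; rewrite cE.
  rewrite -(pair_dels B0 tau_le tauC rc' (FF k)) delsM.
  rewrite (pairD tau_le (sb_mul B0 (dF k) (FDB k)) (sb_mul B0 (FDB k) (dF k))).
  rewrite (pairMC B0 tau_le tauC (FDB k) (dF k)).
  by field.
rewrite /rpair (csum_compose B1_0 D0 FD WeD (b := c)); last by move=> u; exact: rho_le.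
apply: eq_csum => w; congr (_ * _).
rewrite -[LHS]/(rpair tau r (wprod F w)).
rewrite -(pair_dels B0 tau_le tauC rc' (sb_wprod w B1_0 D0 FD)) dels_wprod.
have hs (o : (word d * 'I_d) * word d) := sb_mul B0 (sb_mul B0 (wFB o.1.1) (dF o.1.2)) (wFB o.2).
rewrite (pair_big tau_le _ hs); apply: eq_bigr => o _.
rewrite -mulrA (pairMC B0 tau_le tauC (wFB _) (sb_mul B0 (dF _) (wFB _))).
by rewrite -mulrA -wprod_cat cE.
Qed.

Let N : tens R n := - A.
Let Nq : mb (B + 1) (B + 1) N q. Proof. exact: mbN. Qed.
Let G m : tens R n := \sum_(i < m) N ^+ i.
Let K : R := d%:R / (1 - q).

Let K0 : 0 <= K. Proof. by rewrite divr_ge0 // subr_ge0 ltW. Qed.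

Lemma mb_geometric m : mb (B + 1) (B + 1) (G m) K.
Proof.
have := mb_sum (index_enum 'I_m) B1_0 B1_0 (fun i => mb_exp i B1_0 B1_0 Nq).
apply: mb_mono => //; rewrite -mulr_sumr ler_wpM2l //.
rewrite -[leRHS]mul1r ler_pdivlMr ?subr_gt0 // mulrC.
have -> : (1 - q) * \sum_(i < m) q ^+ i = 1 - q ^+ m.
  by rewrite -opprB mulNr -subrX1 opprB.
by rewrite gerBl exprn_ge0.
Qed.

Lemma geometricl m : (1 + A) * G m = 1 - N ^+ m.
Proof. by rewrite -[A]opprK -/N -opprB mulNr -subrX1 opprB. Qed.

Lemma geometricr m : G m * (1 + A) = 1 - N ^+ m.
Proof.
rewrite -geometricl /G mulr_suml mulr_sumr; apply: eq_bigr => i _.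
rewrite mulrDr mulrDl mulr1 mul1r -[A]opprK -/N mulrN mulNr.
by rewrite -exprSr exprS.
Qed.

Let NqB M e : mb (B + 1) (B + 1) M e -> mb B B M e.
Proof. exact: mb_mono. Qed.

(** Under the trace the [i + 1] terms of the derivative of [A ^ (i + 1)]
    coincide, which cancels the coefficient [1 / (i + 1)] of the logarithm and
    leaves the Neumann series of [(1 + A)^-1]. *)
Lemma rpair_log_legs r c m : tb (B + 1) r c ->
  rpair tau r (log_legs A m) = tpair tau (delt r A * G m).
Proof.
move=> rc; have rc' : tb B r c by apply: tb_mono rc.
have dA := mb_delt B0 rc' Aq.
have Ai i := mb_expS i B1_0 B1_0 Aq.
have Ai1 i : mb (B + 1) B (A ^+ i.+1) (q ^+ i.+1) by apply: mb_mono (Ai i).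
have Ai2 i : mb B (B + 1) (A ^+ i.+1) (q ^+ i.+1) by apply: mb_mono (Ai i).
have Li i := sb_legs B1_0 (Ai1 i) (Ai2 i).
have -> : log_legs A m = \sum_(i < m) ((fun w => ((-1) ^+ i / i.+1%:R) * legs (A ^+ i.+1) w) : ser R d).
  by apply/funext => w; rewrite ser_sumE.
rewrite (rpair_big B0 tau_le _ rc' (fun i : 'I_m => sbZ _ B1_0 (Li i))).
rewrite /G mulr_sumr (tpair_big tau_le _ (fun i : 'I_m => mb_mul B0 B0 dA (NqB (mb_exp i B1_0 B1_0 Nq)))).
apply: eq_bigr => -[i _] _ /=.
rewrite (rpairZ B0 tau_le _ rc' (Li i)) (rpair_legs rc' (Ai1 i) (Ai2 i)).
rewrite -(tpair_delt B0 tau_le tauC rc' (Ai i)) delt_exp.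
have Aj j := NqB (mb_exp j B1_0 B1_0 Aq).
rewrite (tpair_big tau_le _ (fun j : 'I_i.+1 => mb_mul B0 B0 (mb_mul B0 B0 (Aj j) dA) (Aj (i - j)%N))).
rewrite (eq_bigr (fun=> tpair tau (delt r A * A ^+ i))); last first.
  move=> j _; rewrite -mulrA (tpairMC B0 tau_le tauC (Aj _) (mb_mul B0 B0 dA (Aj _))).
  by rewrite -mulrA -exprD subnK // -ltnS.
rewrite sumr_const card_ord -[X in _ * X]mulr_natl mulrA divfK ?pnatr_eq0 //.
have NE : N ^+ i = if odd i then - A ^+ i else A ^+ i.
  elim: i => [|i IH]; first by rewrite !expr0.
  by rewrite !exprS IH /N /=; case: (odd i); rewrite /= ?mulrNN ?mulNr.
have sE : (-1 : C) ^+ i = if odd i then -1 else 1.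
  by rewrite -signr_odd; case: (odd i).
rewrite NE sE; case: (odd i); last by rewrite mul1r.
by rewrite mulN1r mulrN tpairN.
Qed.

Let sd_rearrange (z zn js jr jn dg s x : C) : z - zn - js = jr - jn + dg ->
  s + (jr + (dg + x)) - z = s - zn - js + jn + x.
Proof.
move=> E; have -> : z = jr - jn + dg + zn + js by rewrite -E; ring.
ring.
Qed.

(** [Q] stands for [P o F] and [Z] for [(J P) o F]. The equation for [V0] is
    tested on [r = G m # Q], where [G m] is a partial sum of the Neumann series
    of [(JF)^-1]. In [J (JF # r) = JF * J r + delta_r (JF)], the last term is
    compensated by the variation of the logarithm; the errors caused by the
    truncation are of order [q ^ m]. *)
Lemma sd_change_of_variables_tuple Q Z cQ eZ : tb (B + 1) Q cQ -> mb B B Z eZ ->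
  jac Q = Z * jac (tupof F) -> sd_lhs Q = tpair tau Z.
Proof.
move=> Qc Ze QZ; have cQ0 := tb_ge0 B1_0 Qc.
have eZ0 := mb_ge0 B0 B0 Ze.
have Qc' : tb B Q cQ by apply: tb_mono Qc.
have k0 : 0 <= kappa by have := sb_ge0 B1_0 (Lm 0); rewrite mulr1.
pose c1 := d%:R * cQ.
apply/eqP; rewrite -subr_eq0; apply/eqP.
apply: (@geometric_eq0 _ (c1 * (d%:R * D + eW) + eZ * d%:R + c1 * K + K * cQ * d%:R + K * cQ * kappa) q) => // m.
pose r := act (G m) Q.
have rc : tb (B + 1) r (K * cQ) := tb_act B1_0 (mb_geometric m) Qc.
have rc' : tb B r (K * cQ) by apply: tb_mono rc.
pose s := act (N ^+ m) Q.
have Nm := mb_exp m B1_0 B1_0 Nq.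
have sc : tb (B + 1) s (c1 * q ^+ m).
  by have := tb_act B1_0 Nm Qc; rewrite /c1 mulrAC.
have sc' : tb B s (c1 * q ^+ m) by apply: tb_mono sc.
have E0 : act (jac (tupof F)) r = Q - s.
  by rewrite /r -act_mul tupofF_jac geometricl actDl act1 actNl.
have E1 : sd_lhs Q - sd_lhs s = tpair tau (jac r) + rpair tau r L.
  rewrite -(sd_lhsB Qc' sc') -E0 -(rpair_potential rc) -(sd_tuple sdV rc Ve) (heq rc).
  have FFs := sb_sum (index_enum 'I_d) B1_0 (fun k => sb_mul B1_0 (FD k) (FD k)).
  have Le : sb (B + 1) L kappa.
    have := Lm 0; rewrite mulr1 /log_legs.
    congr (sb _ _ _); apply/funext => w; rewrite serBE big_ord0 subr0 //.
  rewrite /h (rpairD B0 tau_le rc' (sbD B1_0 (sbZ 2^-1 B1_0 FFs) (sb_compose B1_0 D0 FD WeD)) (sbN Le)).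
  by rewrite rpairN subrK.
have E2 : rpair tau r L = tpair tau (delt r A * G m) + rpair tau r (L - log_legs A m).
  rewrite -(rpair_log_legs m rc).
  have lE : L = log_legs A m + (L - log_legs A m) by rewrite addrC subrK.
  have lle : sb (B + 1) (log_legs A m) (kappa + kappa * q ^+ m).
    have := sbD B1_0 (Lm 0) (sbN (Lm m)); rewrite mulr1; congr (sb _ _ _).
    apply/funext => w; rewrite serDE serBE /log_legs big_ord0 subr0.
    by rewrite -[(- _) w]/(- (L w - _)) opprB addrC subrK.
  by rewrite {1}lE (rpairD B0 tau_le rc' lle (Lm m)).
have dA := mb_delt B0 rc' Aq.
have GB := NqB (mb_geometric m).
have JB := NqB (mbD B1_0 B1_0 (@mb1 R n _ _ B1_0 B1_0) Aq).
have jr := mb_jac1 B0 rc.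
have NB := NqB Nm.
have dJ : delt r (1 + A) = delt r A.
  rewrite -[RHS]add0r -(delt1 r); apply/funext => m'.
  rewrite /delt tensDE addrACA; congr (_ + _); rewrite /delw -big_split;
   apply: eq_bigr => t _ /=; rewrite -big_split; apply: eq_bigr => j _ /=;
   by rewrite tensDE scalerDr.
have E3 : tpair tau (jac (Q - s) * G m) = tpair tau (jac r) - tpair tau (jac r * N ^+ m) +
    tpair tau (delt r A * G m).
  rewrite -E0 tupofF_jac -{1}tupofF_jac jac_act tupofF_jac dJ mulrDl.
  rewrite (tpairD tau_le (mb_mul B0 B0 (mb_mul B0 B0 JB jr) GB) (mb_mul B0 B0 dA GB)).
  rewrite -mulrA (tpairMC B0 tau_le tauC JB (mb_mul B0 B0 jr GB)) -mulrA geometricr.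
  by rewrite mulrBr mulr1 (tpairD tau_le jr (mbN (mb_mul B0 B0 jr NB))) tpairN.
have js := mb_jac1 B0 sc.
have E4 : tpair tau (jac (Q - s) * G m) = tpair tau Z - tpair tau (Z * N ^+ m) - tpair tau (jac s * G m).
  rewrite jacD jacN mulrBl QZ tupofF_jac -mulrA geometricl mulrBr mulr1.
  rewrite (tpairD tau_le (mbD B0 B0 Ze (mbN (mb_mul B0 B0 Ze NB))) (mbN (mb_mul B0 B0 js GB))).
  by rewrite tpairN (tpairD tau_le Ze (mbN (mb_mul B0 B0 Ze NB))) tpairN.
have -> : sd_lhs Q - tpair tau Z = sd_lhs s - tpair tau (Z * N ^+ m) - tpair tau (jac s * G m)
    + tpair tau (jac r * N ^+ m) + rpair tau r (L - log_legs A m).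
  have -> : sd_lhs Q = sd_lhs s + (tpair tau (jac r) + rpair tau r L).
    by rewrite -E1 addrC subrK.
  rewrite E2; apply: sd_rearrange; by rewrite -E4 E3.
apply: le_trans (normcD _ _) _; rewrite mulrDl; apply: lerD; last first.
  by rewrite -[leRHS]mulrA; exact: (rpair_le B0 tau_le rc' (Lm m)).
apply: le_trans (normcD _ _) _; rewrite mulrDl; apply: lerD; last first.
  by rewrite -[leRHS]mulrA; exact: (tpair_le tau_le (mb_mul B0 B0 jr NB)).
apply: le_trans (normcD _ _) _; rewrite mulrDl normcN; apply: lerD; last first.
  by rewrite mulrAC; exact: (tpair_le tau_le (mb_mul B0 B0 js GB)).
apply: le_trans (normcD _ _) _; rewrite mulrDl normcN; apply: lerD; last first.
  by rewrite -mulrA; exact: (tpair_le tau_le (mb_mul B0 B0 Ze NB)).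
by rewrite mulrAC; exact: sd_lhs_le.
Qed.

(** For a monomial test tuple the chain rule [jac_chain] provides the
    factorization [J (P o F) = ((J P) o F) * JF] that
    [sd_change_of_variables_tuple] asks for. *)
Lemma sd_change_of_variables : sd_mono (fun w => pair tau (wprod F w)) W.
Proof.
move=> i p.
pose Q := tupat (wprod F p) i; pose Z := jac_wprod F i p.
have Qc : tb (B + 1) Q (D ^+ size p) := tb_tupat i (sb_wprod p B1_0 D0 FD).
have Ze : mb B B Z (\sum_(o <- occ p) D ^+ size o.1.1 * D ^+ size o.2).
  have p0 (u : word d) : 0 <= B ^+ size u by rewrite exprn_ge0.
  have H (o : (word d * 'I_d) * word d) := bsum_mul (fun u => sb_term0 (wprod F o.1.1) u B0)
    (fun u => sb_term0 (wprod F o.2) u B0) (wFB o.1.1) (wFB o.2).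
  have H2 := bsum_big (occ p) (fun o m => mulr_ge0 (sb_term0 (wprod F o.1.1) m.1 B0)
    (sb_term0 (wprod F o.2) m.2 B0)) H.
  apply: bsum_le H2 => m.
  rewrite /Z /jac_wprod; apply: le_trans (ler_wpM2l _ (mnorm_sum _ _)) _.
    by rewrite mulr_ge0.
  rewrite mulr_sumr; apply: ler_sum => o _; rewrite mnorm_delta2 normcM le_eqVlt.
  by apply/orP; left; apply/eqP; ring.
have := sd_change_of_variables_tuple Qc Ze (jac_chain F i p).
have compE k : comp Q k = if k == i then wprod F p else 0.
  apply/funext => w; rewrite /comp /Q /tupat !mxE eqxx andbT.
  by case: eqP => _; rewrite ?mulr1 ?mulr0.
have sh : \sum_k pair tau (comp Q k * F k) = pair tau (wprod F (p ++ [:: i])).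
  rewrite (bigD1 i) //= big1 ?addr0 => [|k ki].
    by rewrite compE eqxx wprod_cat wprod_cons wprod_nil mulr1.
  by rewrite compE (negbTE ki) mul0r /pair -[RHS](csum0 R (word d)); apply: eq_csum => w; rewrite mul0r.
rewrite /sd_lhs sh => E.
transitivity (tpair tau Z); last first.
  rewrite /Z /tpair.
  have hb (o : (word d * 'I_d) * word d) : bsum (fun m : word d * word d => normc
      ((if o.1.2 == i then 1 else 0) * (wprod F o.1.1 m.1 * tau m.1 * (wprod F o.2 m.2 * tau m.2))))
      (D ^+ size o.1.1 * D ^+ size o.2).
    have := bsum_mul (fun u => normc_ge0 _) (fun u => normc_ge0 _)
      (pair_sum tau_le (wFB o.1.1)) (pair_sum tau_le (wFB o.2)).
    apply: bsum_le => m; rewrite -normcM; case: ifP => _; first by rewrite mul1r.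
    by rewrite mul0r normc0 normc_ge0.
  transitivity (csum (fun m : word d * word d => \sum_(o <- occ p)
     (if o.1.2 == i then 1 else 0) * (wprod F o.1.1 m.1 * tau m.1 * (wprod F o.2 m.2 * tau m.2)))).
    apply: eq_csum => m; rewrite /jac_wprod raddf_sum mulr_suml; apply: eq_bigr => o _ /=.
    rewrite mxtraceZ /mxtrace (bigD1 i) //= mxE eqxx big1 ?addr0 => [|k ki]; last first.
      by rewrite mxE (negbTE ki).
    rewrite eq_sym /=; case: (o.1.2 == i); rewrite /= ?mulr1 ?mulr0 ?mul0r // mul1r; ring.
  rewrite (csum_bigD _ hb) [RHS]big_mkcond; apply: eq_bigr => o _; case: ifP => oi; last first.
    by apply: etrans (csum0 _ _); apply: eq_csum => m; rewrite mul0r.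
  have hb2 : bsum (fun m : word d * word d => normc
     (wprod F o.1.1 m.1 * tau m.1 * (wprod F o.2 m.2 * tau m.2))) (D ^+ size o.1.1 * D ^+ size o.2).
    by have := hb o; rewrite oi; apply: bsum_le => m; rewrite mul1r.
  under eq_csum => m do rewrite mul1r.
  rewrite (csum_pair hb2) /=.
  under eq_csum => u do rewrite (csumZ _ (pair_sum tau_le (wFB o.2))).
  by rewrite (csumZr _ (pair_sum tau_le (wFB o.1.1))).
rewrite -E; congr (_ + _).
have Vb : bsum (fun m : word d * word d => normc (W (m.1 ++ i :: m.2) *
    pair tau (wprod F (p ++ (m.2 ++ m.1))))) (D ^+ size p * eW).
  have D1 : bsum (fun w => (D + 1) ^+ size w * normc (W w)) eW := We.
  have := bsum_inj (e := fun m : word d * word d => ((m.1, i), m.2)) _ _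
    (bsum_mark D0 (fun w => normc_ge0 (W w)) D1) => H.
  have := bsumZ (exprn_ge0 (size p) D0) _ (H _ _) => H'; apply: bsum_le (H' _ _ _) => [m|m|q'|].
  - rewrite normcM mulrC mulrA ler_wpM2r ?normc_ge0 //.
    apply: le_trans (pair_le tau_le (wFB _)) _.
    by rewrite size_cat exprD size_cat.
  - by rewrite mulr_ge0 ?exprn_ge0 ?normc_ge0.
  - by rewrite mulr_ge0 ?exprn_ge0 ?normc_ge0.
  - by move=> [? ?] [? ?] [-> ->].
have [_ ->] := csum_gradw_pair (K := fun y => pair tau (wprod F (p ++ y))) Vb.
pose K' (o : (word d * 'I_d) * word d) : C :=
  (if o.1.2 == i then 1 else 0) * (W (o.1.1 ++ o.1.2 :: o.2) * pair tau (wprod F (p ++ (o.2 ++ o.1.1)))).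
have Kb : bsum (fun o => normc (K' o)) (D ^+ size p * eW).
  have D1 : bsum (fun w => (D + 1) ^+ size w * normc (W w)) eW := We.
  have := bsumZ (exprn_ge0 (size p) D0) _ (bsum_mark D0 (fun w => normc_ge0 (W w)) D1) => H.
  apply: bsum_le (H _) => o'; last by rewrite mulr_ge0 ?exprn_ge0 ?normc_ge0.
  rewrite /K'; case: ifP => _; last by rewrite mul0r normc0 !mulr_ge0 ?exprn_ge0 ?normc_ge0.
  rewrite mul1r normcM mulrC mulrA ler_wpM2r ?normc_ge0 //.
  apply: le_trans (pair_le tau_le (wFB _)) _.
  by rewrite size_cat exprD size_cat.
transitivity (csum (fun w => \sum_(o <- occ w) K' o)).
  rewrite (csum_occ Kb); apply: eq_csum => m; rewrite (bigD1 i) //= /K' /= eqxx mul1r.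
  by rewrite big1 ?addr0 // => k /negbTE ->; rewrite mul0r.
apply: eq_csum => w; rewrite mulr_sumr; apply: eq_big_seq => o.
rewrite mem_occ => /eqP oE; rewrite /K' oE compE; case: ifP => _.
  by rewrite mul1r wprod_cat.
rewrite !mul0r /pair (eq_csum (g := fun=> 0)) ?csum0 ?mulr0 // => u; by rewrite mul0r.
Qed.

End ChangeOfVariables.

(** * Fixed points in weighted l^1 balls *)

Section FixedPoint.
Variable R : realType.
Local Notation C := (R[i]).

Lemma csum_nat_shift (f : nat -> C) c m : bsum (fun k => normc (f k)) c ->
  csum f = \sum_(k < m) f k + csum (fun k => f (m + k)%N).
Proof.
move=> fc.
pose f1 k := if (k < m)%N then f k else 0; pose f2 k := if (k < m)%N then 0 else f k.
have b1 : bsum (fun k => normc (f1 k)) c.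
  by apply: bsum_le fc => k; rewrite /f1; case: ifP => // _; rewrite normc0 normc_ge0.
have b2 : bsum (fun k => normc (f2 k)) c.
  by apply: bsum_le fc => k; rewrite /f2; case: ifP => // _; rewrite normc0 normc_ge0.
have -> : csum f = csum (fun k => f1 k + f2 k).
  by apply: eq_csum => k; rewrite /f1 /f2; case: ifP; rewrite ?addr0 ?add0r.
rewrite (csumD b1 b2); congr (_ + _).
  rewrite (@csum_seq _ _ _ (iota 0 m)) ?iota_uniq //.
    rewrite -(big_mkord xpredT f) /index_iota subn0; apply: eq_big_seq => k.
    by rewrite mem_iota add0n leq0n /f1 /= => ->.
  by move=> k; rewrite mem_iota add0n leq0n /f1 /= => /negbTE ->.
rewrite -(@csum_inj _ _ _ f2 (fun k => m + k)%N).
- by apply: eq_csum => k; rewrite /f2 ltnNge leq_addr.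
- exact: addnI.
- move=> j h; rewrite /f2; case: ltnP => // mj.
  by case: (h (j - m)%N); rewrite subnKC.
Qed.

Lemma bsum_geometric (q c : R) : 0 <= q -> q < 1 -> 0 <= c ->
  bsum (fun k : nat => c * q ^+ k) (c / (1 - q)).
Proof.
move=> q0 q1 c0; have q1' : 0 < 1 - q by rewrite subr_gt0.
apply: bsumZ => // [k|]; first by rewrite exprn_ge0.
apply/bsum_sumP => [k|s us]; first by rewrite exprn_ge0.
pose m := (\max_(i <- s) i).+1.
apply: (@le_trans _ _ (\sum_(k <- iota 0 m) q ^+ k)).
  have -> : \sum_(i <- s) q ^+ i = \sum_(i <- iota 0 m | i \in s) q ^+ i.
    rewrite -[RHS]big_filter; apply: perm_big.
    apply: uniq_perm; rewrite ?filter_uniq ?iota_uniq // => k.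
    rewrite mem_filter mem_iota leq0n add0n andb_idr // => ks.
    by rewrite /m ltnS (big_rem k) //= leq_maxl.
  rewrite [leRHS](bigID (mem s)) lerDl; apply: sumr_ge0 => k _; exact: exprn_ge0.
have -> : \sum_(k <- iota 0 m) q ^+ k = \sum_(k < m) q ^+ k.
  by rewrite -(big_mkord xpredT (fun k => q ^+ k)) /index_iota subn0.
rewrite -[leRHS]mul1r ler_pdivlMr // mulrC.
have -> : (1 - q) * \sum_(i < m) q ^+ i = 1 - q ^+ m.
  by rewrite -opprB mulNr -subrX1 opprB.
by rewrite gerBl exprn_ge0.
Qed.

Variables (I : choiceType) (wt : I -> R).
Hypothesis wt0 : forall i, 0 < wt i.
Definition wball (x : I -> C) c := bsum (fun i => wt i * normc (x i)) c.

Lemma wball_term x c i : wball x c -> normc (x i) <= (wt i)^-1 * c.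
Proof.
move=> xc; rewrite ler_pdivlMl //.
by apply: (@bsum_term _ _ (fun i => wt i * normc (x i))) => // j; rewrite mulr_ge0 ?normc_ge0 ?ltW.
Qed.

Lemma wballD x y c e : wball x c -> wball y e -> wball (fun i => x i + y i) (c + e).
Proof.
have g0 (z : I -> C) i : 0 <= wt i * normc (z i) by rewrite mulr_ge0 ?normc_ge0 ?ltW.
move=> xc ye; apply: bsum_le (bsumD (g0 x) (g0 y) xc ye) => i.
by rewrite -mulrDr; apply: ler_wpM2l; [exact: ltW|exact: normcD].
Qed.

Lemma wballN x c : wball x c -> wball (fun i => - x i) c.
Proof. by apply: bsum_le => i; rewrite normcN. Qed.

(** Banach fixed point theorem: the iterates of 0 form a series that converges
    geometrically. The predicate [P] carries symmetries of the iterates to the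
    limit. *)
Lemma wball_fixpoint (Th : (I -> C) -> (I -> C)) (P : (I -> C) -> Prop) (r : R) : 0 <= r ->
  (forall x y e, wball x r -> wball y r -> wball (fun i => x i - y i) e ->
     wball (fun i => Th x i - Th y i) (e / 2)) ->
  wball (Th (fun=> 0)) (r / 2) ->
  P (fun=> 0) -> (forall x, wball x r -> P x -> P (Th x)) ->
  (forall (u : nat -> I -> C) x, (forall k, P (u k)) ->
     (forall i k, normc (x i - u k i) <= (wt i)^-1 * r * 2^-1 ^+ k) -> P x) ->
  exists x, [/\ wball x r, Th x = x & P x].
Proof.
move=> r0 lip Th0 P0 Ps Pc.
have w0 i : 0 <= wt i by rewrite ltW.
pose u k := iter k Th (fun=> 0).
have ur k : wball (u k) r.
  elim: k => [|k IH].
    by apply: bsum_leR r0 _; apply: bsum_le (bsum0 R I) => i; rewrite normc0 mulr0.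
  have h0 : wball (fun=> 0) r.
    by apply: bsum_leR r0 _; apply: bsum_le (bsum0 R I) => i; rewrite normc0 mulr0.
  have := wballD (lip _ _ r IH h0 _) Th0 => H.
  have := H _; rewrite -splitr; rewrite /wball /=.
  have -> : (fun i => wt i * normc (Th (u k) i - Th (fun=> 0) i + Th (fun=> 0) i)) =
      fun i => wt i * normc (Th (u k) i).
    by apply/funext => i; rewrite subrK.
  by apply; apply: bsum_le IH => i; rewrite subr0.
have Pu k : P (u k) by elim: k => //= k IH; apply: Ps.
have ud k : wball (fun i => u k.+1 i - u k i) (r / 2 * 2^-1 ^+ k).
  elim: k => [|k IH]; first by rewrite mulr1; apply: bsum_le Th0 => i; rewrite subr0.
  have := lip _ _ _ (ur k.+1) (ur k) IH; rewrite exprSr mulrA //.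
pose x i := csum (fun k => u k.+1 i - u k i).
have hg : 0 <= 2^-1 :> R by rewrite invr_ge0.
have hl : 2^-1 < 1 :> R by rewrite invf_lt1 ?ltr1n.
have r20 : 0 <= r / 2 by rewrite mulr_ge0.
have geo m : bsum (fun k => r / 2 * 2^-1 ^+ (m + k)%N) (r * 2^-1 ^+ m).
  have := @bsum_geometric 2^-1 (r / 2 * 2^-1 ^+ m) hg hl (mulr_ge0 r20 (exprn_ge0 _ hg)).
  have -> : r / 2 * 2^-1 ^+ m / (1 - 2^-1) = r * 2^-1 ^+ m by field.
  by apply: bsum_le => k; rewrite exprD mulrA.
have ux m : wball (fun i => x i - u m i) (r * 2^-1 ^+ m).
  have E i : x i - u m i = csum (fun k => u (m + k).+1 i - u (m + k)%N i).
    have hb : bsum (fun k => normc (u k.+1 i - u k i)) ((wt i)^-1 * (r * 2^-1 ^+ 0)).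
      have iw : 0 <= (wt i)^-1 by rewrite invr_ge0.
      have := bsumZ iw _ (geo 0) => H; apply: bsum_le (H _) => k.
        by rewrite add0n; exact: (wball_term i (ud k)).
      by rewrite mulr_ge0 ?exprn_ge0.
    rewrite /x (csum_nat_shift m hb).
    have -> : \sum_(k < m) (u k.+1 i - u k i) = u m i.
      by rewrite -(big_mkord xpredT (fun k => u k.+1 i - u k i)) telescope_sumr // subr0.
    by rewrite addrC addKr.
  have hp : bsum (fun p : nat * I => wt p.2 * normc (u (m + p.1).+1 p.2 - u (m + p.1)%N p.2))
     (r * 2^-1 ^+ m).
    apply: (bsum_pair _ _ (geo m)) => [p|k /=]; last exact: ud.
    by rewrite mulr_ge0 ?normc_ge0.
  have hp' : bsum (fun p : I * nat => wt p.1 * normc (u (m + p.2).+1 p.1 - u (m + p.2)%N p.1))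
     (r * 2^-1 ^+ m).
    apply: (bsum_inj (e := fun p : I * nat => (p.2, p.1)) _ _ hp) => [p|].
      by rewrite mulr_ge0 ?normc_ge0.
    by move=> [? ?] [? ?] [-> ->].
  have := bsum_csum (f := fun p : I * nat => u (m + p.2).+1 p.1 - u (m + p.2)%N p.1) w0 hp'.
  by apply: bsum_le => i; rewrite E.
have xr : wball x r.
  by have := ux 0; rewrite mulr1; apply: bsum_le => i; rewrite subr0.
exists x; split => //; last first.
  by apply: (Pc u) => // i k; rewrite -mulrA; exact: wball_term i (ux k).
apply/funext => i; apply/eqP; rewrite -subr_eq0; apply/eqP.
apply: (geometric_eq0 hg hl (K := (wt i)^-1 * (r + r))) => m.
have h1 := lip _ _ _ xr (ur m) (ux m).
have := wballD h1 (wballN (ux m.+1)) => h2.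
have := wball_term i h2.
have -> : Th x i - Th (u m) i + - (x i - u m.+1 i) = Th x i - x i by rewrite opprB addrA subrK.
move=> h; apply: le_trans h _; rewrite -[leRHS]mulrA ler_wpM2l ?invr_ge0 // mulrDl; apply: lerD.
  by rewrite ler_pdivrMr // ler_peMr ?mulr_ge0 ?exprn_ge0 // ler1n.
by rewrite ler_wpM2l // exprS ler_piMl ?exprn_ge0 // ltW.
Qed.

End FixedPoint.

(** * Cyclic averages and the equation for the potential *)

Section Cyclic.
Variables (R : realType) (n : nat).
Local Notation d := n.+1.
Local Notation C := (R[i]).
Implicit Types (u v w : word d) (h psi W L : ser R d) (r : tup R d).

Definition cycS (g : word d -> C) w : C := \sum_(i < size w) g (rot i w).

Definition cycsym (k : ser R d) : ser R d := fun w => (size w)%:R^-1 * cycS k w.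

Lemma rot_add1 i w : (i < size w)%N -> rot i.+1 w = rot i (rot 1 w).
Proof.
case: w => [|x w] //= iw; rewrite -(addn1 i) rotD ?addn1 //.
Qed.

Lemma cycS_rot1 (g : word d -> C) w : cycS g (rot 1 w) = cycS g w.
Proof.
rewrite /cycS size_rot; case: w => [|x w]; first by rewrite !big_ord0.
rewrite -[size (x :: w)]/(size w).+1 [RHS]big_ord_recl [LHS]big_ord_recr [LHS]addrC.
congr (_ + _).
  congr (g _); rewrite -[LHS]/(rot (size w) (rot 1 (x :: w))) -rot_add1 // rot0.
  by rewrite -[(size w).+1]/(size (x :: w)) rot_size.
apply: eq_bigr => i _; rewrite lift0 -rot_add1 //.
Qed.

Definition cyc_inv (g : word d -> C) := forall w, g (rot 1 w) = g w.

Lemma cyc_inv_rot g i w : cyc_inv g -> g (rot i w) = g w.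
Proof.
move=> gc; have [iw|iw] := leqP i (size w); last by rewrite rot_oversize // ltnW.
elim: i iw => [|i IH] iw; first by rewrite rot0.
rewrite -(IH (ltnW iw)) -[in RHS]gc -[in RHS]rotD ?size_rot ?addn1 //.
Qed.

Lemma cyc_inv_cat g u v : cyc_inv g -> g (u ++ v) = g (v ++ u).
Proof. by move=> gc; rewrite -(cyc_inv_rot (size u) _ gc) rot_size_cat. Qed.

Lemma cycsym_inv (k : ser R d) : cyc_inv (cycsym k).
Proof. by move=> w; rewrite /cycsym size_rot cycS_rot1. Qed.

Lemma cycsymB (k h : ser R d) w : cycsym (k - h) w = cycsym k w - cycsym h w.
Proof. by rewrite /cycsym -mulrBr /cycS -sumrB. Qed.

Lemma cycS_rotr (g : word d -> C) w : \sum_(i < size w) g (rotr i w) = cycS g w.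
Proof.
rewrite -cycS_rot1 /cycS size_rot [LHS](reindex_inj rev_ord_inj) /=.
by apply: eq_bigr => i _; rewrite -rot_add1 // /rotr subKn.
Qed.

(** Averaging is symmetric: against a cyclically invariant family, each
    rotation of [w] may be moved from [g] to [h]. *)
Lemma cyc_reindex (g h : word d -> C) c : cyc_inv h ->
  bsum (fun w => normc (g w * h w)) c -> (h [::] = 0) ->
  bsum (fun w => normc (cycsym g w * h w)) c /\
  csum (fun w => cycsym g w * h w) = csum (fun w => g w * h w).
Proof.
move=> hc gh h0.
pose G (p : word d * nat) : C :=
  if (p.2 < size p.1)%N then (size p.1)%:R^-1 * (g p.1 * h p.1) else 0.
have inn w (b : R) : (if w == [::] then 0 else b) = \sum_(k <- iota 0 (size w)) (size w)%:R^-1 * b.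
  rewrite big_const_seq count_predT size_iota iter_addr_0 -[RHS]mulr_natl mulrA.
  case: w => [|x w]; first by rewrite mul0r mul0r.
  by rewrite /= divff ?mul1r // pnatr_eq0.
have nG p : normc (G p) = if (p.2 < size p.1)%N then (size p.1)%:R^-1 * normc (g p.1 * h p.1) else 0.
  by rewrite /G; case: ifP => _; rewrite ?normc0 // normcM normcV normc_nat.
have Gb : bsum (fun p => normc (G p)) c.
  apply: (bsum_pair (c := fun w => normc (g w * h w)) _ _ gh) => [p|w]; first exact: normc_ge0.
  have -> : normc (g w * h w) = \sum_(k <- iota 0 (size w)) normc (G (w, k)).
    rewrite -[LHS](_ : (if w == [::] then 0 else normc (g w * h w)) = _); last first.
      by case: eqP => // ->; rewrite h0 mulr0 normc0.
    rewrite inn; apply: eq_big_seq => k; rewrite mem_iota add0n leq0n nG /= => -> //.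
  apply: bsum_seq => [|k|k]; [exact: iota_uniq|exact: normc_ge0|].
  by rewrite mem_iota add0n leq0n nG /= => /negbTE ->.
pose e (p : word d * nat) := (rot p.2 p.1, p.2); pose e' (p : word d * nat) := (rotr p.2 p.1, p.2).
have ee' : cancel e e' by case=> w k; rewrite /e /e' /= rotK.
have e'e : cancel e' e by case=> w k; rewrite /e /e' /= rotrK.
have Gb' : bsum (fun p => normc (G (e p))) c.
  by apply: (bsum_inj (fun p => normc_ge0 _) (can_inj ee') Gb).
have Ei w : csum (fun k => G (w, k)) = g w * h w.
  rewrite (@csum_seq _ _ _ (iota 0 (size w))) ?iota_uniq //; last first.
    by move=> k; rewrite mem_iota add0n leq0n /G /= => /negbTE ->.
  rewrite (eq_big_seq (fun=> (size w)%:R^-1 * (g w * h w))); last first.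
    by move=> k; rewrite mem_iota add0n leq0n /G /= => ->.
  rewrite big_const_seq count_predT size_iota iter_addr_0 -[LHS]mulr_natl mulrA.
  case: w => [|x w]; first by rewrite !mul0r h0 mulr0.
  by rewrite divff ?mul1r // pnatr_eq0.
have Ee w : csum (fun k => G (e (w, k))) = cycsym g w * h w.
  rewrite (@csum_seq _ _ _ (iota 0 (size w))) ?iota_uniq //; last first.
    by move=> k; rewrite mem_iota add0n leq0n /G /= size_rot => /negbTE ->.
  rewrite /cycsym /cycS mulr_sumr mulr_suml.
  rewrite -(big_mkord xpredT (fun i => (size w)%:R^-1 * g (rot i w) * h w)) /index_iota subn0.
  apply: eq_big_seq => k; rewrite mem_iota add0n leq0n /G /= size_rot => ->.
  by rewrite (cyc_inv_rot k w hc) mulrA.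
split.
  have := @bsum_csum _ _ _ (fun p => G (e p)) (fun=> 1) c (fun=> ler01) => H.
  apply: bsum_le (H _) => [w|]; first by rewrite mul1r Ee.
  by apply: bsum_le Gb' => p; rewrite mul1r.
under eq_csum => w do rewrite -Ee.
under [RHS]eq_csum => w do rewrite -Ei.
by rewrite -(csum_pair Gb') -(csum_pair Gb) (csum_bij _ ee' e'e).
Qed.

Lemma sb_cycsym A (k : ser R d) c : 0 <= A -> sb A k c -> sb A (cycsym k) c.
Proof.
move=> A0 kc.
pose G (p : word d * nat) : R :=
  if (p.2 < size p.1)%N then (size p.1)%:R^-1 * (A ^+ size p.1 * normc (k p.1)) else 0.
have G0 p : 0 <= G p by rewrite /G; case: ifP => // _; rewrite mulr_ge0 ?invr_ge0 ?ler0n ?sb_term0.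
have Gb : bsum G c.
  apply: (bsum_pair (c := fun w => A ^+ size w * normc (k w)) _ _ kc) => // w.
  have : bsum (fun j => G (w, j)) (\sum_(j <- iota 0 (size w)) G (w, j)).
    apply: bsum_seq; rewrite ?iota_uniq // => j.
    by rewrite mem_iota add0n leq0n /G /= => /negbTE ->.
  apply: bsum_leR; rewrite (eq_big_seq (fun=> (size w)%:R^-1 * (A ^+ size w * normc (k w)))); last first.
    by move=> j; rewrite mem_iota add0n leq0n /G /= => ->.
  rewrite big_const_seq count_predT size_iota iter_addr_0 -[leLHS]mulr_natl mulrA.
  case: w => [|x w]; first by rewrite mul0r mul0r sb_term0.
  by rewrite divff ?mul1r // pnatr_eq0.
pose e (p : word d * nat) := (rot p.2 p.1, p.2).
have ie : injective e.
  by apply: (can_inj (g := fun p => (rotr p.2 p.1, p.2))) => -[w j]; rewrite /e /= rotK.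
have [_ h _] := psum_pair (fun p => G0 (e p)) (bsum_inj G0 ie Gb).
apply: bsum_le h => w.
rewrite (@psum_seq _ _ _ (iota 0 (size w))) ?iota_uniq //; last first.
  by move=> j; rewrite mem_iota add0n leq0n /G /= size_rot => /negbTE ->.
rewrite (eq_big_seq (fun j => (size w)%:R^-1 * (A ^+ size w * normc (k (rot j w))))); last first.
  by move=> j; rewrite mem_iota add0n leq0n /G /= size_rot => ->.
rewrite -!mulr_sumr /cycsym normcM normcV normc_nat mulrCA.
rewrite ler_wpM2l ?invr_ge0 ?ler0n // ler_wpM2l ?exprn_ge0 //.
apply: le_trans (normc_sum _ _ _) _.
by rewrite -(big_mkord xpredT (fun j => normc (k (rot j w)))) /index_iota subn0.
Qed.

Variables (tau : word d -> C) (B : R).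
Hypothesis B0 : 0 <= B.
Hypothesis tau_le : forall w, normc (tau w) <= B ^+ size w.
Hypothesis tauC : forall u v, tau (u ++ v) = tau (v ++ u).
Let B1_0 : 0 <= B + 1. Proof. by rewrite addr_ge0. Qed.

Lemma occ_rcons (V : nmodType) x w (g : (word d * 'I_d) * word d -> V) :
  \sum_(o <- occ (rcons w x)) g o =
  \sum_(o <- occ w) g (o.1.1, o.1.2, rcons o.2 x) + g (w, x, [::]).
Proof.
elim: w g => [|y w IH] g; first by rewrite /= occ_cons /occ /= !big_nil addrC.
by rewrite rcons_cons !occ_cons IH /= addrA.
Qed.

Lemma rho_cyc r : cyc_inv (rho tau r).
Proof.
case=> [|x w] //; rewrite rot1_cons /rho occ_rcons occ_cons /= cats0 addrC; congr (_ + _).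
by apply: eq_bigr => o _; rewrite cat_rcons.
Qed.

Lemma rho_nil r : rho tau r [::] = 0.
Proof. by rewrite /rho /occ big_nil. Qed.

(** The variation of [tau] is itself cyclically invariant, so a potential
    matters only up to cyclic permutation. *)
Lemma rpair_cycsym r (k : ser R d) c e : tb B r c -> sb (B + 1) k e ->
  rpair tau r (cycsym k) = rpair tau r k.
Proof.
move=> rc ke.
by case: (cyc_reindex (rho_cyc r) (rpair_sum B0 tau_le rc ke) (rho_nil r)).
Qed.

Lemma eq_rpair r (k : ser R d) h : (forall w, w != [::] -> k w = h w) -> rpair tau r k = rpair tau r h.
Proof.
move=> kh; apply: eq_csum => w; have [->|w0] := eqVneq w [::]; first by rewrite rho_nil !mulr0.
by rewrite kh.
Qed.

Lemma rpairMC r (k : ser R d) h c e e' : tb B r c -> sb (B + 1) k e -> sb (B + 1) h e' ->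
  rpair tau r (k * h) = rpair tau r (h * k).
Proof.
move=> rc ke he.
have kB : sb B k e by apply: sb_mono ke; rewrite ?lerDl.
have hB : sb B h e' by apply: sb_mono he; rewrite ?lerDl.
have dk := sb_dels B0 rc ke; have dh := sb_dels B0 rc he.
rewrite -(pair_dels B0 tau_le tauC rc (sb_mul B1_0 ke he)).
rewrite -(pair_dels B0 tau_le tauC rc (sb_mul B1_0 he ke)) !delsM.
rewrite (pairD tau_le (sb_mul B0 dk hB) (sb_mul B0 kB dh)).
rewrite (pairD tau_le (sb_mul B0 dh kB) (sb_mul B0 hB dk)) addrC.
by rewrite (pairMC B0 tau_le tauC kB dh) (pairMC B0 tau_le tauC dk hB).
Qed.

(** The gradient of a potential whose Euler derivative is [psi]. *)
Definition fld (psi : ser R d) (i : 'I_d) : ser R d := fun u => psi (i :: u).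

Lemma sb_ncvarS A (i : 'I_d) : 0 <= A -> sb A (ncvarS R i) A.
Proof.
move=> A0; have h w : w != [:: i] -> A ^+ size w * normc (ncvarS R i w) = 0.
  by rewrite /ncvarS => /negbTE ->; rewrite normc0 mulr0.
have := bsum1 (fun w => sb_term0 (ncvarS R i) w A0) h.
by rewrite /ncvarS eqxx normc_nat mulr1 expr1; apply.
Qed.

(** The identity [x . D phi = psi] of Euler, up to the constant term. *)
Lemma sum_var_fld psi w : w != [::] -> (\sum_i ncvarS R i * fld psi i : ser R d) w = psi w.
Proof.
case: w => // x w _; rewrite ser_sumE (bigD1 x) //= big1 => [|i ix]; last first.
  rewrite sermulE wfacts_cons {1}/ncvarS /= mul0r add0r big1 // => p _.
  by rewrite /ncvarS eqseq_cons eq_sym (negbTE ix) mul0r.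
rewrite addr0 sermulE wfacts_cons {1}/ncvarS /= mul0r add0r wfacts_delta0 /=.
  by rewrite /ncvarS eqxx mul1r.
by move=> p /negbTE h; rewrite /ncvarS eqseq_cons h andbF mul0r.
Qed.

Lemma rpair_quadratic r c : tb B r c ->
  rpair tau r (fun w => 2^-1 * (\sum_k ncvarS R k * ncvarS R k : ser R d) w) =
  \sum_i Epair tau r i [:: i].
Proof.
move=> rc.
have xs k := sb_mul B1_0 (sb_ncvarS k B1_0) (sb_ncvarS k B1_0).
rewrite (rpairZ B0 tau_le _ rc (sb_sum (index_enum 'I_d) B1_0 xs)).
rewrite (rpair_big B0 tau_le _ rc xs) mulr_sumr; apply: eq_bigr => k _.
have -> : rpair tau r (ncvarS R k * ncvarS R k) = rho tau r [:: k; k].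
  rewrite /rpair (@csum1 _ _ _ [:: k; k]).
    rewrite sermulE !wfacts_cons wfacts_nil /ncvarS /=.
    by rewrite !(eqxx, andbF, mulr0n, mulr1n, mul0r, mulr0, add0r, addr0, mul1r).
  move=> w wk; rewrite sermulE big_seq big1 ?mul0r // => p; rewrite mem_wfacts => /eqP pw.
  rewrite /ncvarS; case: eqP => [p1|]; last by rewrite mul0r.
  case: eqP => [p2|]; last by rewrite mulr0.
  by move: wk; rewrite -pw p1 p2 eqxx.
by rewrite /rho !occ_cons /= /occ /= big_nil addr0 -mulr2n -[X in _ * X]mulr_natl mulrA mulVf ?mul1r // pnatr_eq0.
Qed.

Lemma sb_fld A psi i c : 0 < A -> sb A psi c -> sb A (fld psi i) (c / A).
Proof.
move=> A0 pc; have i0 : 0 <= A^-1 by rewrite invr_ge0 ltW.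
have hb := bsum_inj (e := fun u => i :: u) (fun w => sb_term0 psi w (ltW A0)) _ pc.
have := bsumZ i0 _ (hb _) => H; rewrite mulrC; apply: bsum_le (H _ _) => [u|u|? ? []//].
  by rewrite /fld /= exprS -mulrA mulKf // gt_eqF.
by rewrite mulr_ge0 ?normc_ge0 ?exprn_ge0 // ltW.
Qed.

(** The square of [F = x + D phi] is expanded under a trace, where [x . D phi]
    becomes [psi]; the equation for [psi] says that what remains cancels. *)
Lemma potential_equation r (c : R) psi (V0 : ser R d) W (D e e' : R) L : tb B r c ->
  0 <= D -> cyc_inv psi -> cyc_inv V0 ->
  sb (B + 1) psi e -> sb (B + 1) V0 e -> sb D W e' -> sb (B + 1) L e ->
  (forall k, sb (B + 1) (ncvarS R k + fld psi k) D) ->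
  (forall w, w != [::] -> psi w = V0 w + cycsym (L -
     (fun w => 2^-1 * (\sum_k fld psi k * fld psi k : ser R d) w) -
     compose W (fun k => ncvarS R k + fld psi k)) w) ->
  \sum_i Epair tau r i [:: i] + rpair tau r V0 =
  rpair tau r ((fun w => 2^-1 * (\sum_k (ncvarS R k + fld psi k) * (ncvarS R k + fld psi k) : ser R d) w)
    + compose W (fun k => ncvarS R k + fld psi k) - L).
Proof.
move=> rc D0 pC VC pe Ve We Le FD eqn.
have B1p : 0 < B + 1 by rewrite ltr_wpDl.
have fk k := sb_fld k B1p pe.
have xk (k : 'I_d) := sb_ncvarS k B1_0.
have We2 := sb_compose B1_0 D0 FD We.
set F := fun k => ncvarS R k + fld psi k in FD We2 eqn *.
pose q2 := (fun w => 2^-1 * (\sum_k fld psi k * fld psi k : ser R d) w) : ser R d.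
have q2b := sbZ 2^-1 B1_0 (sb_sum (index_enum 'I_d) B1_0 (fun k => sb_mul B1_0 (fk k) (fk k))).
have E1 : (fun w => 2^-1 * (\sum_k F k * F k : ser R d) w) =
    (fun w => 2^-1 * (\sum_k ncvarS R k * ncvarS R k : ser R d) w) +
    ((fun w => 2^-1 * (\sum_k (ncvarS R k * fld psi k + fld psi k * ncvarS R k) : ser R d) w) + q2) :> ser R d.
  apply/funext => w; rewrite !serDE /q2 -!mulrDr; congr (_ * _).
  rewrite !ser_sumE -!big_split; apply: eq_bigr => k _ /=.
  by rewrite /F mulrDl !mulrDr !serDE !addrA.
have xx k := sb_mul B1_0 (xk k) (xk k).
have xf k := sb_mul B1_0 (xk k) (fk k).
have fx k := sb_mul B1_0 (fk k) (xk k).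
have xfx k := sbD B1_0 (xf k) (fx k).
have b1 := sbZ 2^-1 B1_0 (sb_sum (index_enum 'I_d) B1_0 xx).
have b2 := sbZ 2^-1 B1_0 (sb_sum (index_enum 'I_d) B1_0 xfx).
rewrite E1.
have rD := fun h k e1 e2 => @rpairD R n tau B B0 tau_le r h k c e1 e2 rc.
rewrite (rD _ _ _ _ (sbD B1_0 (sbD B1_0 b1 (sbD B1_0 b2 q2b)) We2) (sbN Le)).
rewrite (rD _ _ _ _ (sbD B1_0 b1 (sbD B1_0 b2 q2b)) We2).
rewrite (rD _ _ _ _ b1 (sbD B1_0 b2 q2b)) (rD _ _ _ _ b2 q2b) (rpair_quadratic rc).
have -> : rpair tau r (fun w => 2^-1 * (\sum_k (ncvarS R k * fld psi k + fld psi k * ncvarS R k) : ser R d) w) =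
    rpair tau r psi.
  rewrite (rpairZ B0 tau_le _ rc (sb_sum (index_enum 'I_d) B1_0 xfx)).
  rewrite (rpair_big B0 tau_le _ rc xfx).
  rewrite (eq_bigr (fun k => 2 * rpair tau r (ncvarS R k * fld psi k))); last first.
    move=> k _; rewrite (rD _ _ _ _ (xf k) (fx k)) (rpairMC rc (fk k) (xk k)).
    by rewrite -mulr2n mulr_natl.
  rewrite -mulr_sumr mulrA mulVf ?pnatr_eq0 // mul1r -(rpair_big B0 tau_le _ rc xf).
  by apply: eq_rpair => w w0; exact: sum_var_fld.
have Gb : sb (B + 1) (L - q2 - compose W F) _ := sbD B1_0 (sbD B1_0 Le (sbN q2b)) (sbN We2).
have -> : rpair tau r psi = rpair tau r V0 + rpair tau r (L - q2 - compose W F).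
  rewrite -(rpair_cycsym rc Gb) -(rD _ _ _ _ Ve (sb_cycsym B1_0 Gb)).
  exact: eq_rpair.
rewrite (rD _ _ _ _ (sbD B1_0 Le (sbN q2b)) (sbN We2)) (rD _ _ _ _ Le (sbN q2b)) !rpairN.
by ring.
Qed.

End Cyclic.

(** * The map Xi: symmetries and Lipschitz estimates *)

Section Symmetries.
Variables (R : realType) (n : nat).
Local Notation d := n.+1.
Local Notation C := (R[i]).
Implicit Types (u v w : word d) (f g psi W : ser R d) (M N : tens R n) (tau : word d -> C).

Definition pert psi (k : 'I_d) : ser R d := ncvarS R k + fld psi k.
Definition jacfld psi : tens R n := jac (tupof (fld psi)).

(** Written with the series of the logarithm,
    [(1 (x) tau + tau (x) 1) Tr log (1 + M)]. *)
Definition logL tau M : ser R d :=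
  fun w => csum (fun i : nat => ((-1) ^+ i / i.+1%:R) * legs tau (M ^+ i.+1) w).
Definition half_square psi : ser R d :=
  fun w => 2^-1 * (\sum_k fld psi k * fld psi k : ser R d) w.

(** The fixed point equation of the transport is [psi = V0 + Xi tau W psi]. *)
Definition Xi tau W psi : ser R d :=
  cycsym (logL tau (jacfld psi) - half_square psi - compose W (pert psi)).

Definition selfadj f := forall w, f (rev w) = conjc (f w).
Definition parity (b : bool) f := forall w, odd (size w) != b -> f w = 0.

(** Invariance under the involution of the tensor square that reverses both
    words and exchanges the two legs; it is multiplicative and holds for
    Jacobians of gradients. *)
Definition tselfadj M := forall u v (i j : 'I_d), M (rev v, rev u) i j = conjc (M (u, v) i j).
Definition teven M := forall m, odd (size m.1 + size m.2) -> M m = 0.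

Lemma conjcM (x y : C) : conjc (x * y) = conjc x * conjc y.
Proof. exact: rmorphM. Qed.
Lemma conjcD (x y : C) : conjc (x + y) = conjc x + conjc y.
Proof. exact: rmorphD. Qed.
Lemma conjcB (x y : C) : conjc (x - y) = conjc x - conjc y.
Proof. exact: rmorphB. Qed.
Lemma conjc_sum (T : Type) (s : seq T) (F : T -> C) :
  conjc (\sum_(i <- s) F i) = \sum_(i <- s) conjc (F i).
Proof. exact: rmorph_sum. Qed.
Lemma conjc_natr (k : nat) : conjc (k%:R : C) = k%:R.
Proof. exact: rmorph_nat. Qed.
Lemma conjc_natV (k : nat) : conjc ((k%:R : C)^-1) = k%:R^-1.
Proof. by rewrite fmorphV rmorph_nat. Qed.
Lemma conjc_log (i : nat) : conjc ((-1 : C) ^+ i / i.+1%:R) = (-1) ^+ i / i.+1%:R.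
Proof. by rewrite conjcM conjc_natV rmorphXn rmorphN rmorph1. Qed.

Lemma rev_inj : injective (@rev 'I_d).
Proof. exact: can_inj revK. Qed.

Lemma csum_rev (F : word d -> C) : csum (fun w => F (rev w)) = csum F.
Proof. exact: (csum_bij _ (@revK _) (@revK _)). Qed.

Lemma mul_rev f g w : (f * g : ser R d) (rev w) =
  \sum_(p <- wfacts w) f (rev p.2) * g (rev p.1).
Proof. by rewrite sermulE wfacts_rev. Qed.

Lemma wprod_rev (F : 'I_d -> ser R d) w u : (forall k, selfadj (F k)) ->
  wprod F w (rev u) = conjc (wprod F (rev w) u).
Proof.
move=> Fs; elim: w u => [|k w IH] u.
  rewrite wprod_nil !ser1E; case: u => [|x u]; first by rewrite conjc_natr.
  by rewrite conjc_natr -size_eq0 size_rev.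
rewrite wprod_cons mul_rev rev_cons -cats1 wprod_cat wprod_cons wprod_nil mulr1 sermulE.
rewrite conjc_sum; apply: eq_bigr => p _.
by rewrite Fs IH conjcM mulrC.
Qed.

Lemma selfadj_compose W F : selfadj W -> (forall k, selfadj (F k)) -> selfadj (compose W F).
Proof.
move=> Ws Fs u; rewrite /compose -csum_conj -csum_rev; apply: eq_csum => w.
by rewrite Ws wprod_rev // revK conjcM.
Qed.

Lemma selfadj_sqr f : selfadj f -> selfadj (f * f).
Proof.
move=> fs w; rewrite mul_rev sermulE conjc_sum; apply: eq_bigr => p _.
by rewrite !fs conjcM mulrC.
Qed.

Lemma selfadj_ncvarS (k : 'I_d) : selfadj (ncvarS R k).
Proof.
move=> w; rewrite /ncvarS conjc_natr -[in LHS](revK [:: k]) (inj_eq rev_inj).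
by rewrite /rev.
Qed.

Lemma selfadj_fld psi k : cyc_inv psi -> selfadj psi -> selfadj (fld psi k).
Proof.
move=> pc ps w; rewrite /fld -ps rev_cons -cats1.
by rewrite -(cyc_inv_cat [:: k] _ pc).
Qed.

Lemma selfadj_pert psi k : cyc_inv psi -> selfadj psi -> selfadj (pert psi k).
Proof.
move=> pc ps w; rewrite /pert !serDE selfadj_ncvarS (selfadj_fld _ pc ps) //.
by rewrite conjcD.
Qed.

Lemma selfadj_half_square psi : cyc_inv psi -> selfadj psi -> selfadj (half_square psi).
Proof.
move=> pc ps w; rewrite /half_square conjcM conjc_natV !ser_sumE conjc_sum; congr (_ * _).
by apply: eq_bigr => k _; apply: selfadj_sqr; exact: selfadj_fld.
Qed.

Lemma tselfadj_jacfld psi : cyc_inv psi -> selfadj psi -> tselfadj (jacfld psi).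
Proof.
move=> pc ps u v i j; rewrite !mxE /= /fld.
rewrite -ps rev_cons rev_cat rev_cons -!cats1.
by rewrite -[LHS]/(psi ([:: i] ++ (rev v ++ j :: rev u))) (cyc_inv_cat _ _ pc) -!catA.
Qed.

Lemma tselfadjM M N : tselfadj M -> tselfadj N -> tselfadj (M * N).
Proof.
move=> Ms Ns u v i j; rewrite !tensmulE /= wfacts_rev exchange_big wfacts_rev /=.
rewrite !summxE conjc_sum; apply: eq_bigr => a _.
rewrite !summxE conjc_sum; apply: eq_bigr => b _.
rewrite !mxE conjc_sum; apply: eq_bigr => k _.
by rewrite Ms Ns conjcM.
Qed.

Lemma tselfadjX M i : tselfadj M -> tselfadj (M ^+ i.+1).
Proof.
move=> Ms; elim: i => [|i IH]; first by rewrite expr1.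
by rewrite exprS; exact: tselfadjM.
Qed.

Lemma tselfadj_tr M u v : tselfadj M -> \tr (M (rev v, rev u)) = conjc (\tr (M (u, v))).
Proof. by move=> Ms; rewrite /mxtrace conjc_sum; apply: eq_bigr => i _; exact: Ms. Qed.

Lemma selfadj_legs tau M : selfadj tau -> tselfadj M -> selfadj (legs tau M).
Proof.
move=> ts Ms w; rewrite /legs conjcD addrC -!csum_conj; congr (_ + _).
  rewrite -csum_rev; apply: eq_csum => v.
  by rewrite tselfadj_tr // ts conjcM.
rewrite -csum_rev; apply: eq_csum => v.
by rewrite tselfadj_tr // ts conjcM.
Qed.

Lemma selfadj_logL tau M : selfadj tau -> tselfadj M -> selfadj (logL tau M).
Proof.
move=> ts Ms w; rewrite /logL -csum_conj; apply: eq_csum => i.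
by rewrite conjcM conjc_log selfadj_legs //; exact: tselfadjX.
Qed.

Lemma selfadj_cycsym f : selfadj f -> selfadj (cycsym f).
Proof.
move=> fs w; rewrite /cycsym conjcM conjc_natV size_rev; congr (_ * _).
rewrite -cycS_rotr /cycS size_rev conjc_sum; apply: eq_bigr => i _.
by rewrite -fs -rev_rot.
Qed.

Lemma selfadj_Xi tau W psi : selfadj tau -> selfadj W -> cyc_inv psi -> selfadj psi ->
  selfadj (Xi tau W psi).
Proof.
move=> ts Ws pc ps; apply: selfadj_cycsym => w; rewrite !serBE !conjcB.
rewrite selfadj_logL //; last exact: tselfadj_jacfld.
rewrite selfadj_half_square // selfadj_compose // => k; exact: selfadj_pert.
Qed.

Lemma parityM b c f g : parity b f -> parity c g -> parity (b (+) c) (f * g).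
Proof.
move=> fb gc w wbc; rewrite sermulE big_seq big1 // => p; rewrite mem_wfacts => /eqP pw.
have [e1|e1] := eqVneq (odd (size p.1)) b; last by rewrite fb ?mul0r.
have [e2|e2] := eqVneq (odd (size p.2)) c; last by rewrite gc ?mulr0.
by move: wbc; rewrite -pw size_cat oddD e1 e2 eqxx.
Qed.

Lemma parity_wprod F w : (forall k, parity true (F k)) -> parity (odd (size w)) (wprod F w).
Proof.
move=> Fo; elim: w => [|k w IH].
  by rewrite wprod_nil => u; rewrite ser1E; case: u.
by rewrite wprod_cons /= -addTb; exact: parityM.
Qed.

Lemma parity_compose W F : parity false W -> (forall k, parity true (F k)) ->
  parity false (compose W F).
Proof.
move=> We Fo u uo; apply: etrans (csum0 _ (word d)); apply: eq_csum => w.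
have [e1|e1] := eqVneq (odd (size w)) false; last by rewrite We ?mul0r.
by rewrite (parity_wprod Fo) ?mulr0 // e1.
Qed.

Lemma parity_fld psi k : parity false psi -> parity true (fld psi k).
Proof. by move=> pe w; rewrite /fld => wo; rewrite pe //=; case: (odd (size w)) wo. Qed.

Lemma parity_pert psi k : parity false psi -> parity true (pert psi k).
Proof.
move=> pe w wo; rewrite /pert serDE (parity_fld _ pe) // addr0 /ncvarS.
by case: eqP => // e; move: wo; rewrite e.
Qed.

Lemma parity_half_square psi : parity false psi -> parity false (half_square psi).
Proof.
move=> pe w wo; rewrite /half_square ser_sumE big1 ?mulr0 // => k _.
by rewrite (parityM (b := true) (c := true)) //; exact: parity_fld.
Qed.

Lemma teven_jacfld psi : parity false psi -> teven (jacfld psi).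
Proof.
move=> pe m mo; apply/matrixP => i j; rewrite !mxE /fld pe //.
by rewrite /= size_cat /= addnS /= mo.
Qed.

Lemma tevenM M N : teven M -> teven N -> teven (M * N).
Proof.
move=> Me Ne m mo; rewrite tensmulE big_seq big1 // => a; rewrite mem_wfacts => /eqP am.
rewrite big_seq big1 // => b; rewrite mem_wfacts => /eqP bm.
have [e1|e1] := boolP (odd (size a.1 + size b.2)); first by rewrite (Me (a.1, b.2)) ?mul0r.
rewrite (Ne (a.2, b.1)) ?mulr0 //=.
move: mo e1; rewrite -am -bm !size_cat !oddD.
by do 4 case: (odd _).
Qed.

Lemma tevenX M i : teven M -> teven (M ^+ i.+1).
Proof.
move=> Ms; elim: i => [|i IH]; first by rewrite expr1.
by rewrite exprS; exact: tevenM.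
Qed.

Lemma parity_legs tau M : parity false tau -> teven M -> parity false (legs tau M).
Proof.
move=> te Me w wo; rewrite /legs.
have h v : \tr (M (w, v)) * tau v = 0.
  have [e|e] := boolP (odd (size v)); first by rewrite te ?mulr0 // e.
  rewrite Me ?mxtrace0 ?mul0r //= oddD (negbTE e) addbF.
  by case: (odd _) wo.
have h' v : \tr (M (v, w)) * tau v = 0.
  have [e|e] := boolP (odd (size v)); first by rewrite te ?mulr0 // e.
  rewrite Me ?mxtrace0 ?mul0r //= oddD (negbTE e) addFb.
  by case: (odd _) wo.
by rewrite (eq_csum h) (eq_csum h') csum0 addr0.
Qed.

Lemma parity_logL tau M : parity false tau -> teven M -> parity false (logL tau M).
Proof.
move=> te Me w wo; apply: etrans (csum0 _ nat); apply: eq_csum => i.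
by rewrite parity_legs ?mulr0 //; exact: tevenX.
Qed.

Lemma parity_cycsym f : parity false f -> parity false (cycsym f).
Proof.
move=> fe w wo; rewrite /cycsym /cycS big1 ?mulr0 // => i _.
by rewrite fe // size_rot.
Qed.

Lemma parity_Xi tau W psi : parity false tau -> parity false W -> parity false psi ->
  parity false (Xi tau W psi).
Proof.
move=> te We pe; apply: parity_cycsym => w wo; rewrite !serBE.
rewrite parity_logL //; last exact: teven_jacfld.
rewrite parity_half_square // parity_compose //; last by move=> k; exact: parity_pert.
by rewrite !subr0.
Qed.

(** The law of the tuple [pert psi] under [tau]. *)
Definition pushlaw tau psi w : C := pair tau (wprod (pert psi) w).

Lemma selfadj_pushlaw tau psi : selfadj tau -> cyc_inv psi -> selfadj psi ->
  selfadj (pushlaw tau psi).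
Proof.
move=> ts pc ps w; rewrite /pushlaw /pair -csum_conj -csum_rev; apply: eq_csum => u.
rewrite ts conjcM wprod_rev ?revK // => k; exact: selfadj_pert.
Qed.

Lemma parity_pushlaw tau psi : parity false tau -> parity false psi ->
  parity false (pushlaw tau psi).
Proof.
move=> te pe w wo; apply: etrans (csum0 _ (word d)); apply: eq_csum => u.
have [e1|e1] := eqVneq (odd (size u)) false; last by rewrite te ?mulr0.
rewrite (parity_wprod (fun k => parity_pert k pe)) ?mul0r // e1 eq_sym //.
Qed.

End Symmetries.

Section Lipschitz.
Variables (R : realType) (n : nat).
Local Notation d := n.+1.
Local Notation C := (R[i]).
Implicit Types (u v w : word d) (f g psi W : ser R d) (M N : tens R n) (tau : word d -> C).
Implicit Types (A B D c e eps rho delta : R).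

Lemma fldB psi psi' k : fld (psi - psi') k = fld psi k - fld psi' k.
Proof. by []. Qed.

Lemma pertB psi psi' k : pert psi k - pert psi' k = fld (psi - psi') k.
Proof. by rewrite fldB /pert opprD addrACA subrr add0r. Qed.

Lemma jacfldB psi psi' : jacfld (psi - psi') = jacfld psi - jacfld psi'.
Proof.
by apply/funext => m; apply/matrixP => i j; rewrite tensDE tensNE !mxE.
Qed.

Lemma tb_fld A psi c : 0 < A -> sb A psi c -> tb A (tupof (fld psi)) (c / A).
Proof.
move=> A0 pc; have i0 : 0 <= A^-1 by rewrite invr_ge0 ltW.
have := bsum_fiber (s := fun u => [seq k :: u | k <- enum 'I_d]) (p := behead)
  (fun w => sb_term0 psi w (ltW A0)) _ _ pc => H.
have hb : bsum (fun u => A * (A ^+ size u * mnorm (tupof (fld psi) u))) c.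
  apply: bsum_le (H _ _) => [u|u|u w]; last by case/mapP => k _ ->.
    rewrite big_map big_enum /= /mnorm mulrA -exprS mulr_sumr; apply: ler_sum => k _.
    by rewrite big_ord1 mxE.
  by rewrite map_inj_uniq ?enum_uniq // => i j [].
have := bsumZ i0 _ hb => H'; rewrite mulrC; apply: bsum_le (H' _) => u.
  by rewrite mulKf // gt_eqF.
by rewrite mulr_ge0 ?tb_term0 // ltW.
Qed.

Lemma mb_jacfld A B psi c : 0 <= B -> B < A -> sb A psi c ->
  mb A B (jacfld psi) (c / A / (A - B)) /\ mb B A (jacfld psi) (c / A / (A - B)).
Proof.
move=> B0 BA pc; have A0 : 0 < A by apply: le_lt_trans BA.
by have h := tb_fld A0 pc; split; [exact: mb_jac | exact: mb_jac'].
Qed.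

Lemma sb_pert A psi c D k : 0 < A -> sb A psi c -> A + c / A <= D -> sb A (pert psi k) D.
Proof.
move=> A0 pc AD.
apply: (sb_mono (ltW A0) (lexx A) AD).
exact: (sbD (ltW A0) (sb_ncvarS k (ltW A0)) (sb_fld k A0 pc)).
Qed.

Definition sersum (g : nat -> ser R d) : ser R d := fun w => csum (fun i => g i w).

Lemma sersum_pair A (g : nat -> ser R d) (e : nat -> R) c : 0 <= A ->
  (forall i, sb A (g i) (e i)) -> bsum e c ->
  bsum (fun p : word d * nat => A ^+ size p.1 * normc (g p.2 p.1)) c.
Proof.
move=> A0 ge ec.
have h : bsum (fun p : nat * word d => A ^+ size p.2 * normc (g p.1 p.2)) c.
  apply: (bsum_pair _ _ ec) => [p|i]; last exact: ge.
  by rewrite mulr_ge0 ?exprn_ge0 ?normc_ge0.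
apply: (bsum_inj (e := fun p : word d * nat => (p.2, p.1)) _ _ h) => [p|].
  by rewrite mulr_ge0 ?exprn_ge0 ?normc_ge0.
by move=> [? ?] [? ?] [-> ->].
Qed.

Lemma sb_sersum A (g : nat -> ser R d) (e : nat -> R) c : 0 <= A ->
  (forall i, sb A (g i) (e i)) -> bsum e c -> sb A (sersum g) c.
Proof.
move=> A0 ge ec.
apply: (@bsum_csum _ _ _ (fun p : word d * nat => g p.2 p.1)) (sersum_pair A0 ge ec) => w.
exact: exprn_ge0.
Qed.

Lemma sersum_summable A (g : nat -> ser R d) (e : nat -> R) c w : 0 < A ->
  (forall i, sb A (g i) (e i)) -> bsum e c ->
  bsum (fun i => normc (g i w)) ((A ^+ size w)^-1 * c).
Proof.
move=> A0 ge ec; have i0 : 0 <= (A ^+ size w)^-1 by rewrite invr_ge0 exprn_ge0 // ltW.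
have hs := sersum_pair (ltW A0) ge ec.
have hw := bsum_inj (e := fun i : nat => (w, i))
  (fun p : word d * nat => mulr_ge0 (exprn_ge0 (size p.1) (ltW A0)) (normc_ge0 _)) _ hs.
have := bsumZ i0 _ (hw _) => H; apply: bsum_le (H _ _) => [i|i|? ? []//].
  by rewrite /= mulKf // expf_neq0 // gt_eqF.
by rewrite mulr_ge0 ?normc_ge0 ?exprn_ge0 // ltW.
Qed.

Lemma sersumB A (g h : nat -> ser R d) (e e' : nat -> R) c c' : 0 < A ->
  (forall i, sb A (g i) (e i)) -> bsum e c -> (forall i, sb A (h i) (e' i)) -> bsum e' c' ->
  sersum g - sersum h = sersum (fun i => g i - h i).
Proof.
move=> A0 ge ec he ec'; apply/funext => w; symmetry.
exact: (csumB (sersum_summable w A0 ge ec) (sersum_summable w A0 he ec')).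
Qed.

Lemma log_coef_le (i : nat) : normc ((-1 : C) ^+ i / i.+1%:R) = i.+1%:R^-1.
Proof.
rewrite normcM normcV normc_nat; suff -> : normc ((-1 : C) ^+ i) = 1 by rewrite mul1r.
elim: i => [|i IH]; first by rewrite expr0; exact: (normc_nat R 1).
by rewrite exprS mulN1r normcN.
Qed.

Lemma natV_le1 (i : nat) : (i.+1%:R : R)^-1 <= 1.
Proof. by rewrite invf_le1 ?ler1n ?ltr0n. Qed.

Lemma mb_powB A B M N rho delta i : 0 <= A -> 0 <= B -> mb A B M rho -> mb A B N rho ->
  mb A B (M - N) delta -> mb A B (M ^+ i.+1 - N ^+ i.+1) (i.+1%:R * rho ^+ i * delta).
Proof.
move=> A0 B0 Mr Nr MN; elim: i => [|i IH]; first by rewrite !expr1 expr0 !mul1r.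
have -> : M ^+ i.+2 - N ^+ i.+2 = M * (M ^+ i.+1 - N ^+ i.+1) + (M - N) * N ^+ i.+1.
  by rewrite mulrBr mulrBl -!exprS addrA subrK.
have := mbD A0 B0 (mb_mul A0 B0 Mr IH) (mb_mul A0 B0 MN (mb_expS i A0 B0 Nr)).
congr (mb _ _ _ _); rewrite -[in RHS]natr1 (exprS rho i); ring.
Qed.

Definition half_leg (s : word d -> C) M : ser R d :=
  fun w => csum (fun v => \tr (M (w, v)) * s v).

Lemma half_leg_sum A B (s : word d -> C) M e eps : 0 <= A -> 0 <= B -> 0 <= eps ->
  (forall v, normc (s v) <= eps * B ^+ size v) -> mb A B M e ->
  bsum (fun p : word d * word d => A ^+ size p.1 * normc (\tr (M p) * s p.2)) (eps * e).
Proof.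
move=> A0 B0 e0 se Me; have := bsumZ e0 (fun m => mb_term0 M m A0 B0) Me.
apply: bsum_le => p; rewrite normcM.
have -> : eps * (A ^+ size p.1 * B ^+ size p.2 * mnorm (M p)) =
  A ^+ size p.1 * (mnorm (M p) * (eps * B ^+ size p.2)) by ring.
by rewrite ler_wpM2l ?exprn_ge0 // ler_pM ?normc_ge0 // normc_mxtrace.
Qed.

Lemma sb_half_leg A B (s : word d -> C) M e eps : 0 <= A -> 0 <= B -> 0 <= eps ->
  (forall v, normc (s v) <= eps * B ^+ size v) -> mb A B M e ->
  sb A (half_leg s M) (eps * e).
Proof.
move=> A0 B0 e0 se Me; have := half_leg_sum A0 B0 e0 se Me.
by apply: (@bsum_csum _ _ _ (fun p : word d * word d => \tr (M p) * s p.2)) => u; exact: exprn_ge0.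
Qed.

Lemma half_leg_summable A B (s : word d -> C) M e eps w : 0 < A -> 0 <= B -> 0 <= eps ->
  (forall v, normc (s v) <= eps * B ^+ size v) -> mb A B M e ->
  bsum (fun v => normc (\tr (M (w, v)) * s v)) ((A ^+ size w)^-1 * (eps * e)).
Proof.
move=> A0 B0 e0 se Me; have i0 : 0 <= (A ^+ size w)^-1 by rewrite invr_ge0 exprn_ge0 // ltW.
have hs := half_leg_sum (ltW A0) B0 e0 se Me.
have hw := bsum_inj (e := fun v => (w, v))
  (fun p : word d * word d => mulr_ge0 (exprn_ge0 (size p.1) (ltW A0)) (normc_ge0 _)) _ hs.
have := bsumZ i0 _ (hw _) => H; apply: bsum_le (H _ _) => [i|i|? ? []//].
  by rewrite /= mulKf // expf_neq0 // gt_eqF.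
by rewrite mulr_ge0 ?normc_ge0 ?exprn_ge0 // ltW.
Qed.

Lemma legsE tau M : legs tau M = half_leg tau M + half_leg tau (flipt M).
Proof. by []. Qed.

Lemma half_legB A B tau M N e e' : 0 < A -> 0 <= B -> (forall v, normc (tau v) <= B ^+ size v) ->
  mb A B M e -> mb A B N e' -> half_leg tau (M - N) = half_leg tau M - half_leg tau N.
Proof.
move=> A0 B0 tb Me Ne; apply/funext => w.
have tb1 v : normc (tau v) <= 1 * B ^+ size v by rewrite mul1r.
rewrite serBE -(csumB (half_leg_summable w A0 B0 ler01 tb1 Me) (half_leg_summable w A0 B0 ler01 tb1 Ne)).
by apply: eq_csum => v; rewrite -mulrBl tensDE tensNE raddfB.
Qed.

Lemma half_leg_lawB A B tau tau' M e : 0 < A -> 0 <= B ->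
  (forall v, normc (tau v) <= B ^+ size v) -> (forall v, normc (tau' v) <= B ^+ size v) ->
  mb A B M e -> half_leg tau M - half_leg tau' M = half_leg (fun v => tau v - tau' v) M.
Proof.
move=> A0 B0 tb tb' Me; apply/funext => w.
have tb1 v : normc (tau v) <= 1 * B ^+ size v by rewrite mul1r.
have tb1' v : normc (tau' v) <= 1 * B ^+ size v by rewrite mul1r.
rewrite serBE -(csumB (half_leg_summable w A0 B0 ler01 tb1 Me) (half_leg_summable w A0 B0 ler01 tb1' Me)).
by apply: eq_csum => v; rewrite -mulrBr.
Qed.

Section Log.
Variables (A B : R).
Hypothesis A0 : 0 < A.
Hypothesis B0 : 0 <= B.

(** The two legs of a tensor play different parts in [legs]: one is evaluated
    by [tau], at radius [B], and the other one remains, at radius [A]. *)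
Definition mb2 M e := mb A B M e /\ mb B A M e.

Lemma mb2_flip M e : mb2 M e -> mb A B (flipt M) e.
Proof. by move=> [_ h]; exact: (mb_flip B0 (ltW A0) h). Qed.

Lemma sb_legs2 tau M e : (forall v, normc (tau v) <= B ^+ size v) -> mb2 M e ->
  sb A (legs tau M) (e + e).
Proof.
by move=> tb [h1 h2]; exact: (sb_legs B0 tb (ltW A0) h1 h2).
Qed.

Let term tau M i : ser R d := fun w => ((-1) ^+ i / i.+1%:R) * legs tau (M ^+ i.+1) w.

Lemma logLE tau M : logL tau M = sersum (term tau M).
Proof. by []. Qed.

Lemma mb2_expS M e i : mb2 M e -> mb2 (M ^+ i.+1) (e ^+ i.+1).
Proof. by move=> [h1 h2]; split; apply: mb_expS => //; exact: ltW. Qed.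

Lemma sb_log_term tau M (q : R) i : (forall v, normc (tau v) <= B ^+ size v) -> 0 <= q -> mb2 M q ->
  sb A (term tau M i) ((q + q) * q ^+ i).
Proof.
move=> tb q0 Mq.
have := sbZ ((-1) ^+ i / i.+1%:R) (ltW A0) (sb_legs2 tb (mb2_expS i Mq)).
apply: (sb_mono (ltW A0) (lexx A)).
have -> : (q + q) * q ^+ i = 1 * (q ^+ i.+1 + q ^+ i.+1) by rewrite exprS; ring.
by rewrite log_coef_le ler_wpM2r ?natV_le1 // addr_ge0 // exprn_ge0.
Qed.

Lemma log_terms_bsum (q : R) : 0 <= q -> q < 1 -> bsum (fun i => (q + q) * q ^+ i) ((q + q) / (1 - q)).
Proof. by move=> q0 q1; apply: bsum_geometric => //; rewrite addr_ge0. Qed.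

Lemma sb_logL tau M (q : R) : (forall v, normc (tau v) <= B ^+ size v) -> 0 <= q -> q < 1 -> mb2 M q ->
  sb A (logL tau M) ((q + q) / (1 - q)).
Proof.
move=> tb q0 q1 Mq; rewrite logLE.
exact: sb_sersum (ltW A0) (fun i => sb_log_term i tb q0 Mq) (log_terms_bsum q0 q1).
Qed.

Lemma sb_logL_tail tau M (q : R) m : (forall v, normc (tau v) <= B ^+ size v) -> 0 <= q -> q < 1 ->
  mb2 M q -> sb A (logL tau M - log_legs tau M m) ((q + q) / (1 - q) * q ^+ m).
Proof.
move=> tb q0 q1 Mq.
have hs w := sersum_summable w A0 (fun i => sb_log_term i tb q0 Mq) (log_terms_bsum q0 q1).
have -> : logL tau M - log_legs tau M m = sersum (fun i => term tau M (m + i)%N).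
  apply/funext => w; rewrite serBE /logL /log_legs (csum_nat_shift m (hs w)).
  by rewrite addrC addKr.
apply: (sb_sersum (ltW A0) (fun i => sb_log_term (m + i) tb q0 Mq)).
have := @bsum_geometric R q ((q + q) * q ^+ m) q0 q1 (mulr_ge0 (addr_ge0 q0 q0) (exprn_ge0 _ q0)).
rewrite mulrAC; apply: bsum_le => i; by rewrite exprD mulrA.
Qed.

(** The factor [i + 1] in the difference of the powers of order [i + 1] is
    cancelled by the coefficient of the logarithm, so the constant is that of a
    geometric series. *)
Lemma sb_logLB tau M N (q e : R) : (forall v, normc (tau v) <= B ^+ size v) -> 0 <= q -> q < 1 ->
  0 <= e -> mb2 M q -> mb2 N q -> mb2 (M - N) e ->
  sb A (logL tau M - logL tau N) ((e + e) / (1 - q)).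
Proof.
move=> tb q0 q1 e0 Mq Nq MN.
have g (L : tens R n) (Lq : mb2 L q) := (fun i => sb_log_term i tb q0 Lq).
rewrite !logLE (sersumB A0 (g M Mq) (log_terms_bsum q0 q1) (g N Nq) (log_terms_bsum q0 q1)).
apply: (sb_sersum (e := fun i => (e + e) * q ^+ i)) => [|i|]; first exact: ltW.
  have P1 : mb A B (M ^+ i.+1 - N ^+ i.+1) (i.+1%:R * q ^+ i * e).
    by apply: mb_powB => //; [exact: ltW|case: Mq|case: Nq|case: MN].
  have P2 : mb B A (M ^+ i.+1 - N ^+ i.+1) (i.+1%:R * q ^+ i * e).
    by apply: mb_powB => //; [exact: ltW|case: Mq|case: Nq|case: MN].
  have E : legs tau (M ^+ i.+1) - legs tau (N ^+ i.+1) = legs tau (M ^+ i.+1 - N ^+ i.+1).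
    have [Mi Ni] := (mb2_expS i Mq, mb2_expS i Nq).
    rewrite !legsE (half_legB A0 B0 tb (proj1 Mi) (proj1 Ni)).
    have -> : flipt (M ^+ i.+1 - N ^+ i.+1) = flipt (M ^+ i.+1) - flipt (N ^+ i.+1) by [].
    rewrite (half_legB A0 B0 tb (mb2_flip Mi) (mb2_flip Ni)).
    by rewrite opprD addrACA.
  have -> : term tau M i - term tau N i =
      (fun w => ((-1) ^+ i / i.+1%:R) * legs tau (M ^+ i.+1 - N ^+ i.+1) w).
    by apply/funext => w; rewrite -E !serBE mulrBr.
  have := sbZ ((-1) ^+ i / i.+1%:R) (ltW A0) (sb_legs2 tb (conj P1 P2)).
  apply: (sb_mono (ltW A0) (lexx A)).
  have i0 : (i.+1%:R : R) != 0 by rewrite pnatr_eq0.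
  rewrite log_coef_le -!mulrA -mulrDr mulKf // mulrDl ![_ * e]mulrC.
  by rewrite lexx.
by apply: bsum_geometric => //; rewrite addr_ge0.
Qed.

Lemma sb_logL_lawB tau tau' M (q eps : R) : (forall v, normc (tau v) <= B ^+ size v) ->
  (forall v, normc (tau' v) <= B ^+ size v) -> 0 <= eps ->
  (forall v, normc (tau v - tau' v) <= eps * B ^+ size v) -> 0 <= q -> q < 1 -> mb2 M q ->
  sb A (logL tau M - logL tau' M) (eps * (q + q) / (1 - q)).
Proof.
move=> tb tb' e0 te q0 q1 Mq.
rewrite !logLE (sersumB A0 (fun i => sb_log_term i tb q0 Mq) (log_terms_bsum q0 q1)
  (fun i => sb_log_term i tb' q0 Mq) (log_terms_bsum q0 q1)).
apply: (sb_sersum (e := fun i => eps * (q + q) * q ^+ i)) => [|i|]; first exact: ltW.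
  have Mi := mb2_expS i Mq.
  have -> : term tau M i - term tau' M i = (fun w => ((-1) ^+ i / i.+1%:R) *
     (half_leg (fun v => tau v - tau' v) (M ^+ i.+1) +
      half_leg (fun v => tau v - tau' v) (flipt (M ^+ i.+1)) : ser R d) w).
    apply/funext => w; rewrite serBE -mulrBr; congr (_ * _).
    rewrite -(half_leg_lawB A0 B0 tb tb' (proj1 Mi)) -(half_leg_lawB A0 B0 tb tb' (mb2_flip Mi)).
    rewrite -[LHS]/((legs tau (M ^+ i.+1) - legs tau' (M ^+ i.+1) : ser R d) w) !legsE.
    by rewrite opprD addrACA.
  have := sbZ ((-1) ^+ i / i.+1%:R) (ltW A0) (sbD (ltW A0)
    (sb_half_leg (ltW A0) B0 e0 te (proj1 Mi)) (sb_half_leg (ltW A0) B0 e0 te (mb2_flip Mi))).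
  apply: (sb_mono (ltW A0) (lexx A)).
  have -> : eps * (q + q) * q ^+ i = 1 * (eps * q ^+ i.+1 + eps * q ^+ i.+1) by rewrite exprS; ring.
  by rewrite log_coef_le ler_wpM2r ?natV_le1 // addr_ge0 // mulr_ge0 // exprn_ge0.
by apply: bsum_geometric => //; rewrite mulr_ge0 // addr_ge0.
Qed.

End Log.

Lemma sb_wprodB A (F G : 'I_d -> ser R d) D delta w : 0 <= A -> 0 <= D ->
  (forall k, sb A (F k) D) -> (forall k, sb A (G k) D) -> (forall k, sb A (F k - G k) delta) ->
  sb A (wprod F w - wprod G w) ((size w)%:R * D ^+ (size w).-1 * delta).
Proof.
move=> A0 D0 FD GD FG; elim: w => [|k w IH].
  by rewrite !wprod_nil subrr mul0r mul0r; exact: sb0.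
have -> : wprod F (k :: w) - wprod G (k :: w) =
    F k * (wprod F w - wprod G w) + (F k - G k) * wprod G w.
  by rewrite !wprod_cons mulrBr mulrBl addrA subrK.
have := sbD A0 (sb_mul A0 (FD k) IH) (sb_mul A0 (FG k) (sb_wprod w A0 D0 GD)).
congr (sb _ _ _); rewrite /= -natr1; case: w {IH} => [|x w] /=; first by rewrite expr0; ring.
by rewrite exprS; ring.
Qed.

Lemma sb_wprodB' A (F G : 'I_d -> ser R d) D delta w : 0 <= A -> 0 <= D -> 0 <= delta ->
  (forall k, sb A (F k) D) -> (forall k, sb A (G k) D) -> (forall k, sb A (F k - G k) delta) ->
  sb A (wprod F w - wprod G w) ((D + 1) ^+ size w * delta).
Proof.
move=> A0 D0 de0 FD GD FG; apply: sb_mono (sb_wprodB w A0 D0 FD GD FG) => //.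
by rewrite ler_wpM2r // pow_derivative_le.
Qed.

Lemma compose_summable A W (F : 'I_d -> ser R d) D e u : 0 < A -> 0 <= D ->
  (forall k, sb A (F k) D) -> sb D W e ->
  bsum (fun w => normc (W w * wprod F w u)) ((A ^+ size u)^-1 * e).
Proof.
move=> A0 D0 FD We; have i0 : 0 <= (A ^+ size u)^-1 by rewrite invr_ge0 exprn_ge0 // ltW.
have hs := compose_sum (ltW A0) D0 FD We.
have hw := bsum_inj (e := fun v => (u, v))
  (fun p : word d * word d => mulr_ge0 (exprn_ge0 (size p.1) (ltW A0)) (normc_ge0 _)) _ hs.
have := bsumZ i0 _ (hw _) => H; apply: bsum_le (H _ _) => [i|i|? ? []//].
  by rewrite /= mulKf // expf_neq0 // gt_eqF.
by rewrite mulr_ge0 ?normc_ge0 ?exprn_ge0 // ltW.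
Qed.

Lemma composeBl A W W' (F : 'I_d -> ser R d) D e e' : 0 < A -> 0 <= D ->
  (forall k, sb A (F k) D) -> sb D W e -> sb D W' e' ->
  compose W F - compose W' F = compose (W - W') F.
Proof.
move=> A0 D0 FD We We'; apply/funext => u; rewrite serBE /compose.
rewrite -(csumB (compose_summable u A0 D0 FD We) (compose_summable u A0 D0 FD We')).
by apply: eq_csum => w; rewrite -mulrBl.
Qed.

(** The difference of two monomials of degree [k] costs a factor [k], paid for
    by the radius [D + 1] at which [W] is measured. *)
Lemma sb_composeBr A W (F G : 'I_d -> ser R d) D delta e : 0 < A -> 0 <= D -> 0 <= delta ->
  (forall k, sb A (F k) D) -> (forall k, sb A (G k) D) -> (forall k, sb A (F k - G k) delta) ->
  sb (D + 1) W e -> sb A (compose W F - compose W G) (delta * e).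
Proof.
move=> A0 D0 de0 FD GD FG We.
have WD : sb D W e by apply: sb_mono We; rewrite ?lerDl.
have D10 : 0 <= D + 1 by rewrite addr_ge0.
have E : compose W F - compose W G = fun u => csum (fun w => W w * (wprod F w - wprod G w : ser R d) u).
  apply/funext => u; rewrite serBE /compose.
  rewrite -(csumB (compose_summable u A0 D0 FD WD) (compose_summable u A0 D0 GD WD)).
  by apply: eq_csum => w; rewrite -mulrBr.
rewrite E.
have h : bsum (fun p : word d * word d => A ^+ size p.2 * normc (W p.1 * (wprod F p.1 - wprod G p.1 : ser R d) p.2))
    (delta * e).
  apply: (bsum_pair _ _ (bsumZ de0 (fun w => sb_term0 W w D10) We)) => [p|w].
    by rewrite mulr_ge0 ?normc_ge0 ?exprn_ge0 // ltW.
  have := bsumZ (normc_ge0 (W w)) (fun u => sb_term0 _ u (ltW A0)) (sb_wprodB' w (ltW A0) D0 de0 FD GD FG).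
  have -> : normc (W w) * ((D + 1) ^+ size w * delta) = delta * ((D + 1) ^+ size w * normc (W w)) by ring.
  by apply: bsum_le => u /=; rewrite normcM mulrCA.
apply: (@bsum_csum _ _ _ (fun p : word d * word d => W p.2 * (wprod F p.2 - wprod G p.2 : ser R d) p.1)) => [u|].
  by apply: exprn_ge0; exact: ltW.
apply: (bsum_inj (e := fun p : word d * word d => (p.2, p.1)) _ _ h) => [p|].
  by rewrite mulr_ge0 ?normc_ge0 ?exprn_ge0 // ltW.
by move=> [? ?] [? ?] [-> ->].
Qed.

Lemma sb_half_square A psi c : 0 < A -> sb A psi c ->
  sb A (half_square psi) (2^-1 * (d%:R * (c / A * (c / A)))).
Proof.
move=> A0 pc; have fk k := sb_fld k A0 pc.
have := sbZ 2^-1 (ltW A0) (sb_sum (index_enum 'I_d) (ltW A0) (fun k => sb_mul (ltW A0) (fk k) (fk k))).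
by rewrite sumr_const card_ord normcV normc_nat -[_ *+ d]mulr_natl.
Qed.

Lemma sb_half_squareB A psi psi' c delta : 0 < A -> sb A psi c -> sb A psi' c ->
  sb A (psi - psi') delta ->
  sb A (half_square psi - half_square psi') (d%:R * (delta / A * (c / A))).
Proof.
move=> A0 pc pc' pd.
have fk k := sb_fld k A0 pc; have fk' k := sb_fld k A0 pc'; have fd k := sb_fld k A0 pd.
have E : half_square psi - half_square psi' = fun w => 2^-1 * (\sum_k
    (fld (psi - psi') k * fld psi k + fld psi' k * fld (psi - psi') k) : ser R d) w.
  apply/funext => w; rewrite serBE /half_square -mulrBr !ser_sumE -sumrB; congr (_ * _).
  by apply: eq_bigr => k _; rewrite fldB mulrBl mulrBr addrA subrK.
rewrite E.
have := sbZ 2^-1 (ltW A0) (sb_sum (index_enum 'I_d) (ltW A0)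
  (fun k => sbD (ltW A0) (sb_mul (ltW A0) (fd k) (fk k)) (sb_mul (ltW A0) (fk' k) (fd k)))).
rewrite sumr_const card_ord normcV normc_nat -[_ *+ d]mulr_natl.
by congr (sb _ _ _); field; rewrite gt_eqF.
Qed.

End Lipschitz.

Section XiLipschitz.
Variables (R : realType) (n : nat).
Local Notation d := n.+1.
Local Notation C := (R[i]).
Implicit Types (u v w : word d) (f g psi W : ser R d) (M N : tens R n) (tau : word d -> C).
Implicit Types (A B D c e eps delta : R).

(** The gradient divides by [A] and the difference quotient by [A - B], both of
    which are large. *)
Lemma mb2_jacfld A B psi c : 0 <= B -> 100 + 2 * B <= A -> sb A psi c ->
  mb2 A B (jacfld psi) (c / 100).
Proof.
move=> B0 AB pc.
have A0 : 0 < A by lra.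
have AB0 : 0 < A - B by lra.
have c0 := sb_ge0 (ltW A0) pc.
have le : c / A / (A - B) <= c / 100.
  rewrite -mulrA ler_wpM2l // -invfM lef_pV2 ?posrE ?mulr_gt0 ?ltr0n //.
  by nra.
have BA : B < A by lra.
have [h1 h2] := mb_jacfld B0 BA pc.
by split; [exact: mb_mono (ltW A0) (lexx _) B0 (lexx _) le h1
          |exact: mb_mono B0 (lexx _) (ltW A0) (lexx _) le h2].
Qed.

(** The constants decrease with the radius for the logarithm and for the
    square, and are proportional to the size of [W] for the composition. *)
Lemma sb_XiB A B D c delta eps eW e0 dW tau tau' W W' psi psi' :
  0 <= B -> 100 + 2 * B <= A -> d%:R <= A -> c <= 1 ->
  (forall v, normc (tau v) <= B ^+ size v) -> (forall v, normc (tau' v) <= B ^+ size v) ->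
  0 <= eps -> (forall v, normc (tau v - tau' v) <= eps * B ^+ size v) ->
  sb A psi c -> sb A psi' c -> sb A (psi - psi') delta ->
  A + c / A <= D -> sb (D + 1) W' eW -> sb D W e0 -> sb D (W - W') dW ->
  sb A (Xi tau W psi - Xi tau' W' psi')
    (delta / 40 + eps * c / 40 + c * delta / 100 + (dW + delta / A * eW)).
Proof.
move=> B0 AB dA c1 tb tb' ep te pc pc' pd AD We' We0 WdW.
have A0 : 0 < A by lra.
have A0' := ltW A0.
have c0 := sb_ge0 A0' pc; have d0 := sb_ge0 A0' pd.
have cA0 : 0 <= c / A by rewrite divr_ge0.
have dA0 : 0 <= delta / A by rewrite divr_ge0.
have D0 : 0 <= D by lra.
have FD k := sb_pert k A0 pc AD; have FD' k := sb_pert k A0 pc' AD.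
have q0 : 0 <= c / 100 by rewrite divr_ge0.
have q1 : c / 100 < 1 by lra.
have Jp := mb2_jacfld B0 AB pc; have Jp' := mb2_jacfld B0 AB pc'.
have Jd : mb2 A B (jacfld psi - jacfld psi') (delta / 100).
  by rewrite -jacfldB; exact: mb2_jacfld B0 AB pd.
have L1 := sb_logLB A0 B0 tb q0 q1 (divr_ge0 d0 (ler0n _ _)) Jp Jp' Jd.
have L2 := sb_logL_lawB A0 B0 tb tb' ep te q0 q1 Jp'.
have H := sb_half_squareB A0 pc pc' pd.
have We'D : sb D W' eW by apply: (sb_mono D0 _ (lexx _) We'); rewrite lerDl.
have C1 := sb_compose A0' D0 FD WdW.
have C2 : sb A (compose W' (pert psi) - compose W' (pert psi')) (delta / A * eW).
  apply: (sb_composeBr A0 D0 dA0 FD FD' _ We') => k.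
  by rewrite pertB; exact: sb_fld.
have key (a a' b h h' x x' m : ser R d) : a - h - x - (a' - h' - x') =
    (a - b) + (b - a') - (h - h') - ((x - m) + (m - x')).
  by apply/funext => u; rewrite !(serBE, serDE); ring.
have E : Xi tau W psi - Xi tau' W' psi' = cycsym
   ((logL tau (jacfld psi) - logL tau (jacfld psi')) + (logL tau (jacfld psi') - logL tau' (jacfld psi'))
    - (half_square psi - half_square psi')
    - (compose (W - W') (pert psi) + (compose W' (pert psi) - compose W' (pert psi')))).
  apply/funext => w; rewrite serBE -cycsymB; congr (cycsym _ w).
  rewrite -(composeBl A0 D0 FD We0 We'D).
  exact: key.
rewrite E; apply: (sb_cycsym A0').
have h1q : 0 < 1 - c / 100 by lra.
have := sbD A0' (sbD A0' (sbD A0' L1 L2) (sbN H)) (sbN (sbD A0' C1 C2)).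
apply: sb_mono => //; rewrite lerD2r; apply: lerD; first apply: lerD.
- by rewrite ler_pdivrMr //; nra.
- rewrite ler_pdivrMr //.
  have ec : 0 <= eps * c by rewrite mulr_ge0.
  nra.
have -> : d%:R * (delta / A * (c / A)) = (d%:R / A) * (c * delta / A) by field; rewrite gt_eqF.
have h1 : d%:R / A <= 1 by rewrite ler_pdivrMr // mul1r.
have h2 : c * delta / A <= c * delta / 100.
  rewrite ler_wpM2l ?mulr_ge0 // lef_pV2 ?posrE //; lra.
have h3 : 0 <= c * delta / A by rewrite divr_ge0 ?mulr_ge0.
have h4 : 0 <= d%:R / A by rewrite divr_ge0.
nra.
Qed.

Lemma sb_Xi0 A B W e tau : 0 <= B -> 100 + 2 * B <= A ->
  (forall v, normc (tau v) <= B ^+ size v) -> sb A W e -> sb A (Xi tau W 0) e.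
Proof.
move=> B0 AB tb We; have A0 : 0 < A by lra.
have A0' := ltW A0; have z := sb0 n A.
have AD : A + 0 / A <= A by rewrite mul0r addr0.
have q0 : (0 / 100 : R) = 0 by rewrite mul0r.
have := mb2_jacfld B0 AB z; rewrite q0 => J.
have L := sb_logL A0 B0 tb (lexx 0) ltr01 J.
have H := sb_half_square A0 z.
have Cm := sb_compose A0' A0' (fun k => sb_pert k A0 z AD) We.
apply: sb_cycsym => //.
have := sbD A0' (sbD A0' L (sbN H)) (sbN Cm).
by rewrite !mul0r !mulr0 !addr0 !mul0r !add0r.
Qed.

Lemma pushlaw_le A B c tau psi w : 0 <= B -> B <= A -> 0 < A -> (forall v, normc (tau v) <= B ^+ size v) ->
  sb A psi c -> normc (pushlaw tau psi w) <= (B + c / A) ^+ size w.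
Proof.
move=> B0 BA A0 tb pc; have c0 := sb_ge0 (ltW A0) pc.
have BD : 0 <= B + c / A by rewrite addr_ge0 // divr_ge0 // ltW.
apply: (pair_le tb); apply: sb_wprod => // k; apply: sbD => //; first exact: sb_ncvarS.
exact: (sb_mono B0 BA (lexx _) (sb_fld k A0 pc)).
Qed.

Lemma pushlawB_le A B c delta tau psi psi' w : 0 <= B -> B <= A -> 0 < A ->
  (forall v, normc (tau v) <= B ^+ size v) ->
  sb A psi c -> sb A psi' c -> sb A (psi - psi') delta ->
  normc (pushlaw tau psi w - pushlaw tau psi' w) <= delta / A * (B + c / A + 1) ^+ size w.
Proof.
move=> B0 BA A0 tb pc pc' pd; have c0 := sb_ge0 (ltW A0) pc.
have d0 := sb_ge0 (ltW A0) pd.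
have BD : 0 <= B + c / A by rewrite addr_ge0 // divr_ge0 // ltW.
have F f e k : sb A f e -> sb B (pert f k) (B + e / A).
  move=> fe; apply: sbD => //; first exact: sb_ncvarS.
  exact: (sb_mono B0 BA (lexx _) (sb_fld k A0 fe)).
have hp := sb_wprod w B0 BD (fun k => F _ _ k pc).
have hp' := sb_wprod w B0 BD (fun k => F _ _ k pc').
rewrite /pushlaw; have -> : pair tau (wprod (pert psi) w) - pair tau (wprod (pert psi') w)
   = pair tau (wprod (pert psi) w - wprod (pert psi') w).
  by rewrite -(pairN tau) (pairD tb hp (sbN hp')).
rewrite mulrC; apply: (pair_le tb); apply: sb_wprodB' => //.
- by rewrite divr_ge0 // ltW.
- by move=> k; exact: F.
- by move=> k; exact: F.
move=> k; rewrite pertB; exact: (sb_mono B0 BA (lexx _) (sb_fld k A0 pd)).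
Qed.

End XiLipschitz.

(** * Existence of the two potentials, and transport *)

Section Potentials.
Variables (R : realType) (n : nat).
Local Notation d := n.+1.
Local Notation C := (R[i]).
Implicit Types (u v w : word d) (f g psi : ser R d) (c e : R).
Variables (tau : word d -> C) (W : ser R d) (A B : R).
Hypothesis (B4 : 4 <= B) (AB : 100 + 2 * B <= A) (dA : d%:R <= A).
Hypothesis tau2 : forall v, normc (tau v) <= 2 ^+ size v.
Hypothesis taus : selfadj tau.
Hypothesis taue : parity false tau.
Hypothesis Ws : selfadj W.
Hypothesis We : parity false W.
Hypothesis W32 : sb (A + 4) W 32^-1.

(** The potential with Euler derivative [f]. *)
Definition uneuler f : ser R d := fun w => (size w)%:R^-1 * f w.

(** The factor of the second equation: from [s = V + Xi] and [V w = s w / |w|]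
    follows [s w = |w| / (|w| - 1) * Xi w]. *)
Definition shrink f : ser R d := fun w => ((size w)%:R / (size w).-1%:R) * f w.

Let wt (i : bool * word d) : R := if i.1 then A ^+ size i.2 else 8 * (A + 2) ^+ size i.2.

(** A pair of series is encoded as one family over [bool * word d], so that
    [wball_fixpoint] applies with a weight that differs on the two components. *)
Definition getp (x : bool * word d -> C) : ser R d := fun w => x (true, w).
Definition gets (x : bool * word d -> C) : ser R d := fun w => x (false, w).
Definition potential_map (x : bool * word d -> C) (i : bool * word d) : C :=
  if i.1 then Xi tau (uneuler (gets x)) (getp x) i.2
  else shrink (Xi (pushlaw tau (getp x)) W (gets x)) i.2.

Let A0 : 0 < A. Proof. by have h1 := B4; have h2 := AB; lra. Qed.
Let A2 : 0 < A + 2. Proof. by have h1 := B4; have h2 := AB; lra. Qed.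
Let B0 : 0 <= B. Proof. by have h1 := B4; have h2 := AB; lra. Qed.

Lemma tau_leB v : normc (tau v) <= B ^+ size v.
Proof.
have hB := B4; apply: le_trans (tau2 v) _; rewrite lerXn2r ?nnegrE //; lra. Qed.

Lemma wball_comps x c : wball wt x c -> sb A (getp x) c /\ sb (A + 2) (gets x) (c / 8).
Proof.
have hB := B4; have hA := AB.
move=> xc; have w0 i : 0 <= wt i * normc (x i).
  rewrite mulr_ge0 ?normc_ge0 // /wt; case: i.1; rewrite ?mulr_ge0 // exprn_ge0 //; lra.
split; first by apply: (bsum_inj (e := fun w => (true, w)) w0 _ xc) => ? ? [].
have := bsum_inj (e := fun w => (false, w)) w0 _ xc => H.
have i8 : 0 <= (8^-1 : R) by lra.
have := bsumZ i8 (fun w => w0 (false, w)) (H _).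
rewrite mulrC; move=> G; apply: bsum_le (G _) => [w|? ? []//].
by rewrite /wt /= -!mulrA mulKf // pnatr_eq0.
Qed.

Lemma comps_wball x c e : sb A (getp x) c -> sb (A + 2) (gets x) e -> wball wt x (c + 8 * e).
Proof.
have hB := B4; have hA := AB.
move=> pc se; rewrite /wball; apply: (bsum_pair (c := fun b : bool => if b then c else 8 * e)).
- by move=> i; rewrite mulr_ge0 ?normc_ge0 // /wt; case: i.1; rewrite ?mulr_ge0 // exprn_ge0 //; lra.
- case; first exact: pc.
  have e0 : 0 <= (8 : R) by lra.
  have := bsumZ e0 (fun w => sb_term0 _ w (ltW A2)) se.
  by apply: bsum_le => w; rewrite /wt /= mulrA.
have c0 := sb_ge0 (ltW A0) pc; have e0 := sb_ge0 (ltW A2) se.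
have := @bsum_seq R bool (fun b => if b then c else 8 * e) [:: true; false] isT.
rewrite big_cons big_seq1; apply; first by case=> //; lra.
by case.
Qed.

Lemma sb_uneuler D f c : 0 <= D -> sb D f c -> sb D (uneuler f) c.
Proof.
move=> D0; apply: bsum_le => w; rewrite ler_wpM2l ?exprn_ge0 // normcM normcV normc_nat.
rewrite ler_piMl ?normc_ge0 //.
by case: (size w) => [|k]; rewrite ?invr0 ?ler01 // natV_le1.
Qed.

Lemma sb_shrink D f c : 0 <= D -> sb D f c -> sb D (shrink f) (2 * c).
Proof.
move=> D0 fc; have two0 : 0 <= (2 : R) by lra.
apply: bsum_le (bsumZ two0 (fun w => sb_term0 f w D0) fc) => w.
rewrite mulrCA ler_wpM2l ?exprn_ge0 // normcM normcM normcV !normc_nat.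
rewrite ler_wpM2r ?normc_ge0 //; case: (size w) => [|[|k]] /=.
- by rewrite mul0r.
- by rewrite invr0 mulr0.
by rewrite ler_pdivrMr ?ltr0n // -natrM ler_nat mul2n -addnn addnS ltnS ltnS leq_addl.
Qed.

Lemma uneulerB f g : uneuler f - uneuler g = uneuler (f - g).
Proof. by apply/funext => w; rewrite serBE /uneuler -mulrBr. Qed.
Lemma shrinkB f g : shrink f - shrink g = shrink (f - g).
Proof. by apply/funext => w; rewrite serBE /shrink -mulrBr. Qed.

Let push_le psi c v : c <= 1 -> sb A psi c -> normc (pushlaw tau psi v) <= B ^+ size v.
Proof.
have hB := B4; have hA := AB; have A0' := A0; have A2' := A2.
move=> c1 pc; have c0 := sb_ge0 (ltW A0) pc.
have le2A : 2 <= A by lra.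
apply: le_trans (pushlaw_le v (ler0n _ 2) le2A A0 tau2 pc) _.
have cA : c / A <= 1 by rewrite ler_pdivrMr //; lra.
have cA0 : 0 <= c / A by rewrite divr_ge0 // ltW.
by rewrite lerXn2r ?nnegrE //; lra.
Qed.

(** The radius of the second component exceeds that of the first by 2, because
    the first equation composes the potential with a perturbation of the
    identity and differentiates it. The weight 8 keeps this potential below 1/8
    in the first equation. *)
Lemma potential_map_lipschitz x y e : wball wt x 1 -> wball wt y 1 ->
  wball wt (fun i => x i - y i) e ->
  wball wt (fun i => potential_map x i - potential_map y i) (e / 2).
Proof.
have hB := B4; have hA := AB; have A0' := A0; have A2' := A2.
move=> x1 y1 xye.
have [px sx] := wball_comps x1; have [py sy] := wball_comps y1; have [pd sd] := wball_comps xye.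
have e0 := sb_ge0 (ltW A0) pd.
have le2A : 2 <= A by lra.
have A1 : A^-1 <= 100^-1 by rewrite lef_pV2 ?posrE //; lra.
have iA0 : 0 <= A^-1 by rewrite invr_ge0 ltW.
have A21 : (A + 2)^-1 <= 100^-1 by rewrite lef_pV2 ?posrE //; lra.
have iA20 : 0 <= (A + 2)^-1 by rewrite invr_ge0 ltW.
have z0 v : normc (tau v - tau v) <= 0 * B ^+ size v by rewrite subrr normc0 mul0r.
have A3 : A + 1 + 1 = A + 2 by lra.
have A00 : 0 <= A + 1 by lra.
have A12 : A + 1 <= A + 2 by lra.
have P1 : sb A (Xi tau (uneuler (gets x)) (getp x) - Xi tau (uneuler (gets y)) (getp y)) (e / 4).
  have AD : A + 1 / A <= A + 1 by rewrite lerD2l; lra.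
  have Wy : sb (A + 1 + 1) (uneuler (gets y)) (1 / 8) by rewrite A3; exact: sb_uneuler (ltW A2) sy.
  have Wx : sb (A + 1) (uneuler (gets x)) (1 / 8).
    exact: (sb_uneuler A00 (sb_mono A00 A12 (lexx _) sx)).
  have Wxy : sb (A + 1) (uneuler (gets x) - uneuler (gets y)) (e / 8).
    rewrite uneulerB; exact: (sb_uneuler A00 (sb_mono A00 A12 (lexx _) sd)).
  have := sb_XiB B0 AB dA (lexx 1) tau_leB tau_leB (lexx 0) z0 px py pd AD Wy Wx Wxy.
  apply: sb_mono => //; [exact: ltW|nra].
have sx1 : sb (A + 2) (gets x) (1 / 8) := sx.
have P2 : sb (A + 2) (Xi (pushlaw tau (getp x)) W (gets x) - Xi (pushlaw tau (getp y)) W (gets y)) (e / 64).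
  have AD : A + 2 + (1 / 8) / (A + 2) <= A + 3 by nra.
  have A34 : A + 3 + 1 = A + 4 by lra.
  have A30 : 0 <= A + 3 by lra.
  have W4 : sb (A + 3 + 1) W 32^-1 by rewrite A34.
  have W3 : sb (A + 3) W 32^-1 by apply: (sb_mono A30 _ (lexx _) W32); lra.
  have W0 : sb (A + 3) (W - W) 0 by rewrite subrr; exact: sb0.
  have AB2 : 100 + 2 * B <= A + 2 by lra.
  have dA2 : d%:R <= A + 2 by apply: le_trans dA _; lra.
  have c8 : (1 / 8 : R) <= 1 by lra.
  have ep : 0 <= e / 100 by lra.
  have te v : normc (pushlaw tau (getp x) v - pushlaw tau (getp y) v) <= e / 100 * B ^+ size v.
    apply: le_trans (pushlawB_le v (ler0n _ 2) le2A A0 tau2 px py pd) _.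
    apply: ler_pM; rewrite ?exprn_ge0 ?divr_ge0 // ?(ltW A0) //; first lra.
      by rewrite ler_wpM2l.
    by rewrite lerXn2r ?nnegrE //; lra.
  have := sb_XiB B0 AB2 dA2 c8 (fun v => push_le v (lexx _) px) (fun v => push_le v (lexx _) py)
    ep te sx sy sd AD W4 W3 W0.
  apply: sb_mono => //; [exact: ltW|nra].
have le : e / 4 + 8 * (2 * (e / 64)) <= e / 2 by lra.
apply: (bsum_leR le); apply: comps_wball; first exact: P1.
have := sb_shrink (ltW A2) P2; rewrite -shrinkB; exact.
Qed.

Definition symmetric_potential f := [/\ cyc_inv f, selfadj f & parity false f].

Lemma selfadj_scale (k : nat -> C) f : (forall m, conjc (k m) = k m) -> selfadj f ->
  selfadj (fun w => k (size w) * f w).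
Proof. by move=> kr fs w; rewrite size_rev fs conjcM kr. Qed.

Lemma symmetric_uneuler f : symmetric_potential f -> symmetric_potential (uneuler f).
Proof.
move=> [fc fs fp]; split; first by move=> w; rewrite /uneuler size_rot fc.
  by apply: (selfadj_scale (k := fun m => m%:R^-1)) fs => m; rewrite conjc_natV.
by move=> w wo; rewrite /uneuler fp ?mulr0.
Qed.

Lemma symmetric_shrink f : symmetric_potential f -> symmetric_potential (shrink f).
Proof.
move=> [fc fs fp]; split; first by move=> w; rewrite /shrink size_rot fc.
  apply: (selfadj_scale (k := fun m => m%:R / m.-1%:R)) fs => m.
  by rewrite conjcM conjc_natV conjc_natr.
by move=> w wo; rewrite /shrink fp ?mulr0.
Qed.

Lemma symmetric_Xi (t U f : ser R d) : selfadj t -> parity false t -> selfadj U ->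
  parity false U -> symmetric_potential f -> symmetric_potential (Xi t U f).
Proof.
move=> ts te Us Ue [fc fs fp]; split; first exact: cycsym_inv.
  exact: selfadj_Xi.
exact: parity_Xi.
Qed.

Lemma eq_of_geometric_limit (x y : C) (a b : nat -> C) (K : R) :
  (forall k, a k = b k) -> (forall k, normc (x - a k) <= K * 2^-1 ^+ k) ->
  (forall k, normc (y - b k) <= K * 2^-1 ^+ k) -> x = y.
Proof.
move=> ab xa yb; apply/eqP; rewrite -subr_eq0; apply/eqP.
apply: (@geometric_eq0 _ _ (K + K) 2^-1) => [||m]; [lra|lra|].
have -> : x - y = (x - a m) - (y - b m) by rewrite ab; ring.
by apply: le_trans (normcB _ _) _; rewrite mulrDl lerD.
Qed.

Lemma symmetric_limit (u : nat -> ser R d) f (K : nat -> R) :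
  (forall k, symmetric_potential (u k)) ->
  (forall w k, normc (f w - u k w) <= K (size w) * 2^-1 ^+ k) -> symmetric_potential f.
Proof.
move=> us uf; split.
- move=> w; apply: (@eq_of_geometric_limit _ _ (fun k => u k (rot 1 w)) (fun k => u k w) (K (size w))).
  + by move=> k; case: (us k) => ->.
  + by move=> k; have := uf (rot 1 w) k; rewrite size_rot.
  + by move=> k; exact: uf.
- move=> w; apply: (@eq_of_geometric_limit _ _ (fun k => u k (rev w)) (fun k => conjc (u k w)) (K (size w))).
  + by move=> k; case: (us k).
  + by move=> k; have := uf (rev w) k; rewrite size_rev.
  + by move=> k; rewrite -conjcB normc_conj; exact: uf.
move=> w wo; apply: (@eq_of_geometric_limit _ _ (fun k => u k w) (fun k => 0) (K (size w))).
- by move=> k; case: (us k) => _ _; apply.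
- by move=> k; exact: uf.
by move=> k; rewrite subrr normc0; apply: le_trans (uf w k); exact: normc_ge0.
Qed.

(** Self-adjointness, parity and cyclic invariance are preserved by every
    iteration, hence by the limit. *)
Lemma exists_potentials : exists p s : ser R d,
  [/\ sb A p 1, sb (A + 2) s (1 / 8), symmetric_potential p & symmetric_potential s] /\
  (forall w, p w = Xi tau (uneuler s) p w) /\
  (forall w, s w = shrink (Xi (pushlaw tau p) W s) w).
Proof.
have hB := B4; have hA := AB; have A0' := A0; have A2' := A2.
have wt0 i : 0 < wt i by rewrite /wt; case: i.1; rewrite ?mulr_gt0 ?exprn_gt0.
pose P (x : bool * word d -> C) := symmetric_potential (getp x) /\ symmetric_potential (gets x).
have sym0 : symmetric_potential (fun=> 0 : C).
  by split=> // w; rewrite conjc0.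
have two (t : ser R d) : Xi t (uneuler 0) 0 = Xi t 0 0.
  by congr (Xi _ _ _); apply/funext => w; rewrite /uneuler mulr0.
have tB := tau_leB.
have p0 v : normc (pushlaw tau 0 v) <= B ^+ size v by exact: (push_le v ler01 (sb0 n A)).
have AB2 : 100 + 2 * B <= A + 2 by lra.
have WA : sb (A + 2) W 32^-1 by apply: (sb_mono (ltW A2') _ (lexx _) W32); lra.
have r1 : 0 <= (1 : R) by [].
have F0 : wball wt (potential_map (fun=> 0)) (1 / 2).
  have : sb A (Xi tau (uneuler 0) 0) 0 by rewrite two; exact: sb_Xi0 B0 hA tB (sb0 n A).
  have := sb_shrink (ltW A2') (sb_Xi0 B0 AB2 p0 WA) => S Z.
  have le : 0 + 8 * (2 * 32^-1) <= 1 / 2 :> R by lra.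
  by apply: (bsum_leR le); exact: comps_wball Z S.
have Pmap x : wball wt x 1 -> P x -> P (potential_map x).
  move=> _ [px sx]; have [uc us ue] := symmetric_uneuler sx; split; first exact: symmetric_Xi.
  have [pc pss pe] := px.
  apply: symmetric_shrink; apply: symmetric_Xi => //; first exact: selfadj_pushlaw.
  exact: parity_pushlaw.
have Plim (u : nat -> bool * word d -> C) x : (forall k, P (u k)) ->
    (forall i k, normc (x i - u k i) <= (wt i)^-1 * 1 * 2^-1 ^+ k) -> P x.
  move=> Pu ux; split.
    apply: (@symmetric_limit (fun k => getp (u k)) _ (fun m => (A ^+ m)^-1 * 1)).
      by move=> k; case: (Pu k).
    by move=> w k; exact: ux (true, w) k.
  apply: (@symmetric_limit (fun k => gets (u k)) _ (fun m => (8 * (A + 2) ^+ m)^-1 * 1)).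
    by move=> k; case: (Pu k).
  by move=> w k; exact: ux (false, w) k.
have [x [xr xf [ps ss]]] := wball_fixpoint wt0 r1 potential_map_lipschitz F0 (conj sym0 sym0) Pmap Plim.
have [px sx] := wball_comps xr.
exists (getp x), (gets x); split; first by split.
by split=> w; rewrite -[LHS]/(x _) -[in LHS]xf.
Qed.

End Potentials.

Section Transport.
Variables (R : realType) (n : nat).
Local Notation d := n.+1.
Local Notation C := (R[i]).
Implicit Types (u v w : word d) (f g psi : ser R d) (c e : R).

(** The estimates under which a solution of the equation for [psi] gives a
    change of variables. The Jacobian of the gradient has norm at most
    [c / 100], so its logarithm converges. *)
Lemma sd_pushlaw (tau : word d -> C) (A B c eW eV : R) psi V0 W : 0 <= B -> 102 + 2 * B <= A ->
  (forall w, normc (tau w) <= B ^+ size w) -> (forall u v, tau (u ++ v) = tau (v ++ u)) ->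
  c <= 1 -> sb A psi c -> cyc_inv psi -> cyc_inv V0 -> sb A V0 eV -> sb A W eW ->
  (forall w, w != [::] -> psi w = V0 w + Xi tau W psi w) ->
  sd_mono tau V0 -> sd_mono (pushlaw tau psi) W.
Proof.
move=> B0 AB tle tC c1 pc pi vi Ve We eqn sdV.
have A0 : 0 < A by lra.
have c0 := sb_ge0 (ltW A0) pc; have eV0 := sb_ge0 (ltW A0) Ve.
have B10 : 0 <= B + 1 by lra.
have B1A : B + 1 <= A by lra.
have BB1 : B <= B + 1 by lra.
have AB1 : 100 + 2 * (B + 1) <= A by lra.
have [J1 J2] := mb2_jacfld B10 AB1 pc.
have q0 : 0 <= c / 100 by lra.
have q1 : c / 100 < 1 by lra.
have Jq : mb (B + 1) (B + 1) (jacfld psi) (c / 100) := mb_mono B10 B1A B10 (lexx _) (lexx _) J1.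
have J2q : mb2 (B + 1) B (jacfld psi) (c / 100).
  by split; [exact: mb_mono B10 (lexx _) B0 BB1 (lexx _) Jq|exact: mb_mono B0 BB1 B10 (lexx _) (lexx _) Jq].
have D0 : 0 <= B + 2 by lra.
have FD k : sb (B + 1) (ncvarS R k + fld psi k) (B + 2).
  have cA : c / A <= 1 by rewrite ler_pdivrMr //; lra.
  have -> : B + 2 = B + 1 + 1 by ring.
  exact: (sbD B10 (sb_ncvarS k B10) (sb_mono B10 B1A cA (sb_fld k A0 pc))).
have WD : sb (B + 2 + 1) W eW by apply: sb_mono We; lra.
have WD' : sb (B + 2) W eW by apply: sb_mono We; lra.
have V1 : sb (B + 1) V0 eV by apply: sb_mono Ve; lra.
have B1p : 0 < B + 1 by lra.
have L := sb_logL B1p B0 tle q0 q1 J2q.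
set eL := (X in sb _ _ X) in L.
have eL0 := sb_ge0 B10 L.
have heq (r : tup R d) (c' : R) : tb (B + 1) r c' -> \sum_i Epair tau r i [:: i] + rpair tau r V0 =
    rpair tau r ((fun w => 2^-1 * (\sum_k (ncvarS R k + fld psi k) * (ncvarS R k + fld psi k) : ser R d) w)
    + compose W (fun k => ncvarS R k + fld psi k) - logL tau (jacfld psi)).
  move=> rc; apply: (@potential_equation _ _ tau B B0 tle tC r c' psi V0 W (B + 2) (c + eV + eL) eW) => //.
  - exact: (tb_mono B0 BB1 (lexx _) rc).
  - by apply: sb_mono pc => //; lra.
  - by apply: sb_mono V1 => //; lra.
  - by apply: sb_mono L => //; lra.
have Lm m := sb_logL_tail B1p B0 m tle q0 q1 J2q.
exact: (sd_change_of_variables B0 tle tC q0 q1 D0 Jq FD WD V1 Lm sdV heq).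
Qed.

Lemma pushlawC (tau : word d -> C) (A B c : R) psi u v : 0 <= B -> B <= A -> 0 < A ->
  (forall w, normc (tau w) <= B ^+ size w) -> (forall u v, tau (u ++ v) = tau (v ++ u)) ->
  sb A psi c -> pushlaw tau psi (u ++ v) = pushlaw tau psi (v ++ u).
Proof.
move=> B0 BA A0 tb tC pc; have c0 := sb_ge0 (ltW A0) pc.
have BD : 0 <= B + c / A by rewrite addr_ge0 // divr_ge0 // ltW.
have F k : sb B (pert psi k) (B + c / A).
  apply: sbD => //; first exact: sb_ncvarS.
  exact: (sb_mono B0 BA (lexx _) (sb_fld k A0 pc)).
rewrite /pushlaw !wprod_cat.
exact: (pairMC B0 tb tC (sb_wprod u B0 BD F) (sb_wprod v B0 BD F)).
Qed.

(** The first change of variables has source potential 0 and target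
    [uneuler s]; the second one has source [uneuler s] and target [W]. In the
    second one the case of a word of length one, where [shrink] has a zero
    denominator, is settled by parity. *)
Theorem two_step_transport (tau : word d -> C) (W : ser R d) (A B : R) :
  4 <= B -> 102 + 2 * B <= A -> d%:R <= A ->
  (forall v, normc (tau v) <= 2 ^+ size v) -> (forall u v, tau (u ++ v) = tau (v ++ u)) ->
  selfadj tau -> parity false tau -> sd_mono tau 0 ->
  selfadj W -> parity false W -> sb (A + 4) W 32^-1 ->
  exists p s : ser R d,
    [/\ sb A p 1, sb A s (1 / 8), symmetric_potential p & symmetric_potential s] /\
    sd_mono (pushlaw tau p) (uneuler s) /\ sd_mono (pushlaw (pushlaw tau p) s) W.
Proof.
move=> B4 AB dA t2 tC ts te sd0 Ws We WA.
have AB0 : 100 + 2 * B <= A by lra.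
have [p [s [[pA sA ps ss] [ep es]]]] := exists_potentials B4 AB0 dA t2 ts te Ws We WA.
have A0 : 0 < A by lra.
have B0 : 0 <= B by lra.
have BA : B <= A by lra.
have A20 : 0 <= A + 2 by lra.
have sA' : sb A s (1 / 8) by apply: sb_mono sA; lra.
have tB := tau_leB B4 AB0 t2.
have zc : cyc_inv (0 : ser R d) by [].
have [[pc _ pe] [sc _ se]] := (ps, ss); have [vc _ _] := symmetric_uneuler ss.
have VA := sb_uneuler (ltW A0) sA'.
have WA' : sb A W 32^-1 by apply: sb_mono WA; lra.
exists p, s; split; first by split.
have S1 : sd_mono (pushlaw tau p) (uneuler s).
  apply: (sd_pushlaw B0 AB tB tC (lexx 1) pA pc zc (sb0 n A) VA) => // w _.
  by rewrite -[in RHS]ep add0r.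
split=> //.
have le2A : 2 <= A by lra.
have pB w : normc (pushlaw tau p w) <= B ^+ size w.
  apply: le_trans (pushlaw_le w (ler0n _ 2) le2A A0 t2 pA) _.
  have cA : 1 / A <= 1 by rewrite ler_pdivrMr //; lra.
  have cA0 : 0 <= 1 / A by rewrite divr_ge0 // ltW.
  by rewrite lerXn2r ?nnegrE //; lra.
have c8 : (1 / 8 : R) <= 1 by lra.
apply: (sd_pushlaw B0 AB pB _ c8 sA' sc vc VA WA' _ S1).
  by move=> u v; exact: (pushlawC u v (ler0n _ 2) le2A A0 t2 tC pA).
case=> [//|k [|l w]] _.
  rewrite [LHS]se // /uneuler se // mulr0 add0r.
  by rewrite (parity_Xi _ We) //; exact: parity_pushlaw.
have e := es (k :: l :: w); rewrite /shrink /= in e.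
set x := Xi _ _ _ _ in e *; rewrite /uneuler e /=.
have h1 : ((size w).+1%:R : C) != 0 by rewrite pnatr_eq0.
have h2 : ((size w).+2%:R : C) != 0 by rewrite pnatr_eq0.
have a1 : ((size w).+2%:R : C) = (size w).+1%:R + 1 by rewrite natr1.
rewrite {}a1 in h2 *; rewrite [((size _).+1)%:R]/= in h2 *.
move: h1 h2; set b := ((size w).+1)%:R : C => h1 h2.
field; exact/andP.
Qed.

End Transport.

(** * Summation by degree and the Schwinger-Dyson equation on words *)

Section Degreewise.
Variables (R : realType) (n : nat).
Local Notation C := (R[i]).
Implicit Types (w u : word n) (e c : R).

(** The words of length less than [N], in the order in which a summation by
    degree meets them. *)
Definition words (N : nat) : seq (word n) :=
  flatten [seq [seq val t | t <- enum {: k.-tuple 'I_n}] | k <- iota 0 N].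

Lemma mem_words N w : (w \in words N) = (size w < N)%N.
Proof.
apply/flatten_mapP/idP => [[k kN /mapP[t _ ->]]|wN].
  by rewrite size_tuple; rewrite mem_iota in kN.
exists (size w); first by rewrite mem_iota.
by apply/mapP; exists (in_tuple w); rewrite ?mem_enum.
Qed.

Lemma uniq_words N : uniq (words N).
Proof.
rewrite /words; elim: N {1}0%N => // N IH m /=; rewrite cat_uniq IH andbT.
rewrite map_inj_uniq ?enum_uniq; last exact: val_inj.
rewrite andTb; apply/hasPn => w /flatten_mapP[k]; rewrite mem_iota => /andP[mk _].
move=> /mapP[t _ ->]; apply/mapP => -[t' _ /(congr1 size)].
by rewrite !size_tuple => km; rewrite km ltnn in mk.
Qed.

Lemma sum_words (V : nmodType) (F : word n -> V) N :
  \sum_(k < N) \sum_(w : k.-tuple 'I_n) F w = \sum_(w <- words N) F w.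
Proof.
rewrite big_flatten big_map -(big_mkord xpredT (fun k => \sum_(w : k.-tuple 'I_n) F w)).
rewrite /index_iota subn0; apply: eq_bigr => k _.
by rewrite big_map big_enum.
Qed.

Lemma words_cover (s : seq (word n)) : exists N, {subset s <= words N}.
Proof.
exists (\max_(w <- s) size w).+1 => w ws; rewrite mem_words ltnS.
by rewrite (big_rem w ws) /= leq_maxl.
Qed.

Lemma subset_words M N : (M <= N)%N -> {subset words M <= words N}.
Proof. by move=> MN w; rewrite !mem_words => /leq_trans; apply. Qed.

Lemma wsums_to_near (V : zmodType) (nrm : V -> R) (F : word n -> V) l :
  (forall e, 0 < e -> exists N, forall M, (N <= M)%N ->
     nrm (\sum_(w <- words M) F w - l) <= e) -> (forall x, 0 <= nrm x) ->
  wsums_to nrm F l.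
Proof.
move=> H nrm0; apply/cvgr0Pnorm_le => e e0; have [N HN] := H e e0.
near=> M; rewrite sum_words ger0_norm //; apply: HN; near: M; exact: nbhs_infty_ge.
Unshelve. all: by end_near. Qed.

Lemma near_wsums_to (V : zmodType) (nrm : V -> R) (F : word n -> V) l : wsums_to nrm F l ->
  forall e, 0 < e -> exists N, forall M, (N <= M)%N ->
     nrm (\sum_(w <- words M) F w - l) <= e.
Proof.
move=> /cvgr0Pnorm_le H e e0; have [N _ HN] := H e e0.
exists N => M NM; have := HN M NM; rewrite sum_words; apply: le_trans; exact: ler_norm.
Qed.

Lemma wsums_to_dist (V : zmodType) (nrm : V -> R) (F : word n -> V) l l' :
  (forall x y, nrm (x + y) <= nrm x + nrm y) -> (forall x, nrm (- x) = nrm x) ->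
  wsums_to nrm F l -> wsums_to nrm F l' -> nrm (l - l') <= 0.
Proof.
move=> nD nN Fl Fl'; apply/ler_addgt0Pr => e e0; rewrite add0r.
have e20 : 0 < e / 2 by rewrite divr_gt0.
have [N HN] := near_wsums_to Fl e20; have [N' HN'] := near_wsums_to Fl' e20.
set M := maxn N N'; set S := \sum_(w <- words M) F w.
have -> : l - l' = - (S - l) + (S - l') by rewrite opprB addrA subrK.
apply: le_trans (nD _ _) _; rewrite nN [e]splitr.
by apply: lerD; [apply: HN; exact: leq_maxl|apply: HN'; exact: leq_maxr].
Qed.

Lemma csum_words (F : word n -> C) c N : bsum (fun w => normc (F w)) c ->
  csum F = \sum_(w <- words N) F w + csum (fun w => if w \in words N then 0 else F w).
Proof.
move=> Fc; pose G w : C := if w \in words N then F w else 0.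
have G0 w : w \notin words N -> G w = 0 by rewrite /G => /negbTE ->.
have -> : \sum_(w <- words N) F w = csum G.
  rewrite (csum_seq (uniq_words N) G0); apply: eq_big_seq => w ws.
  by rewrite /G ws.
have Gc : bsum (fun w => normc (G w)) c.
  by apply: bsum_le Fc => w; rewrite /G; case: ifP; rewrite ?normc0 ?normc_ge0.
have Hc : bsum (fun w => normc (if w \in words N then 0 else F w : C)) c.
  by apply: bsum_le Fc => w; case: ifP; rewrite ?normc0 ?normc_ge0.
rewrite -(csumD Gc Hc); apply: eq_csum => w; rewrite /G.
by case: ifP; rewrite ?addr0 ?add0r.
Qed.

(** An absolutely summable family is exhausted by finite sets, and every finite
    set of words has bounded degree. *)
Lemma wsums_to_csum (F : word n -> C) c : bsum (fun w => normc (F w)) c ->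
  wsums_to (@normc R) F (csum F).
Proof.
move=> Fc; apply: wsums_to_near => [e e0|]; last exact: normc_ge0.
have [s us se] := bsum_tail (fun w => normc_ge0 (F w)) Fc e0.
have [N sN] := words_cover s; exists N => M NM.
rewrite (csum_words M Fc) opprD addrA subrr add0r normcN; apply: csum_le.
apply: bsum_le se => w; case: ifPn => [_|wM]; first by rewrite normc0; case: ifP; rewrite ?normc_ge0.
by rewrite ifF //; apply: contraNF wM => ws; apply: subset_words NM _ (sN _ ws).
Qed.

Lemma nc_pairingE (tau : word n -> C) (f : ncseries R n) c l :
  bsum (fun w => normc (f w * tau w)) c -> nc_pairing tau f l <-> l = csum (fun w => f w * tau w).
Proof.
move=> fc; split=> [fl|->]; last exact: wsums_to_csum fc.
have := wsums_to_dist (@normcD R) (@normcN R) fl (wsums_to_csum fc).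
move=> H; apply/eqP; rewrite -subr_eq0; apply/eqP/eq0_normc/le_anti.
by rewrite H normc_ge0.
Qed.

Lemma bsum_finsupp (I : choiceType) (F : I -> C) (s : seq I) : uniq s ->
  (forall i, i \notin s -> F i = 0) -> bsum (fun i => normc (F i)) (\sum_(i <- s) normc (F i)).
Proof.
move=> us Fs; apply: bsum_seq => // [i|i js]; first exact: normc_ge0.
by rewrite Fs // normc0.
Qed.

Lemma fsbig_csum (I : choiceType) (F : I -> C) (s : seq I) : uniq s ->
  (forall i, i \notin s -> F i = 0) -> \sum_(i \in [set: I]) F i = csum F.
Proof.
move=> us Fs; rewrite (csum_seq us Fs).
rewrite (fsbig_seq _ _ us) (fsbig_widen [set` s] [set: I]) // => i [_ /negP]; exact: Fs.
Qed.

Lemma sum_index_occ (V : nmodType) w (i : 'I_n) (h : word n -> word n -> V) :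
  \sum_(j < size w | nth i w j == i) h (take j w) (drop j.+1 w) =
  \sum_(o <- occ w | o.1.2 == i) h o.1.1 o.2.
Proof.
rewrite big_mkcond [RHS]big_mkcond /=; elim: w h => [|k w IH] h; first by rewrite big_ord0 big_nil.
rewrite big_ord_recl occ_cons /= drop0; congr (_ + _).
rewrite -(IH (fun u v => h (k :: u) v)); apply: eq_bigr => j _; by rewrite /= add0n.
Qed.

End Degreewise.

Section SchwingerDyson.
Variables (R : realType) (n : nat).
Local Notation d := n.+1.
Local Notation C := (R[i]).
Implicit Types (u v w p y : word d) (f g W : ser R d) (i : 'I_d) (c e : R).

(** Only the words of length [size u + 1] contribute to the coefficient of [u],
    and among them only the rotations of [i u]. *)
Lemma cyc_gradE i W : cyc_grad i W = gradw i W.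
Proof.
apply/funext => u; rewrite /cyc_grad.
have E w : cyc_grad_mono R i w u = \sum_(o <- occ w | o.1.2 == i) (o.2 ++ o.1.1 == u)%:R.
  rewrite /cyc_grad_mono -(sum_index_occ w i (fun a b => (b ++ a == u)%:R)) fct_sumE.
  by apply: eq_bigr => j _; rewrite /ncmono eq_sym.
pose s := [seq b.2 ++ i :: b.1 | b <- wfacts u].
have s_in w o : o \in occ w -> o.1.2 = i -> o.2 ++ o.1.1 = u -> w \in s.
  rewrite mem_occ => /eqP wo oi ou; apply/mapP; exists (o.2, o.1.1); first by rewrite mem_wfacts ou.
  by rewrite -wo oi.
have F0 w : w \notin s -> W w * cyc_grad_mono R i w u = 0.
  move=> ws; rewrite E big_seq_cond big1 ?mulr0 // => o /andP[ow /eqP oi].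
  by case: eqP => // ou; rewrite (s_in w o) in ws.
pose f (o : (word d * 'I_d) * word d) : C :=
  if (o.1.2 == i) && (o.2 ++ o.1.1 == u) then W (o.1.1 ++ o.1.2 :: o.2) else 0.
pose t := [seq ((b.2, i), b.1) | b <- wfacts u].
have ut : uniq t by rewrite map_inj_uniq ?uniq_wfacts // => -[? ?] [? ?] [-> ->].
have f0 o : o \notin t -> f o = 0.
  rewrite /f; case: ifP => // /andP[/eqP oi /eqP ou] /mapP[]; exists (o.2, o.1.1).
    by rewrite mem_wfacts ou.
  by case: o oi {ou} => -[a k] b /= ->.
have fb := bsum_finsupp ut f0.
rewrite (fsbig_csum (undup_uniq s)) => [|w]; last by rewrite mem_undup; exact: F0.
transitivity (csum (fun w => \sum_(o <- occ w) f o)).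
  apply: eq_csum => w; rewrite E big_mkcond mulr_sumr; apply: eq_big_seq => o.
  rewrite mem_occ /f => /eqP ->; case: eqP => _ /=; last by rewrite mulr0.
  by case: eqP => _; rewrite ?mulr1 ?mulr0.
rewrite -(@csum_fiber _ _ _ f (@occ d) (fun o => o.1.1 ++ o.1.2 :: o.2) _ _ _ fb) //.
- rewrite (csum_seq ut f0) big_map /gradw; apply: eq_big_seq => b.
  by rewrite mem_wfacts /f /= => /eqP ->; rewrite !eqxx.
- exact: uniq_occ.
by move=> w o; rewrite mem_occ.
Qed.

Lemma diff_quotE i f q : diff_quot i f q = f (q.1 ++ i :: q.2).
Proof.
have E w : diff_quot_mono R i w q = \sum_(o <- occ w | o.1.2 == i) (q == (o.1.1, o.2))%:R.
  rewrite /diff_quot_mono -(sum_index_occ w i (fun a b => (q == (a, b))%:R)) fct_sumE.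
  by apply: eq_bigr => j _; rewrite /tmono.
have E1 w : diff_quot_mono R i w q = (w == q.1 ++ i :: q.2)%:R.
  rewrite E; have [->|wq] := eqVneq w.
    rewrite -big_filter (bigD1_seq ((q.1, i), q.2)) ?filter_uniq ?mem_filter ?mem_occ ?uniq_occ //=;
      rewrite ?eqxx //= -surjective_pairing eqxx big_filter_cond.
    rewrite big_seq_cond big1 ?addr0 // => -[[a k] b] /= /andP[_ /andP[/eqP -> ]] ne.
    by case: (q =P _) => // qab; rewrite qab eqxx in ne.
  rewrite big_seq_cond big1 // => -[[a k] b] /=; rewrite mem_occ /= => /andP[/eqP ab /eqP ki].
  by case: eqP => // qab; rewrite qab /= -ab ki eqxx in wq.
rewrite /diff_quot (@fsbig_csum _ _ _ [:: q.1 ++ i :: q.2]) //.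
  rewrite (csum1 (k := q.1 ++ i :: q.2)) => [|w]; first by rewrite E1 eqxx mulr1.
  by rewrite E1 => /negbTE ->; rewrite mulr0.
by move=> w; rewrite inE E1 => /negbTE ->; rewrite mulr0.
Qed.

Lemma sb_gradw B i W e : 0 <= B -> sb (B + 1) W e -> sb B (gradw i W) e.
Proof.
move=> B0 We; pose K y : C := ((B ^+ size y)%:C)%C.
have nK y : normc (K y) = B ^+ size y by rewrite normc_real ger0_norm // exprn_ge0.
have := bsum_inj (e := fun m : word d * word d => ((m.1, i), m.2)) _ _
    (bsum_mark B0 (fun w => normc_ge0 (W w)) We) => H.
have [] := @csum_gradw_pair R n i W K e.
  apply: bsum_le (H _ _) => [m|q|]; first by rewrite normcM nK mulrC size_cat.
    by rewrite mulr_ge0 ?exprn_ge0 ?normc_ge0.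
  by move=> [? ?] [? ?] [-> ->].
by move=> h _; apply: bsum_le h => y; rewrite normcM nK mulrC.
Qed.

Lemma poly_support (f : ncseries R d) : is_ncpoly f ->
  exists2 s : seq (word d), uniq s & forall w, w \notin s -> f w = 0.
Proof.
move=> /finite_seqP[s fs]; exists (undup s); first exact: undup_uniq.
move=> w; rewrite mem_undup => ws; apply/eqP; apply: contraNT ws => fw.
by have : [set` s] w by rewrite -fs.
Qed.

Variables (tau : word d -> C) (B : R).
Hypothesis B0 : 0 <= B.
Hypothesis tau_le : forall w, normc (tau w) <= B ^+ size w.

Definition sd_left W i p : C := tau (p ++ [:: i]) + csum (fun y => gradw i W y * tau (p ++ y)).
Definition sd_right i p : C := \sum_(o <- occ p | o.1.2 == i) tau o.1.1 * tau o.2.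

Lemma pair_mul_left f g c e : sb B f c -> sb B g e ->
  pair tau (f * g) = csum (fun w => f w * csum (fun y => g y * tau (w ++ y))).
Proof.
move=> fc ge; rewrite (pairM B0 tau_le fc ge).
have hb : bsum (fun p : word d * word d => normc (f p.1 * g p.2 * tau (p.1 ++ p.2))) (c * e).
  have := bsum_mul (fun w => sb_term0 f w B0) (fun w => sb_term0 g w B0) fc ge.
  apply: bsum_le => p; rewrite !normcM.
  have -> : B ^+ size p.1 * normc (f p.1) * (B ^+ size p.2 * normc (g p.2)) =
    normc (f p.1) * normc (g p.2) * B ^+ size (p.1 ++ p.2) by rewrite size_cat exprD; ring.
  by rewrite ler_wpM2l ?mulr_ge0 ?normc_ge0.
rewrite (csum_pair hb); apply: eq_csum => w.
have gw : bsum (fun y => normc (g y * tau (w ++ y))) (B ^+ size w * e).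
  have := bsumZ (exprn_ge0 (size w) B0) (fun w => sb_term0 g w B0) ge.
  apply: bsum_le => y; rewrite normcM mulrA -exprD -size_cat mulrC.
  by rewrite ler_wpM2r ?normc_ge0.
by rewrite -(csumZ _ gw); apply: eq_csum => y; rewrite mulrA.
Qed.

Lemma pair_sd_left i f W c e : sb B f c -> sb (B + 1) W e ->
  pair tau (f * (ncvarS R i + gradw i W) : ser R d) = csum (fun w => f w * sd_left W i w).
Proof.
move=> fc We; have Ge := sb_gradw i B0 We; have Xe := sb_ncvarS i B0.
rewrite (pair_mul_left fc (sbD B0 Xe Ge)); apply: eq_csum => w; congr (_ * _).
have h (g : ser R d) e' : sb B g e' -> bsum (fun y => normc (g y * tau (w ++ y))) (B ^+ size w * e').
  move=> ge; have := bsumZ (exprn_ge0 (size w) B0) (fun w => sb_term0 g w B0) ge.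
  apply: bsum_le => y; rewrite normcM mulrA -exprD -size_cat mulrC.
  by rewrite ler_wpM2r ?normc_ge0.
transitivity (csum (fun y => ncvarS R i y * tau (w ++ y) + gradw i W y * tau (w ++ y))).
  by apply: eq_csum => y; rewrite serDE mulrDl.
rewrite (csumD (h _ _ Xe) (h _ _ Ge)) /sd_left; congr (_ + _).
rewrite (csum1 (k := [:: i])) /ncvarS ?eqxx ?mul1r // => y /negbTE ->.
by rewrite mul0r.
Qed.

Lemma tensor_pairing_trace (P : 'I_d -> ncseries R d) : (forall i, is_ncpoly (P i)) ->
  tensor_pairing tau (\tr (ncJ P)) = \sum_i csum (fun w => P i w * sd_right i w).
Proof.
move=> Pp.
pose f (o : (word d * 'I_d) * word d) : C := P o.1.2 (o.1.1 ++ o.1.2 :: o.2) * (tau o.1.1 * tau o.2).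
have [S Ssup] : {S : 'I_d -> seq (word d) & forall i, uniq (S i) /\ forall w, w \notin S i -> P i w = 0}.
  apply: (@choice _ _ (fun i (s : seq (word d)) => uniq s /\ forall w, w \notin s -> P i w = 0)) => i.
  by have [s us Ps] := poly_support (Pp i); exists s.
pose s := undup (flatten [seq S i | i <- enum 'I_d]).
have us : uniq s by exact: undup_uniq.
have Ps i w : w \notin s -> P i w = 0.
  move=> ws; case: (Ssup i) => _; apply; apply: contraNN ws => ws.
  by rewrite mem_undup; apply/flatten_mapP; exists i; rewrite ?mem_enum.
pose t := undup (flatten [seq occ w | w <- s]).
have ut : uniq t by exact: undup_uniq.
have f0 o : o \notin t -> f o = 0.
  move=> ot; rewrite /f Ps ?mul0r //; apply: contraNN ot => ws.
  by rewrite mem_undup; apply/flatten_mapP; exists (o.1.1 ++ o.1.2 :: o.2) => //; rewrite mem_occ.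
have fb := bsum_finsupp ut f0.
have -> : tensor_pairing tau (\tr (ncJ P)) = csum (fun w => \sum_(o <- occ w) f o).
  rewrite (csum_occ fb) /tensor_pairing.
  have E m : (\tr (ncJ P)) m * (tau m.1 * tau m.2) = \sum_j f ((m.1, j), m.2).
    rewrite /mxtrace fct_sumE mulr_suml; apply: eq_bigr => j _.
    by rewrite mxE diff_quotE.
  rewrite (@fsbig_csum _ _ _ (undup [seq (o.1.1, o.2) | o <- t]) (undup_uniq _)).
    by apply: eq_csum => m; rewrite E.
  move=> m; rewrite mem_undup => mt; rewrite E big1 // => j _; apply: f0.
  by apply: contraNN mt => ot; apply/mapP; exists ((m.1, j), m.2) => //; rewrite -surjective_pairing.
have h i : bsum (fun w => normc (P i w * sd_right i w)) (\sum_(w <- s) normc (P i w * sd_right i w)).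
  apply: bsum_seq => // [w|w ws]; first exact: normc_ge0.
  by rewrite Ps // mul0r normc0.
rewrite -(csum_bigD _ h); apply: eq_csum => w.
rewrite (partition_big (fun o => o.1.2) xpredT) //=; apply: eq_bigr => i _.
rewrite /sd_right mulr_sumr big_seq_cond [RHS]big_seq_cond; apply: eq_bigr => q /andP[].
by rewrite mem_occ /f => /eqP -> /eqP ->.
Qed.

(** Both sides are linear in the test tuple, and the polynomials are spanned by
    the monomials. *)
Lemma schwinger_dysonP W e : sb (B + 1) W e -> schwinger_dyson W tau <-> sd_mono tau W.
Proof.
move=> We.
have key (P : 'I_d -> ncseries R d) : (forall i, is_ncpoly (P i)) ->
    nc_pairing tau (\sum_i ncmul (P i) (ncvar R i + cyc_grad i W)) (tensor_pairing tau (\tr (ncJ P)))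
    <-> \sum_i csum (fun w => P i w * sd_left W i w) = \sum_i csum (fun w => P i w * sd_right i w).
  move=> Pp; have Pb i : exists c, sb B (P i : ser R d) c.
    have [s us Ps] := poly_support (Pp i).
    exists (\sum_(w <- s) B ^+ size w * normc (P i w)); apply: bsum_seq => // [w|w ws].
      exact: sb_term0.
    by rewrite Ps // normc0 mulr0.
  have [c Pc] := choice Pb.
  have Gb i := sbD B0 (sb_ncvarS i B0) (sb_gradw i B0 We).
  have PG i := sb_mul B0 (Pc i) (Gb i).
  have E : (\sum_i ncmul (P i) (ncvar R i + cyc_grad i W)) =
      \sum_i (P i : ser R d) * (ncvarS R i + gradw i W) :> ser R d.
    by apply: eq_bigr => i _; rewrite ncmulE cyc_gradE.
  rewrite {}E (nc_pairingE _ (pair_sum tau_le (sb_sum _ B0 PG))).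
  rewrite -/(pair tau _) (pair_big tau_le _ PG) (tensor_pairing_trace Pp).
  rewrite (eq_bigr _ (fun i _ => pair_sd_left i (Pc i) We)).
  by split=> ->.
split=> [SD i p|sd P Pp]; last first.
  apply/(key P Pp); apply: eq_bigr => i _; apply: eq_csum => w; congr (_ * _).
  exact: sd.
pose P j : ncseries R d := if j == i then ncmono R p else 0.
have Pp j : is_ncpoly (P j).
  rewrite /P; case: eqP => _; last by apply: (sub_finite_set (B := set0)) => // w /=; rewrite eqxx.
  by apply: (sub_finite_set (B := [set p])) => // w /=; rewrite /ncmono; have [->|_] := eqVneq w p; rewrite ?eqxx.
have := (key P Pp).1 (SD P Pp).
have cs (g : 'I_d -> word d -> C) : \sum_j csum (fun w => P j w * g j w) = g i p.
  rewrite (bigD1 i) //= big1 ?addr0 => [|j ji].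
    rewrite (csum1 (k := p)) /P eqxx /ncmono ?eqxx ?mul1r // => w /negbTE ->.
    by rewrite mul0r.
  apply: etrans (csum0 _ (word d)); apply: eq_csum => w.
  by rewrite /P (negbTE ji) mul0r.
by rewrite !cs.
Qed.

End SchwingerDyson.

(** * Uniqueness of bounded solutions *)

Section Uniqueness.
Variables (R : realType) (n : nat).
Local Notation d := n.+1.
Local Notation C := (R[i]).

(** The sum over the letters of [p] telescopes after multiplication by [A - T]. *)
Lemma occ_geometric (A T : R) (p : word d) :
  (A - T) * \sum_(o <- occ p) A ^+ size o.1.1 * T ^+ size o.2 = A ^+ size p - T ^+ size p.
Proof.
elim: p => [|k p IH]; first by rewrite big_nil mulr0 subrr.
rewrite occ_cons /= mul1r.
have -> : \sum_(o <- occ p) A ^+ (size o.1.1).+1 * T ^+ size o.2 =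
    A * \sum_(o <- occ p) A ^+ size o.1.1 * T ^+ size o.2.
  by rewrite mulr_sumr; apply: eq_bigr => o _; rewrite exprS mulrA.
by rewrite mulrDr mulrCA IH !exprS; ring.
Qed.

Lemma occ_geometric' (A T : R) (p : word d) :
  (A - T) * \sum_(o <- occ p) T ^+ size o.1.1 * A ^+ size o.2 = A ^+ size p - T ^+ size p.
Proof.
elim: p => [|k p IH]; first by rewrite big_nil mulr0 subrr.
rewrite occ_cons /= mul1r.
have -> : \sum_(o <- occ p) T ^+ (size o.1.1).+1 * A ^+ size o.2 =
    T * \sum_(o <- occ p) T ^+ size o.1.1 * A ^+ size o.2.
  by rewrite mulr_sumr; apply: eq_bigr => o _; rewrite exprS mulrA.
by rewrite mulrDr mulrCA IH !exprS; ring.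
Qed.

(** The equation expresses the value at [p i] by values on shorter words and by
    a small gradient. In the supremum norm with weight [A ^ size] the former
    contribute a factor of order [1 / (A - T)] and the latter [e], against a
    gain of [A]: the distance of the two solutions is at most half of itself. *)
Lemma sd_mono_unique (t1 t2 : word d -> C) (W : ser R d) (A T e : R) :
  0 <= T -> 100 + 2 * T <= A -> e <= 1 -> sb (A + 1) W e ->
  (forall w, normc (t1 w) <= T ^+ size w) -> (forall w, normc (t2 w) <= T ^+ size w) ->
  t1 [::] = t2 [::] -> sd_mono t1 W -> sd_mono t2 W -> t1 = t2.
Proof.
move=> T0 AT e1 We b1 b2 t0 s1 s2.
have A0 : 0 <= A by lra.
have AT0 : 0 < A - T by lra.
have Ge i := sb_gradw i A0 We.
have TA (w : word d) : T ^+ size w <= A ^+ size w by rewrite lerXn2r ?nnegrE //; lra.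
have tA i p (t : word d -> C) : (forall w, normc (t w) <= T ^+ size w) ->
    bsum (fun y => normc (gradw i W y * t (p ++ y))) (A ^+ size p * e).
  move=> bt; apply: bsum_le (bsumZ (exprn_ge0 (size p) A0) (fun y => sb_term0 _ y A0) (Ge i)) => y.
  rewrite normcM mulrA -exprD -size_cat mulrC ler_wpM2r ?normc_ge0 //.
  exact: le_trans (bt _) (TA _).
pose del w := t1 w - t2 w.
suff H (k : nat) w : normc (del w) <= 2 * 2^-1 ^+ k * A ^+ size w.
  apply/funext => w; apply/eqP; rewrite -subr_eq0; apply/eqP.
  apply: (@geometric_eq0 _ _ (2 * A ^+ size w) 2^-1) => [||m]; [lra|lra|].
  by rewrite mulrAC; exact: H.
elim: k w => [|k IH] w.
  rewrite expr0 mulr1; apply: le_trans (normcB _ _) _.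
  have := TA w; have := b1 w; have := b2 w; lra.
set kp : R := 2 * 2^-1 ^+ k; have kp0 : 0 <= kp by rewrite mulr_ge0 ?exprn_ge0; lra.
case/lastP: w => [|p i].
  by rewrite /del t0 subrr normc0 !mulr_ge0 ?exprn_ge0; lra.
have E : del (rcons p i) = \sum_(o <- occ p | o.1.2 == i) (del o.1.1 * t1 o.2 + t2 o.1.1 * del o.2)
     - csum (fun y => gradw i W y * del (p ++ y)).
  have -> : csum (fun y => gradw i W y * del (p ++ y)) =
     csum (fun y => gradw i W y * t1 (p ++ y)) - csum (fun y => gradw i W y * t2 (p ++ y)).
    rewrite -(csumB (tA i p t1 b1) (tA i p t2 b2)).
    by apply: eq_csum => y; rewrite -mulrBr.
  have h1 := s1 i p; have h2 := s2 i p; rewrite cats1 in h1 h2.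
  transitivity ((t1 (rcons p i) + csum (fun y => gradw i W y * t1 (p ++ y)))
     - (t2 (rcons p i) + csum (fun y => gradw i W y * t2 (p ++ y))) -
     (csum (fun y => gradw i W y * t1 (p ++ y)) - csum (fun y => gradw i W y * t2 (p ++ y)))).
    by rewrite /del; ring.
  rewrite h1 h2 -sumrB; congr (_ - _); apply: eq_bigr => o _; rewrite /del; ring.
have D2 : normc (csum (fun y => gradw i W y * del (p ++ y))) <= kp * A ^+ size p * e.
  apply: csum_le; have k1 : 0 <= kp * A ^+ size p by rewrite mulr_ge0 ?exprn_ge0.
  apply: bsum_le (bsumZ k1 (fun y => sb_term0 _ y A0) (Ge i)) => y.
  rewrite normcM mulrC mulrA ler_wpM2r ?normc_ge0 //.
  by rewrite -mulrA -exprD -size_cat; exact: IH.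
have D1 : normc (\sum_(o <- occ p | o.1.2 == i) (del o.1.1 * t1 o.2 + t2 o.1.1 * del o.2)) <=
    kp * (\sum_(o <- occ p) A ^+ size o.1.1 * T ^+ size o.2 + \sum_(o <- occ p) T ^+ size o.1.1 * A ^+ size o.2).
  apply: le_trans (normc_sum _ _ _) _; rewrite -big_split mulr_sumr /= big_mkcond /=.
  apply: ler_sum => o _; case: ifP => _; last by rewrite mulr_ge0 ?addr_ge0 ?mulr_ge0 ?exprn_ge0.
  apply: le_trans (normcD _ _) _; rewrite [leRHS]mulrDr !normcM; apply: lerD.
    by rewrite mulrA ler_pM ?normc_ge0 //; exact: IH.
  by rewrite mulrCA ler_pM ?normc_ge0 //; exact: IH.
have G1 := occ_geometric A T p; have G2 := occ_geometric' A T p.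
set Z := \sum_(o <- occ p) A ^+ size o.1.1 * T ^+ size o.2 in D1 G1.
set Z' := \sum_(o <- occ p) T ^+ size o.1.1 * A ^+ size o.2 in D1 G2.
have Ap : 0 <= A ^+ size p by rewrite exprn_ge0.
have Tp : 0 <= T ^+ size p by rewrite exprn_ge0.
have Z1 : Z <= A ^+ size p / 50.
  have z0 : 0 <= Z by apply: sumr_ge0 => o _; rewrite mulr_ge0 ?exprn_ge0.
  by nra.
have Z2 : Z' <= A ^+ size p / 50.
  have z0 : 0 <= Z' by apply: sumr_ge0 => o _; rewrite mulr_ge0 ?exprn_ge0.
  by nra.
have e0 := sb_ge0 A0 (Ge i).
rewrite E; apply: le_trans (normcB _ _) _; apply: le_trans (lerD D1 D2) _.
have -> : 2 * 2^-1 ^+ k.+1 * A ^+ size (rcons p i) = kp * A ^+ size p * A / 2.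
  by rewrite size_rcons !exprS /kp; field.
have k1 : 0 <= kp * A ^+ size p by rewrite mulr_ge0.
have h1 : kp * (Z + Z') <= kp * (A ^+ size p / 25) by rewrite ler_wpM2l //; lra.
have h2 : kp * A ^+ size p * e <= kp * A ^+ size p * 1 by rewrite ler_wpM2l.
have h3 : kp * A ^+ size p * 100 <= kp * A ^+ size p * A by rewrite ler_wpM2l //; lra.
by lra.
Qed.

End Uniqueness.

(** * Square roots and norms in tracial C*-algebras *)

Section CStar.
Variables (R : realType) (M : cstarAlgType R).
Local Notation C := (R[i]).
Implicit Types (x y z a h : M) (c e : R).
Lemma cnorm0 : cnorm (0 : M) = 0.
Proof. by rewrite -(scale0r (0 : M)) cnormZ normc0 mul0r. Qed.

Lemma cnormN x : cnorm (- x) = cnorm x.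
Proof. by rewrite -scaleN1r cnormZ normcN (normc_nat R 1) mul1r. Qed.

Lemma cnorm_ge0 x : 0 <= cnorm x.
Proof. have := cnormD x (- x); rewrite subrr cnorm0 cnormN; lra. Qed.

Lemma cnormB x y : cnorm (x - y) <= cnorm x + cnorm y.
Proof. by rewrite -[cnorm y]cnormN cnormD. Qed.

Lemma cnorm_star x : cnorm (star x) = cnorm x.
Proof.
have le (z : M) : cnorm z <= cnorm (star z).
  have := cnorm_star_mul z; have := cnormM (star z) z; have := cnorm_ge0 z.
  rewrite le_eqVlt => /orP[/eqP <-|z0 h1 h2]; first by rewrite cnorm_ge0.
  by rewrite -(ler_pM2r z0) -expr2 -h2.
by apply/le_anti; rewrite le andbT -{2}(starK x) le.
Qed.

Lemma cnorm_sum (T : Type) (s : seq T) (P : pred T) (F : T -> M) :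
  cnorm (\sum_(t <- s | P t) F t) <= \sum_(t <- s | P t) cnorm (F t).
Proof.
elim/big_ind2: _ => [|x c y e xc ye|//]; first by rewrite cnorm0.
by apply: le_trans (cnormD _ _) _; exact: lerD.
Qed.

Lemma star0 : star (0 : M) = 0.
Proof. by apply: (addrI (star (0 : M))); rewrite -starD !addr0. Qed.
Lemma starN x : star (- x) = - star x.
Proof. by apply: (addrI (star x)); rewrite -starD !subrr star0. Qed.
Lemma starB x y : star (x - y) = star x - star y.
Proof. by rewrite starD starN. Qed.
Lemma star1 : star (1 : M) = 1.
Proof. by have := starM (star (1 : M)) 1; rewrite mulr1 !starK mulr1. Qed.
Lemma starX x k : star x = x -> star (x ^+ k) = x ^+ k.
Proof. by move=> xs; elim: k => [|k IH]; rewrite ?expr0 ?star1 // exprS starM IH xs -exprSr -exprS. Qed.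
Lemma star_sum (T : Type) (s : seq T) (F : T -> M) : star (\sum_(t <- s) F t) = \sum_(t <- s) star (F t).
Proof. by elim: s => [|t s IH]; rewrite ?big_nil ?star0 // !big_cons starD IH. Qed.

Lemma cnorm1 : cnorm (1 : M) <= 1.
Proof.
have := cnorm_star_mul (1 : M); rewrite star1 mulr1 => h; have := cnorm_ge0 1.
rewrite le_eqVlt => /orP[/eqP <-|p]; first by rewrite ler01.
suff : cnorm (1 : M) = 1 by move=> ->.
by apply: (mulfI (lt0r_neq0 p)); rewrite -expr2 -h mulr1.
Qed.

Definition clim (u : nat -> M) l := forall e, 0 < e ->
  exists N, forall k, (N <= k)%N -> cnorm (u k - l) <= e.

Lemma clim_cauchy (u : nat -> M) : (forall e, 0 < e -> exists N, forall k, (N <= k)%N ->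
    cnorm (u k - u N) <= e) -> exists l, clim u l.
Proof.
move=> H; have [e e0|l ul] := cnorm_complete u.
  have e30 : 0 < e / 3 by lra.
  have [N HN] := H _ e30; exists N => p q Np Nq.
  have -> : u p - u q = (u p - u N) - (u q - u N) by rewrite opprB addrA subrK.
  have := cnormB (u p - u N) (u q - u N); have := HN p Np; have := HN q Nq; lra.
move/cvgr0Pnorm_le: ul => ul; exists l => e e0; have [N _ HN] := ul e e0; exists N => k Nk.
by have := HN k Nk; apply: le_trans; exact: ler_norm.
Qed.

Lemma cnorm_le0 x : cnorm x <= 0 -> x = 0.
Proof. by move=> x0; apply: cnorm0_eq0; apply/le_anti; rewrite x0 cnorm_ge0. Qed.

Lemma cnorm_sub_eq x y : (forall e, 0 < e -> cnorm (x - y) <= e) -> x = y.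
Proof.
move=> H; apply/eqP; rewrite -subr_eq0; apply/eqP/cnorm_le0.
by apply/ler_addgt0Pr => e e0; rewrite add0r H.
Qed.

Lemma clim_unique u l l' : clim u l -> clim u l' -> l = l'.
Proof.
move=> ul ul'; apply: cnorm_sub_eq => e e0; have e20 : 0 < e / 2 by lra.
have [N HN] := ul _ e20; have [N' HN'] := ul' _ e20.
have h := HN _ (leq_maxl N N'); have h' := HN' _ (leq_maxr N N').
have -> : l - l' = (u (maxn N N') - l') - (u (maxn N N') - l).
  by rewrite opprB [RHS]addrC addrA subrK.
by have := cnormB (u (maxn N N') - l') (u (maxn N N') - l); lra.
Qed.

(** Limits pass through every map with a Lipschitz constant at the limit. *)
Lemma clim_map (f : M -> M) K u l : clim u l -> (forall k, cnorm (f (u k) - f l) <= K * cnorm (u k - l)) ->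
  clim (fun k => f (u k)) (f l).
Proof.
move=> ul fK e e0; have K1 : 0 < `|K| + 1 by have := normr_ge0 K; lra.
have [N HN] := ul _ (divr_gt0 e0 K1); exists N => k Nk; apply: le_trans (fK k) _.
have h := HN k Nk; rewrite ler_pdivlMr // in h.
have : K * cnorm (u k - l) <= (`|K| + 1) * cnorm (u k - l).
  by rewrite ler_wpM2r ?cnorm_ge0 //; have := ler_norm K; lra.
by rewrite [(_ + 1) * _]mulrC => /le_trans; apply.
Qed.

Lemma clim_le u l c : clim u l -> (forall k, cnorm (u k) <= c) -> cnorm l <= c.
Proof.
move=> ul uc; apply/ler_addgt0Pr => e e0; have [N HN] := ul e e0.
have -> : l = u N - (u N - l) by rewrite opprB addrC subrK.
by have := cnormB (u N) (u N - l); have := HN N (leqnn N); have := uc N; lra.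
Qed.

Lemma clim_shift u l : clim u l -> clim (fun k => u k.+1) l.
Proof. by move=> ul e e0; have [N HN] := ul e e0; exists N => k Nk; apply: HN; exact: leqW. Qed.

Lemma cnorm_half x : cnorm (2^-1 *: x) = 2^-1 * cnorm x.
Proof. by rewrite cnormZ normcV normc_nat. Qed.

Lemma cnorm_sqrB x y : cnorm (x * x - y * y) <= (cnorm x + cnorm y) * cnorm (x - y).
Proof.
have -> : x * x - y * y = x * (x - y) + (x - y) * y by rewrite mulrBr mulrBl addrA subrK.
apply: le_trans (cnormD _ _) _; rewrite [leRHS]mulrDl [cnorm y * _]mulrC.
by apply: lerD; exact: cnormM.
Qed.

Section SquareRoot.
Variable y : M.
Hypothesis ys : star y = y.
Hypothesis y1 : cnorm y <= 1.

(** The iteration [z' = (y + z^2) / 2] converges to [1 - sqrt (1 - y)]. It is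
    dominated by the same iteration for the number 1 ([sqrt_bound]), which
    tends to 1 like [1 - 2 / k], also when [cnorm y] is 1. *)
Fixpoint sqrt_iter k : M := if k is k.+1 then 2^-1 *: (y + sqrt_iter k * sqrt_iter k) else 0.
Fixpoint sqrt_bound k : R := if k is k.+1 then 2^-1 * (1 + sqrt_bound k * sqrt_bound k) else 0.

Lemma sqrt_bound_01 k : 0 <= sqrt_bound k <= 1.
Proof. by elim: k => [|k /andP[h1 h2]] /=; rewrite ?lexx ?ler01 //; apply/andP; split; nra. Qed.

Lemma sqrt_bound_rate k : 1 - sqrt_bound k <= 2 / k.+2%:R.
Proof.
elim: k => [|k IH] /=; first by rewrite subr0 divff ?pnatr_eq0.
have /andP[t0 t1] := sqrt_bound_01 k.
set s := 1 - sqrt_bound k in IH.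
have -> : 1 - 2^-1 * (1 + sqrt_bound k * sqrt_bound k) = s - s * s / 2 by rewrite /s; field.
have s0 : 0 <= s by rewrite /s; lra.
have m0 : (0 : R) <= k%:R by [].
rewrite ler_pdivlMr ?ltr0n // in IH; rewrite ler_pdivlMr ?ltr0n //.
have e3 : k.+3%:R = k%:R + 3 :> R by rewrite -addn3 natrD.
have e2 : k.+2%:R = k%:R + 2 :> R by rewrite -addn2 natrD.
rewrite e3; rewrite e2 in IH; set m : R := k%:R in IH m0 *.
have p2 : 0 < m + 2 by lra.
set b := 2 / (m + 2).
have b1 : b <= 1 by rewrite /b ler_pdivrMr //; lra.
have bm : b * (m + 2) = 2 by rewrite /b divfK // gt_eqF.
have b0 : 0 < b by rewrite /b divr_gt0.
have sb : s <= b by rewrite /b ler_pdivlMr.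
have h1 : s - s * s / 2 <= b - b * b / 2 by nra.
have h2 : (b - b * b / 2) * (m + 3) <= 2 by nra.
apply: le_trans h2; rewrite ler_wpM2r //; lra.
Qed.

Lemma sqrt_iter_le k : cnorm (sqrt_iter k) <= sqrt_bound k.
Proof.
elim: k => [|k IH] /=; first by rewrite cnorm0.
rewrite cnorm_half ler_wpM2l ?invr_ge0 //; apply: le_trans (cnormD _ _) _; apply: lerD => //.
by apply: le_trans (cnormM _ _) _; rewrite ler_pM ?cnorm_ge0.
Qed.

Lemma sqrt_iter_step k : cnorm (sqrt_iter k.+1 - sqrt_iter k) <= sqrt_bound k.+1 - sqrt_bound k.
Proof.
elim: k => [|k IH].
  by rewrite /= subr0 mulr0 addr0 mul0r addr0 subr0 cnorm_half ler_wpM2l ?invr_ge0.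
have -> : sqrt_iter k.+2 - sqrt_iter k.+1 =
    2^-1 *: (sqrt_iter k.+1 * sqrt_iter k.+1 - sqrt_iter k * sqrt_iter k).
  by rewrite -[sqrt_iter k.+2]/(2^-1 *: (y + sqrt_iter k.+1 * sqrt_iter k.+1))
     {2}/sqrt_iter -/sqrt_iter -scalerBr opprD addrACA subrr add0r.
have -> : sqrt_bound k.+2 - sqrt_bound k.+1 =
    2^-1 * ((sqrt_bound k.+1 + sqrt_bound k) * (sqrt_bound k.+1 - sqrt_bound k)).
  by rewrite /=; field.
rewrite cnorm_half ler_wpM2l ?invr_ge0 //; apply: le_trans (cnorm_sqrB _ _) _.
by rewrite ler_pM ?addr_ge0 ?cnorm_ge0 // lerD // sqrt_iter_le.
Qed.

Lemma sqrt_iter_dist j k : cnorm (sqrt_iter (j + k) - sqrt_iter k) <= sqrt_bound (j + k) - sqrt_bound k.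
Proof.
elim: j => [|j IH]; first by rewrite !add0n !subrr cnorm0.
have := cnormD (sqrt_iter (j + k).+1 - sqrt_iter (j + k)) (sqrt_iter (j + k) - sqrt_iter k).
by rewrite addrA subrK addSn; have := sqrt_iter_step (j + k); lra.
Qed.

(** The iterates are polynomials in [y] with real coefficients, so
    self-adjointness and commutation relations pass to the limit. *)
Lemma sqrt_one_sub : exists z, [/\ star z = z, cnorm z <= 1, (1 - z) * (1 - z) = 1 - y &
  forall c : M, c * y = y * c -> c * z = z * c].
Proof.
have [e e0|z zl] := @clim_cauchy sqrt_iter.
  have [N hN] : exists N : nat, 2 / e <= N.+2%:R.
    exists (Num.bound (2 / e)); have e2 : 0 <= 2 / e by rewrite divr_ge0 // ltW.
    have := archi_boundP e2; have : (Num.bound (2 / e))%:R <= (Num.bound (2 / e)).+2%:R :> R.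
      by rewrite ler_nat; apply: leqW; exact: leqnSn.
    by move=> h1 h2; apply: ltW; apply: lt_le_trans h2 h1.
  exists N => k Nk; rewrite -(subnK Nk); apply: le_trans (sqrt_iter_dist _ _) _.
  have /andP[_ h1] := sqrt_bound_01 (k - N + N); have h2 := sqrt_bound_rate N.
  have h3 : 2 / N.+2%:R <= e by rewrite ler_pdivrMr ?ltr0n // mulrC -ler_pdivrMr.
  by apply: le_trans h3; apply: le_trans h2; lra.
have zn : cnorm z <= 1.
  apply: (clim_le zl) => k; apply: le_trans (sqrt_iter_le k) _.
  by have /andP[] := sqrt_bound_01 k.
have it1 k : cnorm (sqrt_iter k) <= 1.
  by apply: le_trans (sqrt_iter_le k) _; have /andP[] := sqrt_bound_01 k.
have zeq : z = 2^-1 *: (y + z * z).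
  apply: (clim_unique (clim_shift zl)).
  apply: (clim_map (f := fun x => 2^-1 *: (y + x * x)) (K := 1) zl) => k.
  rewrite -scalerBr opprD addrACA subrr add0r cnorm_half mul1r.
  have := cnorm_sqrB (sqrt_iter k) z; have := it1 k; have := cnorm_ge0 (sqrt_iter k - z).
  by nra.
exists z; split=> //.
- apply: (@clim_unique (fun k => star (sqrt_iter k))).
    by apply: (clim_map (K := 1) zl) => k; rewrite -starB cnorm_star mul1r.
  have E k : star (sqrt_iter k) = sqrt_iter k.
    elim: k => [|k IH]; first exact: star0.
    rewrite /= starZ starD ys starM IH; congr (_ *: _).
    exact: conjc_natV.
  by move=> e e0; have [N HN] := zl e e0; exists N => k Nk; rewrite E; exact: HN.
- have two : z + z = y + z * z.
    have -> : z + z = 2 *: z by rewrite scaler_nat.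
    by rewrite {1}zeq scalerA mulfV ?scale1r // pnatr_eq0.
  have -> : y = z + z - z * z by rewrite two addrK.
  rewrite mulrBr mulr1 mulrBl mul1r !opprB -addrA; congr (_ + _).
  by rewrite opprD addrCA.
move=> c cy; apply: (@clim_unique (fun k => c * sqrt_iter k)).
  by apply: (clim_map (K := cnorm c) zl) => k; rewrite -mulrBr cnormM.
have E k : c * sqrt_iter k = sqrt_iter k * c.
  elim: k => [|k IH]; first by rewrite mulr0 mul0r.
  by rewrite /= -scalerAr -scalerAl mulrDr mulrDl cy mulrA IH -mulrA IH mulrA.
have : clim (fun k => sqrt_iter k * c) (z * c).
  by apply: (clim_map (f := fun x => x * c) (K := cnorm c) zl) => k; rewrite -mulrBl mulrC cnormM.
by move=> H e e0; have [N HN] := H e e0; exists N => k Nk; rewrite E; exact: HN.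
Qed.

End SquareRoot.

Definition imag : C := Complex 0 1.
Lemma imagM : imag * imag = -1.
Proof. by apply/eqP; rewrite eq_complex /= !(mul0r, mulr0, mulr1, subr0, add0r, addr0, oppr0) !eqxx. Qed.
Lemma conjc_imag : conjc imag = - imag.
Proof. by apply/eqP; rewrite eq_complex /= oppr0 !eqxx. Qed.

(** [a + i b] is [T] times a unitary, and [a] is its real part. *)
Lemma cnorm_real_part a b T : 0 <= T -> star a = a -> star b = b -> a * b = b * a ->
  a * a + b * b = (T ^+ 2)%:C%C *: 1 -> cnorm a <= T.
Proof.
move=> T0 sa sb ab E; pose u := a + imag *: b.
have su : star u = a - imag *: b by rewrite /u starD starZ sa sb conjc_imag scaleNr.
have uu : star u * u = (T ^+ 2)%:C%C *: 1.
  rewrite su /u mulrDr !mulrBl -!scalerAl -!scalerAr ab -E scalerA imagM scaleN1r opprK.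
  by rewrite addrA subrK.
have un : cnorm u <= T.
  rewrite -(ler_sqr (cnorm_ge0 u)) ?nnegrE // -cnorm_star_mul uu cnormZ normc_real.
  by rewrite ger0_norm ?exprn_ge0 // ler_piMr ?exprn_ge0 // cnorm1.
have aE : 2 *: a = u + star u by rewrite su /u addrACA subrr addr0 scaler_nat.
have := cnormD u (star u); rewrite -aE cnorm_star cnormZ normc_nat; lra.
Qed.

(** With [k = sqrt (1 - h^2)], [h + i k] is unitary, so [k] is a contraction,
    and so is [1 - h^2 = k^2]. *)
Lemma cnorm_one_sub_sqr h : star h = h -> cnorm h <= 1 -> cnorm (1 - h * h) <= 1.
Proof.
move=> hs h1; have h2s : star (h * h) = h * h by rewrite starM hs.
have h21 : cnorm (h * h) <= 1.
  apply: le_trans (cnormM _ _) _; have := cnorm_ge0 h; nra.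
have [z [zs z1 zz zc]] := sqrt_one_sub h2s h21.
have hz : h * z = z * h by apply: zc; rewrite mulrA.
have ks : star (1 - z) = 1 - z by rewrite starB star1 zs.
have kh : (1 - z) * h = h * (1 - z) by rewrite mulrBl mulrBr mul1r mulr1 hz.
have k1 : cnorm (1 - z) <= 1.
  apply: (cnorm_real_part ler01 ks hs kh); rewrite zz subrK expr1n.
  by rewrite (scale1r (1 : M)).
rewrite -zz; apply: le_trans (cnormM _ _) _; have := cnorm_ge0 (1 - z); nra.
Qed.

End CStar.

Section Trace.
Variables (R : realType) (M : tracialNCSpaceType R).
Local Notation C := (R[i]).
Implicit Types (x y z a h : M) (c e : R).

Lemma trace0 : trace (0 : M) = 0.
Proof. by rewrite -(scale0r (0 : M)) traceZ mul0r. Qed.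
Lemma traceN x : trace (- x) = - trace x.
Proof. by rewrite -scaleN1r traceZ mulN1r. Qed.
Lemma traceB x y : trace (x - y) = trace x - trace y.
Proof. by rewrite traceD traceN. Qed.
Lemma trace_sum (T : Type) (s : seq T) (F : T -> M) : trace (\sum_(t <- s) F t) = \sum_(t <- s) trace (F t).
Proof. by elim: s => [|t s IH]; rewrite ?big_nil ?trace0 // !big_cons traceD IH. Qed.

Definition rtrace x : R := Re (trace x).

Lemma rtraceD x y : rtrace (x + y) = rtrace x + rtrace y.
Proof. by rewrite /rtrace traceD; case: (trace x) (trace y) => [? ?] [? ?]. Qed.
Lemma rtraceN x : rtrace (- x) = - rtrace x.
Proof. by rewrite /rtrace traceN; case: (trace x). Qed.
Lemma rtraceB x y : rtrace (x - y) = rtrace x - rtrace y.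
Proof. by rewrite rtraceD rtraceN. Qed.
Lemma rtraceZ c x : rtrace (c%:C%C *: x) = c * rtrace x.
Proof. by rewrite /rtrace traceZ; case: (trace x) => [? ?] /=; rewrite mul0r subr0. Qed.

Lemma rtrace_ge0 x : 0 <= rtrace (star x * x).
Proof. by have := trace_ge0 x; rewrite /rtrace lecE /= => /andP[]. Qed.
Lemma itrace_sqr x : Im (trace (star x * x)) = 0.
Proof. by have := trace_ge0 x; rewrite lecE /= => /andP[/eqP]. Qed.

Lemma rtrace_faithful x : rtrace (star x * x) = 0 -> x = 0.
Proof.
move=> h; apply: trace_faithful; apply/eqP; rewrite eq_complex /=.
by rewrite [Re _]h itrace_sqr !eqxx.
Qed.

(** The trace of [x* x] is real; polarize with [x + 1] and [x + i]. *)
Lemma trace_star x : trace (star x) = conjc (trace x).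
Proof.
have h1 := itrace_sqr (x + 1); have h2 := itrace_sqr (x + imag R *: 1).
rewrite starD star1 mulrDr !mulrDl !mulr1 mul1r !traceD trace1 in h1.
rewrite starD starZ star1 conjc_imag mulrDr !mulrDl -!scalerAr -!scalerAl !mulr1 !mul1r in h2.
rewrite !traceD !traceZ trace1 in h2.
have hx := itrace_sqr x; move: h1 h2 hx.
case: (trace x) => a b; case: (trace (star x)) => a' b'; case: (trace (star x * x)) => p q /=.
rewrite !(mul0r, mulr0, mulr1, mul1r, subr0, sub0r, add0r, addr0, oppr0) => h1 h2 hq.
by apply/eqP; rewrite eq_complex /=; apply/andP; split; apply/eqP; lra.
Qed.

(** [1 - x] is the square of a self-adjoint element. *)
Lemma rtrace_le x : star x = x -> cnorm x <= 1 -> forall z, rtrace (star z * x * z) <= rtrace (star z * z).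
Proof.
move=> xs x1 z; have [w [ws w1 ww _]] := sqrt_one_sub xs x1.
have := rtrace_ge0 ((1 - w) * z); rewrite starM starB star1 ws mulrA -[_ * _ * (1 - w)]mulrA ww.
by rewrite mulrBr mulr1 mulrBl rtraceB subr_ge0.
Qed.

Lemma rtrace_le_norm x z : star x = x -> rtrace (star z * x * z) <= cnorm x * rtrace (star z * z).
Proof.
move=> xs; have := cnorm_ge0 x; rewrite le_eqVlt => /orP[/eqP x0|x0].
  have -> : x = 0 by apply: cnorm_le0; rewrite -x0.
  by rewrite mulr0 mul0r cnorm0 mul0r /rtrace trace0.
have hs : star ((cnorm x)^-1%:C%C *: x) = (cnorm x)^-1%:C%C *: x by rewrite starZ xs conjc_real.
have hn : cnorm ((cnorm x)^-1%:C%C *: x) <= 1.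
  by rewrite cnormZ normc_real gtr0_norm ?invr_gt0 // mulVf ?gt_eqF.
have := rtrace_le hs hn z; rewrite -scalerAr -scalerAl rtraceZ mulrC.
by rewrite ler_pdivrMr // mulrC.
Qed.

(** After multiplication by a phase, apply [rtrace_le_norm] to the real part. *)
Lemma normc_trace_le x : normc (trace x) <= cnorm x.
Proof.
have [->|t0] := eqVneq (trace x) 0; first by rewrite normc0 cnorm_ge0.
have n0 : 0 < normc (trace x).
  by rewrite lt_def normc_ge0 andbT; apply: contraNneq t0 => /eq0_normc ->.
pose c : C := conjc (trace x) * (normc (trace x))^-1%:C%C.
have nc : normc c = 1.
  by rewrite normcM normc_conj normc_real ger0_norm ?invr_ge0 ?ltW // divff // gt_eqF.
have tc : trace (c *: x) = (normc (trace x))%:C%C.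
  rewrite traceZ /c mulrAC; move: n0; case: (trace x) => a b /=; set s := Num.sqrt _ => s0.
  have s2 : a ^+ 2 + b ^+ 2 = s ^+ 2 by rewrite sqr_sqrtr // addr_ge0 ?sqr_ge0.
  apply/eqP; rewrite eq_complex /=; apply/andP; split; apply/eqP; last by ring.
  rewrite !mulr0 subr0; have -> : a * a - - b * b = s ^+ 2 by rewrite -s2; ring.
  by rewrite expr2 mulfK // gt_eqF.
pose y := c *: x + star (c *: x).
have ys : star y = y by rewrite starD starK addrC.
have h := rtrace_le_norm 1 ys.
rewrite star1 mulr1 !mul1r in h.
have e1 : rtrace (1 : M) = 1 by rewrite /rtrace trace1.
have e2 : rtrace y = 2 * normc (trace x).
  by rewrite /y rtraceD /rtrace trace_star tc /=; ring.
rewrite e1 e2 mulr1 in h.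
have := cnormD (c *: x) (star (c *: x)); rewrite -/y cnorm_star cnormZ nc mul1r; lra.
Qed.

(** Let [g = |h|] and let [n = g - h] be twice the negative part. Then
    [h n = - g n], so [tau (n h n) >= 0] forces [g^(1/2) n = 0] by
    faithfulness, hence [n^2 = 2 g n = 0] and [h = g]. *)
Lemma sqrt_of_trace_ge0 h : star h = h -> cnorm h <= 1 ->
  (forall x, 0 <= rtrace (star x * h * x)) ->
  exists r, [/\ star r = r, r * r = h & forall c : M, c * h = h * c -> c * r = r * c].
Proof.
move=> hs h1 pos.
have ys : star (1 - h * h) = 1 - h * h by rewrite starB star1 starM hs.
have [z [zs z1 zz zc]] := sqrt_one_sub ys (cnorm_one_sub_sqr hs h1).
rewrite subKr in zz.
have [w [ws w1 ww wc]] := sqrt_one_sub zs z1.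
have cz (c : M) : c * h = h * c -> c * z = z * c.
  by move=> ch; apply: zc; rewrite mulrBr mulrBl mulr1 mul1r mulrA ch -mulrA ch mulrA.
have cw (c : M) : c * h = h * c -> c * (1 - w) = (1 - w) * c.
  by move=> ch; rewrite mulrBr mulrBl mulr1 mul1r (wc c) //; exact: cz.
set r := 1 - w in ww cw; set g := 1 - z in zz ww.
have rs : star r = r by rewrite starB star1 ws.
have gs : star g = g by rewrite starB star1 zs.
clearbody r g.
have hr : h * r = r * h by exact: cw.
have hg : h * g = g * h by rewrite -ww [LHS]mulrA hr -[LHS]mulrA hr mulrA.
have rg : r * g = g * r by rewrite -ww mulrA.
pose n := g - h.
have ns : star n = n by rewrite /n starB gs hs.
have nr : n * r = r * n by rewrite /n mulrBl mulrBr rg hr.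
have hn : h * n = - (g * n) by rewrite /n !mulrBr zz hg opprB.
have nn : n * n = 2 *: (g * n).
  by rewrite {1}/n mulrBl hn opprK -mulr2n scaler_nat.
have rn : r * n = 0.
  apply: rtrace_faithful; apply/le_anti; rewrite rtrace_ge0 andbT.
  have := pos n; rewrite ns -mulrA hn mulrN rtraceN oppr_ge0.
  by rewrite starM ns rs -mulrA [r * (r * n)]mulrA ww.
have n0 : n = 0.
  apply: cnorm_le0; have := cnorm_star_mul n; rewrite ns nn -ww -mulrA rn mulr0 scaler0 cnorm0.
  by move/esym/eqP; rewrite sqrf_eq0 => /eqP ->.
exists r; split=> //; rewrite ww; apply/eqP; rewrite -subr_eq0; exact/eqP.
Qed.

Lemma rtrace_cauchy_schwarz x b : star b = b ->
  rtrace (star x * b * x) ^+ 2 <= rtrace (star x * (b * b) * x) * rtrace (star x * x).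
Proof.
move=> bs.
set p := rtrace (star x * b * x); set q := rtrace (star x * (b * b) * x); set r := rtrace _.
have H c : 0 <= q - 2 * c * p + c ^+ 2 * r.
  have := rtrace_ge0 ((b - c%:C%C *: 1) * x).
  have -> : star ((b - c%:C%C *: 1) * x) * ((b - c%:C%C *: 1) * x) =
     star x * (b * b) * x - c%:C%C *: (star x * b * x) - c%:C%C *: (star x * b * x)
     + (c ^+ 2)%:C%C *: (star x * x).
    have -> : (b - c%:C%C *: 1) * x = b * x - c%:C%C *: x by rewrite mulrBl -scalerAl mul1r.
    rewrite starB starM starZ bs conjc_real mulrBl !mulrBr -!scalerAl -!scalerAr.
    by rewrite scalerA -rmorphM -expr2 !mulrA opprB addrA addrAC.
  rewrite rtraceD !rtraceB !rtraceZ -/p -/q -/r; lra.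
have r0 : 0 <= r by exact: rtrace_ge0.
have q0 : 0 <= q by have := H 0; rewrite mulr0 mul0r expr0n mul0r subr0 addr0.
move: r0; rewrite le_eqVlt => /orP[/eqP r0|r0].
  have p0 : p = 0 by rewrite /p (rtrace_faithful (esym r0)) mulr0 /rtrace trace0.
  by rewrite p0 -r0 mulr0 expr0n.
have := H (p / r); rewrite expr_div_n.
have -> : q - 2 * (p / r) * p + p ^+ 2 / r ^+ 2 * r = (q * r - p ^+ 2) / r by field; rewrite gt_eqF.
by rewrite pmulr_lge0 ?invr_gt0 // subr_ge0.
Qed.

(** Were the ratio [q] of the two sides more than 1, the inequality of Cauchy
    and Schwarz would make [tau (x* a^(2^(k+1)) x)] grow like [(q T^2)^(2^k)];
    by traciality it is at most a constant times [tau (a^(2^(k+1)))], that is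
    [T^(2^(k+1))]. *)
Lemma rtrace_sqr_le a T x : star a = a -> 0 < T -> (forall k, rtrace (a ^+ k) <= T ^+ k) ->
  rtrace (star x * (a * a) * x) <= T ^+ 2 * rtrace (star x * x).
Proof.
move=> sa T0 mom; rewrite leNgt; apply/negP => gt.
set r := rtrace (star x * x) in gt.
have r0 : 0 <= r by exact: rtrace_ge0.
have x0 : r != 0.
  apply: contraTneq gt => r0'; rewrite (rtrace_faithful r0') mulr0 /r (rtrace_faithful r0').
  by rewrite /rtrace mulr0 trace0 /= mulr0 ltxx.
have rp : 0 < r by rewrite lt_def x0.
(* The exponents are doubled at each step, because [rtrace_cauchy_schwarz]
   squares the middle factor. *)
pose m k := rtrace (star x * (a ^+ (2 ^ k.+1)) * x).
pose q := m 0%N / (T ^+ 2 * r).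
have T2 : 0 < T ^+ 2 by rewrite exprn_gt0.
have q1 : 1 < q by rewrite /q ltr_pdivlMr ?mulr_gt0 // mul1r /m expr2.
have Q0 : 0 <= q * T ^+ 2 by rewrite mulr_ge0 ?ltW // (lt_trans ltr01).
have mk k : (q * T ^+ 2) ^+ (2 ^ k) * r <= m k.
  elim: k => [|k IH]; first by rewrite expr1 /q -mulrA divfK // mulf_neq0 // gt_eqF.
  have cs := rtrace_cauchy_schwarz x (starX (2 ^ k.+1) sa).
  rewrite -exprD addnn -mul2n -expnS -/r -/(m k) -/(m k.+1) in cs.
  rewrite -(ler_pM2r rp); apply: le_trans cs.
  rewrite expnS mulnC exprM -mulrA -expr2 -exprMn lerXn2r ?nnegrE //.
    by rewrite mulr_ge0 ?(exprn_ge0 _ Q0).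
  by apply: le_trans IH; rewrite mulr_ge0 ?(exprn_ge0 _ Q0).
pose K := cnorm (x * star x).
have mK k : m k <= K * (T ^+ 2) ^+ (2 ^ k).
  have -> : m k = rtrace (star (a ^+ (2 ^ k)) * (x * star x) * a ^+ (2 ^ k)).
    rewrite starX // /m expnS mul2n -addnn exprD /rtrace; congr Re.
    by rewrite traceC !mulrA traceC !mulrA.
  apply: le_trans (rtrace_le_norm _ _) _; first by rewrite starM starK.
  rewrite starX // -exprD addnn -mul2n -exprM ler_wpM2l ?cnorm_ge0 //; exact: mom.
have qk k : q ^+ (2 ^ k) <= K / r.
  rewrite ler_pdivlMr // -(ler_pM2r (exprn_gt0 (2 ^ k) T2)) mulrAC -exprMn.
  exact: le_trans (mk k) (mK k).
clearbody q.
have grow k : 1 + k%:R * (q - 1) <= q ^+ (2 ^ k).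
  have : 1 + k%:R * (q - 1) <= q ^+ k.
    elim: k => [|k IH]; first by rewrite mul0r addr0 expr0.
    have k0 : (0 : R) <= k%:R by [].
    have h1 : 0 <= k%:R * ((q - 1) * (q - 1)) by rewrite !mulr_ge0 //; lra.
    have h2 : q * (1 + k%:R * (q - 1)) <= q * q ^+ k by rewrite ler_wpM2l //; lra.
    by rewrite exprS -natr1; nra.
  move/le_trans; apply; apply: ler_weXn2l; first exact: ltW.
  by apply: ltnW; exact: ltn_expl.
have Kr : 0 <= K / r / (q - 1).
  by rewrite !mulr_ge0 ?invr_ge0 ?cnorm_ge0 //; lra.
have := archi_boundP Kr; set N := Num.bound _; rewrite ltr_pdivrMr; last lra.
have := qk N; have := grow N; lra.
Qed.

(** [T^2 - a^2] is nonnegative for the trace, hence a square [r^2] of an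
    element that commutes with [a] (after scaling by [c] into the unit ball),
    and then [a + i r] is [T] times a unitary. *)
Lemma cnorm_le_of_moments a T : star a = a -> 0 < T -> (forall k, rtrace (a ^+ k) <= T ^+ k) ->
  cnorm a <= T.
Proof.
move=> sa T0 mom.
(* The scaling makes [T^2 - a^2] a contraction, as [sqrt_of_trace_ge0] asks
   for. *)
have n0 := cnorm_ge0 a; pose c := (T ^+ 2 + cnorm a ^+ 2)^-1.
have T2 : 0 < T ^+ 2 by rewrite exprn_gt0.
have c0 : 0 < c by rewrite invr_gt0 ltr_pwDl // exprn_ge0.
pose h := c%:C%C *: ((T ^+ 2)%:C%C *: 1 - a * a).
have hs : star h = h by rewrite /h starZ starB starZ star1 starM sa !conjc_real.
have hn : cnorm h <= 1.
  rewrite /h cnormZ normc_real gtr0_norm // mulrC /c ler_pdivrMr ?mul1r; last by rewrite -invr_gt0.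
  apply: le_trans (cnormB _ _) _; apply: lerD; last by rewrite expr2; exact: cnormM.
  by rewrite cnormZ normc_real gtr0_norm // ler_piMr ?cnorm1 // ltW.
have pos x : 0 <= rtrace (star x * h * x).
  have -> : star x * h * x = c%:C%C *: ((T ^+ 2)%:C%C *: (star x * x) - star x * (a * a) * x).
    by rewrite /h -scalerAr -scalerAl mulrBr mulrBl -scalerAr mulr1 -scalerAl.
  by rewrite rtraceZ rtraceB rtraceZ mulr_ge0 ?subr_ge0 ?rtrace_sqr_le // ltW.
have [r [rs rr rc]] := sqrt_of_trace_ge0 hs hn pos.
have ar : a * r = r * a.
  by apply: rc; rewrite /h -scalerAr -scalerAl mulrBr mulrBl -scalerAr -scalerAl mulr1 mul1r mulrA.
pose t := Num.sqrt c^-1.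
have tt : (t%:C * t%:C * c%:C = 1 :> C)%C.
  have t2 : t * t = c^-1 by rewrite -expr2 sqr_sqrtr // invr_ge0 ltW.
  by rewrite -!rmorphM t2 mulVf ?gt_eqF ?rmorph1.
apply: (@cnorm_real_part R M a (t%:C%C *: r) T (ltW T0) sa).
- by rewrite starZ rs conjc_real.
- by rewrite -scalerAr -scalerAl ar.
by rewrite -scalerAr -scalerAl rr /h !scalerA tt scale1r addrC subrK.
Qed.

End Trace.

Lemma uniq_flatten_fiber (S T : eqType) (g : S -> seq T) (k : T -> S) (s : seq S) : uniq s ->
  (forall x, uniq (g x)) -> (forall x p, p \in g x -> k p = x) -> uniq (flatten [seq g x | x <- s]).
Proof.
move=> us ug gk; elim: s us => //= x s IH /andP[xs us]; rewrite cat_uniq ug IH // andbT /=.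
apply/hasPn => p /flatten_mapP[z zs /gk pz]; apply: contraNN xs => /gk px.
by rewrite -px pz.
Qed.

(** * Evaluation of series at operators *)

Section Evaluation.
Variables (R : realType) (n : nat) (M : cstarAlgType R).
Local Notation d := n.+1.
Local Notation C := (R[i]).
Implicit Types (u v w : word d) (f g : ser R d) (x y : M) (c e : R).

Lemma big_words_sub (F : word d -> M) N k : (N <= k)%N ->
  \sum_(w <- words d k | w \in words d N) F w = \sum_(w <- words d N) F w.
Proof.
move=> Nk; rewrite -big_filter; apply: perm_big; apply: uniq_perm; rewrite ?filter_uniq ?uniq_words //.
move=> w; rewrite mem_filter !mem_words; apply/andP/idP => [[]//|wN].
by rewrite wN (leq_trans wN Nk).
Qed.

(** Absolute convergence implies convergence by degree, by completeness. *)
Lemma wsums_exists (F : word d -> M) c : bsum (fun w => cnorm (F w)) c ->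
  exists l, wsums_to (@cnorm R M) F l.
Proof.
move=> Fc; have F0 w := cnorm_ge0 (F w).
have [e e0|l ul] := @clim_cauchy R M (fun N => \sum_(w <- words d N) F w).
  have [s us se] := bsum_tail F0 Fc e0.
  have [N sN] := words_cover s; exists N => k Nk.
  have -> : \sum_(w <- words d k) F w - \sum_(w <- words d N) F w =
      \sum_(w <- words d k | w \notin words d N) F w.
    rewrite (bigID (fun w => w \in words d N)) /= addrAC.
    by rewrite big_words_sub // subrr add0r.
  apply: le_trans (cnorm_sum _ _ _) _; rewrite -big_filter.
  have se0 w : 0 <= (if w \in s then 0 else cnorm (F w)) by case: ifP.
  have := bsum_sum se0 se (filter_uniq (fun w => w \notin words d N) (uniq_words d k)).
  rewrite !big_filter; apply: le_trans; rewrite le_eqVlt; apply/orP; left; apply/eqP.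
  by apply: eq_bigr => w wN; rewrite ifF //; apply: contraNF wN; exact: sN.
exists l; apply: wsums_to_near => [e e0|x]; last exact: cnorm_ge0.
exact: ul.
Qed.

Lemma wsums_clim (F : word d -> M) l : wsums_to (@cnorm R M) F l ->
  clim (fun N => \sum_(w <- words d N) F w) l.
Proof. by move=> Fl e e0; exact: near_wsums_to Fl e e0. Qed.

Lemma clim_wsums (F : word d -> M) l : clim (fun N => \sum_(w <- words d N) F w) l ->
  wsums_to (@cnorm R M) F l.
Proof. by move=> Fl; apply: wsums_to_near => [e e0|x]; [exact: Fl|exact: cnorm_ge0]. Qed.

Lemma climD (a b : nat -> M) x y : clim a x -> clim b y -> clim (fun k => a k + b k) (x + y).
Proof.
move=> ax bx e e0; have e20 : 0 < e / 2 by lra.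
have [N HN] := ax _ e20; have [N' HN'] := bx _ e20; exists (maxn N N') => k.
rewrite geq_max => /andP[/HN h1 /HN' h2]; rewrite opprD addrACA.
by have := cnormD (a k - x) (b k - y); lra.
Qed.

Lemma clim_bound (a : nat -> M) x : clim a x -> exists N, forall k, (N <= k)%N -> cnorm (a k) <= cnorm x + 1.
Proof.
move=> ax; have [N HN] := ax 1 ltr01; exists N => k /HN h.
by have := cnormD (a k - x) x; rewrite subrK; lra.
Qed.

Lemma climM (a b : nat -> M) x y : clim a x -> clim b y -> clim (fun k => a k * b k) (x * y).
Proof.
move=> ax bx e e0; have [N0 H0] := clim_bound ax.
have x1 : 0 < cnorm x + 1 by have := cnorm_ge0 x; lra.
have y1 : 0 < cnorm y + 1 by have := cnorm_ge0 y; lra.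
have e1 : 0 < e / 2 / (cnorm y + 1) by rewrite !divr_gt0.
have e2 : 0 < e / 2 / (cnorm x + 1) by rewrite !divr_gt0.
have [N HN] := ax _ e1; have [N' HN'] := bx _ e2.
exists (maxn N0 (maxn N N')) => k; rewrite !geq_max => /and3P[/H0 h0 /HN h1 /HN' h2].
have -> : a k * b k - x * y = a k * (b k - y) + (a k - x) * y.
  by rewrite mulrBr mulrBl addrA subrK.
rewrite ler_pdivlMr // in h1; rewrite ler_pdivlMr // in h2.
apply: le_trans (cnormD _ _) _; have m1 := cnormM (a k) (b k - y); have m2 := cnormM (a k - x) y.
have n1 := cnorm_ge0 (b k - y); have n2 := cnorm_ge0 (a k - x); have n3 := cnorm_ge0 y.
have : cnorm (a k) * cnorm (b k - y) <= (cnorm x + 1) * cnorm (b k - y) by rewrite ler_wpM2r.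
nra.
Qed.

Variables (Y : 'I_d -> M) (B : R).
Hypothesis B0 : 0 <= B.
Hypothesis YB : forall i, cnorm (Y i) <= B.

Lemma monom_nil : monom Y [::] = 1.
Proof. by rewrite /monom big_nil. Qed.
Lemma monom_cat u v : monom Y (u ++ v) = monom Y u * monom Y v.
Proof. by rewrite /monom big_cat. Qed.
Lemma monom_cons k w : monom Y (k :: w) = Y k * monom Y w.
Proof. by rewrite /monom big_cons. Qed.

Lemma monom_le w : cnorm (monom Y w) <= B ^+ size w.
Proof.
elim: w => [|k w IH]; first by rewrite monom_nil expr0 cnorm1.
rewrite monom_cons exprS; apply: le_trans (cnormM _ _) _.
by rewrite ler_pM ?cnorm_ge0.
Qed.

Lemma term_le f w : cnorm (f w *: monom Y w) <= B ^+ size w * normc (f w).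
Proof. by rewrite cnormZ mulrC ler_wpM2r ?normc_ge0 ?monom_le. Qed.

Lemma series_eval_exists f c : sb B f c -> exists x, series_eval f Y x.
Proof.
by move=> fc; apply: wsums_exists (c) _; apply: bsum_le fc => w; exact: term_le.
Qed.

Lemma series_evalD f g x y : series_eval f Y x -> series_eval g Y y -> series_eval (f + g) Y (x + y).
Proof.
move=> /wsums_clim fx /wsums_clim gy; apply: clim_wsums.
have := climD fx gy; congr clim; apply/funext => N; rewrite -big_split /=.
by apply: eq_bigr => w _; rewrite -scalerDl.
Qed.

Lemma series_eval_finite f N x : (forall w, (N <= size w)%N -> f w = 0) ->
  \sum_(w <- words d N) f w *: monom Y w = x -> series_eval f Y x.
Proof.
move=> f0 <-; apply: clim_wsums => e e0; exists N => k Nk.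
have -> : \sum_(w <- words d k) f w *: monom Y w = \sum_(w <- words d N) f w *: monom Y w.
  rewrite (bigID (fun w => w \in words d N)) /= big_words_sub // [X in _ + X]big1 ?addr0 // => w.
  by rewrite mem_words -leqNgt => wN; rewrite f0 // scale0r.
by rewrite subrr cnorm0 ltW.
Qed.

Lemma series_eval1 : series_eval (1 : ser R d) Y 1.
Proof.
apply: (@series_eval_finite _ 1) => [w|].
  by rewrite ser1E; case: w.
rewrite (bigD1_seq [::]) ?mem_words ?uniq_words //= big1 ?addr0 => [|w /negbTE w0].
  by rewrite ser1E eqxx scale1r monom_nil.
by rewrite ser1E w0 scale0r.
Qed.

Lemma series_eval_var i : series_eval (ncvarS R i) Y (Y i).
Proof.
apply: (@series_eval_finite _ 2) => [w|].
  by rewrite /ncvarS; case: eqP => // ->.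
rewrite (bigD1_seq [:: i]) ?mem_words ?uniq_words //= big1 ?addr0 => [|w /negbTE wi].
  by rewrite /ncvarS eqxx scale1r /monom big_seq1.
by rewrite /ncvarS wi scale0r.
Qed.

(** The product of two partial sums of degree less than [N] contains all the
    terms of the partial sum of the product; the remaining ones have total
    degree at least [N] and are a tail of a summable family. *)
Lemma series_evalM f g c e x y : sb B f c -> sb B g e -> series_eval f Y x -> series_eval g Y y ->
  series_eval (f * g) Y (x * y).
Proof.
move=> fc ge /wsums_clim fx /wsums_clim gy; apply: clim_wsums.
have ab := climM fx gy.
pose h (p : word d * word d) : M := (f p.1 *: monom Y p.1) * (g p.2 *: monom Y p.2).
pose pairs N := [seq (u, v) | u <- words d N, v <- words d N].
pose low N (p : word d * word d) := (size p.1 + size p.2 < N)%N.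
have up N : uniq (pairs N) by apply: allpairs_uniq; rewrite ?uniq_words // => -[? ?] [? ?].
have mp N p : (p \in pairs N) = (size p.1 < N)%N && (size p.2 < N)%N.
  apply/allpairsP/andP => [[[a b] /= [h1 h2 ->]]|[h1 h2]]; first by rewrite -!mem_words.
  by exists p; rewrite !mem_words; case: p h1 h2.
have AB N : (\sum_(w <- words d N) f w *: monom Y w) * (\sum_(w <- words d N) g w *: monom Y w) =
    \sum_(p <- pairs N) h p.
  by rewrite big_allpairs mulr_suml; apply: eq_bigr => u _; rewrite mulr_sumr.
have P N : \sum_(w <- words d N) (f * g : ser R d) w *: monom Y w = \sum_(p <- pairs N | low N p) h p.
  transitivity (\sum_(p <- flatten [seq wfacts w | w <- words d N]) h p).
    rewrite [RHS]big_flatten big_map; apply: eq_bigr => w _; rewrite sermulE scaler_suml.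
    apply: eq_big_seq => p; rewrite mem_wfacts => /eqP <-.
    by rewrite monom_cat /h -scalerAl -scalerAr scalerA.
  rewrite -[RHS]big_filter; apply: perm_big; apply: uniq_perm; rewrite ?filter_uniq //.
    by apply: (uniq_flatten_fiber (k := fun p => p.1 ++ p.2)) => [||w p]; rewrite ?uniq_words //;
      [exact: uniq_wfacts|rewrite mem_wfacts => /eqP].
  move=> p; rewrite mem_filter mp /low; apply/flatten_mapP/andP => [[w]|[pN _]].
    rewrite mem_words mem_wfacts => wN /eqP pw; rewrite -pw size_cat in wN.
    by rewrite wN (leq_ltn_trans (leq_addr _ _) wN) (leq_ltn_trans (leq_addl _ _) wN).
  by exists (p.1 ++ p.2); rewrite ?mem_words ?size_cat ?mem_wfacts.
have hb : bsum (fun p => cnorm (h p)) (c * e).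
  apply: bsum_le (bsum_mul (fun w => sb_term0 f w B0) (fun w => sb_term0 g w B0) fc ge) => p.
  apply: le_trans (cnormM _ _) _.
  by rewrite ler_pM ?cnorm_ge0 ?term_le.
move=> e1 e10; have e20 : 0 < e1 / 2 by lra.
have h0 p := cnorm_ge0 (h p).
have [s us se] := bsum_tail h0 hb e20.
have [N1 H1] := ab _ e20.
pose N2 := (\max_(p <- s) (size p.1 + size p.2)).+1.
have sN p : p \in s -> low N2 p.
  by move=> ps; rewrite /low ltnS (big_rem p ps) /= leq_maxl.
exists (maxn N1 N2) => k; rewrite geq_max => /andP[/H1 k1 k2].
rewrite AB (bigID (low k)) /= in k1; rewrite P.
set S := \sum_(p <- pairs k | low k p) h p in k1 *.
set S' := \sum_(p <- pairs k | ~~ low k p) h p in k1.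
have S'e : cnorm S' <= e1 / 2.
  apply: le_trans (cnorm_sum _ _ _) _.
  have se0 p : 0 <= (if p \in s then 0 else cnorm (h p)) by case: ifP.
  have := bsum_sum se0 se (filter_uniq (fun p => ~~ low k p) (up k)).
  rewrite !big_filter; apply: le_trans; rewrite le_eqVlt; apply/orP; left; apply/eqP.
  apply: eq_bigr => p pk; rewrite ifF //; apply: contraNF pk => /sN.
  by rewrite /low => /leq_trans; apply.
have -> : S - x * y = (S + S' - x * y) - S' by rewrite addrAC addrK.
by have := cnormB (S + S' - x * y) S'; lra.
Qed.

End Evaluation.

Section LawOfSeries.
Variables (R : realType) (n : nat) (M : tracialNCSpaceType R).
Local Notation d := n.+1.
Local Notation C := (R[i]).
Implicit Types (u v w : word d) (f g : ser R d) (x y : M) (c e : R).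

Variables (Y : 'I_d -> M) (B : R).
Hypothesis B0 : 0 <= B.
Hypothesis YB : forall i, cnorm (Y i) <= B.

Lemma law_le w : normc (law Y w) <= B ^+ size w.
Proof. by apply: le_trans (normc_trace_le _) _; exact: monom_le. Qed.

(** The trace is continuous for the norm. *)
Lemma trace_series f c x : sb B f c -> series_eval f Y x -> trace x = pair (law Y) f.
Proof.
move=> fc /wsums_clim fx; symmetry.
have fb : bsum (fun w => normc (f w * law Y w)) c := pair_sum law_le fc.
have E : nc_pairing (law Y) f (trace x).
  apply: wsums_to_near => [e e0|]; last exact: normc_ge0.
  have [N HN] := fx e e0; exists N => k /HN h.
  apply: le_trans h; have := normc_trace_le (\sum_(w <- words d k) f w *: monom Y w - x).
  rewrite traceB trace_sum; congr (normc (_ - _) <= _).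
  by apply: eq_bigr => w _; rewrite traceZ.
by rewrite ((nc_pairingE _ fb).1 E).
Qed.

Lemma law_of_series (F : 'I_d -> ser R d) (X : 'I_d -> M) D w : 0 <= D ->
  (forall k, sb B (F k) D) -> (forall k, series_eval (F k) Y (X k)) ->
  law X w = pair (law Y) (wprod F w).
Proof.
move=> D0 FD FX.
suff H : series_eval (wprod F w) Y (monom X w) by exact: trace_series (sb_wprod w B0 D0 FD) H.
elim: w => [|k w IH]; first by rewrite wprod_nil /monom big_nil; exact: series_eval1.
rewrite wprod_cons /monom big_cons.
exact: (series_evalM B0 YB (FD k) (sb_wprod w B0 D0 FD) (FX k) IH).
Qed.

(** Reversal of words permutes each partial sum. *)
Lemma star_series f x : (forall i, star (Y i) = Y i) -> selfadj f -> series_eval f Y x -> star x = x.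
Proof.
move=> Ys fs /wsums_clim fx.
have sm w : star (monom Y w) = monom Y (rev w).
  elim: w => [|k w IH]; first by rewrite /monom big_nil star1.
  rewrite monom_cons starM Ys IH rev_cons -cats1 monom_cat; congr (_ * _).
  by rewrite /monom big_seq1.
apply: (@clim_unique _ _ (fun N => star (\sum_(w <- words d N) f w *: monom Y w))).
  by apply: (clim_map (K := 1) fx) => k; rewrite -starB cnorm_star mul1r.
have E N : star (\sum_(w <- words d N) f w *: monom Y w) = \sum_(w <- words d N) f w *: monom Y w.
  rewrite star_sum (eq_bigr (fun w => f (rev w) *: monom Y (rev w))) => [|w _].
    rewrite -(big_map (@rev 'I_d) xpredT (fun w => f w *: monom Y w)); apply: perm_big.
    apply: uniq_perm; rewrite ?uniq_words ?map_inj_uniq ?uniq_words //; first exact: rev_inj.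
    move=> w; rewrite -[w in LHS]revK (mem_map (@rev_inj n)) !mem_words size_rev //.
  by rewrite starZ sm fs.
by move=> e e0; have [N HN] := fx e e0; exists N => k Nk; rewrite E; exact: HN.
Qed.

Lemma law_cat u v : law Y (u ++ v) = law Y (v ++ u).
Proof. by rewrite /law !monom_cat traceC. Qed.

End LawOfSeries.

(** The moments of [Y i] are values of the law at the powers of one letter. *)
Lemma cnorm_le_cutoff (R : realType) (n : nat) (M : tracialNCSpaceType R) (Y : 'I_n -> M) (T : R) i :
  0 < T -> selfadjoint_tuple Y -> cutoff T (law Y) -> cnorm (Y i) <= T.
Proof.
move=> T0 Ys cut; apply: cnorm_le_of_moments => // k.
have := cut (nseq k i); rewrite size_nseq /law.
have -> : monom Y (nseq k i) = Y i ^+ k.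
  by elim: k => [|k IH]; rewrite /monom /= ?big_nil ?expr0 // big_cons [\prod_(_ <- _) _]IH exprS.
by apply: le_trans; apply: le_trans (Re_le_normc _); exact: ler_norm.
Qed.

(** * The Hilbert space of square-summable families *)

Section Ell2.
Variables (R : realType) (I : choiceType).
Local Notation C := (R[i]).

(** Squares are summed, so that the estimates on nonnegative families apply
    directly; [nm] below is the norm. *)
Definition l2 (x : I -> C) (c : R) := bsum (fun w => normc (x w) ^+ 2) c.
Record ell2 := Ell2 { ev :> I -> C ; evP : exists c, l2 ev c }.
Implicit Types (x y z : ell2) (c e t : R) (a b : C).

Lemma ell2_eq x y : (forall w, ev x w = ev y w) -> x = y.
Proof.
case: x y => [f fP] [g gP] /= /funext fg; subst g.
by congr Ell2; exact: Prop_irrelevance.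
Qed.

HB.instance Definition _ := gen_eqMixin ell2.
HB.instance Definition _ := gen_choiceMixin ell2.

Lemma sq_ge0 (f : I -> C) w : 0 <= normc (f w) ^+ 2.
Proof. exact: sqr_ge0. Qed.

(** An equality for [t = q / p]: this parameter turns the triangle inequality
    into a termwise estimate of squares. *)
Lemma weighted_square (p q t : R) : 0 < t -> (p + q) ^+ 2 <= (1 + t) * p ^+ 2 + (1 + t^-1) * q ^+ 2.
Proof.
move=> t0; have := sqr_ge0 (t * p - q); have i0 : 0 < t^-1 by rewrite invr_gt0.
move=> h; have : 0 <= t^-1 * (t * p - q) ^+ 2 by rewrite mulr_ge0 // ltW.
have -> : t^-1 * (t * p - q) ^+ 2 = t * p ^+ 2 - 2 * p * q + t^-1 * q ^+ 2 by field; rewrite gt_eqF.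
nra.
Qed.

Lemma l2D (f g : I -> C) c e t : 0 < t -> l2 f c -> l2 g e ->
  l2 (fun w => f w + g w) ((1 + t) * c + (1 + t^-1) * e).
Proof.
move=> t0 fc ge; have i0 : 0 < t^-1 by rewrite invr_gt0.
have t1 : 0 <= 1 + t by lra. have t1' : 0 <= 1 + t^-1 by lra.
apply: bsum_le (bsumD _ _ (bsumZ t1 (sq_ge0 f) fc) (bsumZ t1' (sq_ge0 g) ge)) => w;
  [|by rewrite mulr_ge0 ?sqr_ge0|by rewrite mulr_ge0 ?sqr_ge0].
apply: le_trans (weighted_square _ _ t0).
by rewrite lerXn2r ?nnegrE ?normcD ?addr_ge0 ?normc_ge0.
Qed.

Lemma l2Z (f : I -> C) a c : l2 f c -> l2 (fun w => a * f w) (normc a ^+ 2 * c).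
Proof.
move=> fc; apply: bsum_le (bsumZ (sqr_ge0 (normc a)) (sq_ge0 f) fc) => w.
by rewrite normcM exprMn.
Qed.

Lemma l2N (f : I -> C) c : l2 f c -> l2 (fun w => - f w) c.
Proof. by apply: bsum_le => w; rewrite normcN. Qed.

Fact ell2_add_subproof x y : exists c, l2 (fun w => ev x w + ev y w) c.
Proof. by case: (evP x) (evP y) => [c xc] [e ye]; eexists; exact: (l2D ltr01 xc ye). Qed.
Definition ell2_add x y := Ell2 (ell2_add_subproof x y).
Fact ell2_opp_subproof x : exists c, l2 (fun w => - ev x w) c.
Proof. by case: (evP x) => [c xc]; exists c; exact: l2N. Qed.
Definition ell2_opp x := Ell2 (ell2_opp_subproof x).
Fact ell2_zero_subproof : exists c, l2 (fun w : I => 0 : C) c.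
Proof. by exists 0; apply: bsum_le (bsum0 R I) => w; rewrite normc0 expr0n. Qed.
Definition ell2_zero := Ell2 ell2_zero_subproof.
Fact ell2_scale_subproof a x : exists c, l2 (fun w => a * ev x w) c.
Proof. by case: (evP x) => [c xc]; eexists; exact: (l2Z a xc). Qed.
Definition ell2_scale a x := Ell2 (ell2_scale_subproof a x).

Fact ell2_addA : associative ell2_add.
Proof. by move=> x y z; apply: ell2_eq => w /=; rewrite addrA. Qed.
Fact ell2_addC : commutative ell2_add.
Proof. by move=> x y; apply: ell2_eq => w /=; rewrite addrC. Qed.
Fact ell2_add0 : left_id ell2_zero ell2_add.
Proof. by move=> x; apply: ell2_eq => w /=; rewrite add0r. Qed.
Fact ell2_addN : left_inverse ell2_zero ell2_opp ell2_add.
Proof. by move=> x; apply: ell2_eq => w /=; rewrite addNr. Qed.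
HB.instance Definition _ := GRing.isZmodule.Build ell2 ell2_addA ell2_addC ell2_add0 ell2_addN.

Lemma evD x y w : ev (x + y) w = ev x w + ev y w. Proof. by []. Qed.
Lemma evN x w : ev (- x) w = - ev x w. Proof. by []. Qed.
Lemma evB x y w : ev (x - y) w = ev x w - ev y w. Proof. by []. Qed.
Lemma ev0 w : ev 0 w = 0. Proof. by []. Qed.

Definition nm x : R := Num.sqrt (psum (fun w => normc (ev x w) ^+ 2)).

Lemma nm_ge0 x : 0 <= nm x. Proof. exact: sqrtr_ge0. Qed.

Lemma nm_l2 x : l2 x (nm x ^+ 2).
Proof.
case: (evP x) => c xc; rewrite /nm sqr_sqrtr; first exact: bsum_psum (sq_ge0 x) xc.
exact: psum_ge0 (sq_ge0 x).
Qed.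

Lemma nm_le x c : 0 <= c -> l2 x (c ^+ 2) -> nm x <= c.
Proof.
move=> c0 xc; rewrite /nm -(ger0_norm c0) -sqrtr_sqr ler_wsqrtr //.
exact: psum_le (sq_ge0 x) xc.
Qed.

Lemma nm_coord x w : normc (ev x w) <= nm x.
Proof.
rewrite -(@ler_pXn2r _ 2) ?nnegrE ?normc_ge0 ?nm_ge0 //.
exact: bsum_term w (sq_ge0 x) (nm_l2 x).
Qed.

Lemma nm_eq0 x : nm x <= 0 -> x = 0.
Proof.
move=> x0; apply: ell2_eq => w; apply/eq0_normc/le_anti; rewrite normc_ge0 andbT.
exact: le_trans (nm_coord x w) x0.
Qed.

Lemma nm0 : nm 0 = 0.
Proof.
apply/le_anti; rewrite nm_ge0 andbT; apply: nm_le => //.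
by rewrite expr0n; apply: bsum_le (bsum0 R I) => w; rewrite normc0 expr0n.
Qed.

Lemma nmN x : nm (- x) = nm x.
Proof.
by rewrite /nm; congr (Num.sqrt (psum _)); apply/funext => w; rewrite evN normcN.
Qed.

Lemma nmD x y : nm (x + y) <= nm x + nm y.
Proof.
have := nm_ge0 x; rewrite le_eqVlt => /orP[/eqP x0|x0].
  by rewrite (@nm_eq0 x) -?x0 // nm0 !add0r.
have := nm_ge0 y; rewrite le_eqVlt => /orP[/eqP y0|y0].
  by rewrite (@nm_eq0 y) -?y0 // nm0 !addr0.
apply: nm_le; first by rewrite addr_ge0 ?nm_ge0.
(* The optimal parameter is the quotient of the two norms. *)
have := l2D (divr_gt0 y0 x0) (nm_l2 x) (nm_l2 y).
by congr (l2 _ _); field; rewrite !gt_eqF.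
Qed.

Lemma nmB x y : nm (x - y) <= nm x + nm y.
Proof. by rewrite -[nm y]nmN nmD. Qed.
Lemma nmBC x y : nm (x - y) = nm (y - x).
Proof. by rewrite -nmN opprB. Qed.

Lemma nmZ a x : nm (ell2_scale a x) <= normc a * nm x.
Proof.
apply: nm_le; first by rewrite mulr_ge0 ?nm_ge0 ?normc_ge0.
by rewrite exprMn; exact: l2Z (nm_l2 x).
Qed.

Definition ip x y : C := csum (fun w => ev x w * conjc (ev y w)).

(** Termwise, [p q <= (b / a) p^2 / 2 + (a / b) q^2 / 2] with [a] and [b] the
    two norms: the sum is the inequality of Cauchy and Schwarz. *)
Lemma ip_sum x y : bsum (fun w => normc (ev x w * conjc (ev y w))) (nm x * nm y).
Proof.
have := nm_ge0 x; rewrite le_eqVlt => /orP[/eqP x0|x0].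
  apply: bsum_leR (bsum_le _ (bsum0 R I)) => [|w]; first by rewrite mulr_ge0 ?nm_ge0.
  by rewrite (@nm_eq0 x) -?x0 // mul0r normc0.
have := nm_ge0 y; rewrite le_eqVlt => /orP[/eqP y0|y0].
  apply: bsum_leR (bsum_le _ (bsum0 R I)) => [|w]; first by rewrite mulr_ge0 ?nm_ge0.
  by rewrite (@nm_eq0 y) -?y0 // conjc0 mulr0 normc0.
have t0 : 0 <= nm y / nm x / 2 by rewrite !divr_ge0 ?nm_ge0.
have s0 : 0 <= nm x / nm y / 2 by rewrite !divr_ge0 ?nm_ge0.
have := bsumD _ _ (bsumZ t0 (sq_ge0 x) (nm_l2 x)) (bsumZ s0 (sq_ge0 y) (nm_l2 y)) => H.
have -> : nm x * nm y = nm y / nm x / 2 * nm x ^+ 2 + nm x / nm y / 2 * nm y ^+ 2.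
  by field; rewrite !gt_eqF.
apply: bsum_le (H _ _) => w;
  [|by rewrite mulr_ge0 ?sqr_ge0|by rewrite mulr_ge0 ?sqr_ge0].
rewrite normcM normc_conj.
set p := normc (ev x w); set q := normc (ev y w); set a := nm x; set b := nm y.
have : 0 <= (b * p - a * q) ^+ 2 / (a * b * 2) by rewrite divr_ge0 ?sqr_ge0 // !mulr_ge0 ?nm_ge0.
have -> : (b * p - a * q) ^+ 2 / (a * b * 2) = b / a / 2 * p ^+ 2 + a / b / 2 * q ^+ 2 - p * q.
  by field; rewrite !gt_eqF.
lra.
Qed.

Lemma ip_le x y : normc (ip x y) <= nm x * nm y.
Proof. exact: csum_le (ip_sum x y). Qed.

Lemma ipDl x y z : ip (x + y) z = ip x z + ip y z.
Proof.
by rewrite /ip -(csumD (ip_sum x z) (ip_sum y z)); apply: eq_csum => w; rewrite evD mulrDl.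
Qed.
Lemma ip_conj x y : ip y x = conjc (ip x y).
Proof.
rewrite /ip -csum_conj; apply: eq_csum => w.
by rewrite conjcM conjcK mulrC.
Qed.
Lemma ipNl x y : ip (- x) y = - ip x y.
Proof. by rewrite /ip -csumN; apply: eq_csum => w; rewrite evN mulNr. Qed.
Lemma ipBl x y z : ip (x - y) z = ip x z - ip y z.
Proof. by rewrite ipDl ipNl. Qed.
Lemma ipZl a x y : ip (ell2_scale a x) y = a * ip x y.
Proof. by rewrite /ip -(csumZ a (ip_sum x y)); apply: eq_csum => w; rewrite mulrA. Qed.
Lemma ipDr x y z : ip x (y + z) = ip x y + ip x z.
Proof. by rewrite ip_conj ipDl conjcD -!ip_conj. Qed.
Lemma ipZr a x y : ip x (ell2_scale a y) = conjc a * ip x y.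
Proof. by rewrite ip_conj ipZl conjcM -ip_conj. Qed.
Lemma ipBr x y z : ip x (y - z) = ip x y - ip x z.
Proof. by rewrite ip_conj ipBl conjcB -!ip_conj. Qed.

Fact delta_subproof (w : I) : exists c, l2 (fun v => (v == w)%:R) c.
Proof.
exists (normc (1 : C) ^+ 2).
have := @bsum1 R I (fun v => normc ((v == w)%:R : C) ^+ 2) w (fun v => sqr_ge0 _) _.
rewrite eqxx; apply => v /negbTE ->; by rewrite normc0 expr0n.
Qed.
Definition delta w := Ell2 (delta_subproof w).

Lemma ip_delta x w : ip x (delta w) = ev x w.
Proof.
rewrite /ip (csum1 (k := w)) /= ?eqxx ?conjc1 ?mulr1 // => v /negbTE ->.
by rewrite conjc0 mulr0.
Qed.

Lemma ip_self x : ip x x = ((nm x ^+ 2)%:C)%C.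
Proof.
have E w : ev x w * conjc (ev x w) = ((normc (ev x w) ^+ 2)%:C)%C.
  case: (ev x w) => a b; apply/eqP; rewrite eq_complex /=; apply/andP; split; apply/eqP; last by ring.
  by rewrite sqr_sqrtr ?addr_ge0 ?sqr_ge0 //; ring.
have sc := nm_l2 x.
rewrite /ip /csum; apply/eqP; rewrite eq_complex /=; apply/andP; split; apply/eqP.
  transitivity (rsum (fun w => normc (ev x w) ^+ 2)); first by congr rsum; apply/funext => w; rewrite E.
  rewrite (rsum_psum (sq_ge0 x) sc) /nm sqr_sqrtr //; exact: psum_ge0 (sq_ge0 x).
transitivity (rsum (fun w : I => 0 : R)); first by congr rsum; apply/funext => w; rewrite E.
by rewrite (@rsum_seq _ _ _ [::]) ?big_nil.
Qed.

Lemma real_cauchy (u : nat -> R) :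
  (forall e, 0 < e -> exists N, forall p, (N <= p)%N -> `|u p - u N| <= e) ->
  exists l, forall e, 0 < e -> exists N, forall p, (N <= p)%N -> `|u p - l| <= e.
Proof.
move=> H; have : cvg (u @ \oo).
  apply/cauchy_cvgP/cauchy_exP => e e0; have e20 : 0 < e / 2 by lra.
  have [N HN] := H _ e20; exists (u N); exists N => // p /= Np.
  by rewrite /ball /= distrC; have := HN p Np; lra.
move=> /cvg_ex[l /cvgrPdist_le ul]; exists l => e e0.
have [N _ HN] := ul e e0; exists N => p Np; rewrite distrC; exact: HN.
Qed.

Lemma complex_cauchy (u : nat -> C) :
  (forall e, 0 < e -> exists N, forall p, (N <= p)%N -> normc (u p - u N) <= e) ->
  exists l, forall e, 0 < e -> exists N, forall p, (N <= p)%N -> normc (u p - l) <= e.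
Proof.
move=> H.
have [a Ha] : exists l, forall e, 0 < e -> exists N, forall p, (N <= p)%N -> `|Re (u p) - l| <= e.
  apply: real_cauchy => e e0; have [N HN] := H e e0; exists N => p Np.
  apply: le_trans (HN p Np); apply: le_trans (Re_le_normc _).
  by case: (u p) (u N) => [? ?] [? ?].
have [b Hb] : exists l, forall e, 0 < e -> exists N, forall p, (N <= p)%N -> `|Im (u p) - l| <= e.
  apply: real_cauchy => e e0; have [N HN] := H e e0; exists N => p Np.
  apply: le_trans (HN p Np); apply: le_trans (Im_le_normc _).
  by case: (u p) (u N) => [? ?] [? ?].
exists (Complex a b) => e e0; have e20 : 0 < e / 2 by lra.
have [N HN] := Ha _ e20; have [N' HN'] := Hb _ e20; exists (maxn N N') => p.
rewrite geq_max => /andP[/HN h1 /HN' h2].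
have -> : u p - Complex a b = ((Re (u p) - a)%:C)%C + Complex 0 1 * ((Im (u p) - b)%:C)%C.
  case: (u p) => c c'; apply/eqP; rewrite eq_complex /=; apply/andP; split; apply/eqP; ring.
apply: le_trans (normcD _ _) _; rewrite normcM !normc_real.
have -> : normc (Complex 0 1 : C) = 1 by rewrite /= expr0n add0r expr1n sqrtr1.
by lra.
Qed.

(** Coordinates converge, and the bound on the distances passes to finite sums
    of coordinates. In [3 * e], two parts come from the comparison of [u p]
    with [u m] through [u N], and the third one pays for the passage to the
    limit on a finite set. *)
Lemma ell2_complete (u : nat -> ell2) :
  (forall e, 0 < e -> exists N, forall p, (N <= p)%N -> nm (u p - u N) <= e) ->
  exists l, forall e, 0 < e -> exists N, forall p, (N <= p)%N -> nm (u p - l) <= e.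
Proof.
move=> H.
have Hc w : exists l, forall e, 0 < e -> exists N, forall p, (N <= p)%N -> normc (ev (u p) w - l) <= e.
  apply: complex_cauchy => e e0; have [N HN] := H e e0; exists N => p Np.
  by apply: le_trans (HN p Np); rewrite -evB nm_coord.
have [l Hl] := choice Hc.
have common e (s : seq I) : 0 < e -> exists N, forall p, (N <= p)%N -> forall w, w \in s ->
    normc (ev (u p) w - l w) <= e.
  move=> e0; elim: s => [|w s [N HN]]; first by exists 0%N.
  have [N' HN'] := Hl w e e0; exists (maxn N N') => p; rewrite geq_max => /andP[Np N'p] v.
  by rewrite inE => /orP[/eqP ->|vs]; [exact: HN'|exact: HN].
have key e N : 0 < e -> (forall p, (N <= p)%N -> nm (u p - u N) <= e) ->
    forall p, (N <= p)%N -> l2 (fun w => ev (u p) w - l w) ((3 * e) ^+ 2).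
  move=> e0 HN p Np; apply/bsum_sumP => [w|s us]; first exact: sqr_ge0.
  have s0 : (0 : R) <= (size s)%:R by [].
  have s1 : (0 : R) < 2 * ((size s)%:R + 1) by lra.
  pose g := e / (2 * ((size s)%:R + 1)); have g0 : 0 < g by rewrite divr_gt0.
  have [m0 Hm0] := common g s g0; pose m := maxn m0 N.
  have [m1 m2] : (m0 <= m)%N /\ (N <= m)%N by rewrite leq_maxl leq_maxr.
  have D : nm (u p - u m) <= 2 * e.
    have -> : u p - u m = (u p - u N) - (u m - u N) by rewrite opprB addrA subrK.
    by have := nmB (u p - u N) (u m - u N); have := HN p Np; have := HN m m2; lra.
  have S1 : \sum_(w <- s) normc (ev (u p - u m) w) ^+ 2 <= (2 * e) ^+ 2.
    apply: le_trans (bsum_sum (fun w => sq_ge0 _ w) (nm_l2 (u p - u m)) us) _.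
    by rewrite lerXn2r ?nnegrE ?nm_ge0 // mulr_ge0 // ltW.
  have S2 : \sum_(w <- s) normc (ev (u m) w - l w) ^+ 2 <= (size s)%:R * g ^+ 2.
    have -> : (size s)%:R * g ^+ 2 = \sum_(w <- s) g ^+ 2.
      by rewrite big_const_seq count_predT iter_addr_0 mulr_natl.
    rewrite big_seq [leRHS]big_seq; apply: ler_sum => w ws.
    by rewrite lerXn2r ?nnegrE ?normc_ge0 ?(ltW g0) // Hm0.
  have S : \sum_(w <- s) normc (ev (u p) w - l w) ^+ 2 <= 2 * (2 * e) ^+ 2 + 2 * ((size s)%:R * g ^+ 2).
    apply: le_trans (lerD (ler_wpM2l (ler0n R 2) S1) (ler_wpM2l (ler0n R 2) S2)).
    rewrite !mulr_sumr -big_split; apply: ler_sum => w _ /=.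
    have -> : ev (u p) w - l w = ev (u p - u m) w + (ev (u m) w - l w) by rewrite evB addrA subrK.
    have := weighted_square (normc (ev (u p - u m) w)) (normc (ev (u m) w - l w)) ltr01.
    rewrite invr1; apply: le_trans.
    by rewrite lerXn2r ?nnegrE ?normcD ?addr_ge0 ?normc_ge0.
  have gs : g * (2 * ((size s)%:R + 1)) = e by rewrite /g divfK // gt_eqF.
  apply: le_trans S _; nra.
have [N1 HN1] := H 1 ltr01.
have lP : exists c, l2 l c.
  have h := key 1 N1 ltr01 HN1 N1 (leqnn _).
  eexists; have := l2D ltr01 (nm_l2 (u N1)) (l2N h).
  by congr (l2 _ _); apply/funext => w; rewrite opprB addrC subrK.
exists (Ell2 lP) => e e0; have e30 : 0 < e / 3 by lra.
have [N HN] := H _ e30; exists N => p Np; apply: nm_le; first exact: ltW.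
have := key _ _ e30 HN p Np; by congr (l2 _ _); field.
Qed.

End Ell2.

(** * The semicircular law on the full Fock space *)

Section Fock.
Variables (R : realType) (n : nat).
Local Notation d := n.+1.
Local Notation C := (R[i]).
Local Notation H := (ell2 R (word d)).
Implicit Types (x y z : H) (u v w : word d) (i j : 'I_d) (c e : R) (a b : C).

(** [lsemi] is the sum of the creation operator that adds a letter on the left
    and of its adjoint; [rsemi], which does this on the right, is its conjugate
    by the reversal of words. The two families commute ([semi_comm]), which is
    what makes the vacuum state below tracial and faithful. *)
Definition lsemi i (f : word d -> C) : word d -> C := fun v =>
  (if v is k :: v' then if k == i then f v' else 0 else 0) + f (i :: v).
Definition rsemi i (f : word d -> C) : word d -> C := fun v => lsemi i (fun u => f (rev u)) (rev v).

Lemma rsemi_nil i f : rsemi i f [::] = f [:: i].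
Proof. by rewrite /rsemi /lsemi /= add0r. Qed.
Lemma rsemi_rcons i f v k : rsemi i f (rcons v k) =
  (if k == i then f v else 0) + f (rcons (rcons v k) i).
Proof. by rewrite /rsemi /lsemi rev_rcons revK rev_cons rev_cons revK. Qed.
Lemma lsemi_nil i f : lsemi i f [::] = f [:: i].
Proof. by rewrite /lsemi add0r. Qed.
Lemma lsemi_cons i f k v : lsemi i f (k :: v) = (if k == i then f v else 0) + f (i :: k :: v).
Proof. by []. Qed.

Lemma semi_comm i j f v : lsemi i (rsemi j f) v = rsemi j (lsemi i f) v.
Proof.
case: v => [|a v]; first by rewrite lsemi_nil rsemi_nil (rsemi_rcons _ _ [::]) lsemi_cons eq_sym.
case/lastP: v => [|v b].
  rewrite lsemi_cons rsemi_nil (rsemi_rcons _ _ [:: i]) (rsemi_rcons _ _ [::]) lsemi_nil lsemi_cons.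
  by rewrite /= addrCA.
rewrite lsemi_cons rsemi_rcons -!rcons_cons !rsemi_rcons /= !lsemi_cons.
by case: (a == i); case: (b == j); rewrite ?add0r ?addr0 //; exact: addrACA.
Qed.

Lemma l2_lsemi i (f : word d -> C) c : l2 f c -> l2 (lsemi i f) (4 * c).
Proof.
move=> fc; have c0 := bsum_ge0 (sq_ge0 f) fc.
have up : l2 (fun v => if v is k :: v' then if k == i then f v' else 0 else 0) c.
  pose g v := normc (if v is k :: v' then if k == i then f v' else 0 else 0 : C) ^+ 2.
  have := @esum_inj R _ _ g (cons i) _ _; rewrite /l2 /bsum => <-.
  - by rewrite /g eqxx.
  - by move=> ? ? [].
  case=> [|k v] h; rewrite /g ?normc0 ?expr0n //.
  by case: eqP => [ki|_]; [case: (h v); rewrite ki|rewrite normc0 expr0n].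
have down : l2 (fun v => f (i :: v)) c.
  by apply: (bsum_inj (e := cons i) (sq_ge0 f) _ fc) => ? ? [].
by have := l2D ltr01 up down; congr (l2 _ _); rewrite invr1; ring.
Qed.

Lemma l2_rev (f : word d -> C) c : l2 f c -> l2 (fun v => f (rev v)) c.
Proof. by move=> fc; apply: (bsum_inj (sq_ge0 f) (@rev_inj n) fc). Qed.

Lemma l2_rsemi i (f : word d -> C) c : l2 f c -> l2 (rsemi i f) (4 * c).
Proof. by move=> fc; apply: l2_rev; apply: l2_lsemi; exact: l2_rev. Qed.

Fact Lop_subproof i x : exists c, l2 (lsemi i x) c.
Proof. by eexists; exact: l2_lsemi (nm_l2 x). Qed.
Definition Lop i x : H := Ell2 (Lop_subproof i x).
Fact Rop_subproof i x : exists c, l2 (rsemi i x) c.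
Proof. by eexists; exact: l2_rsemi (nm_l2 x). Qed.
Definition Rop i x : H := Ell2 (Rop_subproof i x).

Lemma Lop_nm i x : nm (Lop i x) <= 2 * nm x.
Proof.
apply: nm_le; first by rewrite mulr_ge0 ?nm_ge0.
by have := l2_lsemi i (nm_l2 x); congr (l2 _ _); ring.
Qed.
Lemma Rop_nm i x : nm (Rop i x) <= 2 * nm x.
Proof.
apply: nm_le; first by rewrite mulr_ge0 ?nm_ge0.
by have := l2_rsemi i (nm_l2 x); congr (l2 _ _); ring.
Qed.

Lemma lsemi_add i (f g : word d -> C) v :
  lsemi i (fun w => f w + g w) v = lsemi i f v + lsemi i g v.
Proof.
rewrite /lsemi addrACA; case: v => [|k v]; first by rewrite addr0.
by case: (k == i); rewrite ?addr0.
Qed.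
Lemma lsemi_scale i a (f : word d -> C) v : lsemi i (fun w => a * f w) v = a * lsemi i f v.
Proof.
rewrite /lsemi mulrDr; case: v => [|k v]; first by rewrite mulr0.
by case: (k == i); rewrite ?mulr0.
Qed.
Lemma rsemi_scale i a (f : word d -> C) v : rsemi i (fun w => a * f w) v = a * rsemi i f v.
Proof. exact: lsemi_scale. Qed.
Lemma rsemi0 i v : rsemi i (fun=> 0 : C) v = 0.
Proof. by rewrite /rsemi /lsemi addr0; case: (rev v) => // k u; rewrite if_same. Qed.
Lemma rsemi_sum i (T : Type) (s : seq T) (F : T -> word d -> C) v :
  rsemi i (fun w => \sum_(t <- s) F t w) v = \sum_(t <- s) rsemi i (F t) v.
Proof.
elim: s => [|t s IH].
  have -> : (fun w => \sum_(t <- [::]) F t w) = (fun=> 0) by apply/funext => w; rewrite big_nil.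
  by rewrite big_nil rsemi0.
have -> : (fun w => \sum_(u <- t :: s) F u w) = (fun w => F t w + \sum_(u <- s) F u w).
  by apply/funext => w; rewrite big_cons.
by rewrite big_cons -IH; exact: lsemi_add.
Qed.
Lemma LopD i x y : Lop i (x + y) = Lop i x + Lop i y.
Proof. by apply: ell2_eq => v; rewrite evD; exact: lsemi_add. Qed.
Lemma LopZ i a x : Lop i (ell2_scale a x) = ell2_scale a (Lop i x).
Proof. by apply: ell2_eq => v; exact: lsemi_scale. Qed.
Lemma Lop0 i : Lop i 0 = 0.
Proof. by apply: ell2_eq => -[|k v]; rewrite /= /lsemi ?if_same addr0. Qed.
Lemma LopN i x : Lop i (- x) = - Lop i x.
Proof. by apply: (addrI (Lop i x)); rewrite -LopD !subrr Lop0. Qed.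
Lemma LopB i x y : Lop i (x - y) = Lop i x - Lop i y.
Proof. by rewrite LopD LopN. Qed.

Lemma Lop_comm i j x : Lop i (Rop j x) = Rop j (Lop i x).
Proof. by apply: ell2_eq => v; exact: semi_comm. Qed.

(** Creation and annihilation are adjoint to each other. *)
Lemma csum_create i (x y : word d -> C) :
  csum (fun v => (if v is k :: v' then if k == i then x v' else 0 else 0) * conjc (y v)) =
  csum (fun v => x v * conjc (y (i :: v))).
Proof.
symmetry; pose g (v : word d) : C := (if v is k :: v' then if k == i then x v' else 0 else 0) * conjc (y v).
rewrite -[RHS](@csum_inj R _ _ g (cons i)).
- by apply: eq_csum => v; rewrite /g eqxx.
- by move=> ? ? [].
case=> [|k v] h; rewrite /g ?mul0r //.
by case: eqP => [ki|_]; [case: (h v); rewrite ki|rewrite mul0r].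
Qed.

Lemma Lop_sym i x y : ip (Lop i x) y = ip x (Lop i y).
Proof.
have up (z : H) : exists c, l2 (fun v => if v is k :: v' then if k == i then z v' else 0 else 0) c.
  exists (nm z ^+ 2); pose g v := normc (if v is k :: v' then if k == i then z v' else 0 else 0 : C) ^+ 2.
  have := @esum_inj R _ _ g (cons i) _ _; rewrite /l2 /bsum => <-.
  - by have := nm_l2 z; rewrite /g eqxx.
  - by move=> ? ? [].
  case=> [|k v] h; rewrite /g ?normc0 ?expr0n //.
  by case: eqP => [ki|_]; [case: (h v); rewrite ki|rewrite normc0 expr0n].
have down (z : H) : exists c, l2 (fun v => z (i :: v)) c.
  exists (nm z ^+ 2); by apply: (bsum_inj (e := cons i) (sq_ge0 z) _ (nm_l2 z)) => ? ? [].
have E (z : H) : Lop i z = Ell2 (up z) + Ell2 (down z) by apply: ell2_eq.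
rewrite !E ipDl ipDr addrC; congr (_ + _); first last.
  by rewrite {1}/ip csum_create.
transitivity (conjc (csum (fun v => ev y v * conjc (ev x (i :: v))))).
  by rewrite -csum_conj; apply: eq_csum => v; rewrite conjcM conjcK mulrC.
by rewrite [RHS]ip_conj; congr conjc; symmetry; exact: csum_create.
Qed.

Fact flip_subproof x : exists c, l2 (fun v => x (rev v)) c.
Proof. by eexists; exact: l2_rev (nm_l2 x). Qed.
Definition flip x : H := Ell2 (flip_subproof x).
Lemma flip_ip x y : ip (flip x) (flip y) = ip x y.
Proof. exact: (csum_rev (fun w => ev x w * conjc (ev y w))). Qed.
Lemma flipK x : flip (flip x) = x.
Proof. by apply: ell2_eq => v /=; rewrite revK. Qed.
Lemma Rop_flip i x : Rop i x = flip (Lop i (flip x)).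
Proof. exact: ell2_eq. Qed.
Lemma Rop_sym i x y : ip (Rop i x) y = ip x (Rop i y).
Proof. by rewrite !Rop_flip -[y in LHS]flipK flip_ip Lop_sym -{2}(flipK x) flip_ip. Qed.

(** The commutant of the operators [Lop i], which contains the [Rop i].
    Operators come in pairs with their adjoint, which makes the involution an
    exchange of the two components. *)
Definition is_fock_op (f g : H -> H) :=
  [/\ forall x y, ip (f x) y = ip x (g y),
      exists c, forall x, nm (f x) <= c * nm x,
      exists c, forall x, nm (g x) <= c * nm x,
      forall j x, f (Lop j x) = Lop j (f x) &
      forall j x, g (Lop j x) = Lop j (g x)].
Record fock := Fock { fop :> H -> H; fadj : H -> H; fockP : is_fock_op fop fadj }.
Implicit Types (S T U : fock).

Lemma ip_ext x y : (forall z, ip x z = ip y z) -> x = y.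
Proof. by move=> h; apply: ell2_eq => w; rewrite -!ip_delta h. Qed.

Lemma fock_eq S T : (forall x, fop S x = fop T x) -> S = T.
Proof.
case: S T => [f g fg] [f' g' fg'] /= /funext ff; subst f'.
have gg : g = g'.
  apply/funext => y; apply: ip_ext => z; rewrite ip_conj [RHS]ip_conj; congr conjc.
  by case: fg fg' => [h _ _ _ _] [h' _ _ _ _]; rewrite -h h'.
subst g'; congr Fock; exact: Prop_irrelevance.
Qed.

HB.instance Definition _ := gen_eqMixin fock.
HB.instance Definition _ := gen_choiceMixin fock.

Lemma fop_adj S x y : ip (fop S x) y = ip x (fadj S y).
Proof. by case: (fockP S). Qed.
Lemma fadj_op S x y : ip (fadj S x) y = ip x (fop S y).
Proof. by rewrite ip_conj -fop_adj -ip_conj. Qed.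
Lemma fopL S j x : fop S (Lop j x) = Lop j (fop S x).
Proof. by case: (fockP S). Qed.
Lemma fadjL S j x : fadj S (Lop j x) = Lop j (fadj S x).
Proof. by case: (fockP S). Qed.
Lemma fopD S x y : fop S (x + y) = fop S x + fop S y.
Proof. by apply: ip_ext => z; rewrite ipDl !fop_adj ipDl. Qed.
Lemma fopZ S a x : fop S (ell2_scale a x) = ell2_scale a (fop S x).
Proof. by apply: ip_ext => z; rewrite ipZl !fop_adj ipZl. Qed.
Lemma fop_bound S : exists2 c, 0 <= c & forall x, nm (fop S x) <= c * nm x.
Proof.
case: (fockP S) => _ [c h] _ _ _; exists `|c| => // x; apply: le_trans (h x) _.
by rewrite ler_wpM2r ?nm_ge0 // ler_norm.
Qed.
Lemma fadj_bound S : exists2 c, 0 <= c & forall x, nm (fadj S x) <= c * nm x.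
Proof.
case: (fockP S) => _ _ [c h] _ _; exists `|c| => // x; apply: le_trans (h x) _.
by rewrite ler_wpM2r ?nm_ge0 // ler_norm.
Qed.

Fact fock_star_subproof S : is_fock_op (fadj S) (fop S).
Proof. by case: (fockP S) => h1 h2 h3 h4 h5; split=> // x y; exact: fadj_op. Qed.
Definition fock_star S := Fock (fock_star_subproof S).

Fact bound_add (f g : H -> H) : (exists2 c, 0 <= c & forall x, nm (f x) <= c * nm x) ->
  (exists2 c, 0 <= c & forall x, nm (g x) <= c * nm x) -> exists c, forall x, nm (f x + g x) <= c * nm x.
Proof.
move=> [c _ fc] [e _ ge]; exists (c + e) => x; apply: le_trans (nmD _ _) _.
by rewrite mulrDl lerD.
Qed.
Fact fock_add_subproof S T : is_fock_op (fun x => fop S x + fop T x) (fun x => fadj S x + fadj T x).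
Proof.
split=> [x y|||j x|j x]; rewrite ?ipDl ?ipDr ?fop_adj ?fopL ?fadjL ?LopD //.
  by apply: bound_add; exact: fop_bound.
by apply: bound_add; exact: fadj_bound.
Qed.
Definition fock_add S T := Fock (fock_add_subproof S T).

Fact bound_scale a (f : H -> H) : (exists2 c, 0 <= c & forall x, nm (f x) <= c * nm x) ->
  exists c, forall x, nm (ell2_scale a (f x)) <= c * nm x.
Proof.
move=> [c _ fc]; exists (normc a * c) => x; apply: le_trans (nmZ _ _) _.
by rewrite -mulrA ler_wpM2l ?normc_ge0.
Qed.
Fact fock_scale_subproof a S :
  is_fock_op (fun x => ell2_scale a (fop S x)) (fun x => ell2_scale (conjc a) (fadj S x)).
Proof.
split=> [x y|||j x|j x]; rewrite ?ipZl ?ipZr ?conjcK ?fop_adj ?fopL ?fadjL ?LopZ //.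
  by apply: bound_scale; exact: fop_bound.
by apply: bound_scale; exact: fadj_bound.
Qed.
Definition fock_scale a S := Fock (fock_scale_subproof a S).

Fact fock_opp_subproof S : is_fock_op (fun x => - fop S x) (fun x => - fadj S x).
Proof.
split=> [x y|||j x|j x]; rewrite ?ipNl ?fop_adj ?fopL ?fadjL ?LopN //.
- by rewrite -sub0r -[- fadj _ _]sub0r ipBr; congr (_ - _); rewrite ip_conj /ip (eq_csum (g := fun=> 0)) ?csum0 ?conjc0 // => w; rewrite mul0r.
- by have [c _ h] := fop_bound S; exists c => x; rewrite nmN.
by have [c _ h] := fadj_bound S; exists c => x; rewrite nmN.
Qed.
Definition fock_opp S := Fock (fock_opp_subproof S).

Fact fock_zero_subproof : is_fock_op (fun=> 0) (fun=> 0).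
Proof.
have z x : ip 0 x = 0 by apply: etrans (csum0 _ (word d)); apply: eq_csum => w; rewrite mul0r.
split=> [x y|||j x|j x]; rewrite ?Lop0 //; try by exists 0 => x; rewrite nm0 mul0r.
by rewrite z ip_conj z conjc0.
Qed.
Definition fock_zero := Fock fock_zero_subproof.

Fact fock_one_subproof : is_fock_op id id.
Proof. by split=> //; exists 1 => x; rewrite mul1r. Qed.
Definition fock_one := Fock fock_one_subproof.

Fact bound_comp (f g : H -> H) : (exists2 c, 0 <= c & forall x, nm (f x) <= c * nm x) ->
  (exists2 c, 0 <= c & forall x, nm (g x) <= c * nm x) -> exists c, forall x, nm (f (g x)) <= c * nm x.
Proof.
move=> [c c0 fc] [e _ ge]; exists (c * e) => x; apply: le_trans (fc _) _.
by rewrite -mulrA ler_wpM2l.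
Qed.
Fact fock_mul_subproof S T : is_fock_op (fun x => fop S (fop T x)) (fun x => fadj T (fadj S x)).
Proof.
split=> [x y|||j x|j x]; rewrite ?fop_adj ?fopL ?fadjL //.
  by apply: bound_comp; exact: fop_bound.
by apply: bound_comp; exact: fadj_bound.
Qed.
Definition fock_mul S T := Fock (fock_mul_subproof S T).

Fact fock_addA : associative fock_add.
Proof. by move=> S T U; apply: fock_eq => x /=; rewrite addrA. Qed.
Fact fock_addC : commutative fock_add.
Proof. by move=> S T; apply: fock_eq => x /=; rewrite addrC. Qed.
Fact fock_add0 : left_id fock_zero fock_add.
Proof. by move=> S; apply: fock_eq => x /=; rewrite add0r. Qed.
Fact fock_addN : left_inverse fock_zero fock_opp fock_add.
Proof. by move=> S; apply: fock_eq => x /=; rewrite addNr. Qed.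
HB.instance Definition _ := GRing.isZmodule.Build fock fock_addA fock_addC fock_add0 fock_addN.

Fact fock_mulA : associative fock_mul. Proof. by move=> S T U; apply: fock_eq. Qed.
Fact fock_mul1l : left_id fock_one fock_mul. Proof. by move=> S; apply: fock_eq. Qed.
Fact fock_mul1r : right_id fock_one fock_mul. Proof. by move=> S; apply: fock_eq. Qed.
Fact fock_mulDl : left_distributive fock_mul +%R. Proof. by move=> S T U; apply: fock_eq. Qed.
Fact fock_mulDr : right_distributive fock_mul +%R.
Proof. by move=> S T U; apply: fock_eq => x; exact: fopD. Qed.
Fact fock_one_neq0 : fock_one != 0.
Proof.
apply/eqP => h; have : fop fock_one (delta R [::]) [::] = fop (0 : fock) (delta R [::]) [::] by rewrite h.
by move=> h0; have e : (1 : C) = 0 := h0; move/eqP: e; rewrite oner_eq0.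
Qed.
HB.instance Definition _ := GRing.Zmodule_isNzRing.Build fock
  fock_mulA fock_mul1l fock_mul1r fock_mulDl fock_mulDr fock_one_neq0.

Fact fock_scaleA a b S : fock_scale a (fock_scale b S) = fock_scale (a * b) S.
Proof. by apply: fock_eq => x; apply: ell2_eq => w /=; rewrite mulrA. Qed.
Fact fock_scale1 : left_id 1 fock_scale.
Proof. by move=> S; apply: fock_eq => x; apply: ell2_eq => w /=; rewrite mul1r. Qed.
Fact fock_scaleDr : right_distributive fock_scale +%R.
Proof. by move=> a S T; apply: fock_eq => x; apply: ell2_eq => w /=; rewrite mulrDr. Qed.
Fact fock_scaleDl S : {morph fock_scale^~ S : a b / a + b}.
Proof. by move=> a b; apply: fock_eq => x; apply: ell2_eq => w /=; rewrite mulrDl. Qed.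
HB.instance Definition _ := GRing.Zmodule_isLmodule.Build C fock
  fock_scaleA fock_scale1 fock_scaleDr fock_scaleDl.
Fact fock_scaleAl a S T : a *: (S * T) = (a *: S) * T.
Proof. exact: fock_eq. Qed.
HB.instance Definition _ := GRing.Lmodule_isLalgebra.Build C fock fock_scaleAl.
Fact fock_scaleAr a S T : a *: (S * T) = S * (a *: T).
Proof. by apply: fock_eq => x; symmetry; exact: fopZ. Qed.
HB.instance Definition _ := GRing.Lalgebra_isAlgebra.Build C fock fock_scaleAr.

Definition fock_norm S : R := sup [set c | exists2 x, nm x <= 1 & c = nm (fop S x)].

Lemma fock_norm_has_sup S : has_sup [set c | exists2 x, nm x <= 1 & c = nm (fop S x)].
Proof.
split; first by exists (nm (fop S 0)); exists 0 => //; rewrite nm0.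
have [c c0 Sc] := fop_bound S; exists c => _ [x x1 ->]; apply: le_trans (Sc x) _.
by rewrite ler_piMr.
Qed.

Lemma fock_norm_ge0 S : 0 <= fock_norm S.
Proof.
apply: le_trans (nm_ge0 (fop S 0)) _; apply: ub_le_sup; first by case: (fock_norm_has_sup S).
by exists 0; rewrite ?nm0.
Qed.

Lemma fop0 S : fop S 0 = 0.
Proof. by apply: (addrI (fop S 0)); rewrite -fopD !addr0. Qed.

Lemma fock_normP S x : nm (fop S x) <= fock_norm S * nm x.
Proof.
have := nm_ge0 x; rewrite le_eqVlt => /orP[/eqP x0|x0].
  by rewrite (@nm_eq0 _ _ x) -?x0 // fop0 nm0 mulr0.
pose a : C := ((nm x)^-1%:C)%C; pose b : C := ((nm x)%:C)%C.
have na : normc a = (nm x)^-1 by rewrite normc_real gtr0_norm ?invr_gt0.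
have nb : normc b = nm x by rewrite normc_real gtr0_norm.
have y1 : nm (ell2_scale a x) <= 1.
  by apply: le_trans (nmZ a x) _; rewrite na mulVf // gt_eqF.
have xE : x = ell2_scale b (ell2_scale a x).
  apply: ell2_eq => w /=; rewrite mulrA -rmorphM mulfV ?gt_eqF // rmorph1.
  by rewrite mul1r.
rewrite {1}xE fopZ; apply: le_trans (nmZ _ _) _; rewrite nb mulrC ler_wpM2r ?nm_ge0 //.
apply: ub_le_sup; first by case: (fock_norm_has_sup S).
by exists (ell2_scale a x).
Qed.

Lemma fock_norm_le S c : 0 <= c -> (forall x, nm (fop S x) <= c * nm x) -> fock_norm S <= c.
Proof.
move=> c0 h; apply: sup_le_ub; first by case: (fock_norm_has_sup S).
by move=> _ [x x1 ->]; apply: le_trans (h x) _; rewrite ler_piMr.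
Qed.

Fact fock_starK S : fock_star (fock_star S) = S. Proof. exact: fock_eq. Qed.
Fact fock_starD S T : fock_star (S + T) = fock_star S + fock_star T. Proof. exact: fock_eq. Qed.
Fact fock_starZ a S : fock_star (a *: S) = conjc a *: fock_star S. Proof. exact: fock_eq. Qed.
Fact fock_starM S T : fock_star (S * T) = fock_star T * fock_star S. Proof. exact: fock_eq. Qed.

Fact fock_norm_eq0 S : fock_norm S = 0 -> S = 0.
Proof.
move=> S0; apply: fock_eq => x; apply: nm_eq0.
by have := fock_normP S x; rewrite S0 mul0r.
Qed.

Fact fock_normD S T : fock_norm (S + T) <= fock_norm S + fock_norm T.
Proof.
apply: fock_norm_le => [|x]; first by rewrite addr_ge0 ?fock_norm_ge0.
by apply: le_trans (nmD _ _) _; rewrite mulrDl lerD ?fock_normP.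
Qed.

Fact fock_normZ a S : fock_norm (a *: S) = normc a * fock_norm S.
Proof.
have le b T : fock_norm (b *: T) <= normc b * fock_norm T.
  apply: fock_norm_le => [|x]; first by rewrite mulr_ge0 ?fock_norm_ge0 ?normc_ge0.
  by apply: le_trans (nmZ _ _) _; rewrite -mulrA ler_wpM2l ?normc_ge0 ?fock_normP.
apply/le_anti; rewrite le /=; have [->|a0] := eqVneq a 0.
  by rewrite normc0 mul0r fock_norm_ge0.
have n0 : 0 < normc a.
  by rewrite lt_def normc_ge0 andbT; apply: contraNneq a0 => /eq0_normc ->.
have := le a^-1 (a *: S); rewrite scalerA mulVf // scale1r normcV.
by rewrite -(ler_pM2l n0) mulrA mulfV ?mul1r // gt_eqF.
Qed.

Fact fock_normM S T : fock_norm (S * T) <= fock_norm S * fock_norm T.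
Proof.
apply: fock_norm_le => [|x]; first by rewrite mulr_ge0 ?fock_norm_ge0.
apply: le_trans (fock_normP S _) _; rewrite -mulrA ler_wpM2l ?fock_norm_ge0 //.
exact: fock_normP.
Qed.

Lemma nm_fop_sqr S x : nm (fop S x) ^+ 2 <= fock_norm (fock_star S * S) * nm x ^+ 2.
Proof.
have e : ip (fop (fock_star S * S) x) x = ((nm (fop S x) ^+ 2)%:C)%C.
  by rewrite -ip_self -[LHS]/(ip (fadj S (fop S x)) x) fadj_op.
have h := ip_le (fop (fock_star S * S) x) x.
rewrite e normc_real ger0_norm ?sqr_ge0 // in h; apply: le_trans h _.
by rewrite expr2 mulrA ler_wpM2r ?nm_ge0 ?fock_normP.
Qed.

Lemma fock_norm_sqr S : fock_norm S ^+ 2 <= fock_norm (fock_star S * S).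
Proof.
have N0 := fock_norm_ge0 (fock_star S * S).
rewrite -[leRHS](sqr_sqrtr N0) lerXn2r ?nnegrE ?fock_norm_ge0 ?sqrtr_ge0 //.
apply: fock_norm_le => [|x]; first exact: sqrtr_ge0.
rewrite -(@ler_pXn2r _ 2) ?nnegrE ?mulr_ge0 ?nm_ge0 ?sqrtr_ge0 //.
by rewrite exprMn [X in _ <= X * _]sqr_sqrtr //; exact: nm_fop_sqr.
Qed.

(** The inequality [fock_norm S ^ 2 <= fock_norm (S* S)] bounds [fock_norm S]
    by the norm of the adjoint, and the roles can be exchanged. *)
Lemma fock_norm_star S : fock_norm (fock_star S) = fock_norm S.
Proof.
have le T : fock_norm T <= fock_norm (fock_star T).
  have := fock_norm_ge0 T; rewrite le_eqVlt => /orP[/eqP <-|T0]; first exact: fock_norm_ge0.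
  have := le_trans (fock_norm_sqr T) (fock_normM _ _).
  by rewrite expr2 ler_pM2r.
apply/le_anti/andP; split; last exact: le.
by rewrite -[X in _ <= fock_norm X](fock_starK S); exact: le.
Qed.

Fact fock_norm_star_mul S : fock_norm (fock_star S * S) = fock_norm S ^+ 2.
Proof.
apply/le_anti; rewrite fock_norm_sqr andbT expr2 -{1}(fock_norm_star S).
exact: fock_normM.
Qed.

(** Limits are taken pointwise; the bounds pass to the limit. *)
Lemma fock_pointwise_limit (u : nat -> fock) :
  (forall e, 0 < e -> exists N, forall p q, (N <= p)%N -> (N <= q)%N -> fock_norm (u p - u q) < e) ->
  exists f : H -> H, forall e, 0 < e -> exists N, forall p, (N <= p)%N ->
    forall x, nm (fop (u p) x - f x) <= e * nm x.
Proof.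
move=> Hu.
have dist p q x : nm (fop (u p) x - fop (u q) x) <= fock_norm (u p - u q) * nm x.
  exact: (fock_normP (u p - u q) x).
have Hx x : exists l, forall e, 0 < e -> exists N, forall p, (N <= p)%N -> nm (fop (u p) x - l) <= e.
  apply: ell2_complete => e e0.
  have x1 : 0 < nm x + 1 by have := nm_ge0 x; lra.
  have [N HN] := Hu _ (divr_gt0 e0 x1); exists N => p Np.
  apply: le_trans (dist p N x) _; have h := HN p N Np (leqnn N).
  rewrite ltr_pdivlMr // in h; have := fock_norm_ge0 (u p - u N); have := nm_ge0 x; nra.
have [f Hf] := choice Hx; exists f => e e0.
have [N HN] := Hu e e0; exists N => p Np x; apply/ler_addgt0Pr => e1 e10.
have [N1 HN1] := Hf x _ e10; pose m := maxn N N1.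
have h1 := HN1 m (leq_maxr _ _); have h2 := HN p m Np (leq_maxl _ _).
have -> : fop (u p) x - f x = (fop (u p) x - fop (u m) x) + (fop (u m) x - f x) by rewrite addrA subrK.
apply: le_trans (nmD _ _) _; apply: lerD => //; apply: le_trans (dist _ _ _) _.
by rewrite ler_wpM2r ?nm_ge0 // ltW.
Qed.

Lemma nm_small_eq x y c : (forall e, 0 < e -> nm (x - y) <= e * c) -> x = y.
Proof.
move=> h; apply/eqP; rewrite -subr_eq0; apply/eqP/nm_eq0/ler_addgt0Pr => e e0; rewrite add0r.
have c1 : 0 < `|c| + 1 by have := normr_ge0 c; lra.
apply: le_trans (h _ (divr_gt0 e0 c1)) _; have := ler_norm c.
have -> : e / (`|c| + 1) * c = e * (c / (`|c| + 1)) by ring.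
by move=> hc; apply: ler_piMr; [exact: ltW|rewrite ler_pdivrMr // mul1r; lra].
Qed.

Fact fock_complete (u : nat -> fock) :
  (forall e : R, 0 < e ->
     exists N : nat, forall p q : nat, (N <= p)%N -> (N <= q)%N -> fock_norm (u p - u q) < e) ->
  exists l, (fun k => fock_norm (u k - l)) @ \oo --> (0 : R).
Proof.
move=> Hu.
have [f Hf] := fock_pointwise_limit Hu.
have [g Hg] : exists g : H -> H, forall e, 0 < e -> exists N, forall p, (N <= p)%N ->
    forall x, nm (fadj (u p) x - g x) <= e * nm x.
  apply: (@fock_pointwise_limit (fun k => fock_star (u k))) => e e0.
  have [N HN] := Hu e e0; exists N => p q Np Nq.
  have -> : fock_star (u p) - fock_star (u q) = fock_star (u p - u q) by exact: fock_eq.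
  by rewrite fock_norm_star HN.
have bound (h : H -> H) (v : nat -> fock) : (forall e, 0 < e -> exists N, forall p, (N <= p)%N ->
    forall x, nm (fop (v p) x - h x) <= e * nm x) -> exists c, forall x, nm (h x) <= c * nm x.
  move=> hv; have [N HN] := hv 1 ltr01; exists (fock_norm (v N) + 1) => x.
  have := HN N (leqnn N) x; rewrite nmBC => h1.
  have -> : h x = fop (v N) x + (h x - fop (v N) x) by rewrite addrC subrK.
  apply: le_trans (nmD _ _) _; rewrite mulrDl; apply: lerD => //; exact: fock_normP.
have comm (h : H -> H) (v : nat -> fock) j x : (forall e, 0 < e -> exists N, forall p, (N <= p)%N ->
    forall x, nm (fop (v p) x - h x) <= e * nm x) -> h (Lop j x) = Lop j (h x).
  move=> hv; apply: (@nm_small_eq _ _ (nm (Lop j x) + 2 * nm x)) => e e0.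
  have [N HN] := hv e e0.
  have h1 := HN N (leqnn N) (Lop j x); have h2 := HN N (leqnn N) x.
  have -> : h (Lop j x) - Lop j (h x) = Lop j (fop (v N) x - h x) - (fop (v N) (Lop j x) - h (Lop j x)).
    by rewrite LopB fopL opprB [RHS]addrC addrA subrK.
  have := nmB (Lop j (fop (v N) x - h x)) (fop (v N) (Lop j x) - h (Lop j x)).
  by have := Lop_nm j (fop (v N) x - h x); lra.
have fg : is_fock_op f g.
  split=> [x y|||j x|j x].
  - apply/eqP; rewrite -subr_eq0; apply/eqP/eq0_normc/le_anti; rewrite normc_ge0 andbT.
    apply/ler_addgt0Pr => e e0; rewrite add0r.
    have xy1 : 0 < 2 * (nm x * nm y) + 1 by have := mulr_ge0 (nm_ge0 x) (nm_ge0 y); lra.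
    have e1 := divr_gt0 e0 xy1.
    have [N HN] := Hf _ e1; have [N' HN'] := Hg _ e1; pose m := maxn N N'.
    have h1 := HN m (leq_maxl _ _) x; have h2 := HN' m (leq_maxr _ _) y.
    have -> : ip (f x) y - ip x (g y) = ip x (fadj (u m) y - g y) - ip (fop (u m) x - f x) y.
      by rewrite ipBl ipBr fop_adj; ring.
    apply: le_trans (normcB _ _) _; have := ip_le x (fadj (u m) y - g y).
    have := ip_le (fop (u m) x - f x) y; set e' := e / _ in h1 h2 e1.
    have ee : e' * (2 * (nm x * nm y) + 1) = e by rewrite /e' divfK // gt_eqF.
    have := nm_ge0 x; have := nm_ge0 y; nra.
  - exact: bound Hf.
  - exact: (bound g (fun k => fock_star (u k)) Hg).
  - exact: comm Hf.
  - exact: (comm g (fun k => fock_star (u k)) j x Hg).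
exists (Fock fg); apply/cvgr0Pnorm_le => e e0; have [N HN] := Hf e e0.
exists N => // k /= Nk; rewrite ger0_norm ?fock_norm_ge0 //.
apply: fock_norm_le => [|x]; first exact: ltW.
exact: HN.
Qed.

HB.instance Definition _ := isCStarAlgebra.Build R fock fock_starK fock_starD fock_starZ
  fock_starM fock_norm_eq0 fock_normD fock_normZ fock_normM fock_norm_star_mul fock_complete.

Definition vacuum : H := delta R ([::] : word d).
Definition fock_trace S : C := ev (fop S vacuum) [::].

Lemma fock_traceE S : fock_trace S = ip (fop S vacuum) vacuum.
Proof. by rewrite ip_delta. Qed.

Fact fock_traceD S T : fock_trace (S + T) = fock_trace S + fock_trace T. Proof. by []. Qed.
Fact fock_traceZ a S : fock_trace (a *: S) = a * fock_trace S. Proof. by []. Qed.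
Fact fock_trace1 : fock_trace 1 = 1. Proof. by []. Qed.
Lemma fock_trace_sqr S : fock_trace (star S * S) = ((nm (fop S vacuum) ^+ 2)%:C)%C.
Proof. by rewrite fock_traceE -ip_self -fadj_op. Qed.
Fact fock_trace_ge0 S : 0 <= fock_trace (star S * S).
Proof. by rewrite fock_trace_sqr lecR sqr_ge0. Qed.

Lemma Lop_delta j w : Lop j (delta R w) =
  delta R (j :: w) + (if w is k :: w' then if k == j then delta R w' else 0 else 0).
Proof.
apply: ell2_eq => v; rewrite evD /= /lsemi addrC [in RHS]addrC; congr (_ + _).
  case: w => [|k w]; first by rewrite ev0; case: v.
  rewrite eqseq_cons [j == k]eq_sym; case: (k == j) => //=.
case: v => [|k v]; first by case: w.
by rewrite eqseq_cons; case: (k == j).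
Qed.

(** The operators [Lop] generate all basis vectors from the vacuum, and [S]
    commutes with them. *)
Lemma vacuum_separating S : fop S vacuum = 0 -> S = 0.
Proof.
move=> S0.
have Sd w : fop S (delta R w) = 0.
  have [m] := ubnP (size w); elim: m w => // m IH [|j w] //= wm.
  have := Lop_delta j w => /(congr1 (fop S)); rewrite fopL fopD.
  rewrite IH // Lop0; have -> : fop S (if w is k :: w' then if k == j then delta R w' else 0 else 0) = 0.
    case: w wm => [|k w] wm; rewrite ?fop0 //; case: (k == j); rewrite ?fop0 // IH //.
    by move: wm; rewrite ltnS => /ltnW.
  by rewrite addr0.
apply: fock_eq => x; apply: ip_ext => z; rewrite fop_adj.
have -> : fadj S z = 0.
  apply: ell2_eq => w; rewrite -ip_delta fadj_op Sd ip_conj /ip.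
  by rewrite (eq_csum (g := fun=> 0)) ?csum0 ?conjc0 // => v; rewrite mul0r.
rewrite ip_conj /ip (eq_csum (g := fun=> 0)) ?csum0 ?conjc0 => [|v]; last by rewrite mul0r.
by rewrite (eq_csum (g := fun=> 0)) ?csum0 // => v; rewrite mul0r.
Qed.

Fact fock_trace_faithful S : fock_trace (star S * S) = 0 -> S = 0.
Proof.
rewrite fock_trace_sqr => /eqP; rewrite eq_complex /= eqxx andbT sqrf_eq0 => /eqP S0.
by apply: vacuum_separating; apply: nm_eq0; rewrite S0.
Qed.

(** Commutation with [Lop j] moves a letter from the column index of the matrix
    of [S] to the row index. *)
Lemma fop_delta_vacuum S w : ev (fop S (delta R w)) [::] = ev (fop S vacuum) (rev w).
Proof.
pose t u v := ev (fop S (delta R v)) u.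
(* The correction term turns the commutation relation, which involves creation
   and annihilation, into an exact transfer of one letter. *)
pose s u v := t u v - (if u is a :: u' then if v is b :: v' then if a == b then t u' v' else 0 else 0 else 0).
have st u : s u [::] = t u [::] by rewrite /s; case: u => [|a u]; rewrite subr0.
have s0 v : s [::] v = t [::] v by rewrite /s subr0.
have step u j v : s u (j :: v) = s (j :: u) v.
  have E : t u (j :: v) + (if v is k :: v' then if k == j then t u v' else 0 else 0) =
      (if u is k :: u' then if k == j then t u' v else 0 else 0) + t (j :: u) v.
    have := congr1 (fun x => ev (fop S x) u) (Lop_delta j v).
    rewrite fopL fopD evD -/(t u (j :: v)) => h; rewrite -[RHS]/(ev (Lop j (fop S (delta R v))) u) h.
    congr (_ + _); case: v {h} => [|k v]; rewrite ?fop0 ?ev0 //.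
    by case: (k == j); rewrite ?fop0 ?ev0.
  rewrite /s; apply/eqP; rewrite subr_eq; apply/eqP.
  transitivity (t u (j :: v) + (if v is k :: v' then if k == j then t u v' else 0 else 0)
     - (if v is b :: v' then if j == b then t u v' else 0 else 0)).
    case: v {E} => [|k v]; rewrite ?addr0 ?subr0 // [j == k]eq_sym.
    by case: (k == j); rewrite ?addrK ?addr0 ?subr0.
  by rewrite E -addrA addrC.
have all u w' : s u w' = t (rev w' ++ u) [::].
  elim: w' u => [|j w' IH] u; first by rewrite st.
  by rewrite step IH rev_cons cat_rcons.
by rewrite -[LHS]s0 all cats0.
Qed.

(** By [fop_delta_vacuum] the trace of [S T] is the sum over [w] of
    [(T Omega)(w) * (S Omega)(rev w)], with [Omega] the vacuum; reversal
    exchanges [S] and [T]. *)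
Fact fock_traceC S T : fock_trace (S * T) = fock_trace (T * S).
Proof.
have E S' T' : fock_trace (S' * T') = csum (fun w => ev (fop T' vacuum) w * ev (fop S' vacuum) (rev w)).
  rewrite fock_traceE -[LHS]/(ip (fop S' (fop T' vacuum)) vacuum) fop_adj.
  apply: eq_csum => w; congr (_ * _).
  by rewrite -fop_delta_vacuum -[LHS]/(conjc (ev (fadj S' vacuum) w)) -ip_delta -ip_conj -fop_adj ip_delta.
rewrite !E -[RHS]csum_rev; apply: eq_csum => w; by rewrite revK mulrC.
Qed.

HB.instance Definition _ := isTracial.Build R fock fock_traceD fock_traceZ fock_trace1
  fock_trace_ge0 fock_trace_faithful fock_traceC.

Fact semicircular_subproof i : is_fock_op (Rop i) (Rop i).
Proof.
have b x : nm (Rop i x) <= 2 * nm x by exact: Rop_nm.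
by split=> [x y|||j x|j x]; rewrite ?Rop_sym ?Lop_comm //; exists 2.
Qed.

(** A semicircular family of variance 1, since [Rop i] is the sum of a creation
    operator and of its adjoint. *)
Definition semicircular i : fock := Fock (semicircular_subproof i).

Lemma star_semicircular i : star (semicircular i) = semicircular i.
Proof. exact: fock_eq. Qed.

Lemma cnorm_semicircular i : cnorm (semicircular i) <= 2.
Proof. by apply: fock_norm_le => // x; exact: Rop_nm. Qed.

Let mvac w : H := fop (monom semicircular w) vacuum.
Definition semicircular_law : word d -> C := law semicircular.

Lemma mvac_cons k w : mvac (k :: w) = Rop k (mvac w).
Proof. by rewrite /mvac /monom big_cons. Qed.
Lemma mvac_nil : mvac [::] = vacuum.
Proof. by rewrite /mvac /monom big_nil. Qed.
Lemma semicircular_lawE w : semicircular_law w = ev (mvac w) [::].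
Proof. by []. Qed.

(** A first letter [i] of the state can only have been created at an occurrence
    of [i] in [p]; what has been applied before that occurrence must have
    returned to the vacuum. *)
Lemma mvac_letter i p v : ev (mvac p) (i :: v) =
  \sum_(o <- occ p | o.1.2 == i) semicircular_law o.2 * ev (mvac o.1.1) v.
Proof.
rewrite big_mkcond /=; elim: p v => [|k p IH] v.
  by rewrite big_nil mvac_nil.
rewrite occ_cons /= mvac_nil mvac_cons.
have R1 u : ev (Rop k (mvac p)) (i :: u) = (k == i)%:R * semicircular_law p * (u == [::])%:R +
    rsemi k (fun v => ev (mvac p) (i :: v)) u.
  rewrite /=; case/lastP: u => [|u b].
    rewrite (rsemi_rcons _ _ [::]) rsemi_nil /= mulr1 eq_sym; congr (_ + _).
    by case: (k == i); rewrite ?mul1r ?mul0r.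
  by rewrite -rcons_cons !rsemi_rcons -size_eq0 size_rcons mulr0 add0r.
rewrite R1; congr (_ + _).
  by case: (k == i); rewrite ?mul1r ?mul0r //=.
have -> : (fun v => ev (mvac p) (i :: v)) = (fun v => \sum_(o <- occ p)
   (if o.1.2 == i then semicircular_law o.2 * ev (mvac o.1.1) v else 0)) by apply/funext => u; exact: IH.
rewrite rsemi_sum; apply: eq_bigr => o _; case: ifP => _; last exact: rsemi0.
by rewrite rsemi_scale mvac_cons.
Qed.

(** The first operator applied to the vacuum may be taken as [Lop i] as well as
    [Rop i], and [Lop i] commutes with the others. *)
Lemma mvac_rcons p i : mvac (rcons p i) = Lop i (mvac p).
Proof.
elim: p => [|k p IH]; last by rewrite rcons_cons !mvac_cons IH Lop_comm.
rewrite mvac_cons mvac_nil; apply: ell2_eq => v /=.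
have E u : lsemi i (fun v => (v == [::])%:R) u = (u == [:: i])%:R.
  rewrite /lsemi addr0; case: u => [|a u] //; rewrite eqseq_cons.
  by case: (a == i).
have -> : rsemi i (fun v => (v == [::])%:R) v = lsemi i (fun v => (v == [::])%:R) (rev v).
  congr lsemi; apply/funext => u; congr (nat_of_bool _)%:R.
  by rewrite -[in LHS](revK [::]) (inj_eq (@rev_inj n)).
by rewrite !E -[in LHS](revK [:: i]) (inj_eq (@rev_inj n)).
Qed.

(** By [mvac_rcons] the last letter may act last, as [Lop i], and then it
    annihilates the first letter of the state, which [mvac_letter] describes. *)
Lemma semicircular_sd : sd_mono semicircular_law 0.
Proof.
move=> i p; rewrite (eq_csum (g := fun=> 0)) ?csum0 ?addr0 => [|y]; last first.
  by rewrite /gradw big1 ?mul0r.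
rewrite semicircular_lawE cats1 mvac_rcons /= lsemi_nil mvac_letter.
by apply: eq_bigr => o _; rewrite mulrC.
Qed.

Lemma semicircular_even : parity false semicircular_law.
Proof.
have H w v : odd (size w + size v) -> ev (mvac w) v = 0.
  elim: w v => [|k w IH] v; first by rewrite mvac_nil /=; case: v.
  rewrite mvac_cons /=; case/lastP: v => [|v b] o.
    by rewrite rsemi_nil IH // addn1; rewrite addn0 in o.
  rewrite size_rcons addnS /= negbK in o.
  rewrite rsemi_rcons !IH ?if_same ?addr0 // !size_rcons !addnS /= negbK //.
by move=> w wo; rewrite semicircular_lawE H // addn0; case: odd wo.
Qed.

Lemma semicircular_selfadj : selfadj semicircular_law.
Proof.
move=> w; rewrite /semicircular_law /law -trace_star; congr trace.
elim: w => [|k w IH]; first by rewrite monom_nil star1.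
by rewrite monom_cons starM star_semicircular -IH rev_cons -cats1 monom_cat /monom big_seq1.
Qed.

End Fock.

(** * Free Gibbs laws and the transport theorem *)

Section GibbsLaws.
Variables (R : realType) (n : nat).
Local Notation d := n.+1.
Local Notation C := (R[i]).
Implicit Types (u v w : word d) (f g psi : ser R d) (c e : R).

Lemma size_wfacts w : size (wfacts w) = (size w).+1.
Proof. by elim: w => //= k w IH; rewrite size_map IH. Qed.

(** For a cyclically invariant series all the [size y + 1] cuts contribute
    equally, which cancels the denominator of [uneuler]. *)
Lemma cyc_grad_uneuler (s : ser R d) i : cyc_inv s -> cyc_grad i (uneuler s) = fld s i.
Proof.
move=> sc; rewrite cyc_gradE; apply/funext => y; rewrite /gradw /fld.
rewrite (eq_big_seq (fun=> (size y).+1%:R^-1 * s (i :: y))) => [|b].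
  by rewrite big_const_seq count_predT iter_addr_0 size_wfacts -[LHS]mulr_natl mulVKf // pnatr_eq0.
rewrite mem_wfacts => /eqP by_; rewrite /uneuler (cyc_inv_cat _ _ sc) /= -by_.
by rewrite size_cat /= addnS addnC size_cat.
Qed.

Lemma law_nil (M : tracialNCSpaceType R) (X : 'I_d -> M) : law X [::] = 1.
Proof. by rewrite /law monom_nil trace1. Qed.

(** Uniqueness among all the solutions that satisfy the cutoff comes from
    [sd_mono_unique]; laws agree at the empty word because traces are
    normalized. *)
Lemma free_gibbs_law_of_solution (T A e : R) (U : ser R d) (tau : word d -> C) : 0 < T ->
  101 + 2 * T <= A -> e <= 1 -> sb A U e ->
  is_tracial_law tau -> sd_mono tau U -> cutoff T tau -> free_gibbs_law T U tau.
Proof.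
move=> T0 AT e1 Ue tl sd cut.
have UT : sb (T + 1) U e by apply: sb_mono Ue; lra.
have UA : sb (A - 1 + 1) U e by rewrite subrK.
have T0' := ltW T0; have AT' : 100 + 2 * T <= A - 1 by lra.
split; first by split=> //; exact/(schwinger_dysonP T0' cut UT).
move=> tau' [tl' /(schwinger_dysonP T0' _ UT) sd' cut'].
apply: (sd_mono_unique T0' AT' e1 UA cut cut' _ sd (sd' cut')).
by case: tl tl' => [M [X [_ ->]]] [M' [X' [_ ->]]]; rewrite !law_nil.
Qed.

(** The series converges at the tuple, and its law is computed on words by
    [law_of_series]. *)
Lemma perturbed_tuple (M : tracialNCSpaceType R) (Y : 'I_d -> M) (A B c : R) psi :
  0 <= B -> B <= A -> 0 < A -> selfadjoint_tuple Y -> (forall i, cnorm (Y i) <= B) ->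
  sb A psi c -> cyc_inv psi -> selfadj psi ->
  exists X : 'I_d -> M, [/\ forall i, series_eval (fld psi i) Y (X i - Y i),
    selfadjoint_tuple X & law X = pushlaw (law Y) psi].
Proof.
move=> B0 BA A0 Ys YB pc pi pss; have c0 := sb_ge0 (ltW A0) pc.
have fB i : sb B (fld psi i) (c / A) := sb_mono B0 BA (lexx _) (sb_fld i A0 pc).
have [x xE] := choice (fun i => series_eval_exists YB (fB i)).
pose X i := Y i + x i.
have D0 : 0 <= B + c / A by rewrite addr_ge0 // divr_ge0 // ltW.
have FD k : sb B (pert psi k) (B + c / A) := sbD B0 (sb_ncvarS k B0) (fB k).
have FX k : series_eval (pert psi k) Y (X k) := series_evalD (series_eval_var Y k) (xE k).
exists X; split=> [i|i|]; first by rewrite /X addrC addKr.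
  exact: (star_series Ys (selfadj_pert i pi pss) (FX i)).
by apply/funext => w; rewrite (law_of_series B0 YB w D0 FD FX).
Qed.

End GibbsLaws.

(** The lower bound on [A] gives room for the Lipschitz estimates of the
    transport, which is done with moments bounded by powers of [T + 2], and for
    the uniqueness theorem. The last term makes [2 / A <= T - 2]: the
    semicircular variables have norm 2, and each of the two steps adds at most
    [1 / A] to the bound, so the cutoff [T] is respected. *)
Lemma transport_of_gibbs_laws (R : realType) (n : nat) (T A : R) (W : ncseries R n.+1) :
  2 < T -> 110 + 2 * T + n.+1%:R + 2 / (T - 2) <= A ->
  nc_selfadjoint W -> nc_even W -> sb (A + 4) W 32^-1 ->
  exists V : ncseries R n.+1,
    nc_selfadjoint V /\ free_gibbs_well_defined T V /\
    forall (M : tracialNCSpaceType R) (Y : 'I_n.+1 -> M), has_free_gibbs_law T V Y ->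
      exists X : 'I_n.+1 -> M, (forall i, series_eval (cyc_grad i V) Y (X i - Y i)) /\
        has_free_gibbs_law T W X.
Proof.
move=> T2 AT Ws We WA.
have T20 : 0 < T - 2 by lra.
have n0 : (0 : R) <= n.+1%:R by [].
have q0 : 0 <= 2 / (T - 2) by rewrite divr_ge0 // ltW.
have T0 : 0 < T by lra.
have A0 : 0 < A by lra.
have iA : 2 * A^-1 <= T - 2.
  by rewrite ler_pdivrMr // -ler_pdivrMl // mulrC; lra.
have iA0 : 0 < A^-1 by rewrite invr_gt0.
have We' : parity false W by move=> w wo; apply: We; case: odd wo.
pose S := @semicircular R n; pose tau0 : word n.+1 -> R[i] := @semicircular_law R n.
have S2 i : cnorm (S i) <= 2 by exact: cnorm_semicircular.
have tau2 w : normc (tau0 w) <= 2 ^+ size w by apply: (@law_le R n (fock R n : tracialNCSpaceType R) S 2).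
have tauC u v : tau0 (u ++ v) = tau0 (v ++ u) by exact: law_cat.
have B4 : 4 <= T + 2 by lra.
have AB : 102 + 2 * (T + 2) <= A by lra.
have dA : n.+1%:R <= A by lra.
have [p [s [[pA sA [pc ps pe] ss] [sd1 sd2]]]] := two_step_transport B4 AB dA tau2 tauC
  (@semicircular_selfadj R n) (@semicircular_even R n) (@semicircular_sd R n) Ws We' WA.
have [sc sse se] := ss; have [vc vs ve] := symmetric_uneuler ss.
have le2A : 2 <= A by lra.
have AT1 : 101 + 2 * T <= A by lra.
pose tau1 := pushlaw tau0 p; pose V := uneuler s.
have Vb := sb_uneuler (ltW A0) sA.
have t1b w : normc (tau1 w) <= (2 + A^-1) ^+ size w.
  by rewrite -[A^-1]mul1r; exact: (pushlaw_le w (ler0n _ 2) le2A A0 tau2 pA).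
have cut1 : cutoff T tau1.
  by move=> w; apply: le_trans (t1b w) _; rewrite lerXn2r ?nnegrE //; lra.
have gibbs1 : free_gibbs_law T V tau1.
  have [X0 [_ X0s X0l]] := perturbed_tuple (ler0n R 2) le2A A0 (@star_semicircular R n) S2 pA pc ps.
  have e8 : (1 / 8 : R) <= 1 by lra.
  apply: (free_gibbs_law_of_solution T0 AT1 e8 Vb _ sd1 cut1).
  by exists (fock R n), X0.
exists V; split=> //; split; first by exists tau1.
move=> M Y [Ys [Yl Yu]]; have Y1 : law Y = tau1 by apply: Yu; case: gibbs1.
have YT i : cnorm (Y i) <= T by apply: (cnorm_le_cutoff _ T0 Ys); rewrite Y1.
have TA : T <= A by lra.
have [X [XE Xs Xl]] := perturbed_tuple (ltW T0) TA A0 Ys YT sA sc sse.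
exists X; split; first by move=> i; rewrite cyc_grad_uneuler.
split=> //; rewrite Y1 in Xl.
have WA' : sb A W 32^-1 by apply: sb_mono WA; lra.
have e32 : (32^-1 : R) <= 1 by lra.
apply: (free_gibbs_law_of_solution T0 AT1 e32 WA' _ _ _); first by exists M, X.
  by rewrite Xl.
rewrite Xl => w.
have B1 : 0 <= 2 + A^-1 by lra.
have BA : 2 + A^-1 <= A by lra.
apply: le_trans (pushlaw_le w B1 BA A0 t1b sA) _.
by rewrite lerXn2r ?nnegrE //; lra.
Qed.

Theorem theorem3p1 (R : realType) (n : nat) (hn : (1 <= n)%N) (T : R) (hT : 2 < T) :
  exists C eps : R, 0 < C /\ 0 < eps /\
    forall W : ncseries R n,
      nc_selfadjoint W -> nc_even W -> (ncnorm C W < eps%:E)%E ->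
      exists V : ncseries R n,
        nc_selfadjoint V /\
        free_gibbs_well_defined T V /\
        forall (M : tracialNCSpaceType R) (Y : 'I_n -> M),
          has_free_gibbs_law T V Y ->
          exists X : 'I_n -> M,
            (forall i, series_eval (cyc_grad i V) Y (X i - Y i)) /\
            has_free_gibbs_law T W X.
Proof.
case: n hn => // n _.
pose A : R := 110 + 2 * T + n.+1%:R + 2 / (T - 2).
have n0 : (0 : R) <= n.+1%:R by [].
have q0 : 0 <= 2 / (T - 2) by rewrite divr_ge0 //; lra.
exists (A + 4), 32^-1; split; first by rewrite /A; lra.
split=> [|W Ws We Wn]; first by lra.
apply: (@transport_of_gibbs_laws R n T A W) => //.
apply: le_trans (ltW Wn); rewrite le_eqVlt; apply/orP; left; apply/eqP.
by apply: eq_esum => w _; rewrite mulrC.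
Qed.
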